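(* Assume: (1) $F$ is $\nu$-measurable, $\nu(D(A))=1$ and $\int_H(|F(x)|_H^2+|x|_H^2)\,\nu(dx)<\infty$; (2) $\int_H N_0\varphi\,d\nu=0$ for all $\varphi\in\mathcal FC_b^2(H)$; (3) $(1-N_0)(\mathcal FC_b^2(H))$ is dense in $L^2(H,\nu)$; (4) (symmetric case) $N_2^*=N_2$ on $L^2(H,\nu)$; (5) $(Q^{1/2}D,\mathcal FC_b^1(H))$ is closable from $L^2(H,\nu)$ to $L^2(H;H,\nu)$; and in addition at least one of the following: (a) whenever $u_n,u\in\mathcal U_{ad}$ and $u_n\to u$ weakly-star in $L^\infty(H;H,\nu)$, then $Q^{1/2}Bu_n\to Q^{1/2}Bu$ in $L^2(H;H,\nu)$; (b) the embedding of $W^{1,2}(H,\nu)$ into $L^2(H,\nu)$ is compact. Let $g\in L^2(H,\nu)$ and let $u_*\in\mathcal U_{ad}$ be a minimizer over $\mathcal U_{ad}$ of $u\mapsto\int_0^T\int_H\varphi^u(t,x)\,\nu(dx)\,dt$, where $\varphi^u$ is the variational solution of $\frac{d\varphi}{dt}=N_2\varphi+\langle Bu,Q^{1/2}D\varphi\rangle$ on $(0,T)$, $\varphi(0)=g$. Then $$\int_H\Big\langle B(u-u_* ),\int_0^TQ^{1/2}D\varphi_*\,p_*\,dt\Big\rangle d\nu\ \ge 0\qquad\forall u\in\mathcal U_{ad},$$ where $\varphi_*=\varphi^{u_*}$ and $p_*$ is the variational solution of the backward equation $\frac{dp}{dt}=-N_2p-G^{u_*}p-1$ on $(0,T)$,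 $p(T)=0$.
   Context: $H$ is a separable real Hilbert space with norm $|\cdot|_H$ and inner product $\langle\cdot,\cdot\rangle$; $T,\rho\in(0,\infty)$ are fixed. $Q$ is a bounded self-adjoint positive linear operator on $H$ and $\{e_i\}_{i\ge1}$ is an orthonormal basis of $H$ with $Qe_i=q_ie_i$, $q_i\ge0$ and $q_i>0$ for all but finitely many $i$. $\tilde A$ is a self-adjoint m-dissipative linear operator in $H$ with $e_i\in D(\tilde A)$ for all $i$; $F:D(F)\subseteq H\to H$ is a possibly nonlinear map; $A:D(A):=D(F)\to(D(\tilde A))^*$ is given by $\langle A(x),h\rangle:=\langle x,\tilde Ah\rangle+\langle F(x),h\rangle$, $h\in D(\tilde A)$. $\nu$ is a Borel probability measure on $H$. $\mathcal FC_b^k(H)$ is the set of functions $\varphi(x)=\phi(\langle x,e_1\rangle,\dots,\langle x,e_n\rangle)$ with $n\in\mathbb N$, $\phi\in C_b^k(\mathbb R^n)$. $D,D^2$ are the first and second Fréchet derivatives. $N_0\varphi(x):=\frac12\mathrm{Tr}[QD^2\varphi](x)+\langle A(x),D\varphi(x)\rangle$ with domain $\mathcal FC_b^2(H)$. Under (1)-(3), $N_0$ is dissipative and its closure $(N_2,D(N_2))$ in $L^2(H,\nu)$ generates a $C_0$-semigroup of contractions; $N_2^*$ is its adjoint. $B$ is a bounded linear operator on $L^\infty(H;H,\nu)$. $\mathcal U_{ad}=\{u:H\to H:\ u\ \nu\text{-measurable},\ |u(x)|_H\le\rho\ \forall x\in H\}$. $(Q^{1/2}Bu)(x):=Q^{1/2}(Bu(x))$.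 $\mathcal V:=W^{1,2}(H,\nu)$ is the completion of $\mathcal FC_b^2(H)$ under the norm $(\int_H(|\varphi|^2+|Q^{1/2}D\varphi|_H^2)d\nu)^{1/2}$; under (5) it is a subspace of $\mathcal H:=L^2(H,\nu)$ and the closure of $Q^{1/2}D$, again denoted $Q^{1/2}D$, has domain $\mathcal V$. $\mathcal V'$ is the dual of $\mathcal V$ with pivot space $\mathcal H$, pairing ${}_{\mathcal V}(\cdot,\cdot)_{\mathcal V'}$. In the symmetric case, $N_2$ also denotes the continuous extension $\mathcal V\to\mathcal V'$ of $\mathcal FC_b^2(H)\ni\varphi\mapsto N_2\varphi$. For $u\in\mathcal U_{ad}$, $G^u:\mathcal H\to\mathcal V'$ is the bounded operator ${}_{\mathcal V}(\varphi,G^u\psi)_{\mathcal V'}:=\int_H\langle Bu(x),Q^{1/2}D\varphi(x)\rangle\psi(x)\,\nu(dx)$. A variational solution of either equation is the unique function in $C([0,T];\mathcal H)\cap L^2(0,T;\mathcal V)$ with time derivative in $L^2(0,T;\mathcal V')$ satisfying the equation in $\mathcal V'$ for a.e. $t\in(0,T)$ together with the initial (resp. terminal) condition. *)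

(* Defs.v *)
From HB Require Import structures.
From mathcomp Require Import all_boot all_order all_algebra.
From mathcomp Require Import all_classical all_reals all_analysis.

Set Implicit Arguments.
Unset Strict Implicit.
Unset Printing Implicit Defensive.
Import Order.TTheory GRing.Theory Num.Theory.
Import numFieldNormedType.Exports.

Local Open Scope classical_set_scope.
Local Open Scope ring_scope.

(* Real Hilbert spaces.  Separability is not a field: in this development it is
   provided by a countable orthonormal basis (is_orthonormal_basis). *)
HB.mixin Record CompleteNormedModule_isHilbert (R : realType) (H : Type)
    of CompleteNormedModule R H := {
  ip : H -> H -> R ;
  ipC : forall x y, ip x y = ip y x ;
  ipDl : forall x y z, ip (x + y) z = ip x z + ip y z ;
  ipZl : forall a x y, ip (a *: x) y = a * ip x y ;
  ip_sqr_norm : forall x, ip x x = `|x| ^+ 2 }.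

#[short(type="hilbertType")]
HB.structure Definition Hilbert (R : realType) :=
  {H of CompleteNormedModule_isHilbert R H & CompleteNormedModule R H}.

Section hilbert_operators.
Context {R : realType} {H : hilbertType R}.

Definition is_orthonormal_basis (e : nat -> H) : Prop :=
  (forall i j, ip (e i) (e j) = (i == j)%:R) /\
  (forall x, series (fun i => ip x (e i) *: e i) @ \oo --> x).

Definition bounded_sa_positive (S : {linear H -> H}) : Prop :=
  [/\ continuous S,
      forall x y, ip (S x) y = ip x (S y) &
      forall x, 0 <= ip (S x) x].

Definition is_sqrt_op (Q Qh : {linear H -> H}) : Prop :=
  bounded_sa_positive Qh /\ forall x, Qh (Qh x) = Q x.

(* An unbounded operator is a domain D together with a total function A, of
   which only the values on D are meaningful. *)
Definition linear_on (D : set H) (A : H -> H) : Prop :=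
  D 0 /\ forall (a : R) x y, D x -> D y ->
    D (a *: x + y) /\ A (a *: x + y) = a *: A x + A y.

(* The right-hand side of the equivalence is the graph of the adjoint of A. *)
Definition self_adjoint_on (D : set H) (A : H -> H) : Prop :=
  closure D = setT /\
  forall y z, (D y /\ A y = z) <-> (forall x, D x -> ip (A x) y = ip x z).

Definition m_dissipative_on (D : set H) (A : H -> H) : Prop :=
  (forall x, D x -> ip (A x) x <= 0) /\
  (forall y, exists2 x, D x & x - A x = y).

End hilbert_operators.

(* Spaces of equivalence classes (Lebesgue spaces, Sobolev spaces, ...) are
   presented by representatives: ps_mem selects the representatives of elements
   of the space, ps_norm is their norm, and two representatives denote the same
   element iff their difference has norm 0.  ps_norm is only meaningful on
   ps_mem. *)
Record prespace (R : realType) := Prespace {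
  ps_car :> lmodType R ;
  ps_mem : set ps_car ;
  ps_norm : ps_car -> \bar R }.

Section bochner.
Context {R : realType} (X : prespace R) (T : R).
Local Notation leb := (@lebesgue_measure R).

Record simple_map := SimpleMap {
  sm_size : nat ;
  sm_set : 'I_sm_size -> set R ;
  sm_val : 'I_sm_size -> X ;
  _ : forall i, measurable (sm_set i) ;
  _ : forall i, ps_mem (sm_val i) }.

Definition sm_eval (s : simple_map) (t : R) : X :=
  \sum_(i < sm_size s) (\1_(sm_set i) t : R) *: sm_val i.

Definition sm_integral (s : simple_map) : X :=
  \sum_(i < sm_size s) fine (leb (sm_set i `&` `]0, T[)) *: sm_val i.

Definition strongly_measurable (f : R -> X) : Prop :=
  exists s : nat -> simple_map,
    {ae leb, forall t, t \in `]0, T[ ->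
      ps_mem (f t) /\ ps_norm (f t - sm_eval (s n) t) @[n --> \oo] --> 0%E}.

Definition bochner_L2 (f : R -> X) : Prop :=
  strongly_measurable f /\
  (\int[leb]_(t in `]0%R, T[) (ps_norm (f t) ^+ 2) < +oo)%E.

(* I represents the Bochner integral of f over ]0, T[. *)
Definition is_bochner_integral (f : R -> X) (I : X) : Prop :=
  [/\ ps_mem I, strongly_measurable f &
   exists s : nat -> simple_map,
     (\int[leb]_(t in `]0%R, T[) ps_norm (f t - sm_eval (s n) t)
        @[n --> \oo] --> 0)%E /\
     ps_norm (sm_integral (s n) - I) @[n --> \oo] --> 0%E].

Definition continuous_into (f : R -> X) : Prop :=
  forall t, t \in `[0, T] ->
    ps_mem (f t) /\
    ps_norm (f s - f t) @[s --> within `[0, T] (nbhs t)] --> 0%E.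

End bochner.

Definition test_function {R : realType} (T : R) (eta : R -> R) : Prop :=
  (forall n t, derivable (derive1n n eta) t 1) /\
  exists a b, [/\ 0 < a, b < T & forall t, t \notin `[a, b] -> eta t = 0].

(* f : ]0, T[ -> X has the derivative g : ]0, T[ -> Y in the sense of Y-valued
   distributions, X being mapped to Y by j. *)
Definition weak_derivative {R : realType} (X Y : prespace R) (j : X -> Y)
    (T : R) (f : R -> X) (g : R -> Y) : Prop :=
  forall eta, test_function T eta ->
    exists I : Y,
      is_bochner_integral T (fun t => derive1 eta t *: j (f t)) I /\
      is_bochner_integral T (fun t => - (eta t *: g t)) I.

Section C_b.
Context {R : realType}.

Fixpoint Cb (k n : nat) (f : 'rV[R]_n -> R) : Prop :=
  [/\ continuous f, exists M : R, forall x, `|f x| <= M &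
   if k is k'.+1 then
     forall i : 'I_n, (forall x, derivable f x (delta_mx 0 i)) /\
                      Cb k' (fun x => 'D_(delta_mx 0 i) f x)
   else True].

End C_b.

Definition borel (H : ptopologicalType) := g_sigma_algebraType (@open H).

Section gauge.
Context {R : realType} {H : hilbertType R}.
Variable e : nat -> H.

Definition FCb (k : nat) : set (H -> R) :=
  [set phi | exists n (f : 'rV[R]_n -> R),
     Cb k f /\ phi = fun x => f (\row_(i < n) ip x (e i))].

(* The Riesz representative of the Frechet derivative. *)
Definition gradient (phi : H -> R) (x : H) : H :=
  get [set v | forall h, 'd phi x h = ip v h].

Definition hessian (phi : H -> R) (x : H) : H -> H := 'd (gradient phi) x.

Definition trace (S : H -> H) : R :=
  limn (series (fun i => ip (S (e i)) (e i))).

Definition A_pairing (At F : H -> H) (x h : H) : R := ip x (At h) + ip (F x) h.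

Definition N0 (Q : {linear H -> H}) (At F : H -> H) (phi : H -> R) (x : H) : R :=
  2^-1 * trace (fun h => Q (hessian phi x h)) + A_pairing At F x (gradient phi x).

End gauge.

Section spaces.
Context {R : realType} {H : hilbertType R}.
Variable nu : probability (borel H) R.

(* H with the sigma-algebra of nu-measurable sets, i.e. the completion of the
   Borel sigma-algebra, and the completed measure. *)
Definition Hnu := caratheodory_type (mu_ext nu).
Definition nuc : {measure set Hnu -> \bar R} :=
  @completed_measure_extension _ (borel H) R nu.

Definition nu_measurable (D : set H) (u : H -> H) : Prop :=
  measurable (D : set Hnu) /\ measurable_fun (D : set Hnu) (u : Hnu -> borel H).

Definition Lp_real (p : \bar R) : prespace R :=
  @Prespace R (H -> R^o) [set f | (f : Hnu -> R) \in Lfun nuc p]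
    (fun f => Lnorm nuc p (EFin \o f)).

Definition normH (p : \bar R) (u : H -> H) : \bar R :=
  Lnorm nuc p (fun x => `|u x|%:E).

Definition Lp_H (p : \bar R) : prespace R :=
  @Prespace R (H -> H)
    [set u | nu_measurable setT u /\ (normH p u < +oo)%E] (normH p).

(* Bounded linear operators of L^oo(H; H, nu), acting on representatives. *)
Definition bounded_linear_Linfty (B : (H -> H) -> (H -> H)) : Prop :=
  let Linfty := ps_mem (p := Lp_H +oo) in
  [/\ forall u, Linfty u -> Linfty (B u),
      forall u v, Linfty u -> Linfty v ->
        ae_eq nuc setT u v -> ae_eq nuc setT (B u) (B v),
      forall (a : R) u v, Linfty u -> Linfty v ->
        ae_eq nuc setT (B (fun x => a *: u x + v x))
                       (fun x => a *: B u x + B v x) &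
      exists C : R, forall u, Linfty u ->
        (normH +oo (B u) <= C%:E * normH +oo u)%E].

Definition weak_star_cvg (u_ : nat -> H -> H) (u : H -> H) : Prop :=
  forall v, ps_mem (p := Lp_H 1%:E) v ->
    \int[nuc]_x ip (u_ n x) (v x) @[n --> \oo] --> \int[nuc]_x ip (u x) (v x).

Definition admissible (rho : R) : set (H -> H) :=
  [set u | nu_measurable setT u /\ forall x, `|u x| <= rho].

Variable e : nat -> H.

Section sobolev.
Variable Qh : {linear H -> H}.

Definition sqrtQ_D_closable : Prop :=
  forall (phi_ : nat -> H -> R) (G : H -> H),
    (forall n, FCb e 1 (phi_ n)) -> ps_mem (p := Lp_H 2%:E) G ->
    ps_norm (phi_ n : Lp_real 2%:E) @[n --> \oo] --> 0%E ->
    normH 2%:E (fun x => Qh (gradient (phi_ n) x) - G x) @[n --> \oo] --> 0%E ->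
    ae_eq nuc setT G (cst 0).

(* The closure of the graph of Q^{1/2}D on FC_b^2, with G = Q^{1/2}D f.  When
   Q^{1/2}D is closable, its projection on f is the completion of FC_b^2 in the
   norm of W^{1,2}(H, nu), and sqrtQ_D below is determined nu-a.e. *)
Definition sqrtQ_D_graph (f : H -> R) (G : H -> H) : Prop :=
  [/\ ps_mem (f : Lp_real 2%:E), ps_mem (G : Lp_H 2%:E) &
   exists phi_ : nat -> H -> R,
     [/\ forall n, FCb e 2 (phi_ n),
         ps_norm ((phi_ n \- f) : Lp_real 2%:E) @[n --> \oo] --> 0%E &
         normH 2%:E (fun x => Qh (gradient (phi_ n) x) - G x) @[n --> \oo] --> 0%E]].

Definition sqrtQ_D (f : H -> R) : H -> H := get [set G | sqrtQ_D_graph f G].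

Definition W12 : prespace R :=
  @Prespace R (H -> R^o) [set f | exists G, sqrtQ_D_graph f G]
    (fun f => Lnorm nuc 2%:E (fun x => (Num.sqrt (f x ^+ 2 + `|sqrtQ_D f x| ^+ 2))%:E)).

Definition W12_dual : prespace R :=
  @Prespace R (W12 -> R^o)
    [set l | (forall (a : R) (f g : W12), ps_mem f -> ps_mem g ->
                l (a *: f + g) = a * l f + l g) /\
             exists C : R, forall f : W12, ps_mem f ->
                (`|l f|%:E <= C%:E * ps_norm f)%E]
    (fun l => ereal_sup
       [set `|l f|%:E | f in [set f : W12 | ps_mem f /\ (ps_norm f <= 1)%E]]).

(* The embedding of L^2(H, nu) (hence of W^{1,2}) into the dual: L^2 is the pivot
   space. *)
Definition pivot (f : H -> R) : W12_dual :=
  fun psi : W12 => \int[nuc]_x (f x * psi x).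

Definition W12_compact_embedding : Prop :=
  forall (f_ : nat -> W12) (M : R),
    (forall n, ps_mem (f_ n) /\ (ps_norm (f_ n) <= M%:E)%E) ->
    exists (k : nat -> nat) (f : Lp_real 2%:E),
      [/\ {homo k : m n / (m < n)%N}, ps_mem f &
          ps_norm ((f_ (k n) : Lp_real 2%:E) - f) @[n --> \oo] --> 0%E].

End sobolev.
Arguments pivot Qh f : clear implicits.

Section kolmogorov.
Variables (Q Qh : {linear H -> H}) (At F : H -> H).
Local Notation N0 := (N0 e Q At F).

Definition N2_graph (f g : H -> R) : Prop :=
  [/\ ps_mem (f : Lp_real 2%:E), ps_mem (g : Lp_real 2%:E) &
   exists phi_ : nat -> H -> R,
     [/\ forall n, FCb e 2 (phi_ n),
         ps_norm ((phi_ n \- f) : Lp_real 2%:E) @[n --> \oo] --> 0%E &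
         ps_norm ((N0 (phi_ n) \- g) : Lp_real 2%:E) @[n --> \oo] --> 0%E]].

Definition N2_adjoint_graph (f g : H -> R) : Prop :=
  [/\ ps_mem (f : Lp_real 2%:E), ps_mem (g : Lp_real 2%:E) &
   forall h k, N2_graph h k ->
     \int[nuc]_x (k x * f x) = \int[nuc]_x (h x * g x)].

(* The continuous extension W^{1,2} -> (W^{1,2})' of phi |-> N0 phi on FC_b^2. *)
Definition N2_ext (f : W12 Qh) : W12_dual Qh :=
  get [set l : W12_dual Qh | ps_mem l /\
    exists phi_ : nat -> W12 Qh,
      [/\ forall n, FCb e 2 (phi_ n),
          ps_norm (phi_ n - f) @[n --> \oo] --> 0%E &
          ps_norm (pivot Qh (N0 (phi_ n)) - l) @[n --> \oo] --> 0%E]].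

Variable B : (H -> H) -> (H -> H).

Definition drift (u : H -> H) (f : W12 Qh) : H -> R :=
  fun x => ip (B u x) (sqrtQ_D Qh f x).

Definition G_op (u : H -> H) (psi : H -> R) : W12_dual Qh :=
  fun phi : W12 Qh => \int[nuc]_x (ip (B u x) (sqrtQ_D Qh phi x) * psi x).

Variable T : R.

(* f belongs to C([0,T]; L^2) and to L^2(0,T; W^{1,2}), and its time derivative
   belongs to L^2(0,T; (W^{1,2})') and equals rhs (f t) for a.e. t. *)
Definition variational_evolution (rhs : W12 Qh -> W12_dual Qh)
    (f : R -> H -> R) : Prop :=
  [/\ continuous_into (X := Lp_real 2%:E) T f,
      bochner_L2 (X := W12 Qh) T f &
   exists g : R -> W12_dual Qh,
     [/\ bochner_L2 T g,
         weak_derivative (pivot Qh : W12 Qh -> W12_dual Qh) T f g &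
         {ae @lebesgue_measure R, forall t, t \in `]0, T[ ->
           forall psi : W12 Qh, ps_mem psi -> g t psi = rhs (f t) psi}]].

Definition forward_solution (u : H -> H) (g : H -> R) (f : R -> H -> R) : Prop :=
  variational_evolution (fun v => N2_ext v + pivot Qh (drift u v)) f /\
  ae_eq nuc setT (f 0) g.

Definition backward_solution (u : H -> H) (p : R -> H -> R) : Prop :=
  variational_evolution
    (fun v => - N2_ext v - G_op u v - pivot Qh (cst 1)) p /\
  ae_eq nuc setT (p T) (cst 0).

End kolmogorov.

Definition cost (T : R) (f : R -> H -> R) : R :=
  \int[@lebesgue_measure R]_(t in `[0, T]) \int[nuc]_x f t x.

End spaces.

(* Main.v *)
(* For u admissible and 0 < l <= 1 let u_l = us + l (u - us) and w = phi^{u_l} - phi^{us}.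
   Since N_2 acts on W^{1,2} as psi |-> -1/2 int <Q^{1/2}D f, Q^{1/2}D psi> (integrate
   N_0(f psi) to zero and use the symmetry of N_2), testing the equation of w with p_*,
   and that of p_* with w, gives
     int_0^T int w dnu dt = l int_0^T int <B(u - us), Q^{1/2}D phi^{u_l}> p_* dnu dt,
   and the left-hand side is nonnegative by minimality.  The energy identity for w and
   Gronwall's lemma bound w in L^2(0,T; W^{1,2}) by a constant times l, so that
   int_0^T int <B(u - us), Q^{1/2}D phi^{us}> p_* >= - M l for all small l, hence >= 0.
   Finally the functional v |-> int <B(u - us), v> dnu commutes with the Bochner integral
   in L^1(H; H, nu). *)

Require Import Defs.
From HB Require Import structures.
From mathcomp Require Import all_boot all_order all_algebra.
From mathcomp Require Import all_classical all_reals all_analysis.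
From mathcomp Require Import measurable_realfun ess_sup_inf ring lra.
Set Implicit Arguments.
Unset Strict Implicit.
Unset Printing Implicit Defensive.
Import Order.TTheory GRing.Theory Num.Theory.
Import numFieldNormedType.Exports.
Local Open Scope classical_set_scope.
Local Open Scope ring_scope.

(** * Integration of almost everywhere measurable functions *)

(** A solution is only square integrable into [V], with derivative in the dual, so inserting it into
    its own equation is not a direct computation. The energy identity is proved by telescoping the
    squared norm over a partition: each increment is paired with [f t + f t'], and the error is
    controlled by an approximation of [f] that is continuous in time with values in [V]. Partition
    points are picked where the approximation error is at most about its mean over the cell. Duality
    follows by polarization.

    All spaces consist of representatives, and [sqrtQ_D] and [N2_ext] are fixed by a choice; both
    are first turned into real-valued forms. The vector-valued weak derivative is reduced to scalar
    increments by evaluating it at fixed elements of [V].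

    The constant in front of [l] depends on [phi us], [ps], [T] and a bound on the drifts, not on
    the perturbed state, so each step [l] is treated separately and [l] tends to 0 only in a final
    real inequality. The existence of the Bochner integral in the conclusion is a construction of
    its own, resting on the completeness of L^1(H; H, nu). *)

Section ae_integral.
Context d {T : measurableType d} {R : realType}.
Variable mu : {measure set T -> \bar R}.
Implicit Types D : set T.

Local Open Scope ereal_scope.
Import HBNNSimple.

(** The integral of a nonnegative function is a supremum over the simple functions below it, and
    this is monotone whether or not [f] and [g] are measurable. *)
Lemma ge0_integral_le D (f g : T -> \bar R) :
  (forall x, D x -> 0 <= f x) -> (forall x, D x -> f x <= g x) ->
  \int[mu]_(x in D) f x <= \int[mu]_(x in D) g x.
Proof.
move=> f0 fg; rewrite integral_mkcond [leRHS]integral_mkcond.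
have h0 x : 0 <= (f \_ D) x by apply: erestrict_ge0.
have hfg x : (f \_ D) x <= (g \_ D) x.
  by apply: lee_restrict.
have g0 x : 0 <= (g \_ D) x by exact: le_trans (hfg x).
rewrite ge0_integralTE// ge0_integralTE//.
apply: le_ereal_sup => _ [h hf <-]; exists h => // x.
exact: le_trans (hf x) (hfg x).
Qed.

(** A simple function below [f] keeps its integral when it is cut off on the null set where [f <= g]
    fails, and what remains lies below [g]. Neither function has to be measurable, which is
    essential for norms of vector-valued functions of time. *)
Lemma ge0_ae_integral_le D (f g : T -> \bar R) : measurable D ->
  (forall x, D x -> 0 <= f x) -> (forall x, D x -> 0 <= g x) ->
  {ae mu, forall x, D x -> f x <= g x} ->
  \int[mu]_(x in D) f x <= \int[mu]_(x in D) g x.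
Proof.
move=> mD f0 g0 [N [mN N0 sN]].
rewrite integral_mkcond [leRHS]integral_mkcond.
have h0 x : 0 <= (f \_ D) x by apply: erestrict_ge0.
have hg0 x : 0 <= (g \_ D) x by apply: erestrict_ge0.
rewrite ge0_integralTE//; apply: ge_ereal_sup => _ [h hf <-].
have -> : sintegral mu h = \int[mu]_x (h x)%:E by rewrite integralT_nnsfun.
rewrite (ge0_negligible_integral mN)//; last 2 first.
- exact/measurable_EFinP.
- by move=> x _; rewrite lee_fin.
rewrite integral_mkcond; apply: ge0_integral_le => [x _|x _].
  by apply: erestrict_ge0 => y _; rewrite lee_fin.
rewrite patchE; case: ifPn => [xN|_]; last exact: hg0.
apply: le_trans (hf x) _; rewrite !patchE; case: ifPn => // /set_mem Dx.
move: xN => /set_mem [_ nN]; apply: contrapT => fg; apply: nN; apply: sN => /=.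
by move=> /(_ Dx).
Qed.

Lemma ge0_ae_integral_eq D (f g : T -> \bar R) : measurable D ->
  (forall x, D x -> 0 <= f x) -> (forall x, D x -> 0 <= g x) ->
  {ae mu, forall x, D x -> f x = g x} ->
  \int[mu]_(x in D) f x = \int[mu]_(x in D) g x.
Proof.
move=> mD f0 g0 fg; apply/eqP; rewrite eq_le; apply/andP; split;
  apply: ge0_ae_integral_le => //; apply: filterS fg => x h /h ->//.
Qed.

Lemma ae_integral_eq D (f g : T -> \bar R) : measurable D ->
  {ae mu, forall x, D x -> f x = g x} ->
  \int[mu]_(x in D) f x = \int[mu]_(x in D) g x.
Proof.
move=> mD fg; rewrite integralE [RHS]integralE; congr (_ - _);
  apply: ge0_ae_integral_eq => //; apply: filterS fg => x h /h.
- by rewrite !funeposE => ->.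
- by rewrite !funenegE => ->.
Qed.

End ae_integral.

(* Time-dependent quantities below are only known to coincide almost everywhere with
   measurable functions, because Lebesgue measure on Borel sets is not complete. *)
Section ae_integrable.
Context d {T : measurableType d} {R : realType}.
Variable mu : {measure set T -> \bar R}.
Implicit Types (D : set T) (f g : T -> R).

Definition ae_measurable D f := exists2 h : T -> R, measurable_fun D h &
  {ae mu, forall x, D x -> f x = h x}.

Definition ae_integrable D f := exists2 h : T -> R,
  mu.-integrable D (EFin \o h) & {ae mu, forall x, D x -> f x = h x}.

Lemma ae_Rintegral_eq D f g : measurable D ->
  {ae mu, forall x, D x -> f x = g x} ->
  \int[mu]_(x in D) f x = \int[mu]_(x in D) g x.
Proof.
move=> mD fg; congr fine; apply: ae_integral_eq => //.
by apply: filterS fg => x h /h ->.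
Qed.

Lemma measurable_ae_measurable D f : measurable_fun D f -> ae_measurable D f.
Proof. by move=> mf; exists f => //; apply: nearW. Qed.

Lemma integrable_ae_integrable D f :
  mu.-integrable D (EFin \o f) -> ae_integrable D f.
Proof. by move=> fi; exists f => //; apply: nearW. Qed.

Lemma ae_measurable_eq D f g : {ae mu, forall x, D x -> f x = g x} ->
  ae_measurable D f -> ae_measurable D g.
Proof.
by move=> fg [h mh fh]; exists h => //; apply: filterS2 fg fh => x a b Dx;
  rewrite -a// b.
Qed.

Lemma ae_integrable_eq D f g : {ae mu, forall x, D x -> f x = g x} ->
  ae_integrable D f -> ae_integrable D g.
Proof.
by move=> fg [h mh fh]; exists h => //; apply: filterS2 fg fh => x a b Dx;
  rewrite -a// b.
Qed.

Lemma ae_measurable_comp2 D (F : R -> R -> R) f g :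
  (forall u v : T -> R, measurable_fun D u -> measurable_fun D v ->
     measurable_fun D (fun x => F (u x) (v x))) ->
  ae_measurable D f -> ae_measurable D g ->
  ae_measurable D (fun x => F (f x) (g x)).
Proof.
move=> mF [h mh fh] [k mk gk]; exists (fun x => F (h x) (k x)); first exact: mF.
by apply: filterS2 fh gk => x a b Dx; rewrite a// b.
Qed.

Lemma ae_measurableD D f g : ae_measurable D f -> ae_measurable D g ->
  ae_measurable D (fun x => f x + g x).
Proof. by apply: ae_measurable_comp2 => u v mu_ mv; exact: measurable_funD. Qed.

Lemma ae_measurableM D f g : ae_measurable D f -> ae_measurable D g ->
  ae_measurable D (fun x => f x * g x).
Proof. by apply: ae_measurable_comp2 => u v mu_ mv; exact: measurable_funM. Qed.

Lemma ae_integrable_measurable D f : ae_integrable D f -> ae_measurable D f.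
Proof.
by move=> [h /measurable_int/measurable_EFinP mh fh]; exists h.
Qed.

Lemma ae_integrableD D f g : measurable D ->
  ae_integrable D f -> ae_integrable D g ->
  ae_integrable D (fun x => f x + g x).
Proof.
move=> mD [h mh fh] [k mk gk]; exists (fun x => h x + k x).
  by rewrite /comp; under eq_fun do rewrite EFinD; exact: integrableD.
by apply: filterS2 fh gk => x a b Dx; rewrite a// b.
Qed.

Lemma ae_integrableZ D (a : R) f : measurable D ->
  ae_integrable D f -> ae_integrable D (fun x => a * f x).
Proof.
move=> mD [h mh fh]; exists (fun x => a * h x).
  by rewrite /comp; under eq_fun do rewrite EFinM; exact: integrableZl.
by apply: filterS fh => x b Dx; rewrite b.
Qed.

Lemma ae_integrableN D f : measurable D ->
  ae_integrable D f -> ae_integrable D (fun x => - f x).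
Proof.
move=> mD /(ae_integrableZ (-1) mD); apply: ae_integrable_eq.
by apply: nearW => x _; rewrite mulN1r.
Qed.

Lemma ae_integrableB D f g : measurable D ->
  ae_integrable D f -> ae_integrable D g ->
  ae_integrable D (fun x => f x - g x).
Proof. by move=> mD fi gi; apply: ae_integrableD => //; exact: ae_integrableN. Qed.

Lemma ae_integrable_norm D f : measurable D ->
  ae_integrable D f -> ae_integrable D (fun x => `|f x|).
Proof.
move=> mD [h mh fh]; exists (fun x => `|h x|).
  exact: (integrable_norm mh).
by apply: filterS fh => x b Dx; rewrite b.
Qed.

Lemma ae_integrableS D E f : measurable D -> measurable E -> E `<=` D ->
  ae_integrable D f -> ae_integrable E f.
Proof.
move=> mD mE ED [h mh fh]; exists h; first exact: integrableS mh.
by apply: filterS fh => x b /ED/b.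
Qed.

Lemma ae_integrable_cst D (c : R) : measurable D -> (mu D < +oo)%E ->
  ae_integrable D (fun=> c).
Proof.
move=> mD Dy; apply: integrable_ae_integrable.
apply/integrableP; split; first exact: measurable_cst.
rewrite [ltLHS](_ : _ = \int[mu]_(x in D) cst (`|c|%:E) x)%E//.
by rewrite integral_cst// lte_mul_pinfty// lee_fin.
Qed.

Lemma ae_integrable_le D f g : measurable D -> ae_measurable D f ->
  ae_integrable D g -> {ae mu, forall x, D x -> `|f x| <= g x} ->
  ae_integrable D f.
Proof.
move=> mD [h mh fh] [k mk gk] fg; exists h => //.
have /integrableP[mk' ki] := mk.
apply/integrableP; split; first exact/measurable_EFinP.
apply: le_lt_trans ki; apply: ae_ge0_le_integral => //.
- exact/measurableT_comp/measurable_EFinP.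
- exact/measurableT_comp.
apply: filterS3 fh gk fg => x a b c Dx /=.
by rewrite lee_fin -a// -b//; apply: le_trans (c Dx) (ler_norm _).
Qed.

Lemma ae_RintegralD D f g : measurable D ->
  ae_integrable D f -> ae_integrable D g ->
  \int[mu]_(x in D) (f x + g x) =
  \int[mu]_(x in D) f x + \int[mu]_(x in D) g x.
Proof.
move=> mD [h mh fh] [k mk gk].
rewrite (ae_Rintegral_eq mD fh) (ae_Rintegral_eq mD gk) -RintegralD//.
apply: ae_Rintegral_eq => //.
by apply: filterS2 fh gk => x a b Dx; rewrite a// b.
Qed.

Lemma ae_RintegralZ D (a : R) f : measurable D -> ae_integrable D f ->
  \int[mu]_(x in D) (a * f x) = a * \int[mu]_(x in D) f x.
Proof.
move=> mD [h mh fh]; rewrite (ae_Rintegral_eq mD fh) -RintegralZl//.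
by apply: ae_Rintegral_eq => //; apply: filterS fh => x b Dx; rewrite b.
Qed.

Lemma ae_RintegralN D f : measurable D -> ae_integrable D f ->
  \int[mu]_(x in D) (- f x) = - \int[mu]_(x in D) f x.
Proof.
move=> mD fi; rewrite -[RHS]mulN1r -ae_RintegralZ//.
by apply: eq_Rintegral => x _; rewrite mulN1r.
Qed.

Lemma ae_RintegralB D f g : measurable D ->
  ae_integrable D f -> ae_integrable D g ->
  \int[mu]_(x in D) (f x - g x) =
  \int[mu]_(x in D) f x - \int[mu]_(x in D) g x.
Proof.
by move=> mD fi gi; rewrite ae_RintegralD ?ae_RintegralN//; exact: ae_integrableN.
Qed.

Lemma ae_Rintegral_ge0 D f : measurable D ->
  {ae mu, forall x, D x -> 0 <= f x} -> 0 <= \int[mu]_(x in D) f x.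
Proof.
move=> mD f0.
have -> : \int[mu]_(x in D) f x = \int[mu]_(x in D) `|f x|.
  apply: ae_Rintegral_eq => //; apply: filterS f0 => x a Dx.
  by rewrite ger0_norm// a.
exact: Rintegral_ge0.
Qed.

Lemma ae_Rintegral_le D f g : measurable D ->
  ae_integrable D f -> ae_integrable D g ->
  {ae mu, forall x, D x -> f x <= g x} ->
  \int[mu]_(x in D) f x <= \int[mu]_(x in D) g x.
Proof.
move=> mD fi gi fg; rewrite -subr_ge0 -ae_RintegralB//.
by apply: ae_Rintegral_ge0 => //; apply: filterS fg => x a Dx; rewrite subr_ge0 a.
Qed.

Lemma ae_Rintegral_norm D f : measurable D -> ae_integrable D f ->
  `|\int[mu]_(x in D) f x| <= \int[mu]_(x in D) `|f x|.
Proof.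
move=> mD fi; rewrite ler_norml -ae_RintegralN//; last first.
  exact: ae_integrable_norm.
apply/andP; split; apply: ae_Rintegral_le => //.
- exact/ae_integrableN/ae_integrable_norm.
- by apply: nearW => x _; rewrite lerNl -normrN ler_norm.
- exact: ae_integrable_norm.
- by apply: nearW => x _; exact: ler_norm.
Qed.

Lemma ae_Rintegral_norm_le D f g : measurable D -> ae_integrable D f ->
  ae_integrable D g -> {ae mu, forall x, D x -> `|f x| <= g x} ->
  `|\int[mu]_(x in D) f x| <= \int[mu]_(x in D) g x.
Proof.
move=> mD fi gi fg; apply: le_trans (ae_Rintegral_norm mD fi) _.
by apply: ae_Rintegral_le => //; exact: ae_integrable_norm.
Qed.

Lemma ae_integrable_EFin D f : measurable D -> ae_integrable D f ->
  (\int[mu]_(x in D) (f x)%:E = (\int[mu]_(x in D) f x)%:E)%E.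
Proof.
move=> mD [h mh fh]; rewrite (ae_Rintegral_eq mD fh) /Rintegral fineK.
  by apply: ae_integral_eq => //; apply: filterS fh => x a Dx; rewrite a.
exact: integrable_fin_num.
Qed.

Lemma ae_integrable_ge0 D f : measurable D -> ae_measurable D f ->
  (\int[mu]_(x in D) `|f x|%:E < +oo)%E -> ae_integrable D f.
Proof.
move=> mD [h mh fh] fy; exists h => //; apply/integrableP; split.
  exact/measurable_EFinP.
apply: le_lt_trans fy; apply: ge0_ae_integral_le => //.
by apply: filterS fh => x a Dx /=; rewrite a.
Qed.

(** Measurable versions of all the [f_ n] are fixed at once, at the cost of a countable union of
    null sets; they are then set to 0 on a measurable null set [N], so that the limit exists at
    every point of [D]. *)
Lemma ae_measurable_lim D (f_ : nat -> T -> R) f : measurable D ->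
  (forall n, ae_measurable D (f_ n)) ->
  {ae mu, forall x, D x -> f_ n x @[n --> \oo] --> f x} ->
  ae_measurable D f.
Proof.
move=> mD mf ff.
have [h_ hP] : {h_ : nat -> T -> R & forall n, measurable_fun D (h_ n) /\
    {ae mu, forall x, D x -> f_ n x = h_ n x}}.
  apply: (@choice _ _ (fun n h => measurable_fun D h /\
    {ae mu, forall x, D x -> f_ n x = h x})) => n.
  by have [h mh fh] := mf n; exists h.
have hall : {ae mu, forall x, D x -> h_ n x @[n --> \oo] --> f x}.
  have : {ae mu, forall x, forall n, D x -> f_ n x = h_ n x}.
    by apply/ae_foralln => n; have [] := hP n.
  move=> fh; apply: filterS2 ff fh => x a b Dx.
  rewrite (_ : h_ ^~ x = f_ ^~ x) ?a//; first exact: a.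
  by apply/funext => n; rewrite b.
have [N [mN N0 sN]] := hall.
exists (f \_ (~` N)); last first.
  exists N; split => // x /= nfx; apply: contrapT => Nx; apply: nfx => Dx.
  by rewrite patchE mem_set.
apply: (@measurable_fun_cvg _ _ _ _ (fun n => h_ n \_ (~` N))) => [n|x Dx].
  have [mh _] := hP n; apply/measurable_restrict => //; first exact: measurableC.
  exact: measurable_funS mh.
rewrite patchE; case: ifPn => [/set_mem xN|xN].
  rewrite (_ : (fun n => (h_ n \_ (~` N)) x) = h_ ^~ x).
    by apply: contrapT => nc; apply: xN; apply: sN => /= /(_ Dx).
  by apply/funext => n; rewrite patchE mem_set.
rewrite (_ : (fun n => (h_ n \_ (~` N)) x) = cst 0); first exact: cvg_cst.
by apply/funext => n; rewrite patchE (negbTE xN).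
Qed.

End ae_integrable.

Section ae_lebesgue.
Context {R : realType}.
Local Notation leb := (@lebesgue_measure R).

Lemma ae_leb1 (P Q : R -> Prop) : {ae leb, forall x, P x} ->
  (forall x, P x -> Q x) -> {ae leb, forall x, Q x}.
Proof.
by move=> hP PQ; exact: (@filterS _ _ (@ae_filter_ringOfSetsType _ _ _ leb) _ _ PQ hP).
Qed.

Lemma ae_leb2 (P P' Q : R -> Prop) : {ae leb, forall x, P x} ->
  {ae leb, forall x, P' x} ->
  (forall x, P x -> P' x -> Q x) -> {ae leb, forall x, Q x}.
Proof.
by move=> hP hP' PQ; exact: (@filterS2 _ _ (@ae_filter_ringOfSetsType _ _ _ leb)
  _ _ _ PQ hP hP').
Qed.

Lemma ae_leb3 (P P' P'' Q : R -> Prop) : {ae leb, forall x, P x} ->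
  {ae leb, forall x, P' x} -> {ae leb, forall x, P'' x} ->
  (forall x, P x -> P' x -> P'' x -> Q x) -> {ae leb, forall x, Q x}.
Proof.
by move=> hP hP' hP'' PQ; exact: (@filterS3 _ _ (@ae_filter_ringOfSetsType _ _ _ leb)
  _ _ _ _ PQ hP hP' hP'').
Qed.

Lemma ae_lebT (P : R -> Prop) : (forall x, P x) -> {ae leb, forall x, P x}.
Proof.
by move=> hP; exact: (@nearW _ _ _ (@ae_filter_ringOfSetsType _ _ _ leb)).
Qed.

End ae_lebesgue.

(** * Primitives of functions integrable up to a null set *)

Section primitive.
Context {R : realType}.
Local Notation leb := (@lebesgue_measure R).
Implicit Types (f : R -> R) (a b c t : R).

Lemma lebesgue_itvoo_lty a b : (leb `]a, b[%classic < +oo)%E.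
Proof. by rewrite lebesgue_measure_itv/=; case: ifP => // _; rewrite -EFinB ltry. Qed.

Lemma fine_lebesgue_itvoo a b : a <= b -> fine (leb `]a, b[%classic) = b - a.
Proof.
move=> ab; rewrite lebesgue_measure_itv/= lte_fin.
by move: ab; rewrite le_eqVlt => /predU1P[->|->//]; rewrite ltxx subrr.
Qed.

Lemma ae_integrable_itvS a b c t f : c <= a -> b <= t ->
  ae_integrable leb `]c, t[ f -> ae_integrable leb `]a, b[ f.
Proof.
move=> ca bt; apply: ae_integrableS => //.
by apply: subset_itv; rewrite bnd_simp.
Qed.

Lemma ae_Rintegral_itvD a b c f : a <= b -> b <= c ->
  ae_integrable leb `]a, c[ f ->
  \int[leb]_(x in `]a, c[) f x =
  \int[leb]_(x in `]a, b[) f x + \int[leb]_(x in `]b, c[) f x.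
Proof.
move=> ab bc fi.
move: ab; rewrite le_eqVlt => /predU1P[->|ab].
  by rewrite set_itvoo0 ?bnd_simp// Rintegral_set0 add0r.
move: bc; rewrite le_eqVlt => /predU1P[<-|bc].
  by rewrite [X in _ + X](_ : _ = 0) ?addr0// set_itvoo0 ?bnd_simp// Rintegral_set0.
have [h hi fh] := fi.
rewrite (ae_Rintegral_eq _ fh)//.
rewrite [X in X + _](_ : _ = \int[leb]_(x in `]a, b[) h x); last first.
  apply: ae_Rintegral_eq => //; apply: filterS fh => x + xab; apply.
  by move: xab; rewrite /= !in_itv/= => /andP[-> /lt_trans->].
rewrite [X in _ + X](_ : _ = \int[leb]_(x in `]b, c[) h x); last first.
  apply: ae_Rintegral_eq => //; apply: filterS fh => x + xab; apply.
  by move: xab; rewrite /= !in_itv/= => /andP[/(lt_trans ab)-> ->].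
have abc : leb.-integrable `]a, b] (EFin \o h).
  by apply: integrableS hi => //; apply: subset_itv; rewrite bnd_simp.
rewrite [X in _ = X + _]Rintegral_itv_bndo_bndc; last first.
  by apply: integrableS abc => //; apply: subset_itv; rewrite bnd_simp.
by rewrite -(@Rintegral_itvB R h _ _ b hi) ?bnd_simp ?ltW// addrC subrK.
Qed.

Definition primitive f t : R := \int[leb]_(r in `]0%R, t[) f r.

Lemma primitive_sub T f a b : ae_integrable leb `]0, T[ f ->
  0 <= a -> a <= b -> b <= T ->
  \int[leb]_(x in `]a, b[) f x = primitive f b - primitive f a.
Proof.
move=> fi a0 ab bT; rewrite /primitive (@ae_Rintegral_itvD 0 a b)//.
  by rewrite addrAC subrr add0r.
exact: ae_integrable_itvS fi.
Qed.

Lemma primitive0 f : primitive f 0 = 0.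
Proof. by rewrite /primitive set_itvoo0 ?Rintegral_set0// bnd_simp. Qed.

Lemma primitive_nd T f a b : ae_integrable leb `]0, T[ f ->
  {ae leb, forall x, x \in `]0, T[ -> 0 <= f x} ->
  0 <= a -> a <= b -> b <= T -> primitive f a <= primitive f b.
Proof.
move=> fi f0 a0 ab bT; rewrite -subr_ge0 -(primitive_sub fi)//.
apply: ae_Rintegral_ge0 => //; refine (ae_leb1 f0 _) => x + xab; apply.
move: xab; rewrite /= !in_itv/= => /andP[ax xb].
by rewrite (le_lt_trans a0 ax) (lt_le_trans xb bT).
Qed.

Lemma primitive_continuous T f : 0 <= T -> ae_integrable leb `]0, T[ f ->
  {within `[0, T], continuous (primitive f)}.
Proof.
move=> T0 [h hi fh].
(* A measurable version of [f], extended by 0, to which the continuity of parametrised integrals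
   over a closed interval applies. *)
pose k := h \_ `]0, T[.
have ki : leb.-integrable `[0, T] (EFin \o k).
  rewrite -restrict_EFin; apply/integrable_restrict => //=.
  rewrite setIidr//; exact: subset_itv_oo_cc.
have := parameterized_integral_continuous T0 ki.
apply: subspace_eq_continuous => t /set_mem tT.
rewrite /from_subspace /parameterized_integral /primitive.
move: tT; rewrite /= in_itv/= => /andP[t0 tT].
rewrite -Rintegral_itv_bndo_bndc; last first.
  apply: integrableS ki => //; apply: subset_itv; rewrite bnd_simp//.
rewrite -Rintegral_itv_obnd_cbnd; last first.
  apply: integrableS ki => //; apply: subset_itv; rewrite bnd_simp//.
apply/esym/ae_Rintegral_eq => //; apply: filterS fh => x + xt.
have xT : `]0, T[%classic x.
  by move: xt; rewrite /= !in_itv/= => /andP[-> /lt_le_trans->].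
by move=> /(_ xT) ->; rewrite /k patchE mem_set.
Qed.

(** Otherwise [f] would exceed its mean plus [eta] almost everywhere on the interval. This supplies
    the partition points of the energy identity, with [P] recording that they avoid a null set. *)
Lemma exists_good_point a b f (P : R -> Prop) eta : a < b -> 0 < eta ->
  ae_integrable leb `]a, b[ f ->
  {ae leb, forall x, x \in `]a, b[ -> P x} ->
  exists t, [/\ a < t, t < b, P t &
    f t * (b - a) <= \int[leb]_(x in `]a, b[) f x + eta * (b - a)].
Proof.
move=> ab eta0 fi Pae; apply: contrapT => /forallNP noP.
have ba : 0 < b - a by rewrite subr_gt0.
pose c := (\int[leb]_(x in `]a, b[) f x) / (b - a) + eta.
have : \int[leb]_(x in `]a, b[) c <= \int[leb]_(x in `]a, b[) f x.
  apply: ae_Rintegral_le => //.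
    by apply: ae_integrable_cst => //; exact: lebesgue_itvoo_lty.
  refine (ae_leb1 Pae _) => x Px xab; rewrite leNgt; apply/negP => fc.
  move: (xab); rewrite /= in_itv/= => /andP[ax xb].
  apply: (noP x); split => //; first exact: Px.
  move: fc; rewrite -(ltr_pM2r ba) => /ltW/le_trans; apply.
  by rewrite mulrDl divfK// gt_eqF.
rewrite Rintegral_cst// (fine_lebesgue_itvoo (ltW ab)) /c mulrDl divfK ?gt_eqF//.
by rewrite gerDl leNgt mulr_gt0.
Qed.

End primitive.

(** * Energy identity for weak evolutions in a Gelfand triple *)

Section energy.
Context {R : realType} {W : lmodType R}.
Local Notation leb := (@lebesgue_measure R).
(** [M] and [V] select, inside one vector space, the representatives of elements of the pivot space
    and of the smaller space; [hp] is the pivot product and [nv] the norm of [V]. Neither is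
    required to be definite, since different representatives may denote one element. *)
Variables (M V : set W) (hp : W -> W -> R) (nv : W -> R) (T : R).
Hypothesis T0 : 0 < T.
Hypothesis Mlin : forall (a : R) x y, M x -> M y -> M (a *: x + y).
Hypothesis hp_lin : forall (a : R) x y z, M x -> M y -> M z ->
  hp (a *: x + y) z = a * hp x z + hp y z.
Hypothesis hpC : forall x y, hp x y = hp y x.
Hypothesis hp_ge0 : forall x, M x -> 0 <= hp x x.
Hypothesis VM : V `<=` M.
Hypothesis Vlin : forall (a : R) x y, V x -> V y -> V (a *: x + y).
Hypothesis nvD : forall x y, V x -> V y -> nv (x + y) <= nv x + nv y.
Hypothesis nvZ : forall (a : R) x, V x -> nv (a *: x) = `|a| * nv x.
Hypothesis nv_ge0 : forall x, V x -> 0 <= nv x.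

Let VD x y : V x -> V y -> V (x + y).
Proof. by move=> Vx Vy; rewrite -[x]scale1r; exact: Vlin. Qed.

Let VB x y : V x -> V y -> V (x - y).
Proof. by move=> Vx Vy; rewrite addrC -scaleN1r; exact: Vlin. Qed.

Let nvN x : V x -> nv (- x) = nv x.
Proof. by move=> Vx; rewrite -scaleN1r nvZ// normrN1 mul1r. Qed.

Let MD x y : M x -> M y -> M (x + y).
Proof. by move=> Vx Vy; rewrite -[x]scale1r; exact: Mlin. Qed.

Let MB x y : M x -> M y -> M (x - y).
Proof. by move=> Vx Vy; rewrite addrC -scaleN1r; exact: Mlin. Qed.

Let hpDl x y z : M x -> M y -> M z -> hp (x + y) z = hp x z + hp y z.
Proof. by move=> *; rewrite -{1}[x]scale1r hp_lin// mul1r. Qed.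

Let hpBl x y z : M x -> M y -> M z -> hp (x - y) z = hp x z - hp y z.
Proof. by move=> *; rewrite addrC -scaleN1r hp_lin// mulN1r addrC. Qed.

Let hpDr x y z : M x -> M y -> M z -> hp z (x + y) = hp z x + hp z y.
Proof. by move=> *; rewrite hpC hpDl// ![hp _ z]hpC. Qed.

Let hpBr x y z : M x -> M y -> M z -> hp z (x - y) = hp z x - hp z y.
Proof. by move=> *; rewrite hpC hpBl// ![hp _ z]hpC. Qed.

Lemma hp_cauchy_schwarz x y : M x -> M y -> hp x y ^+ 2 <= hp x x * hp y y.
Proof.
move=> Mx My.
have q (r : R) : 0 <= r ^+ 2 * hp x x + r * (hp x y *+ 2) + hp y y.
  have := hp_ge0 (Mlin r Mx My).
  rewrite hp_lin//; last exact: Mlin.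
  rewrite ![hp _ (r *: x + y)]hpC !hp_lin// [hp y x]hpC.
  move=> /le_trans; apply; rewrite le_eqVlt; apply/orP; left; apply/eqP; ring.
have [x0|x0] := eqVneq (hp x x) 0.
  rewrite x0 mul0r; have [->|xy] := eqVneq (hp x y) 0; first by rewrite expr0n.
  (* The form is only semidefinite. Here the quadratic has degenerated to an affine function of [r],
     to which this [r] gives the value -1. *)
  have := q (- (hp y y + 1) / (hp x y *+ 2)); rewrite x0 mulr0 add0r divfK.
    by move=> ?; exfalso; lra.
  by rewrite mulrn_eq0.
have xp : 0 < hp x x by rewrite lt_def x0 hp_ge0.
(* The minimiser of the quadratic. *)
have := q (- hp x y / hp x x).
rewrite -(pmulr_rge0 _ xp).
have -> : hp x x * ((- hp x y / hp x x) ^+ 2 * hp x x +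
   - hp x y / hp x x * (hp x y *+ 2) + hp y y) = hp x x * hp y y - hp x y ^+ 2.
  by field.
by rewrite subr_ge0.
Qed.

Definition time_continuous (f : R -> W) := forall t, t \in `[0, T] ->
  hp (f s - f t) (f s - f t) @[s --> within `[0, T] (nbhs t)] --> 0.

(** Density of continuous functions in L^2(0, T; V), free of measurability questions:
    [nv (f t - s t)] need not be measurable in [t], so a majorant [e] is carried along and only its
    square is integrated. The last clause is the uniform continuity of [s]. *)
Definition approximable (f : R -> W) := forall eps : R, 0 < eps ->
  exists (s : R -> W) (e : R -> R),
  [/\ forall t, V (s t),
      {ae leb, forall t, t \in `]0, T[ -> nv (f t - s t) <= e t},
      ae_integrable leb `]0, T[ (fun t => e t ^+ 2),
      \int[leb]_(t in `]0, T[) (e t ^+ 2) <= eps &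
      forall eta, 0 < eta -> exists2 delta : R, 0 < delta &
        forall t t', t \in `[0, T] -> t' \in `[0, T] -> `|t - t'| <= delta ->
          nv (s t - s t') <= eta].

(* f' = G in the weak sense against V, with f square integrable into V and G
   square integrable into the dual of V; K dominates both norms. *)
Definition evolves (f : R -> W) (G : R -> W -> R) := [/\
  forall t, t \in `[0, T] -> M (f t),
  time_continuous f,
  approximable f,
  exists2 K : R -> R, ae_integrable leb `]0, T[ (fun t => K t ^+ 2) &
    {ae leb, forall t, t \in `]0, T[ -> [/\ V (f t), 0 <= K t,
      nv (f t) <= K t,
      forall (a : R) x y, V x -> V y -> G t (a *: x + y) = a * G t x + G t y &
      forall x, V x -> `|G t x| <= K t * nv x]} &
  forall x, V x -> ae_measurable leb `]0, T[ (G^~ x) /\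
    forall a b, 0 <= a -> a <= b -> b <= T ->
      hp (f b - f a) x = \int[leb]_(t in `]a, b[) G t x].

Lemma energy_continuous f : (forall t, t \in `[0, T] -> M (f t)) ->
  time_continuous f -> {within `[0, T], continuous (fun t => hp (f t) (f t))}.
Proof.
move=> Mf cf; apply/subspace_continuousP => t tT.
have fs0 : Num.sqrt (hp (f s - f t) (f s - f t)) @[s --> within `[0, T] (nbhs t)]
    --> 0.
  rewrite -[X in _ --> X]sqrtr0; apply: continuous_cvg; first exact: sqrt_continuous.
  exact: (cf _ tT).
have lim0 : (hp (f s - f t) (f s - f t) + 2 * Num.sqrt (hp (f t) (f t)) *
  Num.sqrt (hp (f s - f t) (f s - f t))) @[s --> within `[0, T] (nbhs t)] --> 0.
  rewrite -[X in _ --> X]addr0 -[X in _ --> _ + X](mulr0 (2 * Num.sqrt (hp (f t) (f t)))).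
  by apply: cvgD; [exact: (cf _ tT)|exact: cvgMr].
apply/cvgrPdist_le => eps eps0.
have /cvgrPdist_le/(_ _ eps0) := lim0.
rewrite !near_withinE; apply: filterS => s + sT => /(_ sT).
rewrite /from_subspace add0r normrN; apply: le_trans; rewrite distrC [leRHS]ger0_norm; last first.
  by rewrite addr_ge0 ?mulr_ge0 ?sqrtr_ge0// hp_ge0//; apply: MB; apply: Mf.
have Ms := Mf _ sT; have Mt := Mf _ tT.
have -> : hp (f s) (f s) - hp (f t) (f t) =
    hp (f s - f t) (f s - f t) + 2 * hp (f s - f t) (f t).
  rewrite !(hpBl, hpBr)//; try exact: MB.
  rewrite (hpC (f t) (f s)); ring.
apply: le_trans (ler_normD _ _) _; rewrite ger0_norm ?hp_ge0//; last exact: MB.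
rewrite lerD2l normrM ger0_norm// -mulrA ler_pM2l// -sqrtrM ?hp_ge0//.
rewrite -[leLHS]sqrtr_sqr ler_wsqrtr// mulrC.
by apply: hp_cauchy_schwarz => //; exact: MB.
Qed.

(** Young's inequality for each of the four summands, each spending a quarter of [dl * k ^+ 2]. *)
Lemma young_sum (dl k r x y z : R) : 0 < dl ->
  k * (2 * r + x + y + 2 * z) <=
  dl * k ^+ 2 + (4 * r ^+ 2 + x ^+ 2 + y ^+ 2 + 4 * z ^+ 2) / dl.
Proof.
move=> dl0; rewrite -subr_ge0.
have -> : dl * k ^+ 2 + (4 * r ^+ 2 + x ^+ 2 + y ^+ 2 + 4 * z ^+ 2) / dl -
    k * (2 * r + x + y + 2 * z) =
  ((dl * k - 4 * r) ^+ 2 + (dl * k - 2 * x) ^+ 2 + (dl * k - 2 * y) ^+ 2 +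
   (dl * k - 4 * z) ^+ 2) / (4 * dl).
  by field; lra.
by rewrite divr_ge0 ?mulr_ge0 ?addr_ge0 ?sqr_ge0// ltW.
Qed.

Section identity.
Variables (f : R -> W) (G : R -> W -> R).
Hypothesis fG : evolves f G.
Hypothesis mGf : ae_measurable leb `]0, T[ (fun t => G t (f t)).

Lemma evolves_integrable x : V x -> ae_integrable leb `]0, T[ (G^~ x).
Proof.
move=> Vx; have [_ _ _ [K Ki Kae] wk] := fG; have [mx _] := wk x Vx.
apply: (ae_integrable_le (mu := leb) (g := fun t => nv x * (K t ^+ 2 + 1))) => //.
  apply: ae_integrableZ => //; apply: ae_integrableD => //.
  by apply: ae_integrable_cst => //; exact: lebesgue_itvoo_lty.
refine (ae_leb1 Kae _) => t h /h[_ K0 _ _ /(_ _ Vx)] /le_trans; apply.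
by rewrite mulrC ler_wpM2l ?nv_ge0//; nra.
Qed.

Lemma evolves_diag_integrable : ae_integrable leb `]0, T[ (fun t => G t (f t)).
Proof.
have [_ _ _ [K Ki Kae] wk] := fG.
apply: (ae_integrable_le (mu := leb) (g := fun t => K t ^+ 2)) => //.
refine (ae_leb1 Kae _) => t h /h[Vf K0 fK _ /(_ _ Vf)] /le_trans; apply.
by rewrite expr2 ler_wpM2l.
Qed.

(** The energy defect; the energy identity says that it is constant. *)
Let X t := hp (f t) (f t) - 2 * primitive (fun r => G r (f r)) t.

Local Ltac section_lra :=
  clear -T0 Mlin hp_lin hpC hp_ge0 VM Vlin nvD nvZ nvN nv_ge0 VD VB MD MB hpDl hpBl
    hpDr hpBr fG mGf X; lra.

(** The increment of the squared norm is [hp (f t' - f t) (f t' + f t)], hence the integral of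
    [G r (f t' + f t)], because [f t' + f t] lies in [V]. Subtracting [2 * G r (f r)] leaves [G r]
    at [(f t' - f r) + (f t - f r)]. Both differences are small in [V], since they can be routed
    through the continuous [s] at the price [e u + e r + eta]. *)
Lemma energy_step (K : R -> R) (s : R -> W) (e : R -> R) (dl eta t t' : R) : 0 < dl ->
  ae_integrable leb `]0, T[ (fun t => K t ^+ 2) ->
  ae_integrable leb `]0, T[ (fun t => e t ^+ 2) ->
  {ae leb, forall t, t \in `]0, T[ -> [/\ V (f t), 0 <= K t, nv (f t) <= K t,
      forall (a : R) x y, V x -> V y -> G t (a *: x + y) = a * G t x + G t y &
      forall x, V x -> `|G t x| <= K t * nv x]} ->
  (forall t, V (s t)) ->
  {ae leb, forall t, t \in `]0, T[ -> nv (f t - s t) <= e t} ->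
  0 < t -> t <= t' -> t' < T -> V (f t) -> V (f t') ->
  nv (f t - s t) <= e t -> nv (f t' - s t') <= e t' ->
  (forall r, t <= r -> r <= t' -> nv (s t - s r) <= eta /\ nv (s t' - s r) <= eta) ->
  `|X t' - X t| <= primitive (fun r : R => dl * K r ^+ 2 + 4 / dl * e r ^+ 2) t' -
     primitive (fun r : R => dl * K r ^+ 2 + 4 / dl * e r ^+ 2) t +
     (t' - t) / dl * (e t ^+ 2 + e t' ^+ 2 + 4 * eta ^+ 2).
Proof.
move=> dl0 Ki ei Kae Vs eae t0 tt' t'T Vt Vt' et et' seta.
have [Mf _ _ _ wk] := fG.
have tT : t \in `[0, T].
  by rewrite in_itv/= (ltW t0) (le_trans tt' (ltW t'T)).
have t'T' : t' \in `[0, T].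
  by rewrite in_itv/= (ltW (lt_le_trans t0 tt')) (ltW t'T).
have Mt := Mf _ tT; have Mt' := Mf _ t'T'.
have Vtt : V (f t' + f t) by exact: VD.
have -> : X t' - X t =
    \int[leb]_(r in `]t, t'[) (G r (f t' + f t) - 2 * G r (f r)).
  rewrite ae_RintegralB//; last 2 first.
  - by apply: ae_integrable_itvS (evolves_integrable Vtt); exact: ltW.
  - apply: ae_integrableZ => //.
    by apply: ae_integrable_itvS evolves_diag_integrable; exact: ltW.
  rewrite ae_RintegralZ//; last first.
    by apply: ae_integrable_itvS evolves_diag_integrable; exact: ltW.
  rewrite (primitive_sub evolves_diag_integrable (ltW t0) tt' (ltW t'T)).
  have [_ /(_ t t' (ltW t0) tt' (ltW t'T)) <-] := wk _ Vtt.
  rewrite !(hpBl, hpDr)//; last exact: MD.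
  by rewrite (hpC (f t) (f t')) /X; ring.
have Pi : ae_integrable leb `]0, T[ (fun r : R => dl * K r ^+ 2 + 4 / dl * e r ^+ 2).
  by apply: ae_integrableD => //; exact: ae_integrableZ.
rewrite -(primitive_sub Pi (ltW t0) tt' (ltW t'T)).
have -> : (t' - t) / dl * (e t ^+ 2 + e t' ^+ 2 + 4 * eta ^+ 2) =
    \int[leb]_(r in `]t, t'[) ((e t ^+ 2 + e t' ^+ 2 + 4 * eta ^+ 2) / dl).
  by rewrite Rintegral_cst// fine_lebesgue_itvoo//; ring.
rewrite -ae_RintegralD//; last 2 first.
- by apply: ae_integrable_itvS Pi; exact: ltW.
- by apply: ae_integrable_cst => //; exact: lebesgue_itvoo_lty.
apply: ae_Rintegral_norm_le => //.
- apply: ae_integrableB => //.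
    by apply: ae_integrable_itvS (evolves_integrable Vtt); exact: ltW.
  apply: ae_integrableZ => //.
  by apply: ae_integrable_itvS evolves_diag_integrable; exact: ltW.
- apply: ae_integrableD => //.
    by apply: ae_integrable_itvS Pi; exact: ltW.
  by apply: ae_integrable_cst => //; exact: lebesgue_itvoo_lty.
refine (ae_leb2 Kae eae _) => r Kr er; rewrite /= in_itv/= => /andP[tr rt'].
have rT : r \in `]0, T[ by rewrite in_itv/= (lt_trans t0 tr) (lt_trans rt' t'T).
have [Vr K0 _ Gl Gb] := Kr rT; have {}er := er rT.
have Gl1 x y : V x -> V y -> G r (x + y) = G r x + G r y.
  by move=> Vx Vy; rewrite -{1}[x]scale1r Gl// mul1r.
have Gl2 x y : V x -> V y -> G r (x - y) = G r x - G r y.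
  by move=> Vx Vy; rewrite addrC -scaleN1r Gl// mulN1r addrC.
have -> : G r (f t' + f t) - 2 * G r (f r) = G r ((f t' - f r) + (f t - f r)).
  rewrite [RHS]Gl1; [|exact: VB|exact: VB].
  by rewrite !Gl2// Gl1//; ring.
apply: le_trans (Gb _ _) _; first by apply: VD; exact: VB.
have tel (x y z : W) : (x - y) + (y - z) = x - z by rewrite addrA subrK.
have dist u : V (f u) -> nv (f u - s u) <= e u -> nv (s u - s r) <= eta ->
    nv (f u - f r) <= e u + e r + eta.
  move=> Vu eu su.
  have -> : f u - f r = (f u - s u) + ((s u - s r) - (f r - s r)).
    by rewrite opprB !tel.
  apply: le_trans (nvD _ _) _; [exact: VB|by apply: VB; exact: VB|].
  rewrite -[leRHS]addrA lerD//.
  apply: le_trans (nvD _ _) _; [exact: VB|by rewrite opprB; exact: VB|].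
  by rewrite nvN; [rewrite [leRHS]addrC; exact: lerD|exact: VB].
have [st st'] := seta r (ltW tr) (ltW rt').
apply: le_trans (_ : K r * (2 * e r + e t + e t' + 2 * eta) <= _).
  rewrite ler_wpM2l//; apply: le_trans (nvD _ _) _; [exact: VB|exact: VB|].
  have := lerD (dist _ Vt' et' st') (dist _ Vt et st).
  move=> /le_trans; apply; lra.
(* Separates [K r], which is controlled through its square, from the errors; [dl] keeps the share of
   [K] small. *)
apply: le_trans (young_sum _ _ _ _ _ dl0) _.
by rewrite le_eqVlt; apply/orP; left; apply/eqP; field; lra.
Qed.

(** The interval is cut into [n.+1] equal cells, a good point is chosen in each, and [energy_step]
    is summed over neighbouring good points. The end points themselves need not be good, as [f a]
    and [f b] may lie outside [V]; there the continuity of [X] is used, which costs [2 * eta]. *)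
Lemma energy_bound (a b dl eps eta : R) : 0 <= a -> a < b -> b <= T ->
  0 < dl -> 0 < eps -> 0 < eta ->
  {within `[0, T], continuous X} ->
  forall K : R -> R,
  ae_integrable leb `]0, T[ (fun t => K t ^+ 2) ->
  {ae leb, forall t, t \in `]0, T[ -> [/\ V (f t), 0 <= K t, nv (f t) <= K t,
      forall (a : R) x y, V x -> V y -> G t (a *: x + y) = a * G t x + G t y &
      forall x, V x -> `|G t x| <= K t * nv x]} ->
  `|X b - X a| <= dl * primitive (fun r => K r ^+ 2) T + 8 / dl * eps +
    2 * T / dl * (2 * eta + 4 * eta ^+ 2) + 2 * eta.
Proof.
move=> a0 ab bT dl0 eps0 eta0 cX K Ki Kae.
have [Mf _ fapp _ _] := fG.
have [s [e [Vs eae ei eeps ucs]]] := fapp _ eps0.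
have [d0 d00 ucs'] := ucs _ eta0.
have Xnear c : 0 <= c -> c <= T -> exists2 d : R, 0 < d &
    forall t, 0 <= t -> t <= T -> `|c - t| < d -> `|X c - X t| <= eta.
  move=> c0 cT; have cT' : `[0, T]%classic c by rewrite /= in_itv/= c0.
  have /subspace_continuousP/(_ _ cT')/cvgrPdist_le/(_ _ eta0) := cX.
  rewrite near_withinE => /nbhs_ballP[d /= d1 dP]; exists d => // t t0 tT ct.
  by apply: (dP t); rewrite /ball//= in_itv/= t0.
have [da da0 Xa] := Xnear a a0 (ltW (lt_le_trans ab bT)).
have [db db0 Xb] := Xnear b (ltW (le_lt_trans a0 ab)) bT.
pose d := Num.min d0 (Num.min da db).
have dp : 0 < d by rewrite !lt_min d00 da0.
have dd0 : d <= d0 by rewrite ge_min lexx.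
have dda : d <= da by rewrite !ge_min lexx orbT.
have ddb : d <= db by rewrite !ge_min lexx !orbT.
have ba : 0 < b - a by rewrite subr_gt0.
(* Consecutive good points lie in adjacent cells, hence within [2 * h] of each other; this [n] makes
   [2 * h] smaller than the moduli of continuity of [s] and of [X] at both ends. *)
pose n := Num.bound (2 * (b - a) / d).
pose h := (b - a) / n.+1%:R.
have np : 0 < n.+1%:R :> R by [].
have h0 : 0 < h by rewrite divr_gt0.
have nh : n.+1%:R * h = b - a by rewrite mulrC divfK// gt_eqF.
have hd : 2 * h < d.
  have : 2 * (b - a) / d < n.+1%:R.
    apply: lt_le_trans (archi_boundP _) _; first by rewrite divr_ge0 ?mulr_ge0 ?ltW.
    by rewrite ler_nat.
  by rewrite ltr_pdivrMr// /h mulrA ltr_pdivrMr// [d * _]mulrC.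
pose c k := a + k%:R * h.
have cS k : c k.+1 = c k + h by rewrite /c -natr1; ring.
have cle k : (k <= n.+1)%N -> c k <= b.
  move=> kn; rewrite /c -lerBrDl -nh ler_pM2r// ler_nat//.
have ca k : a <= c k by rewrite /c lerDl mulr_ge0// ltW.
have ei2 := ei.
pose Pe := primitive (fun t => e t ^+ 2).
have e2ae : {ae leb, forall x, x \in `]0, T[ -> 0 <= e x ^+ 2}.
  by apply: ae_lebT => x _; exact: sqr_ge0.
have Pend x y : 0 <= x -> x <= y -> y <= T -> Pe x <= Pe y.
  exact: primitive_nd.
(* In each cell a point with [f] in [V], a valid error bound, and [e ^+ 2] not much above its mean
   over the cell. *)
have [t_ tP] : {t_ : nat -> R & forall k, (k < n.+1)%N -> [/\ c k < t_ k,
    t_ k < c k.+1, V (f (t_ k)) /\ nv (f (t_ k) - s (t_ k)) <= e (t_ k) &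
    e (t_ k) ^+ 2 * h <= Pe (c k.+1) - Pe (c k) + eta * h]}.
  apply: (@choice _ _ (fun k t => (k < n.+1)%N -> [/\ c k < t,
    t < c k.+1, V (f t) /\ nv (f t - s t) <= e t &
    e t ^+ 2 * h <= Pe (c k.+1) - Pe (c k) + eta * h])) => k.
  have [kn|kn] := ltnP k n.+1; last by exists 0.
  have ck0 : 0 <= c k by exact: le_trans (ca k).
  have ckT : c k.+1 <= T by exact: le_trans (cle _ kn) bT.
  have ckk : c k < c k.+1 by rewrite cS ltrDl.
  have ei' : ae_integrable leb `]c k, c k.+1[ (fun t => e t ^+ 2).
    exact: ae_integrable_itvS ei.
  have Gae : {ae leb, forall x, x \in `]c k, c k.+1[ ->
      V (f x) /\ nv (f x - s x) <= e x}.
    refine (ae_leb2 Kae eae _) => x Kx ex; rewrite in_itv/= => /andP[x1 x2].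
    have xT : x \in `]0, T[.
      by rewrite in_itv/= (le_lt_trans ck0 x1) (lt_le_trans x2 ckT).
    by have [Vx _ _ _ _] := Kx xT; split => //; exact: ex.
  have [t [t1 t2 Gt et]] := exists_good_point ckk eta0 ei' Gae.
  exists t => _; split => //; move: et.
  by rewrite (primitive_sub ei ck0 (ltW ckk) ckT) cS [X in X - c k]addrC addrK.
pose P := primitive (fun r : R => dl * K r ^+ 2 + 4 / dl * e r ^+ 2).
have Pi : ae_integrable leb `]0, T[ (fun r : R => dl * K r ^+ 2 + 4 / dl * e r ^+ 2).
  by apply: ae_integrableD => //; exact: ae_integrableZ.
have tn k : (k < n.+1)%N -> 0 < t_ k /\ t_ k < T.
  move=> kn; have [t1 t2 _ _] := tP _ kn; split.
    by apply: le_lt_trans t1; exact: le_trans (ca k).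
  by apply: lt_le_trans t2 _; exact: le_trans (cle _ kn) bT.
(* The error at a good point enters the steps on both sides of it, so the cell integrals of [e ^+ 2]
   are counted twice; this explains the two telescoping copies of [Pe]. *)
have ind m : (m < n.+1)%N -> `|X (t_ m) - X (t_ 0)| <= P (t_ m) - P (t_ 0) +
   2 / dl * (Pe (c m.+1) + Pe (c m) - Pe (c 1) - Pe (c 0) +
   m%:R * (2 * eta * h + 4 * eta ^+ 2 * h)).
  elim: m => [|m IH] mn.
    by rewrite !subrr normr0 mul0r addr0 add0r [X in _ * X](_ : _ = 0) ?mulr0//; ring.
  have mn' : (m < n.+1)%N by exact: ltn_trans mn.
  have [t1 t2 [Vt et] eh] := tP _ mn'; have [u1 u2 [Vu eu] eh'] := tP _ mn.
  have [t0 tT] := tn _ mn'; have [u0 uT] := tn _ mn.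
  have tu : t_ m < t_ m.+1 by exact: lt_trans t2 u1.
  have tu2 : t_ m.+1 - t_ m <= 2 * h.
    by move: t1 u2; rewrite !cS; section_lra.
  have ss r : t_ m <= r -> r <= t_ m.+1 ->
      nv (s (t_ m) - s r) <= eta /\ nv (s (t_ m.+1) - s r) <= eta.
    move=> r1 r2.
    have rT : r \in `[0, T].
      by rewrite in_itv/= (le_trans (ltW t0) r1) (le_trans r2 (ltW uT)).
    split; apply: ucs' => //.
    - by rewrite in_itv/= !ltW.
    - by rewrite ler_norml; move: r1 r2 tu2 hd dd0; section_lra.
    - by rewrite in_itv/= !ltW.
    - by rewrite ler_norml; move: r1 r2 tu2 hd dd0; section_lra.
  have := energy_step dl0 Ki ei Kae Vs eae t0 (ltW tu) uT Vt Vu et eu ss.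
  rewrite -/P => st.
  have st2 : (t_ m.+1 - t_ m) / dl * (e (t_ m) ^+ 2 + e (t_ m.+1) ^+ 2 + 4 * eta ^+ 2)
      <= 2 / dl * (Pe (c m.+2) - Pe (c m) + (2 * eta * h + 4 * eta ^+ 2 * h)).
    apply: (@le_trans _ _ (2 * h / dl *
       (e (t_ m) ^+ 2 + e (t_ m.+1) ^+ 2 + 4 * eta ^+ 2))).
      rewrite ler_wpM2r// ?ler_pM2r ?invr_gt0//.
      have := sqr_ge0 (e (t_ m)); have := sqr_ge0 (e (t_ m.+1)).
      by have := sqr_ge0 eta; section_lra.
    have -> : 2 * h / dl * (e (t_ m) ^+ 2 + e (t_ m.+1) ^+ 2 + 4 * eta ^+ 2) =
      2 / dl * (e (t_ m) ^+ 2 * h + e (t_ m.+1) ^+ 2 * h + 4 * eta ^+ 2 * h) by ring.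
    rewrite ler_pM2l ?divr_gt0//; move: eh eh'; section_lra.
  have := le_trans (ler_normD _ _) (lerD (le_trans st (lerD (lexx _) st2)) (IH mn')).
  rewrite addrA subrK => /le_trans; apply.
  rewrite le_eqVlt; apply/orP; left; apply/eqP; rewrite -natr1; ring.
have tn0 := tP 0 isT; have [x1 x2 _ _] := tn0.
have [y1 y2 _ _] := tP n (ltnSn n).
have [z1 z2] := tn 0 isT; have [z3 z4] := tn n (ltnSn n).
have := ind n (ltnSn n).
have c0a : c 0 = a by rewrite /c mul0r addr0.
have cnb : c n.+1 = b by rewrite /c nh addrC subrK.
have XaT := Xa _ (ltW z1) (ltW z2); have XbT := Xb _ (ltW z3) (ltW z4).
have {}XaT : `|X a - X (t_ 0)| <= eta.
  by apply: XaT; rewrite ltr_norml; move: x1 x2 hd dda h0; rewrite cS c0a; section_lra.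
have {}XbT : `|X b - X (t_ n)| <= eta.
  by apply: XbT; rewrite ltr_norml; move: y1 y2 hd ddb h0; move: cnb; rewrite cS; section_lra.
have T0' := ltW T0.
have PeT : Pe T <= eps by [].
have Pe0 x : 0 <= x -> x <= T -> 0 <= Pe x.
  by move=> *; rewrite -(primitive0 (fun t => e t ^+ 2)); exact: Pend.
have b0 : 0 <= b := le_trans a0 (ltW ab).
have Pe1 := Pend _ _ b0 bT (lexx T).
have Pe2 := Pend _ _ (le_trans a0 (ca n)) (le_trans (cle n (leqnSn n)) bT) (lexx T).
have Pe3 := Pe0 _ a0 (le_trans (ltW ab) bT).
have Pe4 := Pe0 _ (le_trans a0 (ca 1%N)) (le_trans (cle 1%N isT) bT).
have PT : P (t_ n) - P (t_ 0) <= dl * primitive (fun r => K r ^+ 2) T + 4 / dl * eps.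
  have pae : {ae leb, forall x, x \in `]0, T[ ->
      0 <= dl * K x ^+ 2 + 4 / dl * e x ^+ 2}.
    apply: ae_lebT => x _; apply: addr_ge0; first by rewrite mulr_ge0 ?sqr_ge0 ?ltW.
    by rewrite mulr_ge0 ?sqr_ge0 ?divr_ge0 ?ltW.
  have P1 := primitive_nd Pi pae (ltW z3) (ltW z4) (lexx T).
  have P2 := primitive_nd Pi pae (lexx 0) (ltW z1) (ltW z2).
  move: P1 P2; rewrite primitive0 -!/P => P1 P2.
  have PTe : P T = dl * primitive (fun r => K r ^+ 2) T + 4 / dl * Pe T.
    rewrite /P /primitive ae_RintegralD//; last 2 first.
    - exact: ae_integrableZ.
    - exact: ae_integrableZ.
    by rewrite !ae_RintegralZ.
  have : 4 / dl * Pe T <= 4 / dl * eps by rewrite ler_wpM2l// divr_ge0// ltW.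
  by move: P1 P2; rewrite PTe; section_lra.
rewrite c0a cnb => ineq.
have nhT : n%:R * h <= T.
  apply: (@le_trans _ _ (n.+1%:R * h)); last by rewrite nh; move: a0 bT; section_lra.
  by rewrite ler_pM2r// ler_nat.
have q0 : 0 <= 2 * eta + 4 * eta ^+ 2.
  by rewrite addr_ge0 ?mulr_ge0 ?sqr_ge0 ?ltW.
have ineq2 : 2 / dl * (Pe b + Pe (c n) - Pe (c 1%N) - Pe a +
   n%:R * (2 * eta * h + 4 * eta ^+ 2 * h)) <=
   2 / dl * (2 * eps + T * (2 * eta + 4 * eta ^+ 2)).
  rewrite ler_pM2l ?divr_gt0//.
  have : n%:R * (2 * eta * h + 4 * eta ^+ 2 * h) <= T * (2 * eta + 4 * eta ^+ 2).
    rewrite [leLHS](_ : _ = n%:R * h * (2 * eta + 4 * eta ^+ 2)); last by ring.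
    by rewrite ler_wpM2r.
  by move: Pe1 Pe2 Pe3 Pe4 PeT; section_lra.
have -> : X b - X a = (X b - X (t_ n)) + ((X (t_ n) - X (t_ 0)) - (X a - X (t_ 0))).
  by ring.
apply: le_trans (ler_normD _ _) _; apply: le_trans (lerD (lexx _) (ler_normB _ _)) _.
have e1 : 2 / dl * (2 * eps + T * (2 * eta + 4 * eta ^+ 2)) = 4 / dl * eps +
   2 * T / dl * (2 * eta + 4 * eta ^+ 2) by ring.
(* One half comes from the integral of [4 / dl * e ^+ 2], the other from the two copies of [Pe]. *)
have e2 : 8 / dl * eps = 4 / dl * eps + 4 / dl * eps by ring.
rewrite e2.
move: ineq2; rewrite e1 => ineq2.
move: ineq ineq2 PT XaT XbT.
set A := `|X b - _|; set A' := `|_ - X (t_ 0)|; set A'' := `|X a - _|.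
set B1 := _ / dl * eps; set B2 := _ * (2 * eta + _); set B3 := dl * _.
by section_lra.
Qed.

Lemma energy_identity (a b : R) : 0 <= a -> a <= b -> b <= T ->
  hp (f b) (f b) - hp (f a) (f a) = 2 * \int[leb]_(r in `]a, b[) G r (f r).
Proof.
move=> a0; rewrite le_eqVlt => /predU1P[->|ab] bT.
  by rewrite set_itvoo0 ?bnd_simp// Rintegral_set0 subrr mulr0.
have [Mf cf _ [K Ki Kae] _] := fG.
have cX : {within `[0, T], continuous X}.
  rewrite /X => t.
  apply: (@continuousB _ _ _ (fun t : subspace `[0, T] => hp (f t) (f t))
     (fun t : subspace `[0, T] => 2 * primitive (fun r => G r (f r)) t)).
    exact: energy_continuous.
  apply: (@continuousM _ _ (cst 2) (fun t : subspace `[0, T] => primitive (fun r => G r (f r)) t)).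
    exact: cvg_cst.
  exact: primitive_continuous (ltW T0) evolves_diag_integrable t.
rewrite (primitive_sub evolves_diag_integrable a0 (ltW ab) bT).
suff : X b - X a = 0 by rewrite /X => XX; lra.
apply/eqP; rewrite -normr_le0; apply/ler_addgt0Pl => c c0; rewrite addr0.
set k := primitive (fun r => K r ^+ 2) T.
have k0 : 0 <= k by apply: Rintegral_ge0 => x _; exact: sqr_ge0.
(* The order of choice matters: [dl] makes the term in [K] at most [c / 4]; [eps], which is divided
   by [dl], is chosen next and gives exactly [c / 4]; [eta] comes last and bounds the rest by
   [c / 4], the constant [L] using [eta <= 1] to absorb [eta ^+ 2]. *)
pose dl := c / (4 * (k + 1)).
have dl0 : 0 < dl by rewrite divr_gt0// mulr_gt0// ltr_wpDl.
pose eps := c * dl / 32.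
have eps0 : 0 < eps by rewrite divr_gt0// mulr_gt0.
pose L := 12 * T / dl + 2.
have L0 : 0 < L by apply: ltr_wpDl => //; apply: divr_ge0; [apply: mulr_ge0 => //|]; exact: ltW.
pose eta := Num.min 1 (c / (4 * L)).
have eta0 : 0 < eta by rewrite lt_min ltr01 divr_gt0// mulr_gt0.
have := energy_bound a0 ab bT dl0 eps0 eta0 cX Ki Kae.
rewrite -/k => /le_trans; apply.
have i1 : dl * k <= c / 4.
  have -> : c / 4 = dl * (k + 1) by rewrite /dl; field; lra.
  by rewrite ler_wpM2l// ?lerDl// ltW.
have i2 : 8 / dl * eps = c / 4 by rewrite /eps; field; lra.
have eta1 : eta <= 1 by rewrite ge_min lexx.
have eta2 : L * eta <= c / 4.
  have -> : c / 4 = L * (c / (4 * L)) by field; lra.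
  by apply: ler_wpM2l; [exact: ltW|rewrite ge_min lexx orbT].
have i3 : 2 * T / dl * (2 * eta + 4 * eta ^+ 2) + 2 * eta <= L * eta.
  have -> : L * eta = 2 * T / dl * (6 * eta) + 2 * eta by rewrite /L; field; lra.
  rewrite lerD2r; apply: ler_wpM2l.
    by apply: divr_ge0; [apply: mulr_ge0 => //|]; exact: ltW.
  have : eta ^+ 2 <= eta by rewrite expr2 ler_piMl// ltW.
  by section_lra.
by rewrite i2; lra.
Qed.

End identity.

Lemma ler_sqrt_sum2 (x y : R) :
  x + y <= Num.sqrt (2 * x ^+ 2 + 2 * y ^+ 2).
Proof.
apply: le_trans (ler_norm _) _; rewrite -sqrtr_sqr ler_wsqrtr// -subr_ge0.
rewrite (_ : _ - _ = (x - y) ^+ 2) ?sqr_ge0//; ring.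
Qed.

Let sqr_sqrt2 (c x y : R) : 0 <= x -> 0 <= y -> 0 <= c ->
  Num.sqrt (2 * (c * x) + 2 * y) ^+ 2 = 2 * (c * x) + 2 * y.
Proof.
move=> x0 y0 c0; rewrite sqr_sqrtr// addr_ge0 ?mulr_ge0//.
Qed.

Let hpZD (a : R) x y : M x -> M y -> hp (a *: x + y) (a *: x + y) =
  a ^+ 2 * hp x x + a * (hp x y *+ 2) + hp y y.
Proof.
move=> Mx My; rewrite hp_lin//; last exact: Mlin.
by rewrite ![hp _ (a *: x + y)]hpC !hp_lin// [hp y x]hpC; ring.
Qed.

(** The values of the form at [a *: x + y] and [- a *: x + y] add up to the right-hand side, and the
    second is nonnegative. *)
Lemma hp_le2 (a : R) x y : M x -> M y -> hp (a *: x + y) (a *: x + y) <=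
  2 * a ^+ 2 * hp x x + 2 * hp y y.
Proof.
move=> Mx My; have := hp_ge0 (Mlin (- a) Mx My).
by rewrite !hpZD// sqrrN; lra.
Qed.

Lemma approximableZD (a : R) f1 f2 : approximable f1 -> approximable f2 ->
  {ae leb, forall t, t \in `]0, T[ -> V (f1 t) /\ V (f2 t)} ->
  approximable (fun t => a *: f1 t + f2 t).
Proof.
move=> app1 app2 Vae eps eps0.
have a2 : 0 < 4 * (a ^+ 2 + 1) by rewrite mulr_gt0// ltr_wpDl ?sqr_ge0.
have [s1 [e1 [V1 ae1 ei1 le1 uc1]]] := app1 _ (divr_gt0 eps0 a2).
have [s2 [e2 [V2 ae2 ei2 le2 uc2]]] := app2 _ (divr_gt0 eps0 (ltr0n _ 4)).
(* Only the squares of [e1] and [e2] are known to be integrable. This root dominates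
   [|a| * e1 t + e2 t], and its own square is a linear combination of theirs. *)
pose e t := Num.sqrt (2 * (a ^+ 2 * e1 t ^+ 2) + 2 * e2 t ^+ 2).
have eE t : e t ^+ 2 = 2 * (a ^+ 2 * e1 t ^+ 2) + 2 * e2 t ^+ 2.
  by rewrite /e sqr_sqrt2 ?sqr_ge0.
exists (fun t => a *: s1 t + s2 t), e; split.
- by move=> t; exact: Vlin.
- refine (ae_leb3 Vae ae1 ae2 _) => t Vt n1 n2 tT.
  have [Vf1 Vf2] := Vt tT.
  have -> : a *: f1 t + f2 t - (a *: s1 t + s2 t) =
      a *: (f1 t - s1 t) + (f2 t - s2 t) by rewrite scalerBr opprD addrACA.
  have VZ x : V x -> V (a *: x).
    move=> Vx; have V0 : V 0 by rewrite -(subrr (f1 t)); exact: VB.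
    by rewrite -[_ *: _]addr0; exact: Vlin.
  have VB1 : V (f1 t - s1 t) by exact: VB.
  have VB2 : V (f2 t - s2 t) by exact: VB.
  apply: le_trans (nvD (VZ _ VB1) VB2) _; rewrite nvZ//.
  apply: le_trans (_ : `|a| * e1 t + e2 t <= _).
    by apply: lerD (n2 tT); rewrite ler_wpM2l// n1.
  apply: le_trans (ler_sqrt_sum2 _ _) _.
  by rewrite exprMn real_normK ?num_real.
- rewrite (_ : (fun t => e t ^+ 2) =
     fun t => 2 * (a ^+ 2 * e1 t ^+ 2) + 2 * e2 t ^+ 2); last exact/funext.
  by apply: ae_integrableD => //; do ?[exact: ae_integrableZ|apply: ae_integrableZ => //].
- rewrite (_ : (fun t => e t ^+ 2) =
     fun t => 2 * (a ^+ 2 * e1 t ^+ 2) + 2 * e2 t ^+ 2); last exact/funext.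
  rewrite ae_RintegralD//; last 2 first.
  - by apply: ae_integrableZ => //; exact: ae_integrableZ.
  - exact: ae_integrableZ.
  rewrite !ae_RintegralZ//; last exact: ae_integrableZ.
  have h1 : a ^+ 2 * (eps / (4 * (a ^+ 2 + 1))) <= eps / 4.
    have -> : eps / 4 = (a ^+ 2 + 1) * (eps / (4 * (a ^+ 2 + 1))).
      by field; rewrite gt_eqF// ltr_wpDl ?sqr_ge0.
    apply: ler_wpM2r; last by rewrite lerDl.
    by apply: divr_ge0; exact: ltW.
  have := le_trans (ler_wpM2l (sqr_ge0 a) le1) h1; lra.
- move=> eta eta0; have a1 : 0 < 2 * (`|a| + 1) by rewrite mulr_gt0// ltr_wpDl.
  have [d1 d10 h1] := uc1 _ (divr_gt0 eta0 a1).
  have [d2 d20 h2] := uc2 _ (divr_gt0 eta0 (ltr0n _ 2)).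
  exists (Num.min d1 d2) => [|t t' tT t'T]; first by rewrite lt_min d10.
  rewrite le_min => /andP[t1 t2].
  have -> : a *: s1 t + s2 t - (a *: s1 t' + s2 t') =
      a *: (s1 t - s1 t') + (s2 t - s2 t') by rewrite scalerBr opprD addrACA.
  have VB1 : V (s1 t - s1 t') by exact: VB.
  have VB2 : V (s2 t - s2 t') by exact: VB.
  have VZ : V (a *: (s1 t - s1 t')).
    have V0 : V 0 by rewrite -(subrr (s1 t)); exact: VB.
    by rewrite -[_ *: _]addr0; exact: Vlin.
  apply: le_trans (nvD VZ VB2) _; rewrite nvZ//.
  have i1 : `|a| * nv (s1 t - s1 t') <= eta / 2.
    apply: (@le_trans _ _ (`|a| * (eta / (2 * (`|a| + 1))))).
      by rewrite ler_wpM2l// h1.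
    have -> : eta / 2 = (`|a| + 1) * (eta / (2 * (`|a| + 1))).
      by field; rewrite gt_eqF// ltr_wpDl.
    apply: ler_wpM2r; last by rewrite lerDl.
    by apply: divr_ge0; exact: ltW.
  by have := h2 _ _ tT t'T t2; lra.
Qed.

Lemma evolvesZD (a : R) f1 f2 G1 G2 : evolves f1 G1 -> evolves f2 G2 ->
  evolves (fun t => a *: f1 t + f2 t) (fun t x => a * G1 t x + G2 t x).
Proof.
move=> [M1 c1 app1 [K1 Ki1 ae1] wk1] [M2 c2 app2 [K2 Ki2 ae2] wk2]; split.
- by move=> t tT; apply: Mlin; [exact: M1|exact: M2].
- move=> t tT.
  apply: (@squeeze_cvgr _ _ _ _ (cst 0) (fun s =>
     2 * a ^+ 2 * hp (f1 s - f1 t) (f1 s - f1 t) +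
     2 * hp (f2 s - f2 t) (f2 s - f2 t))).
  + rewrite near_withinE; near=> s => sT.
    have -> : a *: f1 s + f2 s - (a *: f1 t + f2 t) =
      a *: (f1 s - f1 t) + (f2 s - f2 t) by rewrite scalerBr opprD addrACA.
    have MB1 : M (f1 s - f1 t) by apply: MB; exact: M1.
    have MB2 : M (f2 s - f2 t) by apply: MB; exact: M2.
    by rewrite hp_ge0 ?hp_le2//; exact: Mlin.
  + exact: cvg_cst.
  + rewrite -[X in _ --> X](addr0 0) -[X in _ --> X + _](mulr0 (2 * a ^+ 2)).
    rewrite -[X in _ --> _ + X](mulr0 2).
    by apply: cvgD; apply: cvgMr; [exact: (c1 _ tT)|exact: (c2 _ tT)].
- apply: approximableZD => //; refine (ae_leb2 ae1 ae2 _) => t h1 h2 tT.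
  by have [? _ _ _ _] := h1 tT; have [? _ _ _ _] := h2 tT.
(* The same device as for the approximation error: integrability is known for [K1 ^+ 2] and
   [K2 ^+ 2]. *)
- exists (fun t => Num.sqrt (2 * (`|a| ^+ 2 * K1 t ^+ 2) + 2 * K2 t ^+ 2)).
    rewrite (_ : (fun t => _ ^+ 2) =
      fun t => 2 * (`|a| ^+ 2 * K1 t ^+ 2) + 2 * K2 t ^+ 2); last first.
      by apply/funext => t; rewrite sqr_sqrt2 ?sqr_ge0.
    by apply: ae_integrableD => //; do ?[exact: ae_integrableZ|apply: ae_integrableZ => //].
  refine (ae_leb2 ae1 ae2 _) => t h1 h2 tT.
  have [Vf1 K10 nf1 G1l G1b] := h1 tT; have [Vf2 K20 nf2 G2l G2b] := h2 tT.
  have V0 : V 0 by rewrite -(subrr (f1 t)); exact: VB.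
  have VZ : V (a *: f1 t) by rewrite -[_ *: _]addr0; exact: Vlin.
  have Kle : `|a| * K1 t + K2 t <=
      Num.sqrt (2 * (`|a| ^+ 2 * K1 t ^+ 2) + 2 * K2 t ^+ 2).
    by rewrite -exprMn; exact: ler_sqrt_sum2.
  split.
  + exact: Vlin.
  + exact: sqrtr_ge0.
  + apply: le_trans Kle; apply: le_trans (nvD VZ Vf2) _.
    by rewrite nvZ// lerD// ler_wpM2l.
  + by move=> b x y Vx Vy; rewrite G1l// G2l//; ring.
  + move=> x Vx; apply: le_trans (_ : (`|a| * K1 t + K2 t) * nv x <= _).
      apply: le_trans (ler_normD _ _) _; rewrite normrM mulrDl -mulrA lerD ?G2b//.
      by rewrite ler_wpM2l ?G1b.
    by rewrite ler_wpM2r ?nv_ge0.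
- move=> x Vx; have [m1 w1] := wk1 x Vx; have [m2 w2] := wk2 x Vx; split.
    apply: ae_measurableD => //; apply: ae_measurableM => //.
    by apply: measurable_ae_measurable; exact: measurable_cst.
  move=> b c b0 bc cT.
  have e1 : evolves f1 G1 by split=> //; exists K1.
  have e2 : evolves f2 G2 by split=> //; exists K2.
  have i1 : ae_integrable leb `]b, c[ (G1^~ x).
    by apply: ae_integrable_itvS (evolves_integrable e1 Vx).
  have i2 : ae_integrable leb `]b, c[ (G2^~ x).
    by apply: ae_integrable_itvS (evolves_integrable e2 Vx).
  rewrite ae_RintegralD//; last exact: ae_integrableZ.
  rewrite ae_RintegralZ// -w1// -w2//.
  have -> : a *: f1 c + f2 c - (a *: f1 b + f2 b) =
    a *: (f1 c - f1 b) + (f2 c - f2 b) by rewrite scalerBr opprD addrACA.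
  have bT : b \in `[0, T] by rewrite in_itv/= b0 (le_trans bc).
  have cT' : c \in `[0, T] by rewrite in_itv/= cT (le_trans b0).
  have MM1 : M (f1 c - f1 b) by apply: MB; exact: M1.
  have MM2 : M (f2 c - f2 b) by apply: MB; exact: M2.
  by rewrite hp_lin//; exact: VM.
Unshelve. all: by end_near. Qed.

(** Polarization: the energy identities of [f1] and [f2] are subtracted from that of their sum.
    [evolves] gives measurability of [G t x] in [t] for a fixed [x] only, so it is assumed for the
    four terms evaluated along the trajectories. *)
Lemma duality_identity f1 f2 G1 G2 : evolves f1 G1 -> evolves f2 G2 ->
  ae_measurable leb `]0, T[ (fun t => G1 t (f1 t)) ->
  ae_measurable leb `]0, T[ (fun t => G2 t (f2 t)) ->
  ae_measurable leb `]0, T[ (fun t => G1 t (f2 t)) ->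
  ae_measurable leb `]0, T[ (fun t => G2 t (f1 t)) ->
  hp (f1 T) (f2 T) - hp (f1 0) (f2 0) =
  \int[leb]_(r in `]0, T[) (G1 r (f2 r) + G2 r (f1 r)).
Proof.
move=> e1 e2 m11 m22 m12 m21.
have e12 := evolvesZD 1 e1 e2.
have [M1 c1 app1 [K1 Ki1 ae1] wk1] := e1; have [M2 c2 app2 [K2 Ki2 ae2] wk2] := e2.
have expand : {ae leb, forall t, t \in `]0, T[ ->
    1 * G1 t (1 *: f1 t + f2 t) + G2 t (1 *: f1 t + f2 t) =
    G1 t (f1 t) + G2 t (f2 t) + (G1 t (f2 t) + G2 t (f1 t))}.
  refine (ae_leb2 ae1 ae2 _) => t h1 h2 tT.
  have [Vf1 K10 nf1 G1l G1b] := h1 tT; have [Vf2 K20 nf2 G2l G2b] := h2 tT.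
  by rewrite G1l// G2l//; ring.
have m12' : ae_measurable leb `]0, T[
    (fun t => 1 * G1 t (1 *: f1 t + f2 t) + G2 t (1 *: f1 t + f2 t)).
  apply: (@ae_measurable_eq _ _ _ leb _ (fun t => G1 t (f1 t) + G2 t (f2 t) +
    (G1 t (f2 t) + G2 t (f1 t)))).
    by refine (ae_leb1 expand _) => t h tT; rewrite h.
  by do ?[exact: ae_measurableD|apply: ae_measurableD].
have i11 := evolves_diag_integrable e1 m11.
have i22 := evolves_diag_integrable e2 m22.
have i12 := evolves_diag_integrable e12 m12'.
have it : ae_integrable leb `]0, T[ (fun t => G1 t (f2 t) + G2 t (f1 t)).
  apply: (@ae_integrable_eq _ _ _ leb _
    (fun t => (1 * G1 t (1 *: f1 t + f2 t) + G2 t (1 *: f1 t + f2 t)) -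
       (G1 t (f1 t) + G2 t (f2 t)))).
    by refine (ae_leb1 expand _) => t h tT; rewrite h// addrAC subrr add0r.
  by apply: ae_integrableB => //; exact: ae_integrableD.
have T0' := ltW T0.
have E1 := energy_identity e1 m11 (lexx 0) T0' (lexx T).
have E2 := energy_identity e2 m22 (lexx 0) T0' (lexx T).
have := energy_identity e12 m12' (lexx 0) T0' (lexx T).
have in0 : 0 \in `[0, T] by rewrite in_itv/= lexx.
have inT : T \in `[0, T] by rewrite in_itv/= lexx andbT.
have mT : measurable (`]0, T[%classic : set (measurableTypeR R)) by [].
rewrite (ae_Rintegral_eq mT expand).
have i1122 : ae_integrable leb `]0, T[ (fun t => G1 t (f1 t) + G2 t (f2 t)).
  exact: ae_integrableD.
rewrite (ae_RintegralD mT i1122 it) (ae_RintegralD mT i11 i22).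
rewrite !hpZD//; [|exact: M1|exact: M2|exact: M1|exact: M2].
by move: E1 E2; lra.
Qed.

End energy.

(** * Gronwall's lemma in integral form *)

Section gronwall.
Context {R : realType}.
Local Notation leb := (@lebesgue_measure R).

Lemma continuous_ae_integrable (T : R) (y : R -> R) :
  {within `[0, T], continuous y} -> ae_integrable leb `]0, T[ y.
Proof.
move=> cy; apply: integrable_ae_integrable.
have yi : leb.-integrable `[0, T] (EFin \o y).
  by apply: continuous_compact_integrable => //; exact: segment_compact.
by apply: integrableS yi => //; exact: subset_itv_oo_cc.
Qed.

(** The hypothesis is a differential inequality for the primitive of [y]. It makes
    [expR (- C * x) * primitive y x - k * x] nonincreasing, so that the primitive is at most
    [k * t * expR (C * t)]; inserting this into the hypothesis returns to [y]. *)
Lemma gronwall (T C k : R) (y : R -> R) : 0 < T -> 0 <= C ->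
  {within `[0, T], continuous y} ->
  (forall t, 0 <= t -> t <= T -> y t <= C * primitive y t + k) -> 0 <= k ->
  forall t, 0 <= t -> t <= T -> y t <= (C * T * expR (C * T) + 1) * k.
Proof.
move=> T0 C0 cy yle k0 t t0 tT.
have yi := continuous_ae_integrable cy.
have yi' : leb.-integrable `[0, T] (EFin \o y).
  by apply: continuous_compact_integrable => //; exact: segment_compact.
have cP := primitive_continuous (ltW T0) yi.
have dP x : x \in `]0, T[ -> is_derive x 1 (primitive y) (y x).
  rewrite in_itv/= => /andP[x0 xT].
  have cyx : {for x, continuous y}.
    have [+ _ _] := (continuous_within_itvP y T0).1 cy.
    by apply; rewrite in_itv/= x0.
  have /= [dF F'] := @continuous_FTC1_closed R y 0 x T xT yi' x0 cyx.
  have ee : {near x, (fun x : R => \int[leb]_(t in `[0, x]) y t) =1 primitive y}.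
    have : \forall z \near x, z \in `]0, T[ by apply: near_in_itvoo; rewrite in_itv/= x0.
    apply: filterS => z; rewrite in_itv/= => /andP[z0 zT].
    have iz : leb.-integrable `[0, z] (EFin \o y).
      apply: integrableS yi' => //; apply: subset_itv; rewrite bnd_simp//; exact: ltW.
    rewrite /primitive Rintegral_itv_obnd_cbnd; last first.
      apply: integrableS iz => //; apply: subset_itv; rewrite bnd_simp//.
    rewrite Rintegral_itv_bndo_bndc//.
    apply: integrableS iz => //; apply: subset_itv; rewrite bnd_simp//.
  apply: (near_eq_is_derive ee).
  by apply: DeriveDef; [exact: dF|rewrite -derive1E; exact: F'].
pose Z (x : R) := expR (- C * x) * primitive y x - k * x.
have dE (x : R) : is_derive x 1 (fun x : R => expR (- C * x)) (- C * expR (- C * x)).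
  have dl : is_derive x 1 ( *%R (- C)) (- C).
    have -> : ( *%R (- C)) = (- C) \*: (@id R) by apply/funext.
    by apply: is_derive_eq; rewrite scaler1.
  by have := is_derive1_comp (is_derive_expR (- C * x)) dl; rewrite mulrC.
have dZ (x : R) : x \in `]0, T[ -> is_derive x 1 Z
    (expR (- C * x) * (y x - C * primitive y x) - k).
  move=> /dP dPx; have dEx := dE x.
  have -> : Z = ((fun x : R => expR (- C * x)) * primitive y)%R - (k \*: (@id R)).
    by apply/funext.
  apply: is_derive_eq; rewrite /= scaler1 /GRing.scale/=; ring.
have cZ : {within `[0, T], continuous Z}.
  move=> x; apply: (@continuousB _ _ _ (fun t : subspace `[0, T] => expR (- C * t) * primitive y t)
     (fun t : subspace `[0, T] => k * t)).
    apply: (@continuousM _ _ (fun t : subspace `[0, T] => expR (- C * t))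
      (fun t : subspace `[0, T] => primitive y t)); last exact: cP.
    apply: continuous_subspaceT => {}x.
    by apply: differentiable_continuous; apply/derivable1_diffP; apply: ex_derive.
  apply: continuous_subspaceT => {}x; exact: mulrl_continuous.
have dZ1 x : x \in `]0, T[ -> derivable Z x 1 by move=> /dZ dx; exact: ex_derive.
have dZ2 x : x \in `]0, T[ -> derive1 Z x <= 0.
  move=> xT'; have dx := dZ _ xT'; rewrite derive1E derive_val.
  move: xT'; rewrite in_itv/= => /andP[x0 xT].
  rewrite subr_le0 (@le_trans _ _ (expR (- C * x) * k))//.
    by rewrite ler_pM2l ?expR_gt0// lerBlDl yle// ltW.
  by rewrite ler_piMl// -expR0 ler_expR mulNr oppr_le0 mulr_ge0// ltW.
have in0 : 0 \in `[0, T] by rewrite in_itv/= lexx ltW.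
have int : t \in `[0, T] by rewrite in_itv/= t0.
have Zle : Z t <= Z 0 := ler0_derive1_le_cc dZ1 dZ2 cZ int in0 t0.
move: Zle; rewrite /Z primitive0 !mulr0 subr0 subr_le0 => Zle.
have Pt : primitive y t <= k * t * expR (C * t).
  rewrite -(ler_pM2l (expR_gt0 (- C * t))) (le_trans Zle)//.
  rewrite mulrCA [X in k * t * X](_ : _ = 1) ?mulr1//.
  by rewrite -expRD mulNr addNr expR0.
apply: le_trans (yle _ t0 tT) _; rewrite mulrDl mul1r lerD2r.
apply: (@le_trans _ _ (C * (k * t * expR (C * t)))); first exact: ler_wpM2l.
have -> : C * (k * t * expR (C * t)) = C * k * (t * expR (C * t)) by ring.
have -> : C * T * expR (C * T) * k = C * k * (T * expR (C * T)) by ring.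
apply: ler_wpM2l; first exact: mulr_ge0.
by apply: ler_pM; rewrite ?expR_ge0// ler_expR ler_wpM2l.
Qed.

End gronwall.

(** * Weak derivatives tested against smooth steps *)

Section smooth_step.
Context {R : realType}.
Implicit Types (f g : R -> R) (k : nat) (t : R).

Lemma derivable_is_derive1 f t :
  derivable f t 1 -> is_derive t 1 f (derive1 f t).
Proof. by move=> df; rewrite derive1E; exact: DeriveDef. Qed.

(** Recursion on the derivative, instead of the iterated [derive1n] of [test_function], so that
    closure under products and inverses goes by induction on [k]. *)
Fixpoint times_derivable k f : Prop :=
  if k is k'.+1 then (forall t, derivable f t 1) /\ times_derivable k' (derive1 f)
  else True.

Lemma times_derivableW k f : times_derivable k.+1 f -> times_derivable k f.
Proof.
elim: k f => [//|k IH] f [df dk]; split => //; exact: IH.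
Qed.

Lemma times_derivable_derive1n f : (forall k, times_derivable k f) ->
  forall n t, derivable (derive1n n f) t 1.
Proof.
move=> sf n; elim: n f sf => [|n IH] f sf t; first by have [df _] := sf 1%N; exact: df.
by rewrite derive1Sn; apply: IH => k; have [] := sf k.+1.
Qed.

Lemma times_derivable_cst k (c : R) : times_derivable k (cst c).
Proof.
elim: k c => [//|k IH] c; split; first by move=> t; exact: derivable_cst.
by rewrite (_ : derive1 _ = cst 0) //; apply/funext => t; rewrite derive1_cst.
Qed.

Lemma times_derivableD k f g : times_derivable k f -> times_derivable k g ->
  times_derivable k (fun t => f t + g t).
Proof.
elim: k f g => [//|k IH] f g [df dkf] [dg dkg].
have D t : is_derive t 1 (fun t => f t + g t) (derive1 f t + derive1 g t).
  have Df : is_derive t 1 f (derive1 f t) by exact: derivable_is_derive1.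
  have Dg : is_derive t 1 g (derive1 g t) by exact: derivable_is_derive1.
  exact: is_deriveD.
split; first by move=> t; exact: ex_derive.
rewrite (_ : derive1 _ = fun t => derive1 f t + derive1 g t); first exact: IH.
by apply/funext => t; rewrite [LHS]derive1E derive_val.
Qed.

Lemma times_derivableM k f g : times_derivable k f -> times_derivable k g ->
  times_derivable k (fun t => f t * g t).
Proof.
elim: k f g => [//|k IH] f g sf sg.
have [df dkf] := sf; have [dg dkg] := sg.
have D t : is_derive t 1 (fun t => f t * g t) (f t * derive1 g t + derive1 f t * g t).
  have Df : is_derive t 1 f (derive1 f t) by exact: derivable_is_derive1.
  have Dg : is_derive t 1 g (derive1 g t) by exact: derivable_is_derive1.
  have := is_deriveM Df Dg.
  by rewrite /GRing.scale/= [g t * _]mulrC.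
split; first by move=> t; exact: ex_derive.
rewrite (_ : derive1 _ = fun t => f t * derive1 g t + derive1 f t * g t).
  by apply: times_derivableD; apply: IH => //; exact: times_derivableW.
by apply/funext => t; rewrite [LHS]derive1E derive_val.
Qed.

Lemma times_derivableV k f : times_derivable k f -> (forall t, f t != 0) ->
  times_derivable k (fun t => (f t)^-1).
Proof.
move=> + f0; elim: k => [//|k IH] sf; have [df dkf] := sf.
have D t : is_derive t 1 (fun t => (f t)^-1) (-1 * (derive1 f t * ((f t)^-1 * (f t)^-1))).
  have Df : is_derive t 1 f (derive1 f t) by exact: derivable_is_derive1.
  apply: DeriveDef; first exact: derivableV.
  by rewrite deriveV// derive_val /GRing.scale/=; field; exact: f0.
split; first by move=> t; exact: ex_derive.
rewrite (_ : derive1 _ = fun t => -1 * (derive1 f t * ((f t)^-1 * (f t)^-1))).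
  apply: times_derivableM; first exact: times_derivable_cst.
  have := IH (times_derivableW sf).
  by move=> h; apply: times_derivableM => //; exact: times_derivableM.
by apply/funext => t; rewrite [LHS]derive1E derive_val.
Qed.

Lemma is_derive_affine (a b t : R) : is_derive t 1 (fun t => a * t + b) a.
Proof.
have -> : (fun t => a * t + b) = (a \*: (@id R)) + cst b by apply/funext.
by apply: is_derive_eq; rewrite addr0 scaler1.
Qed.

Lemma derive1_affine f a b : (forall t, derivable f t 1) ->
  (forall t, is_derive t 1 (fun t => f (a * t + b)) (a * derive1 f (a * t + b))).
Proof.
move=> df t.
have Df : is_derive (a * t + b) 1 f (derive1 f (a * t + b)).
  by exact: derivable_is_derive1.
have := @is_derive1_comp R f (fun t => a * t + b) t _ _ Df (is_derive_affine a b t).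
by rewrite mulrC.
Qed.

Lemma times_derivable_affine k f a b : times_derivable k f ->
  times_derivable k (fun t => f (a * t + b)).
Proof.
elim: k f => [//|k IH] f [df dkf]; have D := derive1_affine a b df.
split; first by move=> t; have Dt := D t; exact: ex_derive.
rewrite (_ : derive1 _ = fun t => a * derive1 f (a * t + b)).
  by apply: times_derivableM; [exact: times_derivable_cst|exact: IH].
by apply/funext => t; have Dt := D t; rewrite [LHS]derive1E derive_val.
Qed.

(** The functions p(1/t) exp(-1/t), extended by 0 to the left. Carrying an arbitrary polynomial
    makes the family closed under differentiation; [p = 1] is the classical flat function. *)
Definition exp_flat (p : {poly R}) t : R :=
  if 0 < t then p.[t^-1] * expR (- t^-1) else 0.

(** Each monomial of degree [i] in 1/t costs a factor absorbed by the term of degree [i.+2] of the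
    exponential series. The two spare powers of [t] give the derivative 0 at the origin. *)
Lemma exp_flat_le p : exists C : R, forall t, `|exp_flat p t| <= C * t ^+ 2.
Proof.
exists (\sum_(i < size p) `|p`_i| * (i.+2)`!%:R) => t; rewrite /exp_flat.
have C0 : 0 <= \sum_(i < size p) `|p`_i| * (i.+2)`!%:R by apply: sumr_ge0 => i _; exact: mulr_ge0.
case: ifPn => [t0|_]; last by rewrite normr0 mulr_ge0// sqr_ge0.
have x0 : 0 < t^-1 by rewrite invr_gt0.
rewrite normrM [X in _ * X]ger0_norm ?expR_ge0// horner_coef.
apply: le_trans (ler_wpM2r (expR_ge0 _) (ler_norm_sum _ _ _)) _.
rewrite !mulr_suml; apply: ler_sum => i _.
rewrite normrM -!mulrA ler_wpM2l// ger0_norm; last by apply: exprn_ge0; exact: ltW.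
have h : t^-1 ^+ i.+2 <= (i.+2)`!%:R * expR t^-1.
  have := expR_ge1Dxn i.+1 (ltW x0) => /(le_trans _) h.
  rewrite mulrC -ler_pdivrMr ?ltr0n ?fact_gt0//; apply: h.
  by rewrite lerDr.
have -> : t^-1 ^+ i = t^-1 ^+ i.+2 * t ^+ 2.
  by rewrite -[in RHS]addn2 exprD -mulrA -exprMn mulVf ?gt_eqF// expr1n mulr1.
by rewrite mulrAC ler_wpM2r ?sqr_ge0// expRN ler_pdivrMr ?expR_gt0.
Qed.

(** Away from 0 this is the chain rule, where d(1/t) contributes the factor ['X^2]; at 0 the
    quadratic bound [exp_flat_le] applies. *)
Lemma is_derive_exp_flat p t :
  is_derive t 1 (exp_flat p) (exp_flat ('X^2 * (p - deriv p)) t).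
Proof.
have [t0|t0|->] := ltgtP t 0.
- rewrite /exp_flat ltNge (ltW t0)/=.
  have e0 : {near t, cst 0 =1 exp_flat p}.
    have : \forall z \near t, z \in `]-oo, 0[ by apply: near_in_itvNyo; rewrite in_itv/=.
    by apply: filterS => z; rewrite in_itv/= /exp_flat => z0; rewrite ltNge (ltW z0).
  exact: (near_eq_is_derive e0 (is_derive_cst _ _ _)).
- rewrite {2}/exp_flat t0.
  have e0 : {near t, (fun z : R => p.[z^-1] * expR (- z^-1)) =1 exp_flat p}.
    have : \forall z \near t, z \in `]0, +oo[ by apply: near_in_itvoy; rewrite in_itv/= t0.
    by apply: filterS => z; rewrite in_itv/= andbT /exp_flat => ->.
  apply: (near_eq_is_derive e0).
  have t00 : t != 0 by rewrite gt_eqF.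
  have DV : is_derive t 1 (fun z : R => z^-1) (- t^-1 ^+ 2).
    apply: DeriveDef; first exact: derivableV.
    by rewrite deriveV// derive_id /GRing.scale/= mulr1 exprVn.
  have Dp : is_derive t 1 (fun z : R => p.[z^-1]) ((deriv p).[t^-1] * (- t^-1 ^+ 2)).
    have Dh := derivable_is_derive1 (@derivable_horner R p t^-1).
    rewrite -derivE in Dh.
    exact: (@is_derive1_comp R (horner p) (fun z : R => z^-1) _ _ _ Dh DV).
  have DN : is_derive t 1 (fun z : R => - z^-1) (t^-1 ^+ 2).
    by have := is_deriveN DV; rewrite opprK.
  have De : is_derive t 1 (fun z : R => expR (- z^-1)) (expR (- t^-1) * t^-1 ^+ 2).
    exact: (@is_derive1_comp R expR (fun z : R => - z^-1)).
  have -> : ('X^2 * (p - deriv p)).[t^-1] * expR (- t^-1) =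
      p.[t^-1] *: (expR (- t^-1) * t^-1 ^+ 2) +
      expR (- t^-1) *: ((deriv p).[t^-1] * (- t^-1 ^+ 2)).
    by rewrite hornerM hornerXn hornerD hornerN /GRing.scale/=; ring.
  exact: (is_deriveM Dp De).
- rewrite {2}/exp_flat ltxx; have [C hC] := exp_flat_le p.
  have E0 : exp_flat p 0 = 0 by rewrite /exp_flat ltxx.
  have l0 : (fun h : R => h^-1 *: ((exp_flat p \o shift 0) (h *: 1) - exp_flat p 0))
      @ 0^' --> (0 : R).
    apply/cvgrPdist_le => eps eps0.
    have C1 : 0 < `|C| + 1 by rewrite ltr_wpDl.
    near=> h; rewrite sub0r normrN /= addr0 E0 subr0 /GRing.scale/= mulr1.
    have h0 : h != 0 by near: h; exact: nbhs_dnbhs_neq.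
    rewrite normrM normfV -ler_pdivlMl ?invr_gt0 ?normr_gt0// invrK.
    apply: le_trans (hC h) _; rewrite -real_normK ?num_real// expr2 mulrCA ler_wpM2l//.
    apply: (@le_trans _ _ ((`|C| + 1) * `|h|)).
      by rewrite ler_wpM2r// ler_wpDr// ler_norm.
    rewrite mulrC -ler_pdivlMr//; near: h.
    apply: dnbhs0_le; exact: divr_gt0.
  apply: DeriveDef; first by apply/cvg_ex; exists 0.
  exact/cvg_lim.
Unshelve. all: by end_near. Qed.

Lemma times_derivable_exp_flat k p : times_derivable k (exp_flat p).
Proof.
elim: k p => [//|k IH] p; split.
  by move=> t; have D := is_derive_exp_flat p t; exact: ex_derive.
rewrite (_ : derive1 _ = exp_flat ('X^2 * (p - deriv p))); first exact: IH.
by apply/funext => t; have D := is_derive_exp_flat p t; rewrite derive1E derive_val.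
Qed.

(** The usual smooth transition from 0 on the left of 0 to 1 on the right of 1. The denominator is
    positive because [t] and [1 - t] are never both nonpositive. *)
Definition smooth_step t : R :=
  exp_flat 1 t * (exp_flat 1 t + exp_flat 1 (- t + 1))^-1.

Lemma exp_flat1_ge0 t : 0 <= exp_flat 1 t.
Proof. by rewrite /exp_flat; case: ifP => // _; rewrite hornerE mul1r expR_ge0. Qed.

Lemma exp_flat1_gt0 t : 0 < t -> 0 < exp_flat 1 t.
Proof. by rewrite /exp_flat => ->; rewrite hornerE mul1r expR_gt0. Qed.

Lemma smooth_step_den t : 0 < exp_flat 1 t + exp_flat 1 (- t + 1).
Proof.
have [t0|t0] := ltP 0 t.
  by rewrite ltr_pwDl ?exp_flat1_ge0 ?exp_flat1_gt0.
by rewrite ltr_wpDl ?exp_flat1_ge0// exp_flat1_gt0//; lra.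
Qed.

Lemma times_derivable_smooth_step k : times_derivable k smooth_step.
Proof.
apply: times_derivableM; first exact: times_derivable_exp_flat.
apply: times_derivableV; last by move=> t; rewrite gt_eqF// smooth_step_den.
apply: times_derivableD; first exact: times_derivable_exp_flat.
have := times_derivable_affine (-1) 1 (times_derivable_exp_flat k 1).
by under eq_fun do rewrite mulN1r.
Qed.

Lemma smooth_step_eq0 t : t <= 0 -> smooth_step t = 0.
Proof. by move=> t0; rewrite /smooth_step {1}/exp_flat ltNge t0/= mul0r. Qed.

Lemma smooth_step_eq1 t : 1 <= t -> smooth_step t = 1.
Proof.
move=> t1; rewrite /smooth_step [X in _ + X](_ : _ = 0).
  by rewrite addr0 divff// gt_eqF// exp_flat1_gt0//; lra.
by rewrite /exp_flat ifF//; apply/negbTE; rewrite -leNgt; lra.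
Qed.

Lemma smooth_step_ge0 t : 0 <= smooth_step t.
Proof. by rewrite mulr_ge0 ?exp_flat1_ge0// invr_ge0 ltW// smooth_step_den. Qed.

Lemma smooth_step_le1 t : smooth_step t <= 1.
Proof.
by rewrite /smooth_step ler_pdivrMr ?smooth_step_den// mul1r lerDl exp_flat1_ge0.
Qed.

End smooth_step.

(** * Increments of a continuous function with an integrable weak derivative *)

Section weak_derivative_integral.
Context {R : realType}.
Local Notation leb := (@lebesgue_measure R).
Implicit Types (a b t : R).

Lemma derive1_smooth_step_out t : (t < 0) || (1 < t) -> derive1 smooth_step t = 0.
Proof.
move=> t01; rewrite derive1E; case/orP : t01 => t01.
- have e0 : {near t, cst 0 =1 (@smooth_step R)}.
    have : \forall z \near t, z \in `]-oo, 0[ by apply: near_in_itvNyo; rewrite in_itv/=.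
    by apply: filterS => z; rewrite in_itv/= => z0; rewrite smooth_step_eq0// ltW.
  by have D := near_eq_is_derive e0 (is_derive_cst (0 : R) t 1); rewrite derive_val.
- have e0 : {near t, cst 1 =1 (@smooth_step R)}.
    have : \forall z \near t, z \in `]1, +oo[ by apply: near_in_itvoy; rewrite in_itv/= t01.
    by apply: filterS => z; rewrite in_itv/= andbT => z0; rewrite smooth_step_eq1// ltW.
  by have D := near_eq_is_derive e0 (is_derive_cst (1 : R) t 1); rewrite derive_val.
Qed.

Lemma derivable1_continuous (f : R -> R) : (forall t, derivable f t 1) -> continuous f.
Proof. by move=> df t; exact/differentiable_continuous/derivable1_diffP. Qed.

Lemma derive1_smooth_step_continuous : continuous (derive1 (@smooth_step R)).
Proof.
by apply: derivable1_continuous; have [_ []] := @times_derivable_smooth_step R 2.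
Qed.

Lemma derive1_smooth_step_bounded :
  exists2 M : R, 0 <= M & forall t, `|derive1 (@smooth_step R) t| <= M.
Proof.
have cS : {within `[0, 1], continuous (fun t => `|derive1 (@smooth_step R) t|)}.
  apply: continuous_subspaceT => t.
  by apply: (continuous_comp _ (@norm_continuous _ _ _)); exact: derive1_smooth_step_continuous.
have [c _ cM] := EVT_max ler01 cS.
exists `|derive1 (@smooth_step R) c|; first exact: normr_ge0.
move=> t.
have [t01|] := boolP (t \in `[0, 1]); first exact: cM.
rewrite in_itv/= negb_and -!ltNge => t01.
by rewrite derive1_smooth_step_out// normr0.
Qed.

(** A ramp from 0 to 1 over [[a, a + eps]]; the argument is written in the affine form expected by
    [times_derivable_affine]. *)
Definition step_at (a eps t : R) : R := smooth_step (eps^-1 * t + (- (eps^-1 * a))).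

Lemma is_derive_step_at a eps t : is_derive t 1 (step_at a eps)
  (eps^-1 * derive1 smooth_step (eps^-1 * t + (- (eps^-1 * a)))).
Proof.
apply: derive1_affine; by have [] := @times_derivable_smooth_step R 1.
Qed.

Lemma derive1_step_at a eps t : derive1 (step_at a eps) t =
  eps^-1 * derive1 smooth_step (eps^-1 * t + (- (eps^-1 * a))).
Proof. by have D := is_derive_step_at a eps t; rewrite [LHS]derive1E derive_val. Qed.

Lemma derive1_step_at_continuous a eps : continuous (derive1 (step_at a eps)).
Proof.
rewrite (_ : derive1 _ = fun t => eps^-1 *
  derive1 smooth_step (eps^-1 * t + (- (eps^-1 * a)))); last first.
  by apply/funext => t; rewrite derive1_step_at.
apply: derivable1_continuous => t.
have [_ [dS _]] := @times_derivable_smooth_step R 2.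
have D := derive1_affine (eps^-1) (- (eps^-1 * a)) dS t.
by have DZ := is_deriveZ (eps^-1) D; exact: (@ex_derive _ _ _ _ _ _ _ DZ).
Qed.

Lemma step_at_eq0 a eps t : 0 < eps -> t <= a -> step_at a eps t = 0.
Proof.
move=> e0 ta; apply: smooth_step_eq0.
by rewrite -mulrBr mulr_ge0_le0 ?invr_ge0 ?(ltW e0)// subr_le0.
Qed.

Lemma step_at_eq1 a eps t : 0 < eps -> a + eps <= t -> step_at a eps t = 1.
Proof.
move=> e0 ta; apply: smooth_step_eq1.
by rewrite -mulrBr mulrC ler_pdivlMr// mul1r lerBrDl.
Qed.

Lemma derive1_step_at_out a eps t : 0 < eps -> (t < a) || (a + eps < t) ->
  derive1 (step_at a eps) t = 0.
Proof.
move=> e0 ta; rewrite derive1_step_at derive1_smooth_step_out ?mulr0//.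
rewrite -mulrBr; case/orP : ta => ta; apply/orP; [left|right].
  by rewrite pmulr_rlt0 ?invr_gt0// subr_lt0.
by rewrite mulrC ltr_pdivlMr// mul1r ltrBrDl.
Qed.

Variable T : R.
Hypothesis T0 : 0 < T.

Lemma continuous_within_ae_integrable (f : R -> R) : continuous f ->
  ae_integrable leb `]0, T[ f.
Proof. by move=> cf; apply: continuous_ae_integrable; exact: continuous_subspaceT. Qed.

Lemma integral_derive1_step_at a eps : 0 <= a -> 0 < eps -> a + eps <= T ->
  \int[leb]_(t in `]0, T[) derive1 (step_at a eps) t = 1.
Proof.
move=> a0 e0 aT.
have cw : {within `[0, T], continuous (derive1 (step_at a eps))}.
  by apply: continuous_subspaceT; exact: derive1_step_at_continuous.
have dS t : derivable (step_at a eps) t 1.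
  by have D := is_derive_step_at a eps t; exact: ex_derive.
have cS := derivable1_continuous dS.
have LR : derivable_oo_LRcontinuous (step_at a eps) 0 T.
  split; first by move=> x _; exact: dS.
  - by apply: cvg_at_right_filter; exact: cS.
  - by apply: cvg_at_left_filter; exact: cS.
have wi : leb.-integrable `[0, T] (EFin \o derive1 (step_at a eps)).
  by apply: continuous_compact_integrable; [exact: segment_compact|exact: cw].
have := continuous_FTC2 T0 cw LR (fun x _ => erefl).
rewrite step_at_eq1// step_at_eq0// sube0 => FTC.
rewrite Rintegral_itv_obnd_cbnd; last first.
  by apply: integrableS wi => //; apply: subset_itv; rewrite bnd_simp.
rewrite Rintegral_itv_bndo_bndc; last first.
  by apply: integrableS wi => //; apply: subset_itv; rewrite bnd_simp.
by rewrite /Rintegral FTC.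
Qed.

(** The weight is concentrated on [[a, a + eps]], has total mass 1 and is bounded by [M / eps], so
    that averaging [c - c a] against it gives at most [M * k]. *)
Lemma integral_derive1_step_at_near M k a eps (c : R -> R) :
  (forall t, `|derive1 (@smooth_step R) t| <= M) ->
  0 < a -> 0 < eps -> a + eps < T -> {within `[0, T], continuous c} ->
  (forall t, a <= t -> t <= a + eps -> `|c t - c a| <= k) ->
  `|\int[leb]_(t in `]0, T[) (derive1 (step_at a eps) t * c t) - c a| <= M * k.
Proof.
move=> SM a0 e0 aT cc ck.
set w := derive1 (step_at a eps).
have cw : continuous w by exact: derive1_step_at_continuous.
have wi := continuous_within_ae_integrable cw.
have wci : ae_integrable leb `]0, T[ (fun t => w t * c t).
  apply: continuous_ae_integrable => t.
  apply: (@continuousM _ _ (w : subspace `[0, T] -> R) (c : subspace `[0, T] -> R)).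
    exact: continuous_subspaceT.
  exact: cc.
have -> : \int[leb]_(t in `]0, T[) (w t * c t) - c a =
    \int[leb]_(t in `]0, T[) (w t * c t - c a * w t).
  rewrite ae_RintegralB//; last exact: ae_integrableZ.
  by rewrite ae_RintegralZ// /w integral_derive1_step_at ?ltW// mulr1.
have di : ae_integrable leb `]0, T[ (fun t => w t * c t - c a * w t).
  by apply: ae_integrableB => //; exact: ae_integrableZ.
have aeT : a + eps <= T by exact: ltW.
have aea : a <= a + eps by rewrite lerDl ltW.
have di' : ae_integrable leb `]a, T[ (fun t => w t * c t - c a * w t).
  by apply: ae_integrable_itvS di => //; exact: ltW.
rewrite (ae_Rintegral_itvD (ltW a0) (le_trans aea aeT) di).
rewrite (ae_Rintegral_itvD aea aeT di').
rewrite [X in `|X + _|](_ : _ = 0) ?add0r; last first.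
  rewrite (@eq_Rintegral _ _ _ leb _ (cst 0)) ?Rintegral_cst ?mul0r// => t.
  rewrite inE/= in_itv/= => /andP[_ ta].
  by rewrite /w derive1_step_at_out ?ta// mul0r mulr0 subrr.
rewrite [X in `|_ + X|](_ : _ = 0) ?addr0; last first.
  rewrite (@eq_Rintegral _ _ _ leb _ (cst 0)) ?Rintegral_cst ?mul0r// => t.
  rewrite inE/= in_itv/= => /andP[ta _].
  by rewrite /w derive1_step_at_out ?ta ?orbT// mul0r mulr0 subrr.
have -> : M * k = \int[leb]_(t in `]a, a + eps[) (eps^-1 * M * k).
  rewrite Rintegral_cst// fine_lebesgue_itvoo// [a + eps]addrC addrK.
  by field; rewrite gt_eqF.
apply: ae_Rintegral_norm_le => //.
- by apply: ae_integrable_itvS di' => //.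
- by apply: ae_integrable_cst => //; exact: lebesgue_itvoo_lty.
apply: ae_lebT => t; rewrite /= in_itv/= => /andP[t1 t2].
rewrite [c a * _]mulrC -mulrBr normrM; apply: ler_pM => //.
  rewrite /w derive1_step_at normrM gtr0_norm ?invr_gt0// ler_pM2l ?invr_gt0//.
by apply: ck; exact: ltW.
Qed.

Lemma increment_error (x1 x2 ca cb m k g1 g2 e1 e3 : R) :
  x1 - x2 = - (0 + (e1 + (g2 + (e3 + 0)))) -> `|x1 - ca| <= m ->
  `|x2 - cb| <= m -> `|e3| <= k -> `|g1 - e1| <= k ->
  `|cb - ca - (g1 + g2)| <= m + m + k + k.
Proof.
move=> eqI; rewrite !ler_norml.
move=> /andP[? ?] /andP[? ?] /andP[? ?] /andP[? ?]; apply/andP; split; lra.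
Qed.

(* Test functions rising from 0 to 1 near a and falling back near b: their derivatives
   average c there. *)
Lemma weak_derivative_increment_oo (c g : R -> R) :
  {within `[0, T], continuous c} -> ae_integrable leb `]0, T[ g ->
  (forall eta, test_function T eta ->
    \int[leb]_(t in `]0, T[) (derive1 eta t * c t) =
    \int[leb]_(t in `]0, T[) - (eta t * g t)) ->
  forall a b, 0 < a -> a < b -> b < T ->
    c b - c a = \int[leb]_(t in `]a, b[) g t.
Proof.
move=> cc gi wd a b a0 ab bT.
have [M M0 SM] := derive1_smooth_step_bounded.
have gni : ae_integrable leb `]0, T[ (fun t => `|g t|) by exact: ae_integrable_norm.
pose P := primitive (fun t => `|g t|).
have cP : {within `[0, T], continuous P} by exact: primitive_continuous (ltW T0) gni.
have rnear (f : R -> R) x k : {within `[0, T], continuous f} -> 0 < x -> x < T -> 0 < k ->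
    exists2 d : R, 0 < d & forall t, 0 < t -> t < T -> `|t - x| <= d -> `|f t - f x| <= k.
  move=> cf x0 xT k0.
  have [+ _ _] := (continuous_within_itvP f T0).1 cf.
  move=> /(_ x); rewrite in_itv/= x0 xT => /(_ isT)/cvgrPdist_le/(_ _ k0)/nbhs_ballP[d /= d0 dP].
  exists (d / 2) => [|t t0 tT tx]; first by rewrite divr_gt0.
  rewrite distrC; apply: dP; rewrite /ball/= distrC; apply: le_lt_trans tx _.
  by rewrite ltr_pdivrMr// ltr_pMr// ltr1n.
apply/eqP; rewrite -subr_eq0 -normr_le0; apply/ler_addgt0Pl => k' k'0; rewrite addr0.
(* Each of the two averages of [c] costs [M * k] and each of the two ramps costs [k], as recorded in
   [kk]. *)
pose k := k' / (2 * M + 2).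
have M2 : 0 < 2 * M + 2 by lra.
have k0 : 0 < k by rewrite divr_gt0.
have kk : k' = M * k + M * k + k + k by rewrite /k; field; lra.
have aT : a < T := lt_trans ab bT. have b0 : 0 < b := lt_trans a0 ab.
have [d1 d10 h1] := rnear c a k cc a0 aT k0.
have [d2 d20 h2] := rnear c b k cc b0 bT k0.
have [d3 d30 h3] := rnear P a k cP a0 aT k0.
have [d4 d40 h4] := rnear P b k cP b0 bT k0.
(* Controls the oscillation of [c] and of [P] on both ramps, keeps the second ramp inside []0, T[],
   and keeps the first one to the left of [b]. *)
pose eps := Num.min (Num.min (Num.min d1 d2) (Num.min d3 d4))
   (Num.min ((T - b) / 2) (b - a)).
have e0 : 0 < eps by rewrite !lt_min d10 d20 d30 d40 divr_gt0 ?subr_gt0.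
have [e1 e2 e3 e4] : [/\ eps <= d1, eps <= d2, eps <= d3 & eps <= d4].
  by split; rewrite !ge_min lexx ?orbT.
have e5 : eps <= (T - b) / 2 by rewrite !ge_min lexx ?orbT.
have e6 : eps <= b - a by rewrite !ge_min lexx ?orbT.
have beT : b + eps < T by lra.
have aeb : a + eps <= b by lra.
have aeT : a + eps < T by lra.
pose eta t := step_at a eps t + -1 * step_at b eps t.
have tf : test_function T eta.
  split.
    apply: times_derivable_derive1n => n; apply: times_derivableD.
      by apply: times_derivable_affine; exact: times_derivable_smooth_step.
    apply: times_derivableM; first exact: times_derivable_cst.
    by apply: times_derivable_affine; exact: times_derivable_smooth_step.
  exists a, (b + eps); split => // t; rewrite in_itv/= negb_and -!ltNge => /orP[ta|tb].
    by rewrite /eta !step_at_eq0 ?mulr0 ?addr0// ltW// (lt_trans ta).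
  rewrite /eta !step_at_eq1 ?mulr1 ?subrr//; first exact: ltW.
  by apply: le_trans (ltW tb); rewrite lerD2r ltW.
have dE t : derive1 eta t = derive1 (step_at a eps) t - derive1 (step_at b eps) t.
  have D1 := is_derive_step_at a eps t; have D2 := is_derive_step_at b eps t.
  have D := is_deriveD D1 (is_deriveZ (-1) D2).
  have <- : (step_at a eps + (-1 \*: step_at b eps)) = eta by apply/funext.
  by rewrite derive1E derive_val !derive1_step_at scaleN1r.
have wci x : ae_integrable leb `]0, T[ (fun t => derive1 (step_at x eps) t * c t).
  apply: continuous_ae_integrable => t.
  apply: (@continuousM _ _ (derive1 (step_at x eps) : subspace `[0, T] -> R)
    (c : subspace `[0, T] -> R)).
    by apply: continuous_subspaceT; exact: derive1_step_at_continuous.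
  exact: cc.
have := wd _ tf.
under eq_Rintegral do rewrite dE mulrBl.
rewrite ae_RintegralB//.
have ckab x (d : R) : eps <= d -> 0 < x -> x + eps < T ->
    (forall t, 0 < t -> t < T -> `|t - x| <= d -> `|c t - c x| <= k) ->
    forall t, x <= t -> t <= x + eps -> `|c t - c x| <= k.
  move=> ed x0 xT hc t xt tx; apply: hc; first exact: lt_le_trans xt.
    exact: le_lt_trans xT.
  by rewrite ger0_norm ?subr_ge0// (le_trans _ ed)// lerBlDl.
have i1 := integral_derive1_step_at_near SM a0 e0 aeT cc (ckab _ _ e1 a0 aeT h1).
have i2 := integral_derive1_step_at_near SM b0 e0 beT cc (ckab _ _ e2 b0 beT h2).
have eta01 t : 0 <= eta t <= 1.
  rewrite /eta mulN1r; have [tb|tb] := leP t b.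
    by rewrite [step_at b _ _]step_at_eq0// subr0 smooth_step_ge0 smooth_step_le1.
  rewrite step_at_eq1//; last by lra.
  by rewrite subr_ge0 smooth_step_le1 gerBl smooth_step_ge0.
have ceta : continuous eta.
  apply: derivable1_continuous => t.
  by have [h _] := tf; exact: (h 0%N t).
have egi : ae_integrable leb `]0, T[ (fun t => eta t * g t).
  apply: (@ae_integrable_le _ _ _ leb _ _ (fun t => `|g t|)) => //.
    apply: ae_measurableM; last exact: ae_integrable_measurable.
    by apply: ae_integrable_measurable; exact: continuous_within_ae_integrable.
  apply: ae_lebT => t _; rewrite normrM ler_piMl//.
  by have /andP[? ?] := eta01 t; rewrite ger0_norm.
rewrite ae_RintegralN// => eqI.
have split4 (f : R -> R) : ae_integrable leb `]0, T[ f ->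
    \int[leb]_(t in `]0, T[) f t = \int[leb]_(t in `]0, a[) f t +
     (\int[leb]_(t in `]a, a + eps[) f t + (\int[leb]_(t in `]a + eps, b[) f t +
     (\int[leb]_(t in `]b, b + eps[) f t + \int[leb]_(t in `]b + eps, T[) f t))).
  move=> fi; have aae : a <= a + eps by rewrite lerDl ltW.
  have bbe : b <= b + eps by rewrite lerDl ltW.
  have f1 : ae_integrable leb `]a, T[ f by apply: ae_integrable_itvS fi => //; exact: ltW.
  have f2 : ae_integrable leb `]a + eps, T[ f by apply: ae_integrable_itvS f1.
  have f3 : ae_integrable leb `]b, T[ f by apply: ae_integrable_itvS f2.
  rewrite (ae_Rintegral_itvD (ltW a0) (ltW aT) fi) (ae_Rintegral_itvD aae (ltW aeT) f1).
  by rewrite (ae_Rintegral_itvD aeb (ltW bT) f2) (ae_Rintegral_itvD bbe (ltW beT) f3).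
have zero x y : (forall t, x < t -> t < y -> eta t = 0) ->
    \int[leb]_(t in `]x, y[) (eta t * g t) = 0.
  move=> e00; rewrite (@eq_Rintegral _ _ _ leb _ (cst 0)) ?Rintegral_cst ?mul0r// => t.
  by rewrite inE/= in_itv/= => /andP[xt ty]; rewrite e00 ?mul0r.
have I4 := split4 _ egi.
rewrite (zero 0 a) in I4; last first.
  by move=> t _ ta; rewrite /eta !step_at_eq0 ?mulr0 ?addr0// ltW// (lt_trans ta).
rewrite (zero (b + eps) T) in I4; last first.
  move=> t tb _; rewrite /eta !step_at_eq1 ?mulr1 ?subrr//; first exact: ltW.
  by apply: le_trans (ltW tb); rewrite lerD2r ltW.
have one : \int[leb]_(t in `]a + eps, b[) (eta t * g t) =
    \int[leb]_(t in `]a + eps, b[) g t.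
  apply: eq_Rintegral => t; rewrite inE/= in_itv/= => /andP[t1 t2].
  by rewrite /eta step_at_eq1 ?(ltW t1)// step_at_eq0 ?(ltW t2)// mulr0 addr0 mul1r.
have gab : ae_integrable leb `]a, b[ g by apply: ae_integrable_itvS gi; exact: ltW.
have J : \int[leb]_(t in `]a, b[) g t = \int[leb]_(t in `]a, a + eps[) g t +
    \int[leb]_(t in `]a + eps, b[) g t.
  by apply: ae_Rintegral_itvD => //; rewrite lerDl ltW.
(* On a ramp the integrand is at most [|g|], whose integral is an increment of its primitive [P]. *)
have small x : 0 < x -> x + eps < T -> `|P (x + eps) - P x| <= k ->
    forall f : R -> R, ae_integrable leb `]0, T[ f -> (forall t, `|f t| <= `|g t|) ->
    `|\int[leb]_(t in `]x, x + eps[) f t| <= k.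
  move=> x0 xT Pk f fi fg.
  have xxe : x <= x + eps by rewrite lerDl ltW.
  apply: (@le_trans _ _ (\int[leb]_(t in `]x, x + eps[) `|g t|)).
    apply: ae_Rintegral_norm_le => //.
    - by apply: ae_integrable_itvS fi; exact: ltW.
    - by apply: ae_integrable_itvS gni; exact: ltW.
    - by apply: ae_lebT => t _.
  by rewrite (primitive_sub gni (ltW x0) xxe (ltW xT)) (le_trans (ler_norm _)).
have Pa : `|P (a + eps) - P a| <= k.
  by apply: h3 => //; [exact: addr_gt0|rewrite [a + eps]addrC addrK gtr0_norm].
have Pb : `|P (b + eps) - P b| <= k.
  by apply: h4 => //; [exact: addr_gt0|rewrite [b + eps]addrC addrK gtr0_norm].
have egg t : `|eta t * g t| <= `|g t|.
  by rewrite normrM ler_piMl//; have /andP[? ?] := eta01 t; rewrite ger0_norm.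
have i3 := small b b0 beT Pb _ egi egg.
have i4 : `|\int[leb]_(t in `]a, a + eps[) ((1 - eta t) * g t)| <= k.
  apply: small => //.
    apply: (@ae_integrable_eq _ _ _ leb _ (fun t => g t - eta t * g t)).
      by apply: ae_lebT => t _; rewrite mulrBl mul1r.
    exact: ae_integrableB.
  move=> t; rewrite normrM ler_piMl//; have /andP[? ?] := eta01 t.
  by rewrite ger0_norm ?subr_ge0// gerBl.
have i4E : \int[leb]_(t in `]a, a + eps[) ((1 - eta t) * g t) =
    \int[leb]_(t in `]a, a + eps[) g t - \int[leb]_(t in `]a, a + eps[) (eta t * g t).
  rewrite -ae_RintegralB//.
  - by apply: eq_Rintegral => t _; rewrite mulrBl mul1r.
  - by apply: ae_integrable_itvS gi; exact: ltW.
  - by apply: ae_integrable_itvS egi; exact: ltW.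
move: eqI i1 i2 i3 i4; rewrite i4E I4 one J kk.
exact: increment_error.
Qed.

(** [c] minus the primitive of [g] is constant on the open interval, and it is continuous up to the
    end points. *)
Lemma weak_derivative_increment (c g : R -> R) :
  {within `[0, T], continuous c} -> ae_integrable leb `]0, T[ g ->
  (forall eta, test_function T eta ->
    \int[leb]_(t in `]0, T[) (derive1 eta t * c t) =
    \int[leb]_(t in `]0, T[) - (eta t * g t)) ->
  forall a b, 0 <= a -> a <= b -> b <= T ->
    c b - c a = \int[leb]_(t in `]a, b[) g t.
Proof.
move=> cc gi wd a b a0 ab bT.
pose X t := c t - primitive g t.
have cX : {within `[0, T], continuous X}.
  move=> t; apply: (@continuousB _ _ _ (c : subspace `[0, T] -> R)
    (primitive g : subspace `[0, T] -> R)); first exact: cc.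
  exact: (primitive_continuous (ltW T0) gi).
have Xoo x y : 0 < x -> x < y -> y < T -> X x = X y.
  move=> x0 xy yT; have := weak_derivative_increment_oo cc gi wd x0 xy yT.
  rewrite (primitive_sub gi (ltW x0) (ltW xy) (ltW yT)) /X; lra.
have T20 : 0 < T / 2 by rewrite divr_gt0.
have T2T : T / 2 < T by rewrite ltr_pdivrMr// ltr_pMr// ltr1n.
have Xoo' x : 0 < x -> x < T -> X x = X (T / 2).
  move=> x0 xT; have [xT2|xT2|->//] := ltgtP x (T / 2); first exact: Xoo.
  by apply/esym; exact: Xoo.
have Xc : forall x, 0 <= x -> x <= T -> X x = X (T / 2).
  move=> x x0 xT; apply/eqP; rewrite -subr_eq0 -normr_le0.
  apply/ler_addgt0Pl => k k0; rewrite addr0.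
  have xin : `[0, T]%classic x by rewrite /= in_itv/= x0.
  have /subspace_continuousP/(_ _ xin)/cvgrPdist_le/(_ _ k0) := cX.
  rewrite near_withinE => /nbhs_ballP[d /= d0 dP].
  pose e := Num.min (d / 2) (T / 4).
  have e0 : 0 < e by rewrite lt_min !divr_gt0.
  have ed : e < d.
    by rewrite (@le_lt_trans _ _ (d / 2)) ?ge_min ?lexx// ltr_pdivrMr// ltr_pMr// ltr1n.
  have eT : e <= T / 4 by rewrite ge_min lexx orbT.
  have [xT2|xT2] := leP x (T / 2).
    rewrite -(Xoo' (x + e)); [|lra|lra].
    by apply: dP; [rewrite /ball/= opprD addrA subrr add0r normrN gtr0_norm|rewrite in_itv/=; lra].
  rewrite -(Xoo' (x - e)); [|lra|lra].
  by apply: dP; [rewrite /ball/= opprD addrA subrr add0r opprK gtr0_norm|rewrite in_itv/=; lra].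
rewrite (primitive_sub gi a0 ab bT).
have := Xc _ a0 (le_trans ab bT); have := Xc _ (le_trans a0 ab) bT.
by rewrite /X; lra.
Qed.

End weak_derivative_integral.

(** * Functions with values in a separable Hilbert space *)

Section hilbert_basics.
Context {R : realType} {H : hilbertType R}.
Implicit Types x y z : H.

Lemma ip0l y : ip (0 : H) y = 0.
Proof. by have := ipDl (0 : H) 0 y; rewrite addr0 => h; lra. Qed.

Lemma ipNl x y : ip (- x) y = - ip x y.
Proof. by rewrite -scaleN1r ipZl mulN1r. Qed.

Lemma ipBl x y z : ip (x - y) z = ip x z - ip y z.
Proof. by rewrite ipDl ipNl. Qed.

Lemma ipDr x y z : ip z (x + y) = ip z x + ip z y.
Proof. by rewrite ipC ipDl ![ip _ z]ipC. Qed.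

Lemma ipZr (a : R) x z : ip z (a *: x) = a * ip z x.
Proof. by rewrite ipC ipZl [ip _ z]ipC. Qed.

Lemma ip_suml n (f : 'I_n -> H) y : ip (\sum_(i < n) f i) y = \sum_(i < n) ip (f i) y.
Proof.
by elim/big_ind2 : _ => [|_ x1 _ x2 <- <-|//]; rewrite ?ip0l ?ipDl.
Qed.

Lemma ip_sumr n (f : 'I_n -> H) y : ip y (\sum_(i < n) f i) = \sum_(i < n) ip y (f i).
Proof. by rewrite ipC ip_suml; apply: eq_bigr => i _; rewrite ipC. Qed.

Lemma ip_ge0 x : 0 <= ip x x.
Proof. by rewrite ip_sqr_norm sqr_ge0. Qed.

Lemma ip_norm_le x y : `|ip x y| <= `|x| * `|y|.
Proof.
rewrite -ler_sqr ?nnegrE ?mulr_ge0// real_normK ?num_real// exprMn -!ip_sqr_norm.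
apply: (@hp_cauchy_schwarz _ _ setT (@ip R H)) => //.
- by move=> a u v z _ _ _; rewrite ipDl ipZl.
- exact: ipC.
- by move=> u _; exact: ip_ge0.
Qed.

Lemma ip_le_sum x y : `|ip x y| <= `|x| ^+ 2 + `|y| ^+ 2.
Proof. by apply: le_trans (ip_norm_le x y) _; nra. Qed.

Lemma ip_continuousl y : continuous (fun x : H => ip x y).
Proof.
move=> x; apply/cvgrPdist_le => eps eps0.
have y1 : 0 < `|y| + 1 by rewrite ltr_wpDl.
near=> z; rewrite -ipBl; apply: le_trans (ip_norm_le _ _) _.
apply: (@le_trans _ _ (`|x - z| * (`|y| + 1))); first by rewrite ler_wpM2l// lerDl.
rewrite -ler_pdivlMr//; near: z; apply: cvgr_dist_le; first exact: cvg_id.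
exact: divr_gt0.
Unshelve. all: by end_near. Qed.

Variable e : nat -> H.
Hypothesis he : is_orthonormal_basis e.

Lemma basis_partial_norm x n :
  `|series (fun i => ip x (e i) *: e i) n| ^+ 2 = \sum_(i < n) ip x (e i) ^+ 2.
Proof.
rewrite -ip_sqr_norm /series/= big_mkord ip_suml; apply: eq_bigr => i _.
rewrite ipZl ip_sumr (bigD1 i)//= big1 ?addr0.
  by rewrite ipZr he.1 eqxx mulr1 expr2.
by move=> j ji; rewrite ipZr he.1 eq_sym (inj_eq val_inj) (negbTE ji) mulr0.
Qed.

Lemma parseval x : \sum_(i < n) ip x (e i) ^+ 2 @[n --> \oo] --> `|x| ^+ 2.
Proof.
under eq_fun do rewrite -basis_partial_norm.
by under eq_fun do rewrite expr2; rewrite expr2; apply: cvgM; apply: cvg_norm; exact: he.2.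
Qed.

(** A dense set indexed by a countable type: this is how the orthonormal basis provides
    separability. *)
Definition rat_comb (s : seq rat) : H := \sum_(i < size s) ratr s`_i *: e i.

Lemma rat_comb_dense x (eps : R) : 0 < eps -> exists s, `|x - rat_comb s| < eps.
Proof.
move=> eps0; have e2 : 0 < eps / 2 by rewrite divr_gt0.
have /cvgrPdist_lt/(_ _ e2)[n _ /(_ n (leqnn n)) /= hn] := he.2 x.
pose dl := eps / 2 / n.+1%:R.
have d0 : 0 < dl by rewrite divr_gt0.
have [q hq] : {q : nat -> rat & forall i, `|ip x (e i) - ratr (q i)| <= dl}.
  apply: (@choice _ _ (fun i (r : rat) => `|ip x (e i) - ratr r| <= dl)) => i.
  have [r] := @rat_in_itvoo R (ip x (e i)) (ip x (e i) + dl) (ltr_pwDr d0 (lexx _)).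
  rewrite in_itv/= => /andP[r1 r2]; exists r.
  by rewrite distrC ler_norml; apply/andP; split; move: r1 r2 d0; clear; lra.
exists (mkseq q n); rewrite /rat_comb size_mkseq.
have -> : x - \sum_(i < n) ratr (mkseq q n)`_i *: e i =
    (x - series (fun i => ip x (e i) *: e i) n) +
    \sum_(i < n) (ip x (e i) - ratr (q i)) *: e i.
  rewrite -[LHS]addr0 -[X in _ + X](subrr (series (fun i => ip x (e i) *: e i) n)).
  rewrite -!addrA; congr (_ + _); rewrite addrCA addrC -!addrA addrCA.
  congr (- _ + _); rewrite /series/= big_mkord addrC -sumrB; apply: eq_bigr => i _.
  by rewrite nth_mkseq// scalerBl.
apply: le_lt_trans (ler_normD _ _) _.
have le2 : `|\sum_(i < n) (ip x (e i) - ratr (q i)) *: e i| <= eps / 2.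
  apply: le_trans (ler_norm_sum _ _ _) _.
  apply: (@le_trans _ _ (\sum_(i < n) dl)).
    apply: ler_sum => i _; rewrite normrZ.
    suff -> : `|e i| = 1 by rewrite mulr1.
    apply/eqP; rewrite -sqrp_eq1//.
    by rewrite -ip_sqr_norm he.1 eqxx.
  rewrite sumr_const card_ord -[dl *+ n]mulr_natr -[leRHS](@divfK _ n.+1%:R)//.
  by rewrite ler_wpM2l ?ler_nat// /dl divr_ge0 ?ler0n// ltW.
by move: hn le2; lra.
Qed.

End hilbert_basics.

(** * Borel measurability of maps into a separable Hilbert space *)

Section borel_hilbert.
Context {R : realType} {H : hilbertType R} d {X : measurableType d}.
Implicit Types (u v : X -> H) (f : X -> R).
Variable e : nat -> H.
Hypothesis he : is_orthonormal_basis e.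

Definition borel_fun u := measurable_fun setT (u : X -> borel H).

Lemma borel_fun_comp u (g : H -> R) : continuous g -> borel_fun u ->
  measurable_fun setT (g \o u).
Proof.
move=> cg mu; apply: (@measurableT_comp _ _ _ _ (borel H) _ g) => //.
apply: (measurability _ (RGenOpens.measurableE R)).
move=> _ [_ [a [b ->] <-]]; rewrite setTI.
apply: sub_sigma_algebra.
by apply: open_comp => // x _; exact: cg.
Qed.

Lemma borel_fun_norm u : borel_fun u -> measurable_fun setT (fun x => `|u x|).
Proof. by apply: (borel_fun_comp (g := fun y : H => `|y|)); exact: norm_continuous. Qed.

Lemma borel_fun_ip u h : borel_fun u -> measurable_fun setT (fun x => ip (u x) h).
Proof. by apply: (borel_fun_comp (g := fun y : H => ip y h)); exact: ip_continuousl. Qed.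

(** Weak measurability implies Borel measurability. By Parseval the squared distance to a fixed
    point is a limit of measurable functions, and an open set is the countable union of those balls
    with centre [rat_comb] and radius an inverse integer that it contains. *)
Lemma borel_fun_coordinates u :
  (forall i, measurable_fun setT (fun x => ip (u x) (e i))) -> borel_fun u.
Proof.
move=> mu.
have mdist c : measurable_fun setT (fun x => `|u x - c| ^+ 2).
  apply: (@measurable_fun_cvg _ _ _ _
    (fun n x => \sum_(i < n) ip (u x - c) (e i) ^+ 2)) => [n|x _].
    apply: measurable_sum => i; apply: measurable_funX.
    under eq_fun do rewrite ipBl; apply: measurable_funB => //; exact: measurable_cst.
  exact: parseval.
apply: (@measurability _ _ X (borel H) setT u (@open H) erefl).
move=> _ [U oU <-]; rewrite setTI.
pose I := [set p : seq rat * nat | forall y, `|y - rat_comb e p.1| < p.2.+1%:R^-1 -> U y].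
have -> : u @^-1` U = \bigcup_(p in I) [set x | `|u x - rat_comb e p.1| < p.2.+1%:R^-1].
  apply/seteqP; split => x /=; last by move=> [p pI]; exact: pI.
  move=> Ux; move: oU; rewrite openE => /(_ _ Ux)/nbhs_ballP[r /= r0 rU].
  have r2 : 0 < r / 2 by rewrite divr_gt0.
  have [k kr] : exists k : nat, k.+1%:R^-1 < r / 2.
    have [k _ /(_ k (leqnn k)) hk] := near_infty_natSinv_lt (PosNum r2).
    by exists k.
  have k0 : 0 < k.+1%:R^-1 :> R by rewrite invr_gt0.
  have [s hs] := rat_comb_dense he (u x) k0.
  exists (s, k) => //= y hy; apply: rU; rewrite -ball_normE /ball_/=.
  have -> : u x - y = (u x - rat_comb e s) + (rat_comb e s - y) by rewrite addrA subrK.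
  apply: le_lt_trans (ler_normD _ _) _; rewrite [X in _ + X < _]distrC.
  by move: hs hy kr; rewrite /=; move: (k.+1%:R^-1) => z; lra.
rewrite bigcup_mkcond; apply: countable_bigcupT_measurable => [|p].
  exact: countableP.
case: ifP => // _.
have -> : [set x | `|u x - rat_comb e p.1| < p.2.+1%:R^-1] =
    (fun x => `|u x - rat_comb e p.1| ^+ 2) @^-1` `]-oo, (p.2.+1%:R^-1 ^+ 2)[.
  by apply/funext => x; apply/propext; rewrite /= in_itv/= ltr_pXn2r// nnegrE.
have := mdist (rat_comb e p.1) measurableT _ (measurable_itv `]-oo, (p.2.+1%:R^-1 ^+ 2)[).
by rewrite setTI.
Qed.

Lemma borel_funZD (a : R) u v : borel_fun u -> borel_fun v ->
  borel_fun (fun x => a *: u x + v x).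
Proof.
move=> bu bv; apply: borel_fun_coordinates => i; under eq_fun do rewrite ipDl ipZl.
apply: measurable_funD; last exact: borel_fun_ip.
by apply: measurable_funM; [exact: measurable_cst|exact: borel_fun_ip].
Qed.

Lemma borel_fun_scale f u : measurable_fun setT f -> borel_fun u ->
  borel_fun (fun x => f x *: u x).
Proof.
move=> mf bu; apply: borel_fun_coordinates => i; under eq_fun do rewrite ipZl.
by apply: measurable_funM => //; exact: borel_fun_ip.
Qed.

Lemma borel_fun_lim (u_ : nat -> X -> H) u : (forall n, borel_fun (u_ n)) ->
  (forall x, u_ n x @[n --> \oo] --> u x) -> borel_fun u.
Proof.
move=> bu uu; apply: borel_fun_coordinates => i.
apply: (@measurable_fun_cvg _ _ _ _ (fun n x => ip (u_ n x) (e i))) => [n|x _].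
  exact: borel_fun_ip.
apply: (@cvg_comp _ _ _ (fun n => u_ n x) (fun y : H => ip y (e i)) _ _ _ (uu x)).
exact: ip_continuousl.
Qed.

(** Polarization reduces the inner product of two maps to norms of single maps. *)
Lemma borel_fun_ip2 u v : borel_fun u -> borel_fun v ->
  measurable_fun setT (fun x => ip (u x) (v x)).
Proof.
move=> bu bv.
have -> : (fun x => ip (u x) (v x)) =
    fun x => 4^-1 * (`|1 *: u x + v x| ^+ 2 - `|-1 *: u x + v x| ^+ 2).
  apply/funext => x; rewrite -!ip_sqr_norm !ipDl !ipDr !ipZl !ipZr [ip (v x) (u x)]ipC.
  by field.
apply: measurable_funM; first exact: measurable_cst.
by apply: measurable_funB; apply: measurable_funX; apply: borel_fun_norm; exact: borel_funZD.
Qed.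

End borel_hilbert.

(** * Square integrable functions, real-valued and Hilbert-valued *)

Section square_integrable.
Context {R : realType} {H : hilbertType R} d {X : measurableType d}.
Variables (mu : {measure set X -> \bar R}) (e : nat -> H).
Hypothesis he : is_orthonormal_basis e.
Hypothesis mu_lty : (mu setT < +oo)%E.
Implicit Types (f g : X -> R) (u v : X -> H).

Definition L2R f := measurable_fun setT f /\
  mu.-integrable setT (EFin \o (fun x => f x ^+ 2)).

Definition L2H u := borel_fun u /\
  mu.-integrable setT (EFin \o (fun x => `|u x| ^+ 2)).

Definition ipR f g : R := \int[mu]_x (f x * g x).

Definition ipH u v : R := \int[mu]_x ip (u x) (v x).

Lemma dominated_EFin f g : measurable_fun setT f ->
  mu.-integrable setT (EFin \o g) -> (forall x, `|f x| <= g x) ->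
  mu.-integrable setT (EFin \o f).
Proof.
move=> mf ig fg; apply: le_integrable ig => //; first exact/measurable_EFinP.
by move=> x _ /=; rewrite lee_fin (le_trans (fg x))// ler_norm.
Qed.

Lemma integrable_EFinD f g : mu.-integrable setT (EFin \o f) ->
  mu.-integrable setT (EFin \o g) ->
  mu.-integrable setT (EFin \o (fun x => f x + g x)).
Proof. by move=> fi gi; rewrite /comp; under eq_fun do rewrite EFinD; exact: integrableD. Qed.

Lemma integrable_EFinZ (a : R) f : mu.-integrable setT (EFin \o f) ->
  mu.-integrable setT (EFin \o (fun x => a * f x)).
Proof. by move=> fi; rewrite /comp; under eq_fun do rewrite EFinM; exact: integrableZl. Qed.

Lemma integrable_EFin_cst (a : R) : mu.-integrable setT (EFin \o (fun=> a)).
Proof.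
apply/integrableP; split; first exact/measurable_EFinP/measurable_cst.
rewrite [ltLHS](_ : _ = \int[mu]_(x in setT) cst (`|a|%:E) x)%E//.
by rewrite integral_cst// lte_mul_pinfty// lee_fin.
Qed.

Lemma L2R_mul f g : L2R f -> L2R g -> mu.-integrable setT (EFin \o (fun x => f x * g x)).
Proof.
move=> [mf fi] [mg gi]; apply: dominated_EFin (integrable_EFinD fi gi) _.
  exact: measurable_funM.
by move=> x; rewrite ler_norml; nra.
Qed.

Lemma L2H_ip u v : L2H u -> L2H v -> mu.-integrable setT (EFin \o (fun x => ip (u x) (v x))).
Proof.
move=> [mu_ ui] [mv vi]; apply: dominated_EFin (integrable_EFinD ui vi) _.
  exact: (borel_fun_ip2 he).
by move=> x; exact: ip_le_sum.
Qed.

Lemma L2R_ZD (a : R) f g : L2R f -> L2R g -> L2R (fun x => a * f x + g x).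
Proof.
move=> [mf fi] [mg gi].
have m : measurable_fun setT (fun x => a * f x + g x).
  by apply: measurable_funD => //; apply: measurable_funM => //; exact: measurable_cst.
split => //; apply: (dominated_EFin (g := fun x => (2 * a ^+ 2) * f x ^+ 2 + 2 * g x ^+ 2)).
- exact: measurable_funX.
- by apply: integrable_EFinD; exact: integrable_EFinZ.
- by move=> x; rewrite ger0_norm ?sqr_ge0//; have := sqr_ge0 (a * f x - g x); nra.
Qed.

Lemma L2R_cst (a : R) : L2R (fun=> a).
Proof. by split; [exact: measurable_cst|exact: integrable_EFin_cst]. Qed.

Lemma L2H_norm u : L2H u -> L2R (fun x => `|u x|).
Proof. by move=> [mu_ ui]; split => //; exact: borel_fun_norm. Qed.

Lemma L2H_ZD (a : R) u v : L2H u -> L2H v -> L2H (fun x => a *: u x + v x).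
Proof.
move=> uL vL; have [mu_ _] := uL; have [mv _] := vL.
have m : borel_fun (fun x => a *: u x + v x) by exact: (borel_funZD he).
split => //.
have [_ h] := L2R_ZD `|a| (L2H_norm uL) (L2H_norm vL).
apply: dominated_EFin h _.
  by apply: measurable_funX; exact: borel_fun_norm.
move=> x; rewrite ger0_norm ?sqr_ge0// lerXn2r ?nnegrE ?addr_ge0 ?mulr_ge0//.
by apply: le_trans (ler_normD _ _) _; rewrite normrZ.
Qed.

Lemma L2H_cst0 : L2H (fun=> 0).
Proof.
split; first by apply: (borel_fun_coordinates he) => i; under eq_fun do rewrite ip0l; exact: measurable_cst.
by under eq_fun do rewrite normr0; exact: integrable_EFin_cst.
Qed.

Lemma L2R_dominated f g : measurable_fun setT f -> L2R g ->
  (forall x, `|f x| <= g x) -> L2R f.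
Proof.
move=> mf [mg gi] fg; split => //; apply: dominated_EFin gi _.
  exact: measurable_funX.
move=> x; rewrite ger0_norm ?sqr_ge0// -real_normK ?num_real//.
by rewrite lerXn2r ?nnegrE// (le_trans _ (fg x)).
Qed.

Lemma L2R_bounded_mul f g (C : R) : measurable_fun setT f -> L2R g ->
  {ae mu, forall x, `|f x| <= C} -> L2R (fun x => f x * g x).
Proof.
move=> mf [mg gi] fC; split; first exact: measurable_funM.
have ci : ae_integrable mu setT (fun x => C ^+ 2 * g x ^+ 2).
  by apply: integrable_ae_integrable; exact: integrable_EFinZ.
have [h hi hE] : ae_integrable mu setT (fun x => (f x * g x) ^+ 2).
  apply: (ae_integrable_le (mu := mu) (g := fun x => C ^+ 2 * g x ^+ 2)) => //.
    by apply: measurable_ae_measurable; apply: measurable_funX; exact: measurable_funM.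
  apply: filterS fC => x fx _; rewrite ger0_norm ?sqr_ge0// exprMn.
  rewrite ler_wpM2r ?sqr_ge0// -real_normK ?num_real//.
  by rewrite lerXn2r ?nnegrE// (le_trans _ fx).
apply/integrableP; split.
  by apply/measurable_EFinP; apply: measurable_funX; exact: measurable_funM.
have /integrableP[_] := hi; apply: le_lt_trans.
apply: ge0_ae_integral_le => //.
by apply: filterS hE => x /(_ I) /= ->.
Qed.

Lemma ipR_lin (a : R) f g h : L2R f -> L2R g -> L2R h ->
  ipR (fun x => a * f x + g x) h = a * ipR f h + ipR g h.
Proof.
move=> fL gL hL; rewrite /ipR.
under eq_Rintegral do rewrite mulrDl -mulrA.
by rewrite RintegralD ?RintegralZl//; do ?[exact: L2R_mul|apply: integrable_EFinZ; exact: L2R_mul].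
Qed.

Lemma ipRC f g : ipR f g = ipR g f.
Proof. by apply: eq_Rintegral => x _; rewrite mulrC. Qed.

Lemma ipR_ge0 f : 0 <= ipR f f.
Proof. by apply: Rintegral_ge0 => x _; rewrite -expr2 sqr_ge0. Qed.

Lemma ipH_lin (a : R) u v w : L2H u -> L2H v -> L2H w ->
  ipH (fun x => a *: u x + v x) w = a * ipH u w + ipH v w.
Proof.
move=> fL gL hL; rewrite /ipH.
under eq_Rintegral do rewrite ipDl ipZl.
by rewrite RintegralD ?RintegralZl//; do ?[exact: L2H_ip|apply: integrable_EFinZ; exact: L2H_ip].
Qed.

Lemma ipHC u v : ipH u v = ipH v u.
Proof. by apply: eq_Rintegral => x _; rewrite ipC. Qed.

Lemma ipH_ge0 u : 0 <= ipH u u.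
Proof. by apply: Rintegral_ge0 => x _; exact: ip_ge0. Qed.

Lemma ipH_normE u : ipH u u = ipR (fun x => `|u x|) (fun x => `|u x|).
Proof. by apply: eq_Rintegral => x _; rewrite ip_sqr_norm expr2. Qed.

Lemma Lnorm2_ipR f : L2R f -> Lnorm mu 2%:E (EFin \o f) = (Num.sqrt (ipR f f))%:E.
Proof.
move=> [mf fi]; rewrite unlock.
have -> : (\int[mu]_x (`|(EFin \o f) x| `^ 2) = (ipR f f)%:E)%E.
  rewrite /ipR /Rintegral fineK; last first.
    apply: (integrable_fin_num measurableT).
    by rewrite (_ : (fun x => _) = EFin \o (fun x => f x ^+ 2)) //; apply/funext => x /=; rewrite expr2.
  apply: eq_integral => x _ /=.
  by rewrite -[2]/(2%:R) powR_mulrn// real_normK ?num_real// expr2.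
by rewrite poweR_EFin powR12_sqrt// ipR_ge0.
Qed.

Lemma L2R_Lfun f : f \in Lfun mu 2%:E <-> L2R f.
Proof.
split.
  move=> /[dup] fL /Lfun2_integrable_sqr fi; split => //.
  by move: fL; rewrite inE => /andP[]; rewrite inE.
move=> fL; have [mf fi] := fL.
rewrite inE; apply/andP; split; rewrite inE//=.
by rewrite /finite_norm Lnorm2_ipR// ltry.
Qed.

Lemma Lnorm2_ipH u : L2H u ->
  Lnorm mu 2%:E (fun x => `|u x|%:E) = (Num.sqrt (ipH u u))%:E.
Proof.
move=> uL; rewrite ipH_normE -Lnorm2_ipR//; exact: L2H_norm.
Qed.

Lemma L2H_Lnorm u : borel_fun u ->
  (Lnorm mu 2%:E (fun x => `|u x|%:E) < +oo)%E -> L2H u.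
Proof.
move=> mu_ uy; split => //.
have : (fun x => `|u x|) \in Lfun mu 2%:E.
  rewrite inE; apply/andP; split; rewrite inE//=; exact: borel_fun_norm.
by move=> /L2R_Lfun [].
Qed.

Lemma ipR_cauchy_schwarz f g : L2R f -> L2R g -> ipR f g ^+ 2 <= ipR f f * ipR g g.
Proof.
apply: (@hp_cauchy_schwarz _ (X -> R^o) L2R ipR).
- by move=> a x y; exact: L2R_ZD.
- by move=> a x y z; exact: ipR_lin.
- exact: ipRC.
- by move=> x _; exact: ipR_ge0.
Qed.

Lemma ipH_cauchy_schwarz u v : L2H u -> L2H v -> ipH u v ^+ 2 <= ipH u u * ipH v v.
Proof.
apply: (@hp_cauchy_schwarz _ (X -> H) L2H ipH).
- by move=> a x y; exact: L2H_ZD.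
- by move=> a x y z; exact: ipH_lin.
- exact: ipHC.
- by move=> x _; exact: ipH_ge0.
Qed.

End square_integrable.

(** * Completeness of L^1 for Hilbert-valued maps *)

Section L1H_complete.
Context {R : realType} {H : hilbertType R} d {X : measurableType d}.
Variables (mu : {measure set X -> \bar R}) (e : nat -> H).
Hypothesis he : is_orthonormal_basis e.
Implicit Types (u v : X -> H).

Definition L1H u := borel_fun u /\ mu.-integrable setT (EFin \o (fun x => `|u x|)).

Lemma L1H_ZD (a : R) u v : L1H u -> L1H v -> L1H (fun x => a *: u x + v x).
Proof.
move=> [bu ui] [bv vi]; split; first exact: (borel_funZD he).
apply: (dominated_EFin (g := fun x => `|a| * `|u x| + `|v x|)).
- by apply: borel_fun_norm; exact: (borel_funZD he).
- by apply: integrable_EFinD => //; exact: integrable_EFinZ.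
- by move=> x; rewrite normr_id; apply: le_trans (ler_normD _ _) _; rewrite normrZ.
Qed.

(** The Riesz-Fischer argument: the sum [S] of the norms of consecutive differences is integrable,
    hence finite almost everywhere. Where it is finite the sequence converges absolutely, and [S]
    dominates its distance to the limit. *)
Lemma L1H_complete (u_ : nat -> X -> H) : (forall n, L1H (u_ n)) ->
  (forall n, \int[mu]_x `|u_ n.+1 x - u_ n x| <= 2^-1 ^+ n) ->
  exists2 u, L1H u & \int[mu]_x `|u_ n x - u x| @[n --> \oo] --> 0.
Proof.
move=> uL ule.
pose w n x := `|u_ n.+1 x - u_ n x|.
have wL n : L1H (fun x => -1 *: u_ n x + u_ n.+1 x) by exact: L1H_ZD.
have wE n : w n = fun x => `|-1 *: u_ n x + u_ n.+1 x|.
  by apply/funext => x; rewrite /w scaleN1r addrC.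
have mw n : measurable_fun setT (w n) by rewrite wE; apply: borel_fun_norm; have [] := wL n.
have wi n : mu.-integrable setT (EFin \o w n) by rewrite wE; have [] := wL n.
pose S x := (\sum_(n <oo) (w n x)%:E)%E.
have mS : measurable_fun setT S.
  by apply: ge0_emeasurable_sum => // [n x _ _|n _]; [rewrite lee_fin /w|exact/measurable_EFinP].
have S0 x : (0 <= S x)%E by apply: nneseries_ge0 => n _ _; rewrite lee_fin /w.
have iS : (\int[mu]_x S x < +oo)%E.
  rewrite /S integral_nneseries//; last 2 first.
  - by move=> n; exact/measurable_EFinP.
  - by move=> n x _; rewrite lee_fin /w.
  apply: (@le_lt_trans _ _ (\sum_(n <oo) (2^-1 ^+ n)%:E)%E).
    apply: lee_nneseries => [n _ _|n _].
      by apply: integral_ge0 => x _; rewrite lee_fin /w.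
    have := ule n; rewrite -lee_fin /Rintegral fineK; first exact.
    exact: (integrable_fin_num measurableT (wi n)).
  apply: (@le_lt_trans _ _ 2%:E); last exact: ltry.
  apply: lime_le; first by apply: is_cvg_nneseries => n _ _; rewrite lee_fin exprn_ge0// invr_ge0.
  apply: nearW => n; rewrite sumEFin lee_fin.
  have -> : \sum_(0 <= i < n) 2^-1 ^+ i = 2 - 2 * 2^-1 ^+ n :> R.
    elim: n => [|n IH]; first by rewrite big_nil expr0 mulr1 subrr.
    by rewrite big_nat_recr//= IH exprS; field.
  by rewrite gerBl mulr_ge0// exprn_ge0// invr_ge0.
have iS' : mu.-integrable setT S.
  apply/integrableP; split => //.
  by under eq_integral do rewrite gee0_abs//.
have [N [mN N0 sN]] := integrable_ae measurableT iS'.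
have Sfin x : ~ N x -> S x \is a fin_num.
  by move=> Nx; apply: contrapT => Sx; apply: Nx; apply: sN => /= /(_ I).
have partial x n : ~ N x -> \sum_(0 <= k < n) w k x <= fine (S x).
  move=> Nx; rewrite -lee_fin fineK ?Sfin// -sumEFin.
  by apply: nneseries_lim_ge => k _ _; rewrite lee_fin /w.
have tele x n m : `|u_ (n + m)%N x - u_ n x| <= \sum_(0 <= k < n + m) w k x.
  elim: m => [|m IH]; first by rewrite addn0 subrr normr0 sumr_ge0// => i _; rewrite /w.
  rewrite addnS big_nat_recr//= addrC.
  have -> : u_ (n + m).+1 x - u_ n x = (u_ (n + m).+1 x - u_ (n + m)%N x) + (u_ (n + m)%N x - u_ n x).
    by rewrite addrA subrK.
  by apply: le_trans (ler_normD _ _) _; rewrite lerD2l.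
have ucvg x : ~ N x -> cvgn (u_ ^~ x).
  move=> Nx.
  have wcvg : cvgn [normed series (fun n => u_ n.+1 x - u_ n x)].
    have h : cvgn (fun n => \sum_(0 <= k < n) (w k x)%:E)%E.
      by apply: is_cvg_nneseries => n _ _; rewrite lee_fin /w.
    apply/cvg_ex; exists (fine (S x)).
    have : (\sum_(0 <= k < n) (w k x)%:E)%E @[n --> \oo] --> (fine (S x))%:E.
      by rewrite fineK ?Sfin//; exact: h.
    move/fine_cvg.
    rewrite (_ : fine \o _ = [normed series (fun n => u_ n.+1 x - u_ n x)])//.
    by apply/funext => n; rewrite /= sumEFin.
  have := normed_cvg wcvg => /cvg_ex[l hl]; apply/cvg_ex; exists (l + u_ 0%N x).
  have -> : u_ ^~ x = fun n => series (fun n => u_ n.+1 x - u_ n x) n + u_ 0%N x.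
    by apply/funext => n; rewrite /series/= telescope_sumr// subrK.
  by apply: cvgD => //; exact: cvg_cst.
(* Cutting off on the null set [N] yields convergence at every point, as [borel_fun_lim]
   requires. *)
pose v n x : H := (\1_(~` N) x : R) *: u_ n x.
pose u x : H := if x \in N then 0 else limn (u_ ^~ x).
have vE n x : ~ N x -> v n x = u_ n x.
  by move=> Nx; rewrite /v indicE mem_set// scale1r.
have vN n x : N x -> v n x = 0.
  by move=> Nx; rewrite /v indicE memNset ?scale0r//= => h; exact: h.
have vu x : v n x @[n --> \oo] --> u x.
  rewrite /u; case: ifPn => [/set_mem Nx|/negP Nx].
    by under eq_fun do rewrite vN//; exact: cvg_cst.
  have {}Nx : ~ N x by move=> h; apply: Nx; exact: mem_set.
  by under eq_fun do rewrite vE//; exact: ucvg.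
have bv n : borel_fun (v n).
  apply: (borel_fun_scale he); last by have [] := uL n.
  by apply: measurable_indic; exact: measurableC.
have bu : borel_fun u by exact: (borel_fun_lim he bv vu).
have dist n x : ~ N x -> `|u_ n x - u x| <= fine (S x).
  move=> Nx; have cu := ucvg x Nx.
  have -> : u x = limn (u_ ^~ x) by rewrite /u memNset.
  have cn : `|u_ n x - u_ (n + m)%N x| @[m --> \oo] --> `|u_ n x - limn (u_ ^~ x)|.
    apply: cvg_norm; apply: cvgB; first exact: cvg_cst.
    exact: (@cvg_comp _ _ _ (addn n) (u_ ^~ x) _ _ _ (cvg_addnl n) cu).
  rewrite -(cvg_lim _ cn)//; apply: limr_le; first by apply/cvg_ex; eexists; exact: cn.
  by apply: nearW => m; rewrite distrC (le_trans (tele _ _ _))// partial.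
have aeN : {ae mu, forall x, ~ N x}.
  by exists N; split => // x /= /contrapT.
have bd n : borel_fun (fun x => -1 *: u x + u_ n x).
  by apply: (borel_funZD he) => //; have [] := uL n.
have bdE n : (fun x => -1 *: u x + u_ n x) = (fun x => u_ n x - u x).
  by apply/funext => x; rewrite scaleN1r addrC.
have := @dominated_convergence _ X R mu setT measurableT
  (fun n x => (`|u_ n x - u x|)%:E) (cst 0%E) S.
case.
- move=> n; apply/measurable_EFinP; apply: borel_fun_norm.
  by have := bd n; rewrite bdE.
- exact: measurable_cst.
- apply: filterS aeN => x Nx _.
  apply/fine_cvgP; split; first exact: nearW.
  rewrite /comp /=; apply/norm_cvg0P.
  rewrite -(subrr (u x)); apply: cvgB; last exact: cvg_cst.
  by rewrite (_ : u_ ^~ x = v ^~ x) //; apply/funext => n; rewrite vE.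
- exact: iS'.
- apply: filterS aeN => x Nx n _ /=.
  by rewrite normr_id -(fineK (Sfin x Nx)) lee_fin dist.
move=> _ lim0 _; exists u.
  split => //.
  have [_ i0] := uL 0%N.
  have ui : ae_integrable mu setT (fun x => `|u x|).
    apply: (ae_integrable_le (mu := mu) (g := fun x => `|u_ 0%N x| + fine (S x))) => //.
    - by apply: measurable_ae_measurable; exact: borel_fun_norm.
    - apply: ae_integrableD => //; first exact: integrable_ae_integrable.
      exists (fine \o S); last by apply: nearW.
      apply/integrableP; split.
        by apply/measurable_EFinP; exact: measurableT_comp.
      apply: le_lt_trans iS; apply: ge0_ae_integral_le => //.
      by apply: filterS aeN => x Nx _ /=; rewrite ger0_norm ?fine_ge0// fineK ?Sfin.
    - apply: filterS aeN => x Nx _; rewrite normr_id -[X in `|X|](subrK (u_ 0%N x)) addrC.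
      by apply: le_trans (ler_normD _ _) _; rewrite lerD2l distrC dist.
  apply/integrableP; split; first by apply/measurable_EFinP; exact: borel_fun_norm.
  have [h /integrableP[_ hi] hE] := ui.
  apply: le_lt_trans hi; apply: ge0_ae_integral_le => //.
  by apply: filterS hE => x /(_ I) /= ->.
have : (\int[mu]_x `|u_ n x - u x|%:E)%E @[n --> \oo] --> 0%:E.
  move: lim0; rewrite (_ : (fun n => _) = fun n => (\int[mu]_x `|u_ n x - u x|%:E)%E)//.
  apply/funext => n; apply: eq_integral => x _.
  by rewrite /= ?sube0 ?subr0 ?oppr0 ?addr0 normr_id.
by move/fine_cvg.
Qed.

End L1H_complete.

(** * Cylindrical functions *)

Section partial_derivatives.
Context {R : realType} {n : nat}.
Implicit Types (f g : 'rV[R]_n -> R) (y z : 'rV[R]_n).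

Lemma along_line_derive f y (v : 'rV[R]_n) (t : R) : derivable f (y + t *: v) v ->
  is_derive t 1 (fun s : R => f (y + s *: v)) ('D_v f (y + t *: v)).
Proof.
move=> df.
have E : (fun h : R => h^-1 *: (((fun s : R => f (y + s *: v)) \o shift t) (h *: 1) -
    f (y + t *: v))) =
  (fun h : R => h^-1 *: ((f \o shift (y + t *: v)) (h *: v) - f (y + t *: v))).
  apply/funext => h; congr (_ *: (f _ - _)).
  by rewrite /= [h%:A]mulr1 scalerDl addrCA.
by split; [rewrite /derivable E|rewrite /derive E].
Qed.

Lemma mvt_zero (g dg : R -> R) (s : R) : (forall t : R, is_derive t 1 g (dg t)) ->
  exists2 xi, `|xi| <= `|s| & g s - g 0 = dg xi * s.
Proof.
move=> dg_; have cg : continuous g.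
  by move=> t; have D := dg_ t; apply/differentiable_continuous/derivable1_diffP/ex_derive.
have [s0|s0] := leP 0 s.
  have [xi] := MVT_segment s0 (fun x _ => dg_ x) (continuous_subspaceT cg).
  rewrite in_itv/= subr0 => /andP[x0 xs] E.
  by exists xi => //; rewrite !ger0_norm.
have [xi] := MVT_segment (ltW s0) (fun x _ => dg_ x) (continuous_subspaceT cg).
rewrite in_itv/= sub0r => /andP[x0 xs] E; exists xi.
  by rewrite !ler0_norm ?lerN2// ltW.
by rewrite -opprB E mulrN opprK.
Qed.

Lemma row_norm_le y (c : R) : 0 <= c -> (forall i, `|y 0 i| <= c) -> `|y| <= c.
Proof.
move=> c0 yc; rewrite /Num.norm/= mx_normrE.
by apply: bigmax_le => // -[i j] _; rewrite (ord1 i).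
Qed.

Lemma row_norm_coord y i : `|y 0 i| <= `|y|.
Proof.
rewrite [leRHS]/Num.norm/= mx_normrE.
exact: (le_bigmax _ (fun p : 'I_1 * 'I_n => `|y p.1 p.2|) (0, i)).
Qed.

(** Differentiability from continuous partial derivatives. The increment is split into moves along
    one coordinate at a time, through the truncations [tr m], and the mean value theorem is applied
    to each; the intermediate points stay in the ball because the norm is a maximum over
    coordinates. *)
Lemma continuous_partials_expansion f y :
  (forall i z, derivable f z (delta_mx 0 i)) ->
  (forall i, {for y, continuous ('D_(delta_mx 0 i) f)}) ->
  forall eps : R, 0 < eps -> exists2 d : R, 0 < d & forall k, `|k| < d ->
    `|f (k + y) - f y - \sum_(i < n) 'D_(delta_mx 0 i) f y * k 0 i| <= eps * `|k|.
Proof.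
move=> df cf eps eps0.
(* The [n] coordinate errors must sum to at most [eps]; the successor covers [n = 0]. *)
pose ep := eps / n.+1%:R.
have ep0 : 0 < ep by rewrite divr_gt0.
have : \forall z \near y, forall i,
    `|'D_(delta_mx 0 i) f y - 'D_(delta_mx 0 i) f z| <= ep.
  apply: (@filter_forall _ _ (fun (i : 'I_n) z =>
    `|'D_(delta_mx 0 i) f y - 'D_(delta_mx 0 i) f z| <= ep) (nbhs y) _) => i.
  by have /cvgrPdist_le/(_ _ ep0) := cf i.
move=> /nbhs_ballP[d /= d0 dP]; exists d => // k kd.
pose tr m : 'rV[R]_n := \row_i (if (i < m)%N then k 0 i else 0).
have tr0 : tr 0%N = 0 by apply/rowP => i; rewrite !mxE.
have trn : tr n = k by apply/rowP => i; rewrite !mxE ltn_ord.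
have trS (m : 'I_n) : tr m.+1 = tr m + k 0 m *: delta_mx 0 m.
  apply/rowP => i; rewrite !mxE eqxx/= ltnS leq_eqVlt.
  have [->|im] := eqVneq i m; first by rewrite eqxx ltnn add0r mulr1.
  by rewrite (inj_eq val_inj) (negbTE im)/= mulr0 addr0.
have -> : f (k + y) - f y = \sum_(m < n) (f (y + tr m.+1) - f (y + tr m)).
  rewrite -(big_mkord xpredT (fun m => f (y + tr m.+1) - f (y + tr m))).
  by rewrite telescope_sumr// trn tr0 addr0 [y + k]addrC.
rewrite -sumrB; apply: le_trans (ler_norm_sum _ _ _) _.
apply: (@le_trans _ _ (\sum_(i < n) ep * `|k|)).
  apply: ler_sum => m _.
  have [xi xik E] := mvt_zero (k 0 m)
    (fun t => along_line_derive (df m (y + tr m + t *: delta_mx 0 m))).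
  rewrite trS addrA.
  move: E; rewrite scale0r addr0 => ->; rewrite -mulrBl normrM.
  suff bz : ball y d (y + tr m + xi *: delta_mx 0 m).
    by apply: ler_pM => //; [rewrite distrC; exact: dP|exact: row_norm_coord].
  rewrite -ball_normE /ball_/=.
  rewrite -addrA opprD addrA subrr add0r normrN; apply: le_lt_trans kd.
  apply: row_norm_le => // i; rewrite !mxE eqxx/=.
  have [->|im] := eqVneq i m.
    by rewrite ltnn add0r mulr1 (le_trans xik)// row_norm_coord.
  rewrite mulr0 addr0; case: ifP => _; first exact: row_norm_coord.
  by rewrite normr0.
rewrite sumr_const card_ord -[_ *+ n]mulr_natr mulrAC ler_wpM2r//.
rewrite -[leRHS](@divfK _ n.+1%:R)// ler_wpM2l ?ler_nat//.
by rewrite divr_ge0 ?ler0n// ltW.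
Qed.

Lemma CbW k f : Cb k.+1 f -> Cb k f.
Proof.
elim: k f => [|k IH] f; first by move=> [cf bf _].
by move=> [cf bf df]; split => // i; have [d1 d2] := df i; split => //; exact: IH.
Qed.

Lemma Cb_continuous k f : Cb k f -> continuous f.
Proof. by case: k => [|k] []. Qed.

Lemma Cb_bounded k f : Cb k f -> exists M : R, forall x, `|f x| <= M.
Proof. by case: k => [|k] []. Qed.

Lemma is_derive_D f y v : derivable f y v -> is_derive y v f ('D_v f y).
Proof. by move=> df; exact: DeriveDef. Qed.

Lemma derive_ZD (a : R) f g y v : derivable f y v -> derivable g y v ->
  is_derive y v (fun z => a * f z + g z) (a * 'D_v f y + 'D_v g y).
Proof.
move=> df dg.
exact: (is_deriveD (is_deriveZ a (is_derive_D df)) (is_derive_D dg)).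
Qed.

Lemma derive_M f g y v : derivable f y v -> derivable g y v ->
  is_derive y v (fun z => f z * g z) (f y * 'D_v g y + g y * 'D_v f y).
Proof. by move=> df dg; exact: (is_deriveM (is_derive_D df) (is_derive_D dg)). Qed.

Lemma CbS k f : Cb k.+1 f <-> [/\ continuous f, exists M : R, forall x, `|f x| <= M &
  forall i : 'I_n, (forall x, derivable f x (delta_mx 0 i)) /\
    Cb k (fun x => 'D_(delta_mx 0 i) f x)].
Proof. by []. Qed.

Lemma continuous_ZD (a : R) f g : continuous f -> continuous g ->
  continuous (fun z => a * f z + g z).
Proof.
move=> cf cg z; apply: (@continuousD _ _ _ (fun z => a * f z)); last exact: cg.
by apply: (@continuousM _ _ (cst a)); [exact: cst_continuous|exact: cf].
Qed.

Lemma bounded_ZD (a : R) f g : (exists M : R, forall x, `|f x| <= M) ->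
  (exists M : R, forall x, `|g x| <= M) ->
  exists M : R, forall x, `|a * f x + g x| <= M.
Proof.
move=> [M fM] [N gN]; exists (`|a| * M + N) => z; apply: le_trans (ler_normD _ _) _.
by rewrite normrM lerD// ler_wpM2l.
Qed.

Lemma Cb_ZD k (a : R) f g : Cb k f -> Cb k g -> Cb k (fun z => a * f z + g z).
Proof.
elim: k f g => [|k IH] f g.
  by move=> [cf bf _] [cg bg _]; split; [exact: continuous_ZD|exact: bounded_ZD|].
move=> /CbS[cf bf df] /CbS[cg bg dg]; apply/CbS; split.
- exact: continuous_ZD.
- exact: bounded_ZD.
- move=> i; have [df1 df2] := df i; have [dg1 dg2] := dg i; split.
    by move=> x; have D := derive_ZD a (df1 x) (dg1 x); exact: ex_derive.
  rewrite (_ : (fun x => _) = fun x => a * 'D_(delta_mx 0 i) f x + 'D_(delta_mx 0 i) g x).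
    exact: IH.
  by apply/funext => x; have D := derive_ZD a (df1 x) (dg1 x); rewrite derive_val.
Qed.

Lemma Cb_M k f g : Cb k f -> Cb k g -> Cb k (fun z => f z * g z).
Proof.
have cM (h1 h2 : 'rV[R]_n -> R) : continuous h1 -> continuous h2 -> continuous (fun z : 'rV[R]_n => h1 z * h2 z : R).
  by move=> c1 c2 z; apply: (@continuousM _ _ h1 h2); [exact: c1|exact: c2].
have bM (h1 h2 : 'rV[R]_n -> R) : (exists M : R, forall x, `|h1 x| <= M) ->
    (exists M : R, forall x, `|h2 x| <= M) -> exists M : R, forall x, `|h1 x * h2 x| <= M.
  move=> [M fM] [N gN]; exists (M * N) => z; rewrite normrM; exact: ler_pM.
elim: k f g => [|k IH] f g.
  by move=> [cf bf _] [cg bg _]; split; [exact: cM|exact: bM|].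
move=> Cf Cg; have /CbS[cf bf df] := Cf; have /CbS[cg bg dg] := Cg; apply/CbS; split.
- exact: cM.
- exact: bM.
- move=> i; have [df1 df2] := df i; have [dg1 dg2] := dg i; split.
    by move=> x; have D := derive_M (df1 x) (dg1 x); exact: ex_derive.
  rewrite (_ : (fun x => _) = fun x => 1 * (f x * 'D_(delta_mx 0 i) g x) +
      g x * 'D_(delta_mx 0 i) f x).
    by apply: Cb_ZD; apply: IH => //; exact: CbW.
  by apply/funext => x; have D := derive_M (df1 x) (dg1 x); rewrite derive_val mul1r.
Qed.

Lemma Cb_cst k (c : R) : Cb k (fun _ : 'rV[R]_n => c).
Proof.
elim: k c => [|k IH] c; first by split => //; [exact: cst_continuous|exists (Num.norm c)].
apply/CbS; split; [exact: cst_continuous|by exists (Num.norm c)|] => i; split.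
  by move=> x; exact: derivable_cst.
have -> : (fun x => 'D_(delta_mx 0 i) (fun _ : 'rV[R]_n => c) x) = fun=> 0.
  by apply/funext => x; rewrite derive_val.
exact: IH.
Qed.

End partial_derivatives.

Section restrict_coordinates.
Context {R : realType} {n N : nat}.
Hypothesis nN : (n <= N)%N.

(** Composition with this projection lets a function of [n] coordinates be read as one of [N]
    coordinates, so that two cylindrical functions can share their arguments. *)
Definition rcoord (z : 'rV[R]_N) : 'rV[R]_n := \row_i z 0 (widen_ord nN i).

Lemma rcoordZD (a : R) y z : rcoord (a *: y + z) = a *: rcoord y + rcoord z.
Proof. by apply/rowP => i; rewrite !mxE. Qed.

Lemma rcoordB y z : rcoord (y - z) = rcoord y - rcoord z.
Proof. by apply/rowP => i; rewrite !mxE. Qed.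

Lemma rcoord_continuous : continuous rcoord.
Proof.
move=> y; apply/(@cvgrPdist_le _ _ _ (nbhs y) (nbhs_filter y)) => eps eps0.
apply/nbhs_ballP; exists eps => //= z.
rewrite -ball_normE /ball_/= => /ltW yz.
rewrite -rcoordB; apply: row_norm_le; first exact: ltW.
by move=> i; rewrite mxE; apply: le_trans (row_norm_coord _ _) yz.
Qed.

Lemma derive_rcoord (f : 'rV[R]_n -> R) y (v : 'rV[R]_N) :
  derivable f (rcoord y) (rcoord v) ->
  is_derive y v (fun z => f (rcoord z)) ('D_(rcoord v) f (rcoord y)).
Proof.
move=> df.
have E : (fun h : R => h^-1 *: (((fun z => f (rcoord z)) \o shift y) (h *: v) -
    f (rcoord y))) =
  (fun h : R => h^-1 *: ((f \o shift (rcoord y)) (h *: rcoord v) - f (rcoord y))).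
  by apply/funext => h; rewrite /= rcoordZD.
by split; [rewrite /derivable E|rewrite /derive E].
Qed.

Lemma rcoord_delta (i : 'I_N) : rcoord (delta_mx 0 i) =
  if insub (i : nat) is Some j then delta_mx 0 (j : 'I_n) else 0.
Proof.
case: insubP => [j jn ji|].
  by apply/rowP => l; rewrite !mxE/= -(inj_eq val_inj) /= -ji.
rewrite -leqNgt => ni; apply/rowP => l; rewrite !mxE/= -(inj_eq val_inj)/=.
by rewrite ltn_eqF// (leq_trans (ltn_ord l)).
Qed.

(** The derivative in a retained coordinate is again of this composed form, and the derivative in a
    dropped coordinate is 0. *)
Lemma Cb_rcoord k (f : 'rV[R]_n -> R) : Cb k f -> Cb k (fun z => f (rcoord z)).
Proof.
elim: k f => [|k IH] f.
  move=> [cf [M fM] _]; split => //; last by exists M.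
  by move=> z; apply: (continuous_comp (@rcoord_continuous z)); exact: cf.
move=> /CbS[cf [M fM] df]; apply/CbS; split.
- by move=> z; apply: (continuous_comp (@rcoord_continuous z)); exact: cf.
- by exists M.
move=> i; have D y : is_derive y (delta_mx 0 i) (fun z => f (rcoord z))
    ('D_(rcoord (delta_mx 0 i)) f (rcoord y)).
  apply: derive_rcoord; rewrite rcoord_delta; case: insubP => [j _ _|_]; last exact: derivable0.
  by have [] := df j.
split; first by move=> x; have Dx := D x; exact: ex_derive.
have -> : (fun x => 'D_(delta_mx 0 i) (fun z => f (rcoord z)) x) =
    fun x => 'D_(rcoord (delta_mx 0 i)) f (rcoord x).
  by apply/funext => x; have Dx := D x; rewrite derive_val.
rewrite rcoord_delta; case: insubP => [j _ _|_].
  by have [_ ?] := df j; exact: (IH (fun x => 'D_(delta_mx 0 j) f x)).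
have -> : (fun x => 'D_0 f (rcoord x)) = fun=> 0.
  by apply/funext => x; rewrite derive0.
exact: Cb_cst.
Qed.

End restrict_coordinates.

Section cylindrical.
Context {R : realType} {H : hilbertType R}.
Variable e : nat -> H.
Hypothesis he : is_orthonormal_basis e.
Implicit Types (x h v : H).

Lemma diff_of_expansion (V W : normedModType R) (g : V -> W) (L : {linear V -> W}) (x : V) :
  continuous L ->
  (forall eps : R, 0 < eps -> exists2 d : R, 0 < d & forall h : V, `|h| < d ->
    `|g (h + x) - g x - L h| <= eps * `|h|) ->
  'd g x = L :> (V -> W).
Proof.
move=> cL ex; apply: diff_unique => //; apply/eqaddoP => _/posnumP[eps].
have [d d0 dP] := ex _ [gt0 of eps%:num].
apply/nbhs_ballP; exists d => //= h; rewrite -ball_normE /ball_/= sub0r normrN => hd.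
by have := dP h hd; rewrite /= opprD addrA.
Qed.

Definition ip_right v h : R := ip h v.

Lemma ip_right_is_linear v : linear (ip_right v : H -> R^o).
Proof. by move=> a x y; rewrite /ip_right ipDl ipZl. Qed.

HB.instance Definition _ v := GRing.isLinear.Build R H R^o _ (ip_right v)
  (ip_right_is_linear v).

(** The finite-rank operator with matrix [a] on the first [n] basis vectors; for the matrix of
    second partials it is the second derivative of a cylindrical function. *)
Definition coord_map n (a : 'I_n -> 'I_n -> R) h : H :=
  \sum_(i < n) (\sum_(j < n) a j i * ip h (e j)) *: e i.

Lemma coord_map_is_linear n (a : 'I_n -> 'I_n -> R) : linear (coord_map a).
Proof.
move=> c x y; rewrite /coord_map scaler_sumr -big_split/=; apply: eq_bigr => i _.
rewrite scalerA -scalerDl mulr_sumr -big_split/=; congr (_ *: _).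
by apply: eq_bigr => j _; rewrite ipDl ipZl; ring.
Qed.

HB.instance Definition _ n (a : 'I_n -> 'I_n -> R) := GRing.isLinear.Build R H H _
  (coord_map a) (coord_map_is_linear a).

Lemma basis_norm i : `|e i| = 1.
Proof. by apply/eqP; rewrite -sqrp_eq1// -ip_sqr_norm he.1 eqxx. Qed.

Lemma ip_basis_le h i : `|ip h (e i)| <= `|h|.
Proof. by have := ip_norm_le h (e i); rewrite basis_norm mulr1. Qed.

Lemma bounded_linear_continuous (V W : normedModType R) (L : {linear V -> W}) (C : R) :
  (forall h : V, `|L h| <= C * `|h|) -> continuous L.
Proof.
move=> LC; have C1 : 0 < `|C| + 1 by rewrite ltr_wpDl.
move=> x; apply/(@cvgrPdist_le _ _ _ (nbhs x) (nbhs_filter x)) => eps eps0.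
apply/nbhs_ballP; exists (eps / (`|C| + 1)) => /=; first exact: divr_gt0.
move=> y; rewrite -ball_normE /ball_/= => /ltW; rewrite ler_pdivlMr// => xy.
rewrite -linearB; apply: le_trans (LC _) _; apply: le_trans _ xy.
rewrite mulrC ler_wpM2l//; apply: le_trans (ler_norm _) _.
by rewrite lerDl.
Qed.

Lemma coord_map_continuous n (a : 'I_n -> 'I_n -> R) : continuous (coord_map a).
Proof.
apply: (@bounded_linear_continuous _ _ (coord_map a)
  (\sum_(i < n) \sum_(j < n) `|a j i|)) => h.
apply: le_trans (ler_norm_sum _ _ _) _; rewrite mulr_suml; apply: ler_sum => i _.
rewrite normrZ basis_norm mulr1; apply: le_trans (ler_norm_sum _ _ _) _.
rewrite mulr_suml; apply: ler_sum => j _; rewrite normrM ler_wpM2l//.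
exact: ip_basis_le.
Qed.

Definition coords n x : 'rV[R]_n := \row_(i < n) ip x (e i).

Lemma coordsD n x y : coords n (x + y) = coords n x + coords n y.
Proof. by apply/rowP => i; rewrite !mxE ipDl. Qed.

Lemma coordsB n x y : coords n (x - y) = coords n x - coords n y.
Proof. by apply/rowP => i; rewrite !mxE ipBl. Qed.

Lemma proj_norm_le n x : `|coords n x| <= `|x|.
Proof. by apply: row_norm_le => // i; rewrite mxE ip_basis_le. Qed.

Lemma coords_continuous n : continuous (coords n).
Proof.
move=> y; apply/(@cvgrPdist_le _ _ _ (nbhs y) (nbhs_filter y)) => eps eps0.
apply/nbhs_ballP; exists eps => //= z; rewrite -ball_normE /ball_/= => /ltW yz.
by rewrite -coordsB (le_trans (proj_norm_le _ _)).
Qed.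

Definition pd n (i : 'I_n) (f : 'rV[R]_n -> R) : 'rV[R]_n -> R := 'D_(delta_mx 0 i) f.

Lemma FCb_expansion n f x : @Cb R 1 n f -> forall eps : R, 0 < eps ->
  exists2 d : R, 0 < d & forall h, `|h| < d ->
  `|f (coords n (h + x)) - f (coords n x) - \sum_(i < n) pd i f (coords n x) * ip h (e i)|
    <= eps * `|h|.
Proof.
move=> /CbS[cf _ df] eps eps0.
have [i z|i|] := @continuous_partials_expansion _ _ f (coords n x) _ _ eps eps0.
- by have [] := df i.
- by have [_ /Cb_continuous c] := df i; exact: c.
move=> d d0 dP; exists d => // h hd.
have := dP (coords n h) (le_lt_trans (proj_norm_le _ _) hd).
rewrite -coordsD (eq_bigr (fun i => pd i f (coords n x) * ip h (e i))); last first.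
  by move=> i _; rewrite mxE.
by move=> /le_trans; apply; rewrite ler_wpM2l ?proj_norm_le// ltW.
Qed.

Lemma diff_FCb n f x h : @Cb R 1 n f ->
  'd (fun x => f (coords n x)) x h = \sum_(i < n) pd i f (coords n x) * ip h (e i).
Proof.
move=> Cf; pose v := \sum_(i < n) pd i f (coords n x) *: e i.
have vE k : ip_right v k = \sum_(i < n) pd i f (coords n x) * ip k (e i).
  by rewrite /ip_right ip_sumr; apply: eq_bigr => i _; rewrite ipZr.
rewrite -vE; congr (_ h).
apply: (@diff_of_expansion H R^o _ (ip_right v)).
  exact: ip_continuousl.
move=> eps eps0; have [d d0 dP] := FCb_expansion x Cf eps0.
by exists d => // k kd; have := dP k kd; rewrite -vE.
Qed.

(** The explicit vector represents the differential, and nondegeneracy of the inner product forces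
    the one selected by [get] to equal it. *)
Lemma gradient_FCb n f x : @Cb R 1 n f ->
  gradient (fun x => f (coords n x)) x = \sum_(i < n) pd i f (coords n x) *: e i.
Proof.
move=> Cf; rewrite /gradient; set v := \sum_(i < n) _.
have vP h : 'd (fun x => f (coords n x)) x h = ip v h.
  by rewrite diff_FCb// ip_suml; apply: eq_bigr => i _; rewrite ipZl [ip (e i) _]ipC.
have ex : exists w, [set v | forall h, 'd (fun x => f (coords n x)) x h = ip v h] w.
  by exists v.
have wP := getPex ex; set w := get _ in wP *.
apply/eqP; rewrite -subr_eq0 -normr_eq0 -sqrf_eq0 -ip_sqr_norm ipBl.
by rewrite -wP vP subrr.
Qed.

Lemma hessian_FCb n f x h : @Cb R 2 n f ->
  hessian (fun x => f (coords n x)) x h =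
  coord_map (fun j i => pd j (pd i f) (coords n x)) h.
Proof.
move=> Cf; have /CbS[_ _ df] := Cf.
rewrite /hessian; congr (_ h).
apply: (@diff_of_expansion H H _ (coord_map (fun j i => pd j (pd i f) (coords n x)))).
  exact: coord_map_continuous.
move=> eps eps0; have eps1 : 0 < eps / n.+1%:R by rewrite divr_gt0.
have [d dP] : {d : 'I_n -> R & forall i, 0 < d i /\ forall h, `|h| < d i ->
  `|pd i f (coords n (h + x)) - pd i f (coords n x) -
    \sum_(j < n) pd j (pd i f) (coords n x) * ip h (e j)| <= eps / n.+1%:R * `|h|}.
  apply: (@choice _ _ (fun i (d : R) => 0 < d /\ forall h, `|h| < d ->
  `|pd i f (coords n (h + x)) - pd i f (coords n x) -
    \sum_(j < n) pd j (pd i f) (coords n x) * ip h (e j)| <= eps / n.+1%:R * `|h|)) => i.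
  have [_ Cdf] := df i; have [d d0 dP] := FCb_expansion x Cdf eps1.
  by exists d.
exists (\big[Num.min/1]_(i < n) d i).
  by elim/big_ind : _ => //= [a b a0 b0|i _]; [rewrite lt_min a0|have [] := dP i].
move=> k kd.
have kdi i : `|k| < d i.
  by apply: lt_le_trans kd _; exact: bigmin_le_cond.
rewrite !gradient_FCb; [|exact: CbW|exact: CbW].
rewrite /coord_map -!sumrB; apply: le_trans (ler_norm_sum _ _ _) _.
apply: (@le_trans _ _ (\sum_(i < n) eps / n.+1%:R * `|k|)).
  apply: ler_sum => i _; rewrite -!scalerBl normrZ basis_norm mulr1.
  by have [_] := dP i; apply.
rewrite sumr_const card_ord -[_ *+ n]mulr_natr mulrAC ler_wpM2r//.
rewrite -[leRHS](@divfK _ n.+1%:R)// ler_wpM2l ?ler_nat//.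
by rewrite divr_ge0 ?ler0n// ltW.
Qed.

Lemma FCbE k (phi : H -> R) : FCb e k phi <->
  exists n (f : 'rV[R]_n -> R), Cb k f /\ phi = fun x => f (coords n x).
Proof. by []. Qed.

Lemma proj_rcoord n N (nN : (n <= N)%N) x : rcoord nN (coords N x) = coords n x.
Proof. by apply/rowP => i; rewrite !mxE. Qed.

(** Both are composed with the projections from the larger number of coordinates. Sums and products
    of cylindrical functions rest on this. *)
Lemma FCb_common k (phi psi : H -> R) : FCb e k phi -> FCb e k psi ->
  exists n (f g : 'rV[R]_n -> R), [/\ Cb k f, Cb k g,
    phi = (fun x => f (coords n x)) & psi = fun x => g (coords n x)].
Proof.
move=> /FCbE[n [f [Cf ->]]] /FCbE[m [g [Cg ->]]].
exists (maxn n m), (fun z => f (rcoord (leq_maxl n m) z)),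
  (fun z => g (rcoord (leq_maxr n m) z)); split.
- exact: Cb_rcoord.
- exact: Cb_rcoord.
- by apply/funext => x; rewrite proj_rcoord.
- by apply/funext => x; rewrite proj_rcoord.
Qed.

Lemma FCbW k phi : FCb e k.+1 phi -> FCb e k phi.
Proof. by move=> [n [f [Cf ->]]]; exists n, f; split => //; exact: CbW. Qed.

Lemma FCb_ZD k (a : R) phi psi : FCb e k phi -> FCb e k psi ->
  FCb e k (fun x => a * phi x + psi x).
Proof.
move=> Fphi Fpsi; have [n [f [g [Cf Cg -> ->]]]] := FCb_common Fphi Fpsi.
by exists n, (fun z => a * f z + g z); split => //; exact: Cb_ZD.
Qed.

Lemma FCb_M k phi psi : FCb e k phi -> FCb e k psi ->
  FCb e k (fun x => phi x * psi x).
Proof.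
move=> Fphi Fpsi; have [n [f [g [Cf Cg -> ->]]]] := FCb_common Fphi Fpsi.
by exists n, (fun z => f z * g z); split => //; exact: Cb_M.
Qed.

Lemma FCb_cst k (c : R) : FCb e k (fun=> c).
Proof. by exists 0%N, (fun=> c); split => //; exact: Cb_cst. Qed.

Lemma FCb_continuous k phi : FCb e k phi -> continuous phi.
Proof.
move=> [n [f [Cf ->]]] x.
apply: (@continuous_comp _ _ _ (coords n) f); first exact: coords_continuous.
exact: (Cb_continuous Cf).
Qed.

Lemma FCb_bounded k phi : FCb e k phi -> exists M : R, forall x, `|phi x| <= M.
Proof. by move=> [n [f [/Cb_bounded[M fM] ->]]]; exists M. Qed.

Lemma gradient_ZD (a : R) phi psi x : FCb e 1 phi -> FCb e 1 psi ->
  gradient (fun x => a * phi x + psi x) x = a *: gradient phi x + gradient psi x.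
Proof.
move=> Fphi Fpsi; have [n [f [g [Cf Cg -> ->]]]] := FCb_common Fphi Fpsi.
have Ch := Cb_ZD a Cf Cg.
rewrite (gradient_FCb x Ch) !gradient_FCb// scaler_sumr -big_split/=.
apply: eq_bigr => i _; rewrite scalerA -scalerDl; congr (_ *: _).
have /CbS[_ _ df] := Cf; have /CbS[_ _ dg] := Cg.
have D := derive_ZD a ((df i).1 (coords n x)) ((dg i).1 (coords n x)).
by rewrite /pd derive_val.
Qed.

(** * The second-order operator on cylindrical functions and its product rule *)

Section carre_du_champ.
Variables (Q Qh : {linear H -> H}) (q : nat -> R) (DAt : set H) (At F : H -> H).
Hypotheses (hQ : bounded_sa_positive Q) (hQh : is_sqrt_op Q Qh).
Hypothesis hQe : forall i, Q (e i) = q i *: e i.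
Hypotheses (At_lin : linear_on DAt At) (eDAt : forall i, DAt (e i)).

(** [Q] is diagonal in the basis and [coord_map] has its range in the span of the first [n] vectors,
    so the partial sums are constant from index [n] on. *)
Lemma trace_coord_map n (a : 'I_n -> 'I_n -> R) (S : H -> H) :
  (forall h, S h = Q (coord_map a h)) ->
  trace e S = \sum_(i < n) q i * a i i.
Proof.
move=> SE; have [_ Qsa _] := hQ.
pose b (i : nat) : R := if insub i is Some j then q i * a (j : 'I_n) j else 0.
have tE i : ip (S (e i)) (e i) = b i.
  rewrite SE Qsa hQe ipZr /coord_map ip_suml /b.
  case: insubP => [j _ ji|].
    rewrite (bigD1 j)//= [X in _ + X]big1 ?addr0; last first.
      by move=> l lj; rewrite ipZl he.1 -ji (inj_eq val_inj) (negbTE lj) mulr0.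
    rewrite ipZl he.1 ji eqxx mulr1 (bigD1 j)//= big1 ?addr0; last first.
      by move=> l lj; rewrite he.1 -ji eq_sym (inj_eq val_inj) (negbTE lj) mulr0.
    by rewrite he.1 ji eqxx mulr1.
  rewrite -leqNgt => ni; rewrite big1 ?mulr0// => l _.
  by rewrite ipZl he.1 ltn_eqF ?mulr0// (leq_trans (ltn_ord l)).
rewrite /trace; suff lim : series (fun i => ip (S (e i)) (e i)) @ \oo -->
    \sum_(i < n) q i * a i i by exact: (cvg_lim _ lim).
apply: cvg_near_cst; exists n => // m /= nm.
rewrite /series/=; under eq_bigr do rewrite tE.
rewrite (@big_cat_nat _ _ _ n)//= [X in _ + X]big1_seq ?addr0; last first.
  move=> i /=; rewrite mem_index_iota => /andP[ni _]; rewrite /b.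
  by case: insubP => // j; rewrite ltnNge ni.
rewrite big_mkord; apply: eq_bigr => i _; rewrite /b.
by case: insubP => [j _ /val_inj ->//|]; rewrite ltn_ord.
Qed.

Lemma At_sum n (c : 'I_n -> R) :
  DAt (\sum_(i < n) c i *: e i) /\
  At (\sum_(i < n) c i *: e i) = \sum_(i < n) c i *: At (e i).
Proof.
have [D0 lin] := At_lin.
have At0 : At 0 = 0.
  have [_] := lin (-1) 0 0 D0 D0; rewrite scaler0 addr0 scaleN1r addrC subrr.
  by [].
elim: n c => [|n IH] c; first by rewrite !big_ord0.
rewrite !big_ord_recr/= ![_ + c ord_max *: _]addrC.
have [D1 A1] := IH (fun i => c (widen_ord (leqnSn n) i)).
have [D2 A2] := lin (c ord_max) (e n) _ (eDAt n) D1.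
by rewrite A2 -A1.
Qed.

Lemma N0_FCb n f x : @Cb R 2 n f -> N0 e Q At F (fun x => f (coords n x)) x =
  2^-1 * (\sum_(i < n) q i * pd i (pd i f) (coords n x)) +
  \sum_(i < n) pd i f (coords n x) * (ip x (At (e i)) + ip (F x) (e i)).
Proof.
move=> Cf; rewrite /N0; congr (_ * _ + _).
  rewrite (@trace_coord_map n (fun j i => pd j (pd i f) (coords n x)))// => h.
  by rewrite hessian_FCb.
rewrite /A_pairing gradient_FCb; last exact: CbW.
rewrite (At_sum _).2 !ip_sumr -big_split/=; apply: eq_bigr => i _.
by rewrite !ipZr mulrDr.
Qed.

(** Self-adjointness moves both square roots to one side, where they compose to the diagonal [Q]. *)
Lemma sqrtQ_gradient_ip n f g x : @Cb R 1 n f -> @Cb R 1 n g ->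
  ip (Qh (gradient (fun x => f (coords n x)) x)) (Qh (gradient (fun x => g (coords n x)) x)) =
  \sum_(i < n) q i * (pd i f (coords n x) * pd i g (coords n x)).
Proof.
move=> Cf Cg; have [[_ Qhsa _] QhQ] := hQh.
rewrite -Qhsa QhQ !gradient_FCb// linear_sum ip_suml; apply: eq_bigr => i _.
rewrite linearZ hQe ip_sumr (bigD1 i)//= [X in _ + X]big1 ?addr0; last first.
  by move=> j ji; rewrite !ipZl ipZr he.1 eq_sym (inj_eq val_inj) (negbTE ji) !mulr0.
by rewrite !ipZl ipZr he.1 eqxx mulr1; ring.
Qed.

Lemma pd_M n (i : 'I_n) (f g : 'rV[R]_n -> R) z :
  derivable f z (delta_mx 0 i) -> derivable g z (delta_mx 0 i) ->
  pd i (fun z => f z * g z) z = f z * pd i g z + g z * pd i f z.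
Proof. by move=> df dg; have D := derive_M df dg; rewrite [LHS]derive_val. Qed.

Lemma pd_D n (i : 'I_n) (f g : 'rV[R]_n -> R) z :
  derivable f z (delta_mx 0 i) -> derivable g z (delta_mx 0 i) ->
  pd i (fun z => 1 * f z + g z) z = pd i f z + pd i g z.
Proof. by move=> df dg; have D := derive_ZD 1 df dg; rewrite [LHS]derive_val mul1r. Qed.

(** The Leibniz rule at the level of sums: [c] and [d] are derivatives of the two factors. The mixed
    term occurs twice in the second derivatives, which cancels the factor [2^-1]. *)
Lemma product_sums n (w s c1 c2 d1 d2 p1 p2 : 'I_n -> R) (a b : R) :
  (forall i, p1 i = a * d1 i + b * c1 i) ->
  (forall i, p2 i = a * d2 i + d1 i * c1 i + (b * c2 i + c1 i * d1 i)) ->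
  2^-1 * (\sum_(i < n) w i * p2 i) + \sum_(i < n) p1 i * s i =
  a * (2^-1 * (\sum_(i < n) w i * d2 i) + \sum_(i < n) d1 i * s i) +
  b * (2^-1 * (\sum_(i < n) w i * c2 i) + \sum_(i < n) c1 i * s i) +
  \sum_(i < n) w i * (c1 i * d1 i).
Proof.
move=> h1 h2.
rewrite (eq_bigr (fun i => a * (w i * d2 i) + (2 * (w i * (c1 i * d1 i)) +
  b * (w i * c2 i)))); last by move=> i _; rewrite h2; ring.
rewrite [X in _ + X = _](eq_bigr (fun i => a * (d1 i * s i) + b * (c1 i * s i)));
  last by move=> i _; rewrite h1; ring.
by rewrite !big_split/= -!mulr_sumr; field.
Qed.

(** The carre du champ identity: the first-order part is a derivation, so only the mixed
    second-order term survives. *)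
Lemma N0_product phi psi x : FCb e 2 phi -> FCb e 2 psi ->
  N0 e Q At F (fun x => phi x * psi x) x =
  phi x * N0 e Q At F psi x + psi x * N0 e Q At F phi x +
  ip (Qh (gradient phi x)) (Qh (gradient psi x)).
Proof.
move=> Fphi Fpsi; have [n [f [g [Cf Cg -> ->]]]] := FCb_common Fphi Fpsi.
rewrite (sqrtQ_gradient_ip _ (CbW Cf) (CbW Cg)).
rewrite (@N0_FCb n (fun z => f z * g z) x (Cb_M Cf Cg)) (N0_FCb x Cf) (N0_FCb x Cg).
have /CbS[_ _ df] := Cf; have /CbS[_ _ dg] := Cg.
apply: product_sums => i; first exact: (pd_M ((df i).1 _) ((dg i).1 _)).
have -> : pd i (fun z => f z * g z) = fun z => 1 * (f z * pd i g z) + g z * pd i f z.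
  apply/funext => z; rewrite mul1r; exact: (pd_M ((df i).1 _) ((dg i).1 _)).
have /CbS[_ _ ddf] := (df i).2; have /CbS[_ _ ddg] := (dg i).2.
have E1 := derive_M ((df i).1 (coords n x)) ((ddg i).1 (coords n x)).
have E2 := derive_M ((dg i).1 (coords n x)) ((ddf i).1 (coords n x)).
rewrite (pd_D (@ex_derive _ _ _ _ _ _ _ E1) (@ex_derive _ _ _ _ _ _ _ E2)).
by rewrite (pd_M ((df i).1 _) ((ddg i).1 _)) (pd_M ((dg i).1 _) ((ddf i).1 _)).
Qed.

End carre_du_champ.

End cylindrical.

(** * The completion of [nu] *)

Section completed_measure.
Context {R : realType} {H : hilbertType R}.
Variable nu : probability (borel H) R.
Variable e : nat -> H.
Hypothesis he : is_orthonormal_basis e.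
Local Notation nn := (nuc nu).
Local Notation X := (Hnu nu).

Lemma borel_measurable_nu (A : set H) : measurable (A : set (borel H)) ->
  measurable (A : set X).
Proof. by move=> mA; exact: caratheodory_measurable_mu_ext. Qed.

Lemma nuc_borel (A : set H) : measurable (A : set (borel H)) -> nn A = nu A.
Proof. by move=> mA; exact: measurable_mu_extE. Qed.

Lemma nuc_setT : nn setT = 1%E.
Proof. by rewrite nuc_borel// probability_setT. Qed.

Lemma nuc_lty : (nn setT < +oo)%E.
Proof. by rewrite nuc_setT ltry. Qed.

Lemma nuc_complete : measure_is_complete nn.
Proof. exact: measure_is_complete_caratheodory. Qed.

Lemma borel_fun_id : borel_fun (X := X) (fun x : H => x).
Proof. by move=> _ A mA; rewrite setTI; exact: borel_measurable_nu. Qed.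

Lemma continuous_measurable_nu (g : H -> R) : continuous g ->
  measurable_fun setT (g : X -> R).
Proof. by move=> cg; exact: (borel_fun_comp cg borel_fun_id). Qed.

(** Holds because the measure is complete; choices determined only up to null sets, such as
    [sqrtQ_D], then cause no measurability problem in the space variable. *)
Lemma ae_measurable_nu (f g : X -> R) : {ae nn, forall x, f x = g x} ->
  measurable_fun setT f -> measurable_fun setT g.
Proof.
move=> fg mf; apply/measurable_EFinP.
apply: (ae_measurable_fun nuc_complete (f := EFin \o f)); last exact/measurable_EFinP.
by apply: filterS fg => x /= -> _.
Qed.

Lemma ae_borel_fun_nu (u v : X -> H) : {ae nn, forall x, u x = v x} ->
  borel_fun u -> borel_fun v.
Proof.
move=> uv bu; apply: (borel_fun_coordinates he) => i.
apply: (@ae_measurable_nu (fun x => ip (u x) (e i))); last exact: borel_fun_ip.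
by apply: filterS uv => x ->.
Qed.

Lemma ae_nu1 (P1 P : H -> Prop) : {ae nn, forall x, P1 x} ->
  (forall x, P1 x -> P x) -> {ae nn, forall x, P x}.
Proof.
by move=> h1 PP; exact: (@filterS _ _ (@ae_filter_ringOfSetsType _ _ _ nn) P1 P PP h1).
Qed.

Lemma ae_nuT (P : H -> Prop) : (forall x, P x) -> {ae nn, forall x, P x}.
Proof.
by move=> hP; exact: (@nearW _ _ _ (@ae_filter_ringOfSetsType _ _ _ nn)).
Qed.

Lemma ae_nu2 (P1 P2 P : H -> Prop) : {ae nn, forall x, P1 x} -> {ae nn, forall x, P2 x} ->
  (forall x, P1 x -> P2 x -> P x) -> {ae nn, forall x, P x}.
Proof.
by move=> h1 h2 PP; exact: (@filterS2 _ _ (@ae_filter_ringOfSetsType _ _ _ nn)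
  P1 P2 P PP h1 h2).
Qed.

Lemma ae_full (D : set H) : measurable (D : set X) -> nn D = 1%E ->
  {ae nn, forall x, D x}.
Proof.
move=> mD D1; exists (~` D); split => //; first exact: measurableC.
have mDc : measurable (~` D : set X) by exact: measurableC.
have : nn (D `|` ~` D) = (nn D + nn (~` D))%E.
  by apply: measureU => //; rewrite setICr.
rewrite setUCr nuc_setT D1; case: (nn (~` D)) => [r||] //.
by rewrite -EFinD => -[] /esym/eqP; rewrite addrC -subr_eq0 addrK => /eqP ->.
Qed.

End completed_measure.

(** * The Sobolev space and its dual *)

Section sobolev_space.
Context {R : realType} {H : hilbertType R}.
Variables (nu : probability (borel H) R) (e : nat -> H).
Hypothesis he : is_orthonormal_basis e.
Variable Qh : {linear H -> H}.
Local Notation nn := (nuc nu).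
Local Notation X := (Hnu nu).
Implicit Types (f g phi psi : H -> R) (u v G : H -> H).

Lemma sqrt_cvg0 (a : nat -> R) : (forall n, 0 <= a n) ->
  (fun n => (Num.sqrt (a n))%:E) @ \oo --> 0%E <-> a n @[n --> \oo] --> 0.
Proof.
move=> a0; split => [/fine_cvg h|h].
  have : (fun n => Num.sqrt (a n) * Num.sqrt (a n)) @ \oo --> (0 : R).
    by rewrite -[X in _ --> X](mulr0 0); apply: cvgM; exact: h.
  by under eq_fun do rewrite -expr2 sqr_sqrtr//.
apply/fine_cvgP; split; first exact: nearW.
rewrite /comp/= -[X in _ --> X]sqrtr0.
apply: (@cvg_comp _ _ _ (fun n => a n) (@Num.sqrt R) _ _ _ h); exact: sqrt_continuous.
Qed.

Lemma L2R_B f g : L2R nn f -> L2R nn g -> L2R nn (fun x => f x - g x).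
Proof.
move=> fL gL; have := L2R_ZD (-1) gL fL.
by congr L2R; apply/funext => x; rewrite mulN1r addrC.
Qed.

Lemma L2H_B u v : L2H nn u -> L2H nn v -> L2H nn (fun x => u x - v x).
Proof.
move=> uL vL; have := L2H_ZD he (-1) vL uL.
by congr L2H; apply/funext => x; rewrite scaleN1r addrC.
Qed.

Lemma ipR_le2 (a : R) f g : L2R nn f -> L2R nn g ->
  ipR nn (fun x => a * f x + g x) (fun x => a * f x + g x) <=
  2 * a ^+ 2 * ipR nn f f + 2 * ipR nn g g.
Proof.
apply: (@hp_le2 _ (X -> R^o) (L2R nn) (ipR nn)).
- by move=> b x y; exact: L2R_ZD.
- by move=> b x y z; exact: ipR_lin.
- exact: ipRC.
- by move=> x _; exact: ipR_ge0.
Qed.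

Lemma ipH_le2 (a : R) u v : L2H nn u -> L2H nn v ->
  ipH nn (fun x => a *: u x + v x) (fun x => a *: u x + v x) <=
  2 * a ^+ 2 * ipH nn u u + 2 * ipH nn v v.
Proof.
apply: (@hp_le2 _ (X -> H) (L2H nn) (ipH nn)).
- by move=> b x y; exact: (L2H_ZD he).
- by move=> b x y z; exact: (ipH_lin he).
- exact: ipHC.
- by move=> x _; exact: ipH_ge0.
Qed.

Lemma ae_ipH u u' v v' : {ae nn, forall x, u x = u' x} -> {ae nn, forall x, v x = v' x} ->
  ipH nn u v = ipH nn u' v'.
Proof.
move=> uu' vv'; apply: ae_Rintegral_eq => //.
by apply: (ae_nu2 uu' vv') => x -> -> _.
Qed.

Lemma FCb_L2R k phi : FCb e k phi -> L2R nn phi.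
Proof.
move=> Fphi; have [M phiM] := FCb_bounded Fphi.
apply: L2R_dominated (L2R_cst (nuc_lty nu) M) phiM.
by apply: continuous_measurable_nu; exact: (FCb_continuous he Fphi).
Qed.

Lemma FCb_QD_L2H phi : FCb e 1 phi -> L2H nn (fun x => Qh (gradient phi x)).
Proof.
move=> [n [f [Cf ->]]].
have /CbS[_ _ df] := Cf.
have E x : Qh (gradient (fun x => f (coords e n x)) x) =
    \sum_(i < n) pd i f (coords e n x) *: Qh (e i).
  rewrite (gradient_FCb he _ Cf) linear_sum; apply: eq_bigr => i _.
  by rewrite linearZ.
have mpd i : measurable_fun setT (fun x : X => pd i f (coords e n x) : R).
  apply: continuous_measurable_nu; have [_ Cd] := df i => x.
  apply: (@continuous_comp _ _ _ (coords e n) (pd i f)); first exact: (coords_continuous he).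
  exact: (Cb_continuous Cd).
have b : borel_fun (X := X) (fun x => Qh (gradient (fun x => f (coords e n x)) x)).
  apply: (borel_fun_coordinates he) => j.
  under eq_fun do rewrite E ip_suml.
  apply: measurable_sum => i; under eq_fun do rewrite ipZl.
  by apply: measurable_funM => //; exact: measurable_cst.
split => //.
have [M MP] : {M : 'I_n -> R & forall i x, `|pd i f x| <= M i}.
  apply: (@choice _ _ (fun i (M : R) => forall x, `|pd i f x| <= M)) => i.
  by have [_ /Cb_bounded[M ?]] := df i; exists M.
apply: (dominated_EFin (g := fun=> (\sum_(i < n) M i * `|Qh (e i)|) ^+ 2)).
- by apply: measurable_funX; exact: borel_fun_norm.
- exact: (integrable_EFin_cst (nuc_lty nu)).
- move=> x; rewrite ger0_norm ?sqr_ge0// E.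
  have le : `|\sum_(i < n) pd i f (coords e n x) *: Qh (e i)| <= \sum_(i < n) M i * `|Qh (e i)|.
    apply: le_trans (ler_norm_sum _ _ _) _; apply: ler_sum => i _.
    by rewrite normrZ ler_wpM2r.
  by rewrite lerXn2r ?nnegrE// (le_trans _ le).
Qed.

Local Notation graph := (sqrtQ_D_graph nu e Qh).

(** Replaces the extended-real norms of the definition by the real quadratic forms [ipR] and [ipH],
    on which bilinear algebra is available. *)
Lemma graphP f G : graph f G <-> [/\ L2R nn f, L2H nn G &
  exists phi_ : nat -> H -> R, [/\ forall n, FCb e 2 (phi_ n),
    ipR nn (fun x => phi_ n x - f x) (fun x => phi_ n x - f x) @[n --> \oo] --> 0 &
    ipH nn (fun x => Qh (gradient (phi_ n) x) - G x)
      (fun x => Qh (gradient (phi_ n) x) - G x) @[n --> \oo] --> 0]].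
Proof.
have eqR (phi_ : nat -> H -> R) f' : (forall n, FCb e 2 (phi_ n)) -> L2R nn f' ->
    (fun n => ps_norm ((phi_ n \- f') : Lp_real nu 2%:E)) =
    fun n => (Num.sqrt (ipR nn (fun x => phi_ n x - f' x) (fun x => phi_ n x - f' x)))%:E.
  move=> Fphi fL; apply/funext => n.
  exact: (Lnorm2_ipR (L2R_B (FCb_L2R (Fphi n)) fL)).
have eqH (phi_ : nat -> H -> R) G' : (forall n, FCb e 2 (phi_ n)) -> L2H nn G' ->
    (fun n => normH nu 2%:E (fun x => Qh (gradient (phi_ n) x) - G' x)) =
    fun n => (Num.sqrt (ipH nn (fun x => Qh (gradient (phi_ n) x) - G' x)
      (fun x => Qh (gradient (phi_ n) x) - G' x)))%:E.
  move=> Fphi GL; apply/funext => n.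
  exact: (Lnorm2_ipH (L2H_B (FCb_QD_L2H (FCbW (Fphi n))) GL)).
split.
- move=> [/L2R_Lfun fL [[_ bG] Gy] [phi_ [Fphi c1 c2]]].
  have GL : L2H nn G by exact: (L2H_Lnorm bG Gy).
  split => //; exists phi_; split => //.
  + by apply/sqrt_cvg0 => [n|]; [exact: ipR_ge0|rewrite -eqR].
  + by apply/sqrt_cvg0 => [n|]; [exact: ipH_ge0|rewrite -eqH].
- move=> [fL GL [phi_ [Fphi c1 c2]]]; split.
  + exact/L2R_Lfun.
  + by split; [split; [exact: measurableT|have [] := GL]|rewrite /normH Lnorm2_ipH// ltry].
  + exists phi_; split => //.
    * by rewrite eqR//; apply/sqrt_cvg0 => // n; exact: ipR_ge0.
    * by rewrite eqH//; apply/sqrt_cvg0 => // n; exact: ipH_ge0.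
Qed.

Lemma cvg0_le (a b : nat -> R) : (forall n, 0 <= a n <= b n) -> b n @[n --> \oo] --> 0 ->
  a n @[n --> \oo] --> 0.
Proof.
move=> ab b0; apply: (@squeeze_cvgr _ _ _ _ (cst 0) b) => //; last exact: cvg_cst.
exact: nearW.
Qed.

Lemma cvg0_ZD (a b : R) (x y : nat -> R) : x n @[n --> \oo] --> 0 ->
  y n @[n --> \oo] --> 0 -> a * x n + b * y n @[n --> \oo] --> 0.
Proof.
move=> x0 y0; rewrite -[X in _ --> X](addr0 0) -[X in _ --> X + _](mulr0 a).
by rewrite -[X in _ --> _ + X](mulr0 b); apply: cvgD; exact: cvgMr.
Qed.

Lemma scale_add_sub (V : lmodType R) (a : R) (x y z w : V) :
  a *: x + y - (a *: z + w) = a *: (x - z) + (y - w).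
Proof. by rewrite scalerBr opprD addrACA. Qed.

Lemma graph_ZD (a : R) f g G K : graph f G -> graph g K ->
  graph (fun x => a * f x + g x) (fun x => a *: G x + K x).
Proof.
move=> /graphP[fL GL [phi_ [F1 c1 d1]]] /graphP[gL KL [psi_ [F2 c2 d2]]].
apply/graphP; split; [exact: L2R_ZD|exact: (L2H_ZD he)|].
exists (fun n x => a * phi_ n x + psi_ n x); split.
- by move=> n; exact: FCb_ZD.
- apply: cvg0_le (cvg0_ZD (2 * a ^+ 2) 2 c1 c2) => n; rewrite ipR_ge0/=.
  have -> : (fun x => a * phi_ n x + psi_ n x - (a * f x + g x)) =
      (fun x => a * (phi_ n x - f x) + (psi_ n x - g x)).
    by apply/funext => x; ring.
  by apply: ipR_le2; [exact: (L2R_B (FCb_L2R (F1 n)) fL)|exact: (L2R_B (FCb_L2R (F2 n)) gL)].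
- apply: cvg0_le (cvg0_ZD (2 * a ^+ 2) 2 d1 d2) => n; rewrite ipH_ge0/=.
  have -> : (fun x => Qh (gradient (fun x => a * phi_ n x + psi_ n x) x) - (a *: G x + K x)) =
      (fun x => a *: (Qh (gradient (phi_ n) x) - G x) + (Qh (gradient (psi_ n) x) - K x)).
    apply/funext => x; rewrite (gradient_ZD he); [|exact: FCbW|exact: FCbW].
    have -> : Qh (a *: gradient (phi_ n) x + gradient (psi_ n) x) =
        a *: Qh (gradient (phi_ n) x) + Qh (gradient (psi_ n) x) by exact: linearP.
    exact: scale_add_sub.
  by apply: ipH_le2; [exact: (L2H_B (FCb_QD_L2H (FCbW (F1 n))) GL)|
    exact: (L2H_B (FCb_QD_L2H (FCbW (F2 n))) KL)].
Qed.

Lemma graph_FCb phi : FCb e 2 phi -> graph phi (fun x => Qh (gradient phi x)).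
Proof.
move=> Fphi; apply/graphP; split; [exact: (FCb_L2R Fphi)|exact: (FCb_QD_L2H (FCbW Fphi))|].
exists (fun=> phi); split => //.
- have -> : (fun n : nat => ipR nn (fun x => phi x - phi x) (fun x => phi x - phi x)) =
      cst 0; last exact: cvg_cst.
  apply/funext => n; rewrite /ipR.
  by under eq_Rintegral do rewrite subrr mulr0; rewrite /Rintegral integral0.
- have -> : (fun n : nat => ipH nn (fun x => Qh (gradient phi x) - Qh (gradient phi x))
      (fun x => Qh (gradient phi x) - Qh (gradient phi x))) = cst 0; last exact: cvg_cst.
  apply/funext => n; rewrite /ipH.
  by under eq_Rintegral do rewrite subrr ip0l; rewrite /Rintegral integral0.
Qed.

Hypothesis Q_closable : sqrtQ_D_closable nu e Qh.

(** The difference of the two candidates belongs to the graph over 0, where closability applies. *)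
Lemma graph_unique f G K : graph f G -> graph f K -> {ae nn, forall x, G x = K x}.
Proof.
move=> fG fK; have := graph_ZD (-1) fK fG.
rewrite (_ : (fun x => -1 * f x + f x) = fun=> 0); last first.
  by apply/funext => x; rewrite mulN1r addNr.
move=> /[dup] /graphP[_ dL _] [_ dm [phi_ [F c d]]].
have := Q_closable (fun n => FCbW (F n)) dm.
have -> : (fun n => ps_norm (phi_ n : Lp_real nu 2%:E)) =
    fun n => ps_norm ((phi_ n \- (fun=> 0)) : Lp_real nu 2%:E).
  by apply/funext => n; congr ps_norm; apply/funext => x /=; rewrite subr0.
move=> /(_ c d); move=> /ae_nu1; apply => x /(_ I) /= /eqP.
by rewrite scaleN1r addrC subr_eq0 => /eqP.
Qed.

Definition W12mem f := exists G, graph f G.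

Local Notation V := W12mem.
Local Notation QD := (sqrtQ_D nu e Qh).

Lemma graph_QD f : V f -> graph f (QD f).
Proof. by move=> Vf; exact: (getPex Vf). Qed.

Lemma QD_ae f G : graph f G -> {ae nn, forall x, QD f x = G x}.
Proof. by move=> fG; exact: (graph_unique (graph_QD (ex_intro _ G fG : V f)) fG). Qed.

Lemma W12mem_ZD (a : R) f g : V f -> V g -> V (fun x => a * f x + g x).
Proof. by move=> [G fG] [K gK]; exists (fun x => a *: G x + K x); exact: graph_ZD. Qed.

(** [sqrtQ_D] selects a representative by choice, so it is linear only almost everywhere; the forms
    built from it below are linear exactly. *)
Lemma QD_ZD (a : R) f g : V f -> V g ->
  {ae nn, forall x, QD (fun x => a * f x + g x) x = a *: QD f x + QD g x}.
Proof. by move=> Vf Vg; apply: QD_ae; apply: graph_ZD; exact: graph_QD. Qed.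

Lemma W12mem_FCb phi : FCb e 2 phi -> V phi.
Proof. by move=> F; eexists; exact: graph_FCb. Qed.

Lemma QD_FCb phi : FCb e 2 phi -> {ae nn, forall x, QD phi x = Qh (gradient phi x)}.
Proof. by move=> F; apply: QD_ae; exact: graph_FCb. Qed.

Lemma W12mem_L2R f : V f -> L2R nn f.
Proof. by move=> [G /graphP[]]. Qed.

Lemma QD_L2H f : V f -> L2H nn (QD f).
Proof. by move=> /graph_QD/graphP[]. Qed.

(** Twice the Dirichlet form of [N2]: the factor one half is written out wherever [N2] appears. *)
Definition dq f g := ipH nn (QD f) (QD g).

Definition vq f g := ipR nn f g + dq f g.

Lemma dqC f g : dq f g = dq g f. Proof. exact: ipHC. Qed.

Lemma vqC f g : vq f g = vq g f. Proof. by rewrite /vq ipRC dqC. Qed.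

Lemma dq_lin (a : R) f g h : V f -> V g -> V h ->
  dq (fun x => a * f x + g x) h = a * dq f h + dq g h.
Proof.
move=> Vf Vg Vh; rewrite /dq (ae_ipH (QD_ZD a Vf Vg) (v' := QD h)); last exact: ae_nuT.
by rewrite (ipH_lin he)//; exact: QD_L2H.
Qed.

Lemma vq_lin (a : R) f g h : V f -> V g -> V h ->
  vq (fun x => a * f x + g x) h = a * vq f h + vq g h.
Proof.
move=> Vf Vg Vh; rewrite /vq (dq_lin a Vf Vg Vh).
rewrite (ipR_lin a (W12mem_L2R Vf) (W12mem_L2R Vg) (W12mem_L2R Vh)) mulrDr; exact: addrACA.
Qed.

Lemma dq_ge0 f : 0 <= dq f f. Proof. exact: ipH_ge0. Qed.

Lemma vq_ge0 f : 0 <= vq f f. Proof. by rewrite addr_ge0 ?ipR_ge0 ?dq_ge0. Qed.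

Lemma W12_norm f : V f -> ps_norm (f : W12 nu e Qh) = (Num.sqrt (vq f f))%:E.
Proof.
move=> Vf; have [mf fi] := W12mem_L2R Vf; have [mG Gi] := QD_L2H Vf.
have mS : measurable_fun setT (fun x : X => Num.sqrt (f x ^+ 2 + `|QD f x| ^+ 2) : R).
  apply: (@measurableT_comp _ _ _ _ _ _ (@Num.sqrt R)).
    by apply: continuous_measurable_fun; exact: sqrt_continuous.
  by apply: measurable_funD; apply: measurable_funX; [exact: mf|exact: (borel_fun_norm mG)].
have sE x : Num.sqrt (f x ^+ 2 + `|QD f x| ^+ 2) ^+ 2 = f x ^+ 2 + `|QD f x| ^+ 2.
  by rewrite sqr_sqrtr// addr_ge0 ?sqr_ge0.
have SL : L2R nn (fun x => Num.sqrt (f x ^+ 2 + `|QD f x| ^+ 2)).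
  by split; [exact: mS|rewrite /comp; under eq_fun do rewrite sE; exact: (integrable_EFinD fi Gi)].
rewrite /= -/(EFin \o _) (Lnorm2_ipR SL) /vq; congr (Num.sqrt _)%:E.
rewrite /ipR; under eq_Rintegral do rewrite -expr2 sE.
rewrite (RintegralD measurableT fi Gi); congr (_ + _).
by apply: eq_Rintegral => x _; exact: esym (ip_sqr_norm _).
Qed.

Definition vnorm f := Num.sqrt (vq f f).

Lemma vnorm_ge0 f : 0 <= vnorm f. Proof. exact: sqrtr_ge0. Qed.

Lemma vnorm_sqr f : vnorm f ^+ 2 = vq f f.
Proof. by rewrite sqr_sqrtr// vq_ge0. Qed.

Lemma norm_le_mul (x a b : R) : 0 <= a -> 0 <= b -> x ^+ 2 <= a ^+ 2 * b ^+ 2 ->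
  `|x| <= a * b.
Proof.
move=> a0 b0 h; rewrite -ler_sqr ?nnegrE ?mulr_ge0//.
by rewrite exprMn real_normK ?num_real.
Qed.

Lemma sqr_le_add (x y z s t : R) : 0 <= s -> 0 <= t -> s ^+ 2 = x -> t ^+ 2 = y ->
  `|z| <= s * t -> Num.sqrt (x + z + (z + y)) <= s + t.
Proof.
move=> s0 t0 sx ty zst.
have -> : s + t = Num.sqrt ((s + t) ^+ 2) by rewrite sqrtr_sqr ger0_norm// addr_ge0.
by apply: ler_wsqrtr; have := le_trans (ler_norm _) zst; nra.
Qed.

Lemma vq_cauchy_schwarz f g : V f -> V g -> `|vq f g| <= vnorm f * vnorm g.
Proof.
move=> Vf Vg; apply: norm_le_mul (vnorm_ge0 f) (vnorm_ge0 g) _.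
rewrite (vnorm_sqr f) (vnorm_sqr g).
exact: (@hp_cauchy_schwarz _ (H -> R^o) V vq W12mem_ZD vq_lin vqC (fun x _ => vq_ge0 x)).
Qed.

Lemma dq_le f g : V f -> V g -> `|dq f g| <= vnorm f * vnorm g.
Proof.
move=> Vf Vg; apply: norm_le_mul (vnorm_ge0 f) (vnorm_ge0 g) _.
rewrite (vnorm_sqr f) (vnorm_sqr g).
apply: le_trans (ipH_cauchy_schwarz he (QD_L2H Vf) (QD_L2H Vg)) _.
by apply: ler_pM (dq_ge0 f) (dq_ge0 g) _ _; rewrite lerDr ipR_ge0.
Qed.

Lemma ipR_le_vnorm f g : L2R nn f -> V g -> `|ipR nn f g| <= Num.sqrt (ipR nn f f) * vnorm g.
Proof.
move=> fL Vg; apply: norm_le_mul (sqrtr_ge0 _) (vnorm_ge0 g) _.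
rewrite (vnorm_sqr g) (sqr_sqrtr (ipR_ge0 nn f)).
apply: le_trans (ipR_cauchy_schwarz fL (W12mem_L2R Vg)) _.
by apply: ler_wpM2l (ipR_ge0 nn f) _ _ _; rewrite lerDl dq_ge0.
Qed.

Lemma vnormD f g : V f -> V g -> vnorm (fun x => f x + g x) <= vnorm f + vnorm g.
Proof.
move=> Vf Vg.
have E : (fun x => f x + g x) = (fun x => 1 * f x + g x).
  by apply/funext => x; rewrite mul1r.
have Vfg : V (fun x => 1 * f x + g x) by exact: W12mem_ZD.
rewrite {1}/vnorm E (vq_lin 1 Vf Vg Vfg) mul1r.
rewrite (vqC f) (vqC g) (vq_lin 1 Vf Vg Vf) (vq_lin 1 Vf Vg Vg) !mul1r (vqC g f).
exact: (sqr_le_add (vnorm_ge0 f) (vnorm_ge0 g) (vnorm_sqr f) (vnorm_sqr g)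
  (vq_cauchy_schwarz Vf Vg)).
Qed.

Lemma W12mem0 : V (fun=> 0).
Proof. by apply: W12mem_FCb; exact: FCb_cst. Qed.

Lemma W12mem_Z (a : R) f : V f -> V (fun x => a * f x).
Proof.
move=> Vf; have := W12mem_ZD a Vf W12mem0; congr V.
by apply/funext => x; rewrite addr0.
Qed.

Lemma vnormZ (a : R) f : V f -> vnorm (fun x => a * f x) = `|a| * vnorm f.
Proof.
move=> Vf; rewrite /vnorm -sqrtr_sqr -sqrtrM ?sqr_ge0//; congr Num.sqrt.
(* A multiple is put in the shape of a combination of two members, the only shape covered by
   [vq_lin]. *)
have aE : (fun x => a * f x) = (fun x => (a - 1) * f x + f x).
  by apply/funext => x; rewrite mulrBl mul1r subrK.
have Va : V (fun x => (a - 1) * f x + f x) by exact: W12mem_ZD.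
rewrite aE (vq_lin (a - 1) Vf Vf Va) (vqC f) (vq_lin (a - 1) Vf Vf Vf).
by move: (vq f f) => z; ring.
Qed.

End sobolev_space.

(** * Integration by parts for the Kolmogorov operator *)

Section kolmogorov_operator.
Context {R : realType} {H : hilbertType R}.
Variables (nu : probability (borel H) R) (e : nat -> H).
Hypothesis he : is_orthonormal_basis e.
Variables (Q Qh : {linear H -> H}) (q : nat -> R) (DAt : set H) (At F : H -> H).
Hypotheses (hQ : bounded_sa_positive Q) (hQh : is_sqrt_op Q Qh).
Hypothesis hQe : forall i, Q (e i) = q i *: e i.
Hypotheses (At_lin : linear_on DAt At) (eDAt : forall i, DAt (e i)).
Variable DF : set H.
Hypotheses (F_meas : nu_measurable nu DF F) (DF_full : nuc nu DF = 1%E).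
Hypothesis F_moment : (\int[nuc nu]_x (`|F x| ^+ 2 + `|x| ^+ 2)%:E < +oo)%E.
Hypothesis N0_invariant : forall phi, FCb e 2 phi ->
  (\int[nuc nu]_x (N0 e Q At F phi x)%:E = 0)%E.
Hypothesis N2_symmetric : forall f g,
  N2_adjoint_graph nu e Q At F f g <-> N2_graph nu e Q At F f g.
Hypothesis Q_closable : sqrtQ_D_closable nu e Qh.
Local Notation nn := (nuc nu).
Local Notation X := (Hnu nu).
Local Notation V := (W12mem nu e Qh).
Local Notation dq := (dq nu e Qh).
Local Notation vnorm := (vnorm nu e Qh).
Local Notation N0 := (N0 e Q At F).
Implicit Types (f g phi psi : H -> R).

(** [F] is measurable on [DF] only. Its extension by 0 is measurable everywhere and agrees with [F]
    almost everywhere, which suffices after completion. *)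
Lemma borel_F : borel_fun (X := X) F.
Proof.
have [mD mF] := F_meas.
pose F' x := if x \in DF then F x else 0.
apply: (ae_borel_fun_nu he (u := F')).
  apply: (ae_nu1 (ae_full mD DF_full)) => x Dx.
  by rewrite /F' mem_set.
move=> _ A mA; rewrite setTI.
have -> : F' @^-1` A = (DF `&` F @^-1` A) `|` (~` DF `&` [set x | A 0]).
  apply/seteqP; split => x; rewrite /F' /=.
    by case: ifPn => [/set_mem Dx Ax|/negP Dx A0]; [left|right; split => // Dx'; apply: Dx; exact: mem_set].
  case=> -[Dx Ax]; first by rewrite mem_set.
  by rewrite memNset.
apply: measurableU; first exact: (mF mD A mA).
apply: measurableI; first exact: measurableC.
have [A0|A0] := pselect (A 0).
  by rewrite (_ : [set x | A 0] = setT) //; apply/seteqP; split.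
by rewrite (_ : [set x | A 0] = set0) //; apply/seteqP; split.
Qed.

Lemma moment_integrable : nn.-integrable setT (EFin \o (fun x : X => `|F x| ^+ 2 + `|x : H| ^+ 2)).
Proof.
apply/integrableP; split.
  apply/measurable_EFinP; apply: measurable_funD; apply: measurable_funX.
    exact: (borel_fun_norm borel_F).
  exact: (borel_fun_norm (@borel_fun_id R H nu)).
rewrite (_ : (\int[_]_(x in _) _ = \int[nn]_x (`|F x| ^+ 2 + `|x : H| ^+ 2)%:E)%E)//.
by apply: eq_integral => x _ /=; rewrite ger0_norm// addr_ge0 ?sqr_ge0.
Qed.

Lemma L2H_F : L2H nn F.
Proof.
split; first exact: borel_F.
apply: dominated_EFin moment_integrable _.
  by apply: measurable_funX; exact: (borel_fun_norm borel_F).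
by move=> x; rewrite ger0_norm ?sqr_ge0// lerDl sqr_ge0.
Qed.

Lemma L2H_id : L2H nn (fun x : X => x : H).
Proof.
split; first exact: borel_fun_id.
apply: dominated_EFin moment_integrable _.
  by apply: measurable_funX; exact: (borel_fun_norm (@borel_fun_id R H nu)).
by move=> x; rewrite ger0_norm ?sqr_ge0// lerDr sqr_ge0.
Qed.

Lemma L2R_ip (u : X -> H) (h : H) : L2H nn u -> L2R nn (fun x => ip (u x) h).
Proof.
move=> uL; have [bu _] := uL.
apply: (L2R_dominated (g := fun x => `|h| * `|u x| + 0)).
- exact: (borel_fun_ip _ bu).
- exact: (L2R_ZD _ (L2H_norm uL) (L2R_cst (nuc_lty nu) 0)).
- by move=> x; rewrite addr0 mulrC; exact: ip_norm_le.
Qed.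

Lemma L2R_D f g : L2R nn f -> L2R nn g -> L2R nn (fun x => f x + g x).
Proof.
move=> fL gL; have := L2R_ZD 1 fL gL.
by have -> : (fun x : X => 1 * f x + g x) = (fun x => f x + g x)
  by apply/funext => x; rewrite mul1r.
Qed.

Lemma L2R_Z (a : R) f : L2R nn f -> L2R nn (fun x => a * f x).
Proof.
move=> fL; have := L2R_ZD a fL (L2R_cst (nuc_lty nu) 0).
by have -> : (fun x : X => a * f x + 0) = (fun x => a * f x)
  by apply/funext => x; rewrite addr0.
Qed.

Lemma L2R_sum n (a : 'I_n -> H -> R) : (forall i, L2R nn (a i)) ->
  L2R nn (fun x => \sum_(i < n) a i x).
Proof.
elim: n a => [|n IH] a aL.
  have -> : (fun x : X => \sum_(i < 0) a i x) = fun=> 0.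
    by apply/funext => x; rewrite big_ord0.
  exact: (L2R_cst (nuc_lty nu)).
have -> : (fun x : X => \sum_(i < n.+1) a i x) =
    fun x => a ord0 x + \sum_(i < n) a (lift ord0 i) x.
  by apply/funext => x; rewrite big_ord_recl.
by apply: L2R_D; [exact: aL|apply: IH => i; exact: aL].
Qed.

(** The first-order coefficients are unbounded in [x], but [F_moment] makes them square integrable,
    and they are multiplied by bounded partial derivatives. *)
Lemma N0_L2R phi : FCb e 2 phi -> L2R nn (N0 phi).
Proof.
move=> [n [f [Cf ->]]].
have -> : N0 (fun x => f (\row_(i < n) ip x (e i))) = fun x =>
    2^-1 * (\sum_(i < n) q i * pd i (pd i f) (coords e n x)) +
    \sum_(i < n) pd i f (coords e n x) * (ip x (At (e i)) + ip (F x) (e i)).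
  by apply/funext => x; exact: (N0_FCb he F hQ hQe At_lin eDAt x Cf).
have /CbS[_ _ df] := Cf.
apply: L2R_D.
  apply: L2R_Z; apply: L2R_sum => i; apply: L2R_Z.
  have [_ /CbS[_ _ ddf]] := df i.
  apply: (@FCb_L2R _ _ nu e he 0); exists n, (pd i (pd i f)); split => //.
  by have [] := ddf i.
apply: L2R_sum => i.
have Fd : FCb e 1 (fun x => pd i f (coords e n x)).
  by exists n, (pd i f); split => //; have [] := df i.
have [M pM] := FCb_bounded Fd.
apply: (L2R_bounded_mul (C := M)).
- by have [] := FCb_L2R nu he Fd.
- by apply: L2R_D; [exact: (L2R_ip _ L2H_id)|exact: (L2R_ip _ L2H_F)].
- exact: ae_nuT.
Qed.

Lemma N2_graph_N0 phi : FCb e 2 phi -> N2_graph nu e Q At F phi (N0 phi).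
Proof.
move=> Fphi; split.
- exact/L2R_Lfun/(FCb_L2R nu he Fphi).
- exact/L2R_Lfun/N0_L2R.
- exists (fun=> phi); split=> //.
    have -> : (fun n : nat => ps_norm ((phi \- phi) : Lp_real nu 2%:E)) = cst 0%E; last exact: cvg_cst.
    apply/funext => n /=; have -> : EFin \o (phi \- phi) = cst 0%E.
      by apply/funext => x /=; rewrite subrr.
    by rewrite Lnorm0.
  have -> : (fun n : nat => ps_norm ((N0 phi \- N0 phi) : Lp_real nu 2%:E)) = cst 0%E; last exact: cvg_cst.
  apply/funext => n /=; have -> : EFin \o (N0 phi \- N0 phi) = cst 0%E.
    by apply/funext => x /=; rewrite subrr.
  by rewrite Lnorm0.
Qed.

Lemma N0_by_parts phi psi : FCb e 2 phi -> FCb e 2 psi ->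
  ipR nn (N0 phi) psi =
  - (2^-1 * ipH nn (fun x => Qh (gradient phi x)) (fun x => Qh (gradient psi x))).
Proof.
move=> Fphi Fpsi.
(* Symmetry is assumed for the closure: its graph contains [(psi, N0 psi)], which is therefore in
   the graph of the adjoint and may be tested against [(phi, N0 phi)]. *)
have sym : ipR nn (N0 phi) psi = ipR nn phi (N0 psi).
  have [_ _ h] := (N2_symmetric psi (N0 psi)).2 (N2_graph_N0 Fpsi).
  exact: (h _ _ (N2_graph_N0 Fphi)).
have inv : \int[nn]_x (N0 (fun x => phi x * psi x) x) = 0.
  by rewrite /Rintegral (N0_invariant (FCb_M Fphi Fpsi)).
have pL := FCb_L2R nu he Fphi; have sL := FCb_L2R nu he Fpsi.
have i1 := L2R_mul pL (N0_L2R Fpsi); have i2 := L2R_mul sL (N0_L2R Fphi).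
have i3 := L2H_ip he (FCb_QD_L2H nu he Qh (FCbW Fphi)) (FCb_QD_L2H nu he Qh (FCbW Fpsi)).
have : ipR nn phi (N0 psi) + ipR nn psi (N0 phi) +
    ipH nn (fun x => Qh (gradient phi x)) (fun x => Qh (gradient psi x)) = 0.
  rewrite -inv /ipR /ipH -(RintegralD measurableT i1 i2).
  rewrite -(RintegralD measurableT (integrable_EFinD i1 i2) i3).
  apply: eq_Rintegral => x _.
  exact: esym (N0_product he F hQ hQh hQe At_lin eDAt x Fphi Fpsi).
rewrite (ipRC nn psi) -sym; move: (ipR _ _ _) (ipH _ _ _) => a b; lra.
Qed.

Lemma limit_vanish (c a b : R) (x y : nat -> R) : x n @[n --> \oo] --> 0 ->
  y n @[n --> \oo] --> 0 -> (forall n, c ^+ 2 <= a * x n + b * y n) -> c = 0.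
Proof.
move=> x0 y0 cxy; apply/eqP; rewrite -sqrf_eq0 eq_le sqr_ge0 andbT.
have := cvg0_ZD a b x0 y0 => h.
rewrite -(cvg_lim _ h)//; apply: limr_ge; last exact: nearW.
by apply/cvg_ex; exists 0.
Qed.

Lemma sum_sqr_le (c a b s t x y : R) : c = a + 2^-1 * b -> a ^+ 2 <= s * x -> b ^+ 2 <= t * y ->
  c ^+ 2 <= (2 * s) * x + (2 * t) * y.
Proof.
by move=> -> h1 h2; have := sqr_ge0 (a - 2^-1 * b); have := sqr_ge0 b; nra.
Qed.

Lemma difference_eq (a a' da b b' db : R) : da = a' - a -> db = b' - b ->
  a' = - (2^-1 * b') -> a + 2^-1 * b = - da + 2^-1 * - db.
Proof. by move=> -> -> ->; ring. Qed.

Lemma ipR_subr f g h : L2R nn h -> L2R nn f -> L2R nn g ->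
  ipR nn h (fun x => f x - g x) = ipR nn h f - ipR nn h g.
Proof.
move=> hL fL gL; have := ipR_lin (-1) gL fL hL.
have -> : (fun x : X => -1 * g x + f x) = (fun x => f x - g x).
  by apply/funext => x; rewrite mulN1r addrC.
by rewrite (ipRC nn _ h) (ipRC nn g) (ipRC nn f) mulN1r addrC => ->.
Qed.

Lemma ipH_subr (u v w : X -> H) : L2H nn w -> L2H nn u -> L2H nn v ->
  ipH nn w (fun x => u x - v x) = ipH nn w u - ipH nn w v.
Proof.
move=> hL fL gL; have := ipH_lin he (-1) gL fL hL.
have -> : (fun x : X => -1 *: v x + u x) = (fun x => u x - v x).
  by apply/funext => x; rewrite scaleN1r addrC.
by rewrite (ipHC nn _ w) (ipHC nn v) (ipHC nn u) mulN1r addrC => ->.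
Qed.

(** [psi] is approximated in the graph by cylindrical functions, for which the formula is
    [N0_by_parts]. The defect is a fixed number whose square is bounded, by Cauchy-Schwarz, by
    multiples of two null sequences. *)
Lemma N0_dq phi psi : FCb e 2 phi -> V psi ->
  ipR nn (N0 phi) psi = - (2^-1 * dq phi psi).
Proof.
move=> Fphi Vpsi; have NL := N0_L2R Fphi.
set QDp : X -> H := fun x => Qh (gradient phi x).
have pL : L2H nn QDp := FCb_QD_L2H nu he Qh (FCbW Fphi).
have -> : dq phi psi = ipH nn QDp (sqrtQ_D nu e Qh psi).
  by apply: ae_ipH; [exact: (QD_FCb he Q_closable Fphi)|exact: ae_nuT].
have /(graphP nu he)[sL GL [psi_ [Fpsi c d]]] := graph_QD Vpsi.
apply/eqP; rewrite -addr_eq0; apply/eqP.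
apply: (limit_vanish c d) => n.
have Fn := FCb_L2R nu he (Fpsi n); have Gn := FCb_QD_L2H nu he Qh (FCbW (Fpsi n)).
apply: (@sum_sqr_le _ (- ipR nn (N0 phi) (fun x => psi_ n x - psi x))
  (- ipH nn QDp (fun x => Qh (gradient (psi_ n) x) - sqrtQ_D nu e Qh psi x))
  (ipR nn (N0 phi) (N0 phi)) (ipH nn QDp QDp)).
- exact: (difference_eq (ipR_subr NL Fn sL) (ipH_subr pL Gn GL) (N0_by_parts Fphi (Fpsi n))).
- rewrite sqrrN; exact: (ipR_cauchy_schwarz NL (L2R_B Fn sL)).
- rewrite sqrrN; exact: (ipH_cauchy_schwarz he pL (L2H_B he Gn GL)).
Qed.

End kolmogorov_operator.

(** * The dual of the Sobolev space and the extension of [N2] to it *)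

Section dual_space.
Context {R : realType} {H : hilbertType R}.
Variables (nu : probability (borel H) R) (e : nat -> H).
Hypothesis he : is_orthonormal_basis e.
Variable Qh : {linear H -> H}.
Hypothesis Q_closable : sqrtQ_D_closable nu e Qh.
Local Notation nn := (nuc nu).
Local Notation X := (Hnu nu).
Local Notation V := (W12mem nu e Qh).
Local Notation dq := (dq nu e Qh).
Local Notation vnorm := (vnorm nu e Qh).
Implicit Types (f g phi psi : H -> R).

(* The [+ 1] avoids dividing by a vanishing norm. *)
Lemma dual_eval_le (l : W12_dual nu e Qh) psi : V psi ->
  (forall a : R, (l : W12 nu e Qh -> R^o) (fun x => a * psi x) = a * l psi) ->
  (`|l psi|%:E <= (vnorm psi + 1)%:E * ps_norm l)%E.
Proof.
move=> Vpsi lin; set a := (vnorm psi + 1)^-1.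
have p0 : 0 < vnorm psi + 1 by rewrite ltr_wpDl ?vnorm_ge0.
have a0 : 0 < a by rewrite invr_gt0.
have -> : `|l psi| = (vnorm psi + 1) * `|l (fun x => a * psi x)|.
  by rewrite lin normrM gtr0_norm// mulrA divff ?mul1r// gt_eqF.
rewrite EFinM; apply: lee_wpmul2l; first by rewrite lee_fin ltW.
apply: ereal_sup_ubound; exists (fun x => a * psi x) => //.
have Va : V (fun x => a * psi x) by exact: (W12mem_Z he a Vpsi).
split=> //; rewrite (W12_norm he Va) lee_fin -/(vnorm (fun x => a * psi x)).
by rewrite (vnormZ he Q_closable a Vpsi) gtr0_norm// mulrC ler_pdivrMr// mul1r lerDl.
Qed.

Lemma dual_norm_ge0 (l : W12_dual nu e Qh) : (0 <= ps_norm l)%E.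
Proof.
have V00 := W12mem_Z he 0 (W12mem0 nu he Qh).
apply: (@le_trans _ _ `|l (fun x => 0 * 0)|%:E); first by rewrite lee_fin.
apply: ereal_sup_ubound; exists (fun x => 0 * 0) => //; split => //.
rewrite (W12_norm he V00) lee_fin -/(vnorm (fun x => 0 * 0)).
by rewrite (vnormZ he Q_closable 0 (W12mem0 nu he Qh)) normr0 mul0r.
Qed.

Lemma dual_norm_le (l : W12_dual nu e Qh) (C : R) : 0 <= C ->
  (forall psi, V psi -> `|l psi| <= C * vnorm psi) -> (ps_norm l <= C%:E)%E.
Proof.
move=> C0 lC; apply: ge_ereal_sup => _ [psi [Vpsi p1] <-].
rewrite lee_fin; apply: le_trans (lC _ Vpsi) _.
move: p1; rewrite (W12_norm he Vpsi) lee_fin => p1.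
by rewrite -[leRHS]mulr1; exact: (ler_wpM2l C0 p1).
Qed.

Lemma linear_homogeneous (l : (H -> R) -> R) psi (a : R) :
  (forall (a : R) f g, V f -> V g -> l (fun x => a * f x + g x) = a * l f + l g) ->
  V psi -> l (fun x => a * psi x) = a * l psi.
Proof.
move=> lin Vpsi; have -> : (fun x => a * psi x) = (fun x => (a - 1) * psi x + psi x).
  by apply/funext => x; rewrite mulrBl mul1r subrK.
by rewrite lin// mulrBl mul1r subrK.
Qed.

Section N2_extension.
Variables (Q : {linear H -> H}) (q : nat -> R) (DAt : set H) (At F : H -> H).
Hypotheses (hQ : bounded_sa_positive Q) (hQh : is_sqrt_op Q Qh).
Hypothesis hQe : forall i, Q (e i) = q i *: e i.
Hypotheses (At_lin : linear_on DAt At) (eDAt : forall i, DAt (e i)).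
Variable DF : set H.
Hypotheses (F_meas : nu_measurable nu DF F) (DF_full : nuc nu DF = 1%E).
Hypothesis F_moment : (\int[nuc nu]_x (`|F x| ^+ 2 + `|x| ^+ 2)%:E < +oo)%E.
Hypothesis N0_invariant : forall phi, FCb e 2 phi ->
  (\int[nuc nu]_x (N0 e Q At F phi x)%:E = 0)%E.
Hypothesis N2_symmetric : forall f g,
  N2_adjoint_graph nu e Q At F f g <-> N2_graph nu e Q At F f g.
Local Notation N2 := (@N2_ext R H nu e Q Qh At F).

Let N0_pairing := N0_dq he hQ hQh hQe At_lin eDAt F_meas DF_full F_moment N0_invariant
  N2_symmetric Q_closable.

Lemma W12mem_B f g : V f -> V g -> V (fun x => f x - g x).
Proof.
move=> Vf Vg; have := W12mem_ZD he (-1) Vg Vf.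
have -> // : (fun x => -1 * g x + f x) = (fun x => f x - g x).
by apply/funext => x; rewrite mulN1r addrC.
Qed.

Lemma dq_linr (a : R) f g h : V f -> V g -> V h ->
  dq h (fun x => a * f x + g x) = a * dq h f + dq h g.
Proof. by move=> Vf Vg Vh; rewrite (dqC _ _ _ h) (dq_lin he Q_closable a Vf Vg Vh) (dqC _ _ _ f) (dqC _ _ _ g). Qed.

Lemma dq_B f g h : V f -> V g -> V h -> dq (fun x => f x - g x) h = dq f h - dq g h.
Proof.
move=> Vf Vg Vh; have := dq_lin he Q_closable (-1) Vg Vf Vh.
have -> : (fun x => -1 * g x + f x) = (fun x => f x - g x).
  by apply/funext => x; rewrite mulN1r addrC.
by rewrite mulN1r addrC.
Qed.

(** Pins down any outcome of the choice in [N2_ext]: [pivot (N0 (phi_ n))] acts on [psi] as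
    [- (2^-1 * dq (phi_ n) psi)], which tends to [l psi] and also to the value at [f]. The estimate
    stays in the extended reals because the dual norms may be infinite for some [n]. *)
Lemma N2_ext_spec f (l : W12_dual nu e Qh) : V f ->
  (exists phi_ : nat -> W12 nu e Qh,
      [/\ forall n, FCb e 2 (phi_ n),
          ps_norm (phi_ n - (f : W12 nu e Qh)) @[n --> \oo] --> 0%E &
          ps_norm (@pivot R H nu e Qh (N0 e Q At F (phi_ n)) - l) @[n --> \oo] --> 0%E]) ->
  (forall psi (a : R), V psi -> (l : W12 nu e Qh -> R^o) (fun x => a * psi x) = a * l psi) ->
  forall psi, V psi -> l psi = - (2^-1 * dq f psi).
Proof.
move=> Vf [phi_ [Fphi c1 c2]] lin psi Vpsi.
apply/eqP; rewrite -subr_eq0 -normr_le0.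
set z := `|_|.
pose r n : W12_dual nu e Qh := @pivot R H nu e Qh (N0 e Q At F (phi_ n)) - l.
pose a n : R := vnorm (fun x => phi_ n x - f x).
have aE n : ps_norm (phi_ n - (f : W12 nu e Qh)) = (a n)%:E.
  exact: (W12_norm he (W12mem_B (W12mem_FCb nu he Qh (Fphi n)) Vf)).
have key n : (z%:E <= (vnorm psi + 1)%:E * ps_norm (r n) + (2^-1 * vnorm psi)%:E * (a n)%:E)%E.
  have Vn := W12mem_FCb nu he Qh (Fphi n).
  have rE : (r n : W12 nu e Qh -> R^o) psi = - (2^-1 * dq (phi_ n) psi) - l psi.
    by rewrite -(N0_pairing (Fphi n) Vpsi).
  have rlin (b : R) : (r n : W12 nu e Qh -> R^o) (fun x => b * psi x) = b * r n psi.
    have -> : (r n : W12 nu e Qh -> R^o) (fun x => b * psi x) =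
        ipR nn (N0 e Q At F (phi_ n)) (fun x => b * psi x) - l (fun x => b * psi x) by [].
    rewrite rE (N0_pairing (Fphi n) (W12mem_Z he b Vpsi)) (lin _ _ Vpsi).
    rewrite (linear_homogeneous (l := dq (phi_ n)) b _ Vpsi).
      by move: (dq _ _) (l _) => y z'; ring.
    by move=> c f1 f2 V1 V2; exact: dq_linr.
  have := dual_eval_le Vpsi rlin; rewrite rE => rle.
  apply: (@le_trans _ _ (`|- (2^-1 * dq (phi_ n) psi) - l psi|%:E +
    (2^-1 * vnorm psi)%:E * (a n)%:E)%E); last exact: (leeD rle (lexx _)).
  rewrite -EFinM -EFinD lee_fin.
  have := dq_le he (W12mem_B Vn Vf) Vpsi.
  rewrite (dq_B Vn Vf Vpsi) -/(a n) /z.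
  move: (dq _ _) (dq _ _) (vnorm _) (l _) (a n) => y x p m b h.
  have -> : m - - (2^-1 * y) = (- (- (2^-1 * x) - m)) - 2^-1 * (x - y) by ring.
  apply: le_trans (ler_normB _ _) _; rewrite normrN lerD2l normrM ger0_norm ?invr_ge0//.
  by rewrite -mulrA ler_wpM2l ?invr_ge0// mulrC.
have lim0 : ((vnorm psi + 1)%:E * ps_norm (r n) + (2^-1 * vnorm psi)%:E * (a n)%:E)%E
    @[n --> \oo] --> 0%E.
  rewrite -[X in _ --> X]adde0.
  rewrite -[X in _ --> (X + _)%E](mule0 (vnorm psi + 1)%:E).
  rewrite -[X in _ --> (_ + X)%E](mule0 (2^-1 * vnorm psi)%:E).
  apply: cvgeD; first by rewrite !mule0.
    by apply: cvgeZl => //; exact: c2.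
  apply: cvgeZl => //.
  by have -> : (fun n => (a n)%:E) = (fun n => ps_norm (phi_ n - (f : W12 nu e Qh)))
    by apply/funext => n; rewrite aE.
suff : (z%:E <= 0)%E by rewrite lee_fin.
rewrite -(cvg_lim _ lim0)//; apply: lime_ge; last exact: nearW.
by apply/cvg_ex; exists 0%E.
Qed.

Lemma dq_graph f phi : V f -> FCb e 2 phi ->
  dq (fun x => phi x - f x) (fun x => phi x - f x) =
  ipH nn (fun x => Qh (gradient phi x) - sqrtQ_D nu e Qh f x)
    (fun x => Qh (gradient phi x) - sqrtQ_D nu e Qh f x).
Proof.
move=> Vf Fphi; have := graph_ZD he (-1) (graph_QD Vf) (graph_FCb nu he Qh Fphi).
have -> : (fun x => -1 * f x + phi x) = (fun x => phi x - f x).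
  by apply/funext => x; rewrite mulN1r addrC.
have -> : (fun x => -1 *: sqrtQ_D nu e Qh f x + Qh (gradient phi x)) =
    (fun x => Qh (gradient phi x) - sqrtQ_D nu e Qh f x).
  by apply/funext => x; rewrite scaleN1r addrC.
by move=> /(QD_ae he Q_closable) G; apply: ae_ipH; exact: G.
Qed.

(** The witness is [- (2^-1 * dq f psi)]. Any sequence defining the gradient of [f] will do, since
    the dual norm of the error is at most the Sobolev norm of [phi_ n - f]. *)
Lemma N2_ext_exists f : V f -> exists l : W12_dual nu e Qh, ps_mem l /\
  exists phi_ : nat -> W12 nu e Qh,
    [/\ forall n, FCb e 2 (phi_ n),
        ps_norm (phi_ n - (f : W12 nu e Qh)) @[n --> \oo] --> 0%E &
        ps_norm (@pivot R H nu e Qh (N0 e Q At F (phi_ n)) - l) @[n --> \oo] --> 0%E].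
Proof.
move=> Vf; exists (fun psi => - (2^-1 * dq f psi)); split.
  split=> [a g h Vg Vh|]; first by rewrite (dq_linr a Vg Vh Vf); move: (dq f g) (dq f h) => x y; ring.
  exists (2^-1 * vnorm f) => g Vg; rewrite (W12_norm he Vg) -EFinM lee_fin.
  rewrite normrN normrM ger0_norm ?invr_ge0// -mulrA ler_wpM2l ?invr_ge0//.
  exact: (dq_le he Vf Vg).
have /(graphP nu he)[fL GL [phi_ [Fphi c d]]] := graph_QD Vf.
have Vn n := W12mem_FCb nu he Qh (Fphi n).
pose a n : R := vnorm (fun x => phi_ n x - f x).
have aE n : ps_norm ((phi_ n : W12 nu e Qh) - f) = (a n)%:E.
  exact: (W12_norm he (W12mem_B (Vn n) Vf)).
have a0 : (fun n => (a n)%:E) @ \oo --> 0%E.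
  apply/sqrt_cvg0 => [n|]; first exact: vq_ge0.
  have := cvg0_ZD 1 1 c d; under eq_fun do rewrite !mul1r.
  by under [X in _ -> X @ _ --> _]eq_fun do rewrite /vq (dq_graph Vf (Fphi _)).
exists phi_; split => //; first by under eq_fun do rewrite aE.
apply: (squeeze_cvge (f := cst 0%E) (h := fun n => (a n)%:E)); last 2 first.
- exact: cvg_cst.
- exact: a0.
apply: nearW => n; rewrite dual_norm_ge0/=.
apply: dual_norm_le; first exact: vnorm_ge0.
move=> psi Vpsi.
have -> : (@pivot R H nu e Qh (N0 e Q At F (phi_ n)) - (fun psi => - (2^-1 * dq f psi)) :
    W12_dual nu e Qh) psi = ipR nn (N0 e Q At F (phi_ n)) psi - - (2^-1 * dq f psi) by [].
rewrite (N0_pairing (Fphi n) Vpsi).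
have := dq_le he (W12mem_B (Vn n) Vf) Vpsi; rewrite (dq_B (Vn n) Vf Vpsi) -/(a n).
have := mulr_ge0 (vnorm_ge0 nu e Qh (fun x => phi_ n x - f x)) (vnorm_ge0 nu e Qh psi).
move: (dq _ _) (dq _ _) (vnorm psi) => y x p; rewrite -/(a n); move: (a n) => b b0 h.
have -> : - (2^-1 * x) - - (2^-1 * y) = - (2^-1 * (x - y)) by ring.
rewrite normrN normrM ger0_norm ?invr_ge0//; apply: le_trans h.
by rewrite ler_piMl// invf_le1// ler1n.
Qed.

Lemma N2_extE f psi : V f -> V psi -> N2 f psi = - (2^-1 * dq f psi).
Proof.
move=> Vf Vpsi; have [[lin _] ex] := getPex (N2_ext_exists Vf).
apply: (N2_ext_spec Vf ex) => // g a Vg.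
by apply: (linear_homogeneous (l := N2 f)) => // b f1 f2; exact: lin.
Qed.

End N2_extension.
End dual_space.

(** * Bochner integrals in prespaces *)

Section integration_supplement.
Context {d} {T : measurableType d} {R : realType}.
Variable mu : {measure set T -> \bar R}.
Implicit Types f g : T -> R.

Lemma ae_integrable_sum (D : set T) n (f : 'I_n -> T -> R) : measurable D ->
  (forall i, ae_integrable mu D (f i)) -> ae_integrable mu D (fun t => \sum_(i < n) f i t) /\
  \int[mu]_(t in D) (\sum_(i < n) f i t) = \sum_(i < n) \int[mu]_(t in D) f i t.
Proof.
move=> mD; elim: n f => [|n IH] f fi.
  have -> : (fun t => \sum_(i < 0) f i t) = fun=> 0 by apply/funext => t; rewrite big_ord0.
  rewrite big_ord0; split; last by rewrite /Rintegral integral0.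
  by apply: integrable_ae_integrable; exact: integrable0.
have [i1 e1] := IH (fun i => f (lift ord0 i)) (fun i => fi _).
have -> : (fun t => \sum_(i < n.+1) f i t) =
    fun t => f ord0 t + \sum_(i < n) f (lift ord0 i) t.
  by apply/funext => t; rewrite big_ord_recl.
by rewrite big_ord_recl -e1; split; [exact: ae_integrableD|exact: ae_RintegralD].
Qed.

Lemma ae_dominated_cvg0 (D : set T) (f_ : nat -> T -> R) g : measurable D ->
  (forall n, ae_measurable mu D (f_ n)) -> ae_integrable mu D g ->
  {ae mu, forall t, D t -> f_ n t @[n --> \oo] --> 0} ->
  {ae mu, forall t, D t -> forall n, `|f_ n t| <= g t} ->
  (forall n, ae_integrable mu D (f_ n)) /\ \int[mu]_(t in D) f_ n t @[n --> \oo] --> 0.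
Proof.
move=> mD mf gi f0 fg.
have fi n : ae_integrable mu D (f_ n).
  apply: (ae_integrable_le (mu := mu) (g := g)) => //.
  by apply: filterS fg => t h Dt; exact: h.
split => //.
have [h_ hP] : {h_ : nat -> T -> R & forall n, measurable_fun D (h_ n) /\
    {ae mu, forall x, D x -> f_ n x = h_ n x}}.
  by apply: (@choice _ _ (fun n h => measurable_fun D h /\
    {ae mu, forall x, D x -> f_ n x = h x})) => n; have [h ? ?] := mf n; exists h.
have fh : {ae mu, forall x, forall n, D x -> f_ n x = h_ n x}.
  by apply: ae_foralln => n; have [] := hP n.
have [k ki gk] := gi.
have := @dominated_convergence _ T R mu D mD (fun n t => (h_ n t)%:E) (cst 0%E) (EFin \o k).
case.
- by move=> n; apply/measurable_EFinP; have [] := hP n.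
- exact: measurable_cst.
- apply: filterS2 f0 fh => t f0t fht Dt; apply/fine_cvgP; split; first exact: nearW.
  by rewrite /comp/= -(_ : f_ ^~ t = h_ ^~ t); [exact: f0t|apply/funext => n; exact: fht].
- exact: ki.
- apply: filterS3 fg fh gk => t fgt fht gkt Dt n /=.
  by rewrite lee_fin -fht// -gkt// fgt.
move=> _ _; rewrite integral0 => /fine_cvg.
rewrite (_ : fine \o _ = fun n => \int[mu]_(t in D) f_ n t)//.
apply/funext => n /=; apply: esym; apply: ae_Rintegral_eq => //.
by have [] := hP n.
Qed.

End integration_supplement.

(** Compactness in its near-covering form. Only [t] is confined to [[0, T]], as [c] is continuous on
    the whole line; stating the result for all small [delta] lets finitely many functions be treated
    together. *)
Lemma heine_cantor {R : realType} (T : R) (c : R -> R) : continuous c ->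
  forall eta, 0 < eta -> \forall delta \near 0^'+,
    forall t t', t \in `[0, T] -> `|t - t'| <= delta -> `|c t - c t'| <= eta.
Proof.
move=> cc eta eta0.
have cover := (@compact_near_coveringP _ `[0, T]%classic).1 (@segment_compact R 0 T).
have : \forall delta \near 0^'+, `[0, T]%classic `<=` (fun t => forall t', `|t - t'| <= delta ->
    `|c t - c t'| <= eta).
  apply: (cover R 0^'+ (fun delta t => forall t', `|t - t'| <= delta ->
    `|c t - c t'| <= eta)) => t tT.
  have e2 : 0 < eta / 2 by rewrite divr_gt0.
  have /cvgrPdist_le/(_ _ e2)/nbhs_ballP[r /= r0 rP] := cc t.
  exists (ball t (r / 2), [set x | 0 < x < r / 2]).
    split => /=; first by apply: nbhsx_ballx; rewrite divr_gt0.
    apply: filterS2 (@nbhs_right_gt R 0) (@nbhs_right_lt R 0 (r / 2) _) => [x x0 xr|].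
      by apply/andP.
    by rewrite divr_gt0.
  move=> [x delta] /= [tx /andP[_ dr]] t' xt'.
  have h1 : `|c t - c x| <= eta / 2.
    by apply: rP; apply: le_ball tx; rewrite ler_pdivrMr// ler_peMr ?ltW// ltr1n.
  have h2 : `|c t - c t'| <= eta / 2.
    apply: rP; rewrite /ball/= -(subrK x t) -addrA; apply: le_lt_trans (ler_normD _ _) _.
    by rewrite [ltRHS](splitr r); apply: ltrD; [exact: tx|exact: le_lt_trans dr].
  rewrite -(subrK (c t) (c x)) -addrA; apply: le_trans (ler_normD _ _) _.
  by rewrite [leRHS](splitr eta) distrC; apply: lerD.
by apply: filterS => delta h t t' tT tt'; exact: (h t tT).
Qed.

Section simple_maps.
Context {R : realType} (X : prespace R) (T : R).
Local Notation leb := (@lebesgue_measure R).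
Local Notation V := (@ps_mem _ X).
Hypothesis V0 : V 0.
Hypothesis VZD : forall (a : R) x y, V x -> V y -> V (a *: x + y).

Definition linear_form (l : X -> R) := forall (a : R) x y, V x -> V y ->
  l (a *: x + y) = a * l x + l y.

Lemma mem_sum n (a : 'I_n -> R) (v : 'I_n -> X) : (forall i, V (v i)) ->
  V (\sum_(i < n) a i *: v i).
Proof.
move=> Vv; elim: n a v Vv => [|n IH] a v Vv; first by rewrite big_ord0.
by rewrite big_ord_recl; apply: VZD => //; exact: IH.
Qed.

Lemma linear_form0 l : linear_form l -> l 0 = 0.
Proof.
move=> lin; have := lin 1 0 0 V0 V0; rewrite scale1r addr0 mul1r => /esym/eqP.
by rewrite -subr_eq0 addrK => /eqP.
Qed.

Lemma linear_formB l x y : linear_form l -> V x -> V y -> l (x - y) = l x - l y.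
Proof. by move=> lin Vx Vy; rewrite addrC -scaleN1r lin// mulN1r addrC. Qed.

Lemma mem_B x y : V x -> V y -> V (x - y).
Proof. by move=> Vx Vy; rewrite addrC -scaleN1r; exact: VZD. Qed.

Lemma linear_form_sum l n (a : 'I_n -> R) (v : 'I_n -> X) : linear_form l ->
  (forall i, V (v i)) -> l (\sum_(i < n) a i *: v i) = \sum_(i < n) a i * l (v i).
Proof.
move=> lin Vv; elim: n a v Vv => [|n IH] a v Vv.
  by rewrite !big_ord0 linear_form0.
by rewrite !big_ord_recl lin ?IH//; exact: mem_sum.
Qed.

Lemma sm_set_measurable (s : simple_map X) (i : 'I_(sm_size s)) : measurable (sm_set i).
Proof. by case: s i. Qed.

Lemma sm_val_mem (s : simple_map X) (i : 'I_(sm_size s)) : V (sm_val i).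
Proof. by case: s i. Qed.

Lemma sm_eval_mem s t : V (sm_eval s t).
Proof. by apply: mem_sum => i; exact: sm_val_mem. Qed.

Lemma sm_integral_mem s : V (sm_integral T s).
Proof. by apply: mem_sum => i; exact: sm_val_mem. Qed.

Lemma sm_eval_form l s t : linear_form l ->
  l (sm_eval s t) = \sum_(i < sm_size s) (\1_(sm_set i) t : R) * l (sm_val i).
Proof. by move=> lin; apply: linear_form_sum => // i; exact: sm_val_mem. Qed.

Lemma indic_integral (A : set R) : measurable A ->
  leb.-integrable `]0, T[ (EFin \o (\1_A : R -> R)) /\
  \int[leb]_(t in `]0, T[) (\1_A t : R) = fine (leb (A `&` `]0, T[)).
Proof.
move=> mA; split; last by rewrite /Rintegral integral_indic.
apply/integrableP; split.
  by apply/measurable_EFinP; exact: measurable_indic.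
have -> : (\int[leb]_(t in `]0%R, T[) `|(EFin \o (\1_A : R -> R)) t| =
    \int[leb]_(t in `]0%R, T[) (\1_A t)%:E)%E.
  by apply: eq_integral => t _ /=; rewrite ger0_norm.
rewrite integral_indic//; apply: le_lt_trans (lebesgue_itvoo_lty 0 T).
by apply: le_measure; rewrite ?inE//; exact: measurableI.
Qed.

Lemma sm_eval_integral l s : linear_form l ->
  [/\ measurable_fun setT (fun t : measurableTypeR R => l (sm_eval s t)),
      ae_integrable leb `]0, T[ (fun t => l (sm_eval s t)) &
      \int[leb]_(t in `]0, T[) l (sm_eval s t) = l (sm_integral T s)].
Proof.
move=> lin; have E t := sm_eval_form s t lin.
have mi i := @indic_integral _ (@sm_set_measurable s i).
have fi i : ae_integrable leb `]0, T[
    (fun t => l (sm_val i) * (\1_(@sm_set _ _ s i) t : R)).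
  by apply: ae_integrableZ => //; apply: integrable_ae_integrable; have [] := mi i.
have [I1 E1] := ae_integrable_sum (mu := leb) (D := `]0, T[%classic) (measurable_itv _) fi.
have FE : (fun t => l (sm_eval s t)) = fun t => \sum_(i < sm_size s)
    (l (sm_val i) * (\1_(@sm_set _ _ s i) t : R)).
  by apply/funext => t; rewrite E; apply: eq_bigr => i _; rewrite mulrC.
split.
- rewrite FE; apply: measurable_sum => i.
  apply: measurable_funM; first exact: measurable_cst.
  by apply: measurable_indic; exact: sm_set_measurable.
- by rewrite FE.
- rewrite FE E1 linear_form_sum//; last by move=> i; exact: sm_val_mem.
  apply: eq_bigr => i _; rewrite ae_RintegralZ//; last first.
    by apply: integrable_ae_integrable; have [] := mi i.
  by have [_ ->] := mi i; rewrite mulrC.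
Qed.

Hypothesis norm_ge0 : forall x : X, (0 <= ps_norm x)%E.

Lemma strongly_measurable_form (l : X -> R) f : linear_form l ->
  (forall x, V x -> (`|l x|%:E <= ps_norm x)%E) -> strongly_measurable T f ->
  ae_measurable leb `]0, T[ (fun t => l (f t)).
Proof.
move=> lin lle [s sP].
apply: (ae_measurable_lim (mu := leb) (f_ := fun n t => l (sm_eval (s n) t))) => //.
  move=> n; apply: measurable_ae_measurable; apply: measurable_funTS.
  by have [] := sm_eval_integral (s n) lin.
refine (ae_leb1 sP _) => t h /h[Vf ft].
apply/subr_cvg0.
have : (fun n => `|l (f t - sm_eval (s n) t)|%:E) @ \oo --> 0%E.
  apply: (squeeze_cvge (f := cst 0%E) (h := fun n => ps_norm (f t - sm_eval (s n) t))).
  - apply: nearW => n; rewrite lee_fin normr_ge0 lle//.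
    by apply: mem_B => //; exact: sm_eval_mem.
  - exact: cvg_cst.
  - exact: ft.
move=> /fine_cvg; rewrite /comp/= => h0.
apply/norm_cvg0P; rewrite (_ : (fun n => _) =
  fun n => `|l (f t - sm_eval (s n) t)|)//.
apply/funext => n; rewrite distrC (linear_formB lin Vf (sm_eval_mem _ _)); exact: erefl.
Qed.

(** [l] commutes with the integral of a simple map, and domination by the norm controls both
    approximation errors. The norm of [f t - sm_eval (s n) t] need not be measurable in [t]; its
    integral is used only as an upper bound for that of the scalar error. *)
Lemma bochner_integral_form (l : X -> R) f I : linear_form l ->
  (forall x, V x -> (`|l x|%:E <= ps_norm x)%E) -> is_bochner_integral T f I ->
  ae_integrable leb `]0, T[ (fun t => l (f t)) /\
  \int[leb]_(t in `]0, T[) l (f t) = l I.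
Proof.
move=> lin lle [VI fm [s [s0 sI]]].
have mf := strongly_measurable_form lin lle fm.
have [s' s'P] := fm.
have Vf : {ae leb, forall t, t \in `]0, T[ -> V (f t)}.
  by refine (ae_leb1 s'P _) => t h /h[].
have si n := sm_eval_integral (s n) lin.
have mD : measurable (`]0, T[%classic : set (measurableTypeR R)) by exact: measurable_itv.
have le n : (\int[leb]_(t in `]0%R, T[) `|l (f t) - l (sm_eval (s n) t)|%:E <=
    \int[leb]_(t in `]0%R, T[) ps_norm (f t - sm_eval (s n) t))%E.
  apply: ge0_ae_integral_le => //.
  refine (ae_leb1 Vf _) => t h /h Vft.
  rewrite -(linear_formB lin Vft (sm_eval_mem _ _)); apply: lle.
  by apply: mem_B => //; exact: sm_eval_mem.
(* Convergence to 0 in the extended reals makes these integrals finite from some index on. *)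
have [N _ NP] : \forall n \near \oo,
    (\int[leb]_(t in `]0%R, T[) ps_norm (f t - sm_eval (s n) t) < +oo)%E.
  have /fine_cvgP[fin _] := s0; apply: filterS fin => n fn.
  by rewrite ltey_eq fn.
have msub n : ae_measurable leb `]0, T[ (fun t => l (f t) - l (sm_eval (s n) t)).
  have [m _ _] := si n; apply: (ae_measurable_comp2 (mu := leb) (F := fun x y => x - y)) => //.
    by move=> u v mu_ mv; exact: measurable_funB.
  by apply: measurable_ae_measurable; apply: measurable_funTS.
have isub n : (N <= n)%N -> ae_integrable leb `]0, T[ (fun t => l (f t) - l (sm_eval (s n) t)).
  move=> Nn; apply: ae_integrable_ge0 => //.
  by exact: le_lt_trans (le n) (NP n Nn).
have fi : ae_integrable leb `]0, T[ (fun t => l (f t)).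
  have [_ i _] := si N; have := ae_integrableD mD (isub N (leqnn N)) i.
  by apply: ae_integrable_eq; apply: ae_lebT => t _; rewrite subrK.
split => //; apply/eqP; rewrite -subr_eq0 -normr_le0.
rewrite -lee_fin.
have lim0 : (\int[leb]_(t in `]0%R, T[) ps_norm (f t - sm_eval (s n) t) +
    ps_norm (sm_integral T (s n) - I))%E @[n --> \oo] --> 0%E.
  by rewrite -[X in _ --> X]adde0; apply: cvgeD.
rewrite -[leRHS](cvg_lim _ lim0)//; apply: lime_ge; first by apply/cvg_ex; exists 0%E.
exists N => // n Nn.
have [_ i e1] := si n.
have -> : \int[leb]_(t in `]0, T[) l (f t) - l I =
    \int[leb]_(t in `]0, T[) (l (f t) - l (sm_eval (s n) t)) + l (sm_integral T (s n) - I).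
  rewrite ae_RintegralB// e1 (linear_formB lin (sm_integral_mem _) VI).
  by rewrite addrA subrK.
apply: (@le_trans _ _ ((`|\int[leb]_(t in `]0, T[) (l (f t) - l (sm_eval (s n) t))| +
  `|l (sm_integral T (s n) - I)|)%R%:E)); first by rewrite lee_fin ler_normD.
rewrite EFinD.
apply: leeD; last by apply: lle; apply: mem_B => //; exact: sm_integral_mem.
apply: le_trans (le n); rewrite ae_integrable_EFin//; last first.
  by apply: ae_integrable_norm => //; exact: isub.
by rewrite lee_fin; apply: ae_Rintegral_norm => //; exact: isub.
Qed.

End simple_maps.

(** * Prespaces whose norm comes from a bilinear form *)

Section hilbert_prespace.
Context {R : realType} (X : prespace R) (T : R).
Local Notation leb := (@lebesgue_measure R).
Local Notation V := (@ps_mem _ X).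
Hypothesis V0 : V 0.
Hypothesis VZD : forall (a : R) x y, V x -> V y -> V (a *: x + y).
Variable q : X -> X -> R.
Hypothesis q_lin : forall (a : R) x y z, V x -> V y -> V z ->
  q (a *: x + y) z = a * q x z + q y z.
Hypothesis qC : forall x y, q x y = q y x.
Hypothesis q_ge0 : forall x, V x -> 0 <= q x x.
Hypothesis ps_normE : forall x, V x -> ps_norm x = (Num.sqrt (q x x))%:E.
Let nx x := Num.sqrt (q x x).
Let VB := mem_B VZD.

Lemma nx_ge0 x : 0 <= nx x. Proof. exact: sqrtr_ge0. Qed.

Lemma nx_sqr x : V x -> nx x ^+ 2 = q x x.
Proof. by move=> Vx; rewrite sqr_sqrtr// q_ge0. Qed.

Lemma ps_norm_cvg0 f (s : nat -> simple_map X) t : V (f t) ->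
  ps_norm (f t - sm_eval (s n) t) @[n --> \oo] --> 0%E ->
  nx (f t - sm_eval (s n) t) @[n --> \oo] --> 0.
Proof.
move=> Vf h; have Vn n : V (f t - sm_eval (s n) t) by apply: VB => //; exact: sm_eval_mem.
by move: h; under eq_fun do rewrite (ps_normE (Vn _)); move/fine_cvg.
Qed.

Lemma nx_sqr_cvg0 f (s : nat -> simple_map X) t : V (f t) ->
  nx (f t - sm_eval (s n) t) @[n --> \oo] --> 0 ->
  q (f t - sm_eval (s n) t) (f t - sm_eval (s n) t) @[n --> \oo] --> 0.
Proof.
move=> Vf h; have Vn n : V (f t - sm_eval (s n) t) by apply: VB => //; exact: sm_eval_mem.
have : nx (f t - sm_eval (s n) t) * nx (f t - sm_eval (s n) t) @[n --> \oo] --> 0 * (0 : R).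
  exact: cvgM.
by rewrite mul0r; under eq_fun do rewrite -expr2 nx_sqr//.
Qed.

(** Between simple maps the form is a finite sum of indicators with real coefficients. Boundedness
    passes to the limit after the difference is expanded into three terms, each containing an
    approximation error. *)
Lemma form_ae_measurable (b : X -> X -> R) (C : R) f g :
  (forall z, V z -> linear_form (b ^~ z)) -> (forall z, V z -> linear_form (b z)) ->
  (forall x y, V x -> V y -> `|b x y| <= C * nx x * nx y) ->
  strongly_measurable T f -> strongly_measurable T g ->
  ae_measurable leb `]0, T[ (fun t => b (f t) (g t)).
Proof.
move=> linl linr bC [s sP] [r rP].
apply: (ae_measurable_lim (mu := leb)
  (f_ := fun n t => b (sm_eval (s n) t) (sm_eval (r n) t))) => //.
  move=> n; apply: measurable_ae_measurable; apply: measurable_funTS.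
  have -> : (fun t => b (sm_eval (s n) t) (sm_eval (r n) t)) =
      fun t => \sum_(i < sm_size (s n)) (\1_(sm_set i) t : R) *
        \sum_(j < sm_size (r n)) (\1_(sm_set j) t : R) * b (sm_val i) (sm_val j).
    apply/funext => t.
    rewrite (sm_eval_form V0 VZD _ _ (linl _ (sm_eval_mem V0 VZD _ _))).
    apply: eq_bigr => i _; congr (_ * _).
    by rewrite (sm_eval_form V0 VZD _ _ (linr _ (sm_val_mem _))).
  apply: measurable_sum => i; apply: measurable_funM.
    by apply: measurable_indic; exact: sm_set_measurable.
  apply: measurable_sum => j; apply: measurable_funM; last exact: measurable_cst.
  by apply: measurable_indic; exact: sm_set_measurable.
refine (ae_leb2 sP rP _) => t hs hr tT; have [Vf fs] := hs tT; have [Vg gr] := hr tT.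
have {fs} fs := ps_norm_cvg0 Vf fs; have {gr} gr := ps_norm_cvg0 Vg gr.
apply/subr_cvg0; apply/norm_cvg0P.
apply: (@squeeze_cvgr _ _ _ _ (cst 0) (fun n =>
  C * nx (f t - sm_eval (s n) t) * nx (g t) + C * nx (f t) * nx (g t - sm_eval (r n) t) +
  C * nx (f t - sm_eval (s n) t) * nx (g t - sm_eval (r n) t))).
- apply: nearW => n; rewrite normr_ge0/=.
  have Vs := sm_eval_mem V0 VZD (s n) t; have Vr := sm_eval_mem V0 VZD (r n) t.
  have Vfs := VB Vf Vs; have Vgr := VB Vg Vr.
  have -> : b (sm_eval (s n) t) (sm_eval (r n) t) - b (f t) (g t) =
      - b (f t - sm_eval (s n) t) (g t) - b (f t) (g t - sm_eval (r n) t) +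
      b (f t - sm_eval (s n) t) (g t - sm_eval (r n) t).
    rewrite !(linear_formB (l := b ^~ _) (linl _ _))// !(linear_formB (linr _ _))//.
    ring.
  apply: le_trans (ler_normD _ _) _; apply: lerD; last exact: bC.
  by apply: le_trans (ler_normB _ _) _; rewrite normrN; apply: lerD; exact: bC.
- exact: cvg_cst.
- rewrite -[X in _ --> X](_ : C * 0 * nx (g t) + C * nx (f t) * 0 + C * 0 * 0 = 0);
    last by rewrite !mulr0 mul0r !addr0.
  apply: cvgD; first apply: cvgD.
  + by apply: cvgM; [apply: cvgM; [exact: cvg_cst|exact: fs]|exact: cvg_cst].
  + by apply: cvgM; [exact: cvg_cst|exact: gr].
  + by apply: cvgM; [apply: cvgM; [exact: cvg_cst|exact: fs]|exact: gr].
Qed.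

Lemma sm_strongly_measurable (s : simple_map X) : strongly_measurable T (sm_eval s).
Proof.
exists (fun=> s); apply: ae_lebT => t _; split; first exact: sm_eval_mem.
rewrite subrr ps_normE//.
have -> : q 0 0 = 0.
  by rewrite -[X in q X _](scale0r (0 : X)) -[X in q X _]addr0 q_lin// mul0r add0r;
  have := q_lin 1 V0 V0 V0; rewrite scale1r addr0 mul1r => /esym/eqP; rewrite -subr_eq0 addrK => /eqP.
by rewrite sqrtr0; exact: cvg_cst.
Qed.

Lemma q_cauchy_schwarz x y : V x -> V y -> `|q x y| <= 1 * nx x * nx y.
Proof.
move=> Vx Vy; rewrite mul1r; apply: norm_le_mul; try exact: nx_ge0.
by rewrite !nx_sqr//; exact: (hp_cauchy_schwarz VZD q_lin qC q_ge0).
Qed.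

Lemma q_linear z : V z -> linear_form (q ^~ z).
Proof. by move=> Vz a x y Vx Vy; exact: q_lin. Qed.

Lemma q_linearr z : V z -> linear_form (q z).
Proof. by move=> Vz a x y Vx Vy; rewrite ![q z _]qC; exact: q_lin. Qed.

Lemma q_ae_measurable f g : strongly_measurable T f -> strongly_measurable T g ->
  ae_measurable leb `]0, T[ (fun t => q (f t) (g t)).
Proof.
by apply: (form_ae_measurable (C := 1)); [exact: q_linear|exact: q_linearr|
  exact: q_cauchy_schwarz].
Qed.

Lemma q_subr x y : V x -> V y -> q (x - y) (x - y) = q x x - 2 * q x y + q y y.
Proof.
move=> Vx Vy; rewrite (linear_formB (q_linear _))//; last exact: VB.
rewrite !(linear_formB (q_linearr _))// (qC y x); ring.
Qed.

Lemma q_le2 (a : R) x y : V x -> V y ->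
  q (a *: x + y) (a *: x + y) <= 2 * a ^+ 2 * q x x + 2 * q y y.
Proof. exact: (hp_le2 VZD q_lin qC q_ge0). Qed.

Lemma q_leB x y : V x -> V y -> q (x - y) (x - y) <= 2 * q x x + 2 * q y y.
Proof.
move=> Vx Vy; have := q_le2 (-1) Vy Vx; rewrite scaleN1r [- y + x]addrC sqrrN expr1n mulr1.
by rewrite [2 * q y y + _]addrC.
Qed.

Lemma q_diff_ae_measurable f g : strongly_measurable T f -> strongly_measurable T g ->
  ae_measurable leb `]0, T[ (fun t => q (f t - g t) (f t - g t)).
Proof.
move=> fm gm; have [s sP] := fm; have [r rP] := gm.
apply: (ae_measurable_eq (mu := leb) (f := fun t => (q (f t) (f t) + (-2) * q (f t) (g t)) + q (g t) (g t))).
  refine (ae_leb2 sP rP _) => t hs hr tT; have [Vf _] := hs tT; have [Vg _] := hr tT.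
  by rewrite q_subr// mulNr.
apply: ae_measurableD; last exact: q_ae_measurable.
apply: ae_measurableD; first exact: q_ae_measurable.
apply: ae_measurableM; last exact: q_ae_measurable.
by apply: measurable_ae_measurable; exact: measurable_cst.
Qed.

Lemma bochner_L2_integrable f : bochner_L2 T f ->
  ae_integrable leb `]0, T[ (fun t => q (f t) (f t)).
Proof.
move=> [fm fy]; have [s sP] := fm.
apply: ae_integrable_ge0 => //; first exact: q_ae_measurable.
apply: le_lt_trans fy; apply: ge0_ae_integral_le => //.
  move=> t _; rewrite expe2; case: (ps_norm (f t)) => [r||].
  - by rewrite -EFinM lee_fin -expr2 sqr_ge0.
  - by rewrite mulyy.
  - by rewrite mulNyNy.
refine (ae_leb1 sP _) => t h /h[Vf _].
by rewrite ps_normE// -EFin_expe nx_sqr// ger0_norm// q_ge0.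
Qed.

End hilbert_prespace.

(** Clipping to [0, 1] does not increase the distance to 0 or 1, and a distance at most 1 dominates
    its square. An L^1 approximation of an indicator thus becomes an L^2 one. *)
Lemma clip_le {R : realType} (a g : R) : (a == 0) || (a == 1) ->
  (a - Num.max 0 (Num.min 1 g)) ^+ 2 <= `|a - g|.
Proof.
move=> a01; have [g0|g0] := leP g 0.
  rewrite min_r; last exact: le_trans g0 ler01.
  rewrite max_l//; case/orP: a01 => /eqP ->; rewrite ler_normr; apply/orP; left; nra.
have [g1|g1] := leP 1 g.
  rewrite max_r//; case/orP: a01 => /eqP ->; rewrite ler_normr; apply/orP; right; nra.
rewrite max_r ?(ltW g0)//.
by case/orP: a01 => /eqP ->; rewrite ler_normr; apply/orP; [right|left]; nra.
Qed.

(** * Simple and continuous approximation in L^2(0, T; X) *)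

Section hilbert_approximation.
Context {R : realType} (X : prespace R) (T : R).
Local Notation leb := (@lebesgue_measure R).
Local Notation V := (@ps_mem _ X).
Hypothesis V0 : V 0.
Hypothesis VZD : forall (a : R) x y, V x -> V y -> V (a *: x + y).
Variable q : X -> X -> R.
Hypothesis q_lin : forall (a : R) x y z, V x -> V y -> V z ->
  q (a *: x + y) z = a * q x z + q y z.
Hypothesis qC : forall x y, q x y = q y x.
Hypothesis q_ge0 : forall x, V x -> 0 <= q x x.
Hypothesis ps_normE : forall x, V x -> ps_norm x = (Num.sqrt (q x x))%:E.
Let nx x := Num.sqrt (q x x).

Definition sm_restr (s : simple_map X) (E : set R) (mE : measurable E) : simple_map X :=
  @SimpleMap _ X (sm_size s) (fun i => sm_set i `&` E) (@sm_val _ X s)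
    (fun i => measurableI _ _ (@sm_set_measurable _ X s i) mE) (@sm_val_mem _ X s).

Lemma sm_restrE s (E : set R) (mE : measurable E) t :
  sm_eval (sm_restr s mE) t = (\1_E t : R) *: sm_eval s t.
Proof.
rewrite /sm_eval scaler_sumr; apply: eq_bigr => i _ /=.
by rewrite scalerA indicI /= mulrC.
Qed.

(* Cutting the approximants off where their norm exceeds twice that of f keeps the
   pointwise convergence and makes the errors dominated by 10 times the squared norm. *)
Lemma bochner_L2_simple f : bochner_L2 T f -> exists s : nat -> simple_map X,
  {ae leb, forall t, t \in `]0, T[ -> V (f t) /\
     q (f t - sm_eval (s n) t) (f t - sm_eval (s n) t) @[n --> \oo] --> 0} /\
  (forall n, ae_integrable leb `]0, T[
     (fun t => q (f t - sm_eval (s n) t) (f t - sm_eval (s n) t))) /\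
  \int[leb]_(t in `]0, T[) q (f t - sm_eval (s n) t) (f t - sm_eval (s n) t)
     @[n --> \oo] --> 0.
Proof.
move=> f2; have [fm _] := f2.
have [h hi fh] := bochner_L2_integrable V0 VZD q_lin qC q_ge0 ps_normE f2.
have [s sP] := fm.
have mh : measurable_fun (`]0, T[%classic : set (measurableTypeR R)) h.
  by move: hi => /measurable_int/measurable_EFinP.
have ms n : measurable_fun setT (fun t : measurableTypeR R => q (sm_eval (s n) t) (sm_eval (s n) t)).
  have -> : (fun t => q (sm_eval (s n) t) (sm_eval (s n) t)) =
      fun t => \sum_(i < sm_size (s n)) (\1_(sm_set i) t : R) *
        \sum_(j < sm_size (s n)) (\1_(sm_set j) t : R) * q (sm_val i) (sm_val j).
    apply/funext => t.
    rewrite (sm_eval_form V0 VZD _ _ (q_linear q_lin (sm_eval_mem V0 VZD _ _))).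
    apply: eq_bigr => i _; congr (_ * _).
    by rewrite (sm_eval_form V0 VZD _ _ (q_linearr q_lin qC (sm_val_mem _))).
  apply: measurable_sum => i; apply: measurable_funM.
    by apply: measurable_indic; exact: sm_set_measurable.
  apply: measurable_sum => j; apply: measurable_funM; last exact: measurable_cst.
  by apply: measurable_indic; exact: sm_set_measurable.
(* Twice the norm is four times the form; the measurable version [h] of [q (f t) (f t)] makes the
   set measurable. *)
pose E n : set R := `]0, T[ `&` [set t | q (sm_eval (s n) t) (sm_eval (s n) t) <= 4 * h t].
have mE n : measurable (E n : set (measurableTypeR R)).
  apply: measurable_fun_le => //; first exact: measurable_funTS.
  by apply: measurable_funM => //; exact: measurable_cst.
have mE' n : @measurable _ (measurableTypeR R) (E n) by exact: mE.
pose s' n := sm_restr (s n) (mE' n).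
pose D n t := q (f t - sm_eval (s' n) t) (f t - sm_eval (s' n) t).
pose D0 n t := q (f t - sm_eval (s n) t) (f t - sm_eval (s n) t).
have key : {ae leb, forall t, t \in `]0, T[ -> [/\ V (f t), D0 n t @[n --> \oo] --> 0,
    forall n, 0 <= D n t <= 10 * q (f t) (f t) & forall n, D n t <= 10 * D0 n t]}.
  refine (ae_leb2 sP fh _) => t hs hft tT; have [Vf fs] := hs tT.
  have {}fs := ps_norm_cvg0 V0 VZD ps_normE Vf fs.
  have D00 := nx_sqr_cvg0 V0 VZD qC q_ge0 Vf fs.
  suff H n : 0 <= D n t <= 10 * q (f t) (f t) /\ D n t <= 10 * D0 n t.
    by split => // n; have [] := H n.
  have Vs := sm_eval_mem V0 VZD (s n) t.
  have Vfs := mem_B VZD Vf Vs.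
  have p0 := q_ge0 Vf; have p1 := q_ge0 Vs; have p2 := q_ge0 Vfs.
  have p3 := q_leB VZD q_lin qC q_ge0 Vf Vs.
  have p4 := q_leB VZD q_lin qC q_ge0 Vf Vfs.
  have p5 : q (sm_eval (s n) t) (sm_eval (s n) t) <= 2 * q (f t) (f t) + 2 * D0 n t.
    by move: p4; rewrite /D0 opprB addrC subrK.
  rewrite /D /s' sm_restrE indicE; case: (boolP (t \in E n)) => tE.
    rewrite mulr1n scale1r -/(D0 n t); move: tE => /set_mem[_ /=]; rewrite -hft// => q4.
    rewrite -/(D0 n t) in p2 p3.
    by split; [apply/andP; split => //|]; lra.
  (* Off [E n] the error becomes [q (f t) (f t)], and this is below [D0 n t]: the form at
     [sm_eval (s n) t] exceeds 4 times [q (f t) (f t)], but by [p5] it is at most twice that plus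
     [2 * D0 n t]. *)
  rewrite mulr0n scale0r subr0.
  have : 4 * q (f t) (f t) < q (sm_eval (s n) t) (sm_eval (s n) t).
    by rewrite ltNge; apply/negP => q4; move/negP: tE; apply; apply/mem_set; split => //=; rewrite -hft.
  rewrite -/(D0 n t) in p2 p3 => q4.
  by split; [apply/andP; split => //|]; lra.
have mD n : ae_measurable leb `]0, T[ (D n).
  apply: (q_diff_ae_measurable V0 VZD q_lin qC q_ge0 ps_normE) => //.
  exact: (sm_strongly_measurable _ V0 VZD q_lin ps_normE).
have D0' : {ae leb, forall t, t \in `]0, T[ -> D n t @[n --> \oo] --> 0}.
  refine (ae_leb1 key _) => t ht tT; have [_ d0 dle dle'] := ht tT.
  apply: (@squeeze_cvgr _ _ _ _ (cst 0) (fun n => 10 * D0 n t)).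
  - by apply: nearW => n; have /andP[-> _] := dle n; rewrite dle'.
  - exact: cvg_cst.
  - by rewrite -[X in _ --> X](mulr0 10); apply: cvgM => //; exact: cvg_cst.
exists s'; split.
  refine (ae_leb2 key D0' _) => t ht ht' tT; split; [by have [] := ht tT|exact: ht'].
apply: (ae_dominated_cvg0 (mu := leb) (g := fun t => 10 * q (f t) (f t))) => //.
- apply: ae_integrableZ => //.
  exact: (bochner_L2_integrable V0 VZD q_lin qC q_ge0 ps_normE).
- refine (ae_leb1 key _) => t ht tT n; have [_ _ dle _] := ht tT.
  by have /andP[d0 d10] := dle n; rewrite ger0_norm.
Qed.

(** [q_le2] doubles the constant with each summand. This crude factor is harmless, as the number of
    summands is fixed before the coefficients are made small. *)
Lemma q_sum_le n (a : 'I_n -> R) (v : 'I_n -> X) : (forall i, V (v i)) ->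
  q (\sum_(i < n) a i *: v i) (\sum_(i < n) a i *: v i) <=
  2 ^+ n * \sum_(i < n) a i ^+ 2 * q (v i) (v i).
Proof.
elim: n a v => [|n IH] a v Vv.
  by rewrite !big_ord0 mulr0 (linear_form0 V0 (q_linear q_lin V0)).
rewrite !big_ord_recl; set w := \sum_(i < n) _; set S := \sum_(i < n) _.
have Vw : V w by apply: (mem_sum V0 VZD) => i; exact: Vv.
apply: le_trans (q_le2 VZD q_lin qC q_ge0 _ (Vv _) Vw) _.
have h : q w w <= 2 ^+ n * S by apply: IH => i; exact: Vv.
have p1 : 0 <= a ord0 ^+ 2 * q (v ord0) (v ord0) by rewrite mulr_ge0 ?sqr_ge0// q_ge0.
have p2 : (1 : R) <= 2 ^+ n by rewrite exprn_ege1// ler1n.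
rewrite (exprS 2 n); have := ler_wpM2r p1 p2; rewrite mul1r.
move: (a ord0 ^+ 2) (q (v ord0) (v ord0)) (q w w) (2 ^+ n) h => A B y z yS p3.
by lra.
Qed.

Lemma indic_approximation (A : set R) (eps : R) :
  measurable (A : set (measurableTypeR R)) -> 0 < eps ->
  exists c : R -> R, [/\ continuous c,
    ae_integrable leb `]0, T[ (fun t => ((\1_A t : R) - c t) ^+ 2) &
    \int[leb]_(t in `]0, T[) (((\1_A t : R) - c t) ^+ 2) <= eps].
Proof.
move=> mA eps0.
have mD : measurable (`]0, T[%classic : set (measurableTypeR R)) by exact: measurable_itv.
have [iA _] := indic_integral T mA.
have [g [cg gi g0]] := approximation_continuous_integrable mD (lebesgue_itvoo_lty 0 T) iA.
have di n : leb.-integrable `]0, T[ (EFin \o (fun t => (\1_A t : R) - g n t)).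
  exact: (integrableB mD iA (gi n)).
have : \forall n \near \oo, \int[leb]_(t in `]0, T[) `|(\1_A t : R) - g n t| < eps.
  move/fine_cvg : g0 => /cvgrPdist_lt/(_ _ eps0); apply: filterS => n.
  by rewrite /= sub0r normrN; apply: le_lt_trans; rewrite ler_norm.
case=> n _ /(_ n (leqnn n)) gn.
pose c t := Num.max 0 (Num.min 1 (g n t)).
have cc : continuous c.
  move=> t; apply: (@continuous_max _ _ (cst 0) (cst 1 \min g n)); first exact: cvg_cst.
  by apply: (@continuous_min _ _ (cst 1) (g n)); [exact: cvg_cst|exact: cg].
have le t : ((\1_A t : R) - c t) ^+ 2 <= `|(\1_A t : R) - g n t|.
  by rewrite indicE; case: (t \in A); rewrite ?mulr1n ?mulr0n /c; apply: clip_le;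
    rewrite ?eqxx ?orbT.
have mc : measurable_fun setT (fun t : measurableTypeR R => ((\1_A t : R) - c t) ^+ 2).
  apply: measurable_funX; apply: measurable_funB; first exact: measurable_indic.
  exact: continuous_measurable_fun.
have dn : ae_integrable leb `]0, T[ (fun t => `|(\1_A t : R) - g n t|).
  by apply: ae_integrable_norm => //; exact: integrable_ae_integrable.
have ci : ae_integrable leb `]0, T[ (fun t => ((\1_A t : R) - c t) ^+ 2).
  apply: (ae_integrable_le (mu := leb) (g := fun t => `|(\1_A t : R) - g n t|)) => //.
    by apply: measurable_ae_measurable; exact: measurable_funTS.
  by apply: ae_lebT => t _; rewrite ger0_norm ?sqr_ge0.
exists c; split => //; apply: le_trans (ltW gn).
by apply: ae_Rintegral_le => //; apply: ae_lebT => t _; exact: le.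
Qed.

(** A simple map close to [f] is taken first, then its indicators are replaced by continuous
    functions. A finite combination of fixed vectors with continuous coefficients is uniformly
    continuous on [[0, T]]. *)
Lemma bochner_L2_approximable f : bochner_L2 T f -> approximable V nx T f.
Proof.
move=> f2 eps eps0; have [s [s1 [s2 s3]]] := bochner_L2_simple f2.
have mD : measurable (`]0, T[%classic : set (measurableTypeR R)) by exact: measurable_itv.
pose D n t := q (f t - sm_eval (s n) t) (f t - sm_eval (s n) t).
have [n Dn] : exists n, \int[leb]_(t in `]0, T[) D n t <= eps / 4.
  have e4 : 0 < eps / 4 by rewrite divr_gt0.
  have /cvgrPdist_le/(_ _ e4)[n _ /(_ n (leqnn n))] := s3.
  by rewrite sub0r normrN => h; exists n; exact: le_trans (ler_norm _) h.
pose N := sm_size (s n).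
pose v i : X := @sm_val _ X (s n) i.
have Vv i : V (v i) by exact: sm_val_mem.
pose S := 2 ^+ N * (\sum_(i < N) q (v i) (v i) + 1).
have S0 : 0 < S.
  by rewrite mulr_gt0 ?exprn_gt0// ltr_wpDl// sumr_ge0// => i _; exact: q_ge0.
have [c cP] : {c : 'I_N -> R -> R & forall i, [/\ continuous (c i),
    ae_integrable leb `]0, T[ (fun t => ((\1_(@sm_set _ X (s n) i) t : R) - c i t) ^+ 2) &
    \int[leb]_(t in `]0, T[) (((\1_(@sm_set _ X (s n) i) t : R) - c i t) ^+ 2) <= eps / 4 / S]}.
  apply: (@choice _ _ (fun i (c : R -> R) => [/\ continuous c,
    ae_integrable leb `]0, T[ (fun t => ((\1_(@sm_set _ X (s n) i) t : R) - c t) ^+ 2) &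
    \int[leb]_(t in `]0, T[) (((\1_(@sm_set _ X (s n) i) t : R) - c t) ^+ 2) <= eps / 4 / S])) => i.
  apply: indic_approximation; first exact: sm_set_measurable.
  by rewrite !divr_gt0.
pose a i t := (\1_(@sm_set _ X (s n) i) t : R) - c i t.
pose w t := \sum_(i < N) c i t *: v i.
have Vw t : V (w t) by exact: (mem_sum V0 VZD).
pose M t := \sum_(i < N) a i t ^+ 2 * q (v i) (v i).
(* Dominates the form at [f t - w t]. The simple approximation and the smoothing of the indicators
   each contribute at most [eps / 2] to its integral. *)
pose e2 t := 2 * D n t + 2 * 2 ^+ N * M t.
have [Mi EM] : ae_integrable leb `]0, T[ M /\
    \int[leb]_(t in `]0, T[) M t = \sum_(i < N) q (v i) (v i) * \int[leb]_(t in `]0, T[) (a i t ^+ 2).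
  have fi i : ae_integrable leb `]0, T[ (fun t => a i t ^+ 2 * q (v i) (v i)).
    apply: (ae_integrable_eq (mu := leb) (f := fun t => q (v i) (v i) * a i t ^+ 2)).
      by apply: ae_lebT => t _; rewrite mulrC.
    by apply: ae_integrableZ => //; have [] := cP i.
  have [i1 ->] := ae_integrable_sum (mu := leb) mD fi; split => //.
  apply: eq_bigr => i _; rewrite -ae_RintegralZ//; last by have [] := cP i.
  by apply: eq_Rintegral => t _; rewrite mulrC.
have M0 t : 0 <= M t by apply: sumr_ge0 => i _; rewrite mulr_ge0 ?sqr_ge0// q_ge0.
have p2 : (0 : R) <= 2 * 2 ^+ N by rewrite mulr_ge0// exprn_ge0.
have e2i : ae_integrable leb `]0, T[ e2.
  by apply: ae_integrableD => //; apply: ae_integrableZ => //; exact: s2.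
have sE t : sm_eval (s n) t - w t = \sum_(i < N) a i t *: v i.
  by rewrite /sm_eval /w -sumrB; apply: eq_bigr => i _; rewrite -scalerBl.
have e2sq : {ae leb, forall t, t \in `]0, T[ -> 0 <= D n t /\ Num.sqrt (e2 t) ^+ 2 = e2 t}.
  refine (ae_leb1 s1 _) => t ht tT; have [Vf _] := ht tT.
  have d0 : 0 <= D n t by apply: q_ge0; apply: (mem_B VZD) => //; exact: sm_eval_mem.
  split => //; rewrite sqr_sqrtr// addr_ge0 ?mulr_ge0//.
exists w, (fun t => Num.sqrt (e2 t)); split => //.
- refine (ae_leb2 s1 e2sq _) => t ht h2 tT; have [Vf _] := ht tT; have [d0 _] := h2 tT.
  apply: ler_wsqrtr; rewrite /e2.
  have -> : f t - w t = 1 *: (f t - sm_eval (s n) t) + (sm_eval (s n) t - w t).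
    by rewrite scale1r addrA subrK.
  have Vs := sm_eval_mem V0 VZD (s n) t.
  apply: le_trans (q_le2 VZD q_lin qC q_ge0 1 (mem_B VZD Vf Vs) (mem_B VZD Vs (Vw t))) _.
  rewrite expr1n mulr1 -/(D n t) lerD2l -mulrA ler_wpM2l// sE.
  exact: q_sum_le.
- apply: (ae_integrable_eq (mu := leb) (f := e2)) => //.
  by refine (ae_leb1 e2sq _) => t h /h[_ ->].
- have -> : \int[leb]_(t in `]0, T[) (Num.sqrt (e2 t) ^+ 2) = \int[leb]_(t in `]0, T[) e2 t.
    by apply: ae_Rintegral_eq => //; refine (ae_leb1 e2sq _) => t h /h[].
  have i1 := ae_integrableZ (mu := leb) 2 mD (s2 n).
  have i2 := ae_integrableZ (mu := leb) (2 * 2 ^+ N) mD Mi.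
  rewrite (ae_RintegralD mD i1 i2) (ae_RintegralZ 2 mD (s2 n)) (ae_RintegralZ _ mD Mi) EM.
  have : 2 ^+ N * \sum_(i < N) q (v i) (v i) * \int[leb]_(t in `]0, T[) (a i t ^+ 2) <= eps / 4.
    apply: (@le_trans _ _ (2 ^+ N * (\sum_(i < N) q (v i) (v i) * (eps / 4 / S)))).
      rewrite ler_wpM2l ?exprn_ge0//; apply: ler_sum => i _.
      by rewrite ler_wpM2l ?q_ge0//; have [] := cP i.
    rewrite -mulr_suml.
    have -> : 2 ^+ N * ((\sum_(i < N) q (v i) (v i)) * (eps / 4 / S)) =
        eps / 4 * ((2 ^+ N * \sum_(i < N) q (v i) (v i)) / S) by ring.
    apply: ler_piMr; first by rewrite divr_ge0// ltW.
    by rewrite ler_pdivrMr// mul1r /S ler_wpM2l ?exprn_ge0// lerDl.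
  move: (\sum_(i < N) _ * _) Dn (2 ^+ N) => x; move: (\int[leb]_(t in _) _) => y yle z; lra.
- move=> eta eta0.
  (* Chosen so that [theta ^+ 2 * S] is at most [eta ^+ 2]. *)
  pose theta := eta / (S + 1).
  have S1 : 0 < S + 1 by rewrite addr_gt0.
  have th0 : 0 < theta by rewrite divr_gt0.
  have unif : \forall delta \near 0^'+, forall i t t', t \in `[0, T] -> `|t - t'| <= delta ->
      `|c i t - c i t'| <= theta.
    apply: filter_forall => i; apply: heine_cantor => //; by have [] := cP i.
  have [delta [/= d0 dP]] := filter_ex (filterI (@nbhs_right_gt R 0) unif).
  exists delta => // t t' tT _ tt'.
  have -> : w t - w t' = \sum_(i < N) (c i t - c i t') *: v i.
    by rewrite /w -sumrB; apply: eq_bigr => i _; rewrite -scalerBl.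
  rewrite /nx -[leRHS]gtr0_norm// -sqrtr_sqr; apply: ler_wsqrtr.
  apply: le_trans (q_sum_le _ Vv) _.
  apply: (@le_trans _ _ (2 ^+ N * (\sum_(i < N) theta ^+ 2 * q (v i) (v i)))).
    rewrite ler_wpM2l ?exprn_ge0//; apply: ler_sum => i _; rewrite ler_wpM2r ?q_ge0//.
    rewrite -real_normK ?num_real// lerXn2r ?nnegrE ?(ltW th0)//; exact: dP.
  rewrite -mulr_sumr mulrCA.
  apply: (@le_trans _ _ (theta ^+ 2 * S)).
    by rewrite ler_wpM2l ?sqr_ge0// /S ler_wpM2l ?exprn_ge0// lerDl.
  rewrite /theta expr_div_n -mulrA ler_piMr ?sqr_ge0// mulrC ler_pdivrMr ?exprn_gt0// mul1r.
  by move: (S) S0 => z z0; nra.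
Qed.

End hilbert_approximation.

(** * Variational solutions *)

Section evolution.
Context {R : realType} {H : hilbertType R}.
Variables (nu : probability (borel H) R) (e : nat -> H).
Hypothesis he : is_orthonormal_basis e.
Variable Qh : {linear H -> H}.
Hypothesis Q_closable : sqrtQ_D_closable nu e Qh.
Local Notation nn := (nuc nu).
Local Notation X := (Hnu nu).
Local Notation V := (W12mem nu e Qh).
Local Notation vq := (vq nu e Qh).
Local Notation vnorm := (vnorm nu e Qh).
Local Notation leb := (@lebesgue_measure R).
Local Notation W := (W12 nu e Qh).
Local Notation W' := (W12_dual nu e Qh).
Local Notation LV := (@linear_form R W).

Lemma W12_mem0 : @ps_mem R W 0.
Proof. exact: (W12mem0 nu he Qh). Qed.

Lemma W12_memZD (a : R) (x y : W) : ps_mem x -> ps_mem y -> ps_mem (a *: x + y).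
Proof. exact: (W12mem_ZD he a). Qed.

Lemma W12_lin (a : R) (x y z : W) : ps_mem x -> ps_mem y -> ps_mem z ->
  vq (a *: x + y) z = a * vq x z + vq y z.
Proof. exact: (vq_lin he Q_closable a). Qed.

Lemma W12_form_ge0 (x : W) : ps_mem x -> 0 <= vq x x.
Proof. by move=> _; exact: vq_ge0. Qed.

Lemma W12_normE (x : W) : ps_mem x -> ps_norm x = (Num.sqrt (vq x x))%:E.
Proof. exact: (W12_norm he). Qed.

Lemma W12_dual_mem0 : @ps_mem R W' 0.
Proof.
split=> [a f g _ _|]; first by rewrite -[RHS]/(a * 0 + 0) mulr0 addr0.
by exists 0 => f _; rewrite normr0 mul0e.
Qed.

Lemma W12_dual_memZD (a : R) (x y : W') : ps_mem x -> ps_mem y -> ps_mem (a *: x + y).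
Proof.
move=> [lx [Cx bx]] [ly [Cy by_]]; split.
  move=> b f g Vf Vg.
  rewrite -[LHS]/(a * x (b *: f + g) + y (b *: f + g)) lx// ly//.
  rewrite -[(a *: x + y) f]/(a * x f + y f) -[(a *: x + y) g]/(a * x g + y g).
  by move: (x f) (x g) (y f) (y g) => p1 p2 p3 p4; ring.
exists (`|a| * Cx + Cy) => f Vf.
have := by_ f Vf; have := bx f Vf; rewrite W12_normE// -!EFinM !lee_fin => h1 h2.
rewrite -[(a *: x + y) f]/(a * x f + y f).
apply: le_trans (ler_normD _ _) _; rewrite normrM mulrDl; apply: lerD => //.
by rewrite -mulrA ler_wpM2l.
Qed.

Section evaluation.
Variables (psi : H -> R) (Vpsi : V psi).

(** Evaluation at [psi], scaled so as to be dominated by the dual norm, the normalisation required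
    by [bochner_integral_form]. *)
Definition evaluation (l : W') : R := (vnorm psi + 1)^-1 * l psi.

Lemma evaluation_linear : linear_form evaluation.
Proof.
move=> a x y _ _; rewrite /evaluation -[(a *: x + y) psi]/(a * x psi + y psi).
by move: (x psi) (y psi) => p1 p2; ring.
Qed.

Lemma evaluation_le (l : W') : ps_mem l -> (`|evaluation l|%:E <= ps_norm l)%E.
Proof.
move=> [lin _]; have lin' (a : R) : (l : W -> R^o) (fun x => a * psi x) = a * l psi.
  by apply: (linear_homogeneous (nu := nu) (e := e) (Qh := Qh) (l := l)) => // b f g; exact: lin.
have p0 : 0 < vnorm psi + 1 by rewrite ltr_wpDl ?vnorm_ge0.
have := dual_eval_le he Q_closable Vpsi lin'.
rewrite /evaluation normrM gtr0_norm ?invr_gt0// EFinM -lee_pdivrMl ?invr_gt0 ?invrK//.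
Qed.

End evaluation.

Lemma cst_strongly_measurable (T : R) (psi : W) : ps_mem psi ->
  strongly_measurable T (fun=> psi).
Proof.
move=> Vpsi; pose s := @SimpleMap _ W 1 (fun=> setT) (fun=> psi)
  (fun=> measurableT) (fun=> Vpsi).
have -> : (fun=> psi) = sm_eval s.
  by apply/funext => t; rewrite /sm_eval big_ord1 indicE in_setT scale1r.
exact: (sm_strongly_measurable T W12_mem0 W12_memZD W12_lin W12_normE).
Qed.

Lemma continuous_into_time_continuous (T : R) (f : R -> H -> R) :
  continuous_into (X := Lp_real nu 2%:E) T f ->
  (forall t, t \in `[0, T] -> L2R nn (f t)) /\
  time_continuous (W := H -> R^o) (ipR nn) T f.
Proof.
move=> cf; have fL t : t \in `[0, T] -> L2R nn (f t).
  by move=> tT; apply/L2R_Lfun; have [] := cf t tT.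
split => // t tT; have [_ ct] := cf t tT.
have nE s : s \in `[0, T] -> ps_norm ((f s : Lp_real nu 2%:E) - f t) =
    (Num.sqrt (ipR nn (fun x => f s x - f t x) (fun x => f s x - f t x)))%:E.
  by move=> sT; exact: (Lnorm2_ipR (L2R_B (fL s sT) (fL t tT))).
have : Num.sqrt (ipR nn (f s - f t) (f s - f t)) @[s --> within `[0, T] (nbhs t)] --> 0.
  move/fine_cvg : ct; apply: cvg_trans; apply: near_eq_cvg.
  by rewrite near_withinE; apply: nearW => s sT; rewrite /comp nE.
move=> h; have : Num.sqrt (ipR nn (f s - f t) (f s - f t)) *
    Num.sqrt (ipR nn (f s - f t) (f s - f t)) @[s --> within `[0, T] (nbhs t)] --> 0 * (0 : R).
  exact: cvgM.
by rewrite mul0r; under eq_fun do rewrite -expr2 sqr_sqrtr ?ipR_ge0//.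
Qed.

Lemma time_continuous_form (T : R) (f : R -> H -> R) psi :
  (forall t, t \in `[0, T] -> L2R nn (f t)) ->
  time_continuous (W := H -> R^o) (ipR nn) T f -> L2R nn psi ->
  {within `[0, T], continuous (fun t => ipR nn (f t) psi)}.
Proof.
move=> fL cf pL; apply/subspace_continuousP => t tT.
apply/subr_cvg0; apply/norm_cvg0P.
apply: (@squeeze_cvgr _ _ _ _ (cst 0) (fun s =>
  Num.sqrt (ipR nn (f s - f t) (f s - f t)) * Num.sqrt (ipR nn psi psi))).
- rewrite near_withinE; apply: nearW => s sT; rewrite normr_ge0/=.
  have -> : ipR nn (f s) psi - ipR nn (f t) psi = ipR nn (fun x => f s x - f t x) psi.
    by rewrite ![ipR nn _ psi]ipRC (ipR_subr pL (fL s sT) (fL t tT)).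
  apply: norm_le_mul; rewrite ?sqrtr_ge0// !sqr_sqrtr ?ipR_ge0//.
  exact: (ipR_cauchy_schwarz (L2R_B (fL s sT) (fL t tT)) pL).
- exact: cvg_cst.
- rewrite -[X in _ --> X](mul0r (Num.sqrt (ipR nn psi psi))).
  apply: cvgM; last exact: cvg_cst.
  rewrite -[X in _ --> X]sqrtr0.
  by apply: (@cvg_comp _ _ _ (fun s => ipR nn (f s - f t) (f s - f t)) (@Num.sqrt R) _ _ _
    (cf t tT)); exact: sqrt_continuous.
Qed.

Section right_hand_side.
(** Splitting the right-hand side into a bounded bilinear form [b] and a bounded functional [k]
    covers the state equation and the adjoint equation at once. *)
Variables (T : R) (rhs : W -> W') (b : W -> W -> R) (k : W -> R) (C : R).
Hypotheses (T0 : 0 < T) (C0 : 0 <= C).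
Hypothesis rhsE : forall x y, V x -> V y -> rhs x y = b x y + k y.
Hypothesis b_linl : forall z, V z -> LV (b ^~ z).
Hypothesis b_linr : forall z, V z -> LV (b z).
Hypothesis b_le : forall x y, V x -> V y -> `|b x y| <= C * vnorm x * vnorm y.
Hypothesis k_lin : LV k.
Hypothesis k_le : forall y, V y -> `|k y| <= C * vnorm y.

(** Evaluating the vector-valued weak derivative at [psi] gives a scalar weak derivative of the
    function [t |-> ipR nn (f t) psi]. That function is continuous on [[0, T]], so
    [weak_derivative_increment] turns the equation into an identity for increments. *)
Lemma evolution_evolves (f : R -> H -> R) : variational_evolution T rhs f ->
  evolves (W := H -> R^o) (L2R nn) V (ipR nn) vnorm T f (fun t y => b (f t) y + k y).
Proof.
move=> [cf f2 [g [g2 wd gE]]].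
have mD : measurable (`]0, T[%classic : set (measurableTypeR R)) by exact: measurable_itv.
have [fL tc] := continuous_into_time_continuous cf.
have fi := bochner_L2_integrable W12_mem0 W12_memZD W12_lin (@vqC _ _ nu e Qh)
  W12_form_ge0 W12_normE f2.
have [fm _] := f2; have [s sP] := fm.
have Vf : {ae leb, forall t, t \in `]0, T[ -> V (f t)}.
  by refine (ae_leb1 sP _) => t h /h[].
(* One function must dominate both [vnorm (f t)] and the dual norm, at most [C * (vnorm (f t) + 1)].
   The inequality (p + 1)^2 <= 2 p^2 + 2 keeps its square affine in [vq (f t) (f t)], which is known
   to be integrable. *)
pose K t := (C + 1) * Num.sqrt (2 * vq (f t) (f t) + 2).
have K2 t : K t ^+ 2 = (C + 1) ^+ 2 * (2 * vq (f t) (f t) + 2).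
  by rewrite exprMn sqr_sqrtr// addr_ge0// mulr_ge0// vq_ge0.
have Ki : ae_integrable leb `]0, T[ (fun t => K t ^+ 2).
  have -> : (fun t => K t ^+ 2) = fun t => (C + 1) ^+ 2 * (2 * vq (f t) (f t) + 2).
    by apply/funext => t; rewrite K2.
  apply: ae_integrableZ => //; apply: ae_integrableD => //; first exact: ae_integrableZ.
  by apply: ae_integrable_cst => //; exact: lebesgue_itvoo_lty.
have G_le t y : V (f t) -> V y -> `|b (f t) y + k y| <= K t * vnorm y.
  move=> Vft Vy; apply: le_trans (ler_normD _ _) _.
  apply: le_trans (lerD (b_le Vft Vy) (k_le Vy)) _.
  rewrite -mulrDl ler_wpM2r ?vnorm_ge0//.
  rewrite -[X in _ + X]mulr1 -mulrDr /K; apply: ler_pM => //.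
  - by rewrite addr_ge0 ?vnorm_ge0.
  - by rewrite lerDl.
  - rewrite -[leLHS]ger0_norm ?addr_ge0 ?vnorm_ge0// -sqrtr_sqr; apply: ler_wsqrtr.
    have := vnorm_sqr nu e Qh (f t); move: (vnorm _) (vq _ _) => p r <-.
    by have := sqr_ge0 (p - 1); nra.
split => //.
- exact: (bochner_L2_approximable W12_mem0 W12_memZD W12_lin (@vqC _ _ nu e Qh)
    W12_form_ge0 W12_normE f2).
- exists K => //; refine (ae_leb1 Vf _) => t h tT; have Vft := h tT; split => //.
  + by rewrite mulr_ge0 ?sqrtr_ge0// addr_ge0.
  + rewrite /K -[leLHS]mul1r; apply: ler_pM; rewrite ?vnorm_ge0 ?lerDr//.
    by apply: ler_wsqrtr; have := vq_ge0 nu e Qh (f t); lra.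
  + move=> a x y Vx Vy; rewrite (b_linr Vft a Vx Vy) (k_lin a Vx Vy).
    by move: (b _ x) (b _ y) (k x) (k y) => p1 p2 p3 p4; ring.
  + by move=> x Vx; exact: G_le.
move=> psi Vpsi.
have mG : ae_measurable leb `]0, T[ (fun t => b (f t) psi + k psi).
  apply: ae_measurableD; last by apply: measurable_ae_measurable; exact: measurable_cst.
  exact: (form_ae_measurable W12_mem0 W12_memZD W12_normE b_linl b_linr b_le fm
    (cst_strongly_measurable T Vpsi)).
have pL := W12mem_L2R he Vpsi.
have Gi : ae_integrable leb `]0, T[ (fun t => b (f t) psi + k psi).
  apply: (ae_integrable_le (mu := leb) (g := fun t => vnorm psi * (K t ^+ 2 + 1))) => //.
    apply: ae_integrableZ => //; apply: ae_integrableD => //.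
    by apply: ae_integrable_cst => //; exact: lebesgue_itvoo_lty.
  refine (ae_leb1 Vf _) => t h tT; apply: le_trans (G_le t psi (h tT) Vpsi) _.
  by rewrite mulrC ler_wpM2l ?vnorm_ge0//; have := sqr_ge0 (K t - 1); nra.
split => // a c a0 ac cT.
have -> : ipR nn (f c - f a) psi = ipR nn (f c) psi - ipR nn (f a) psi.
  have aT : a \in `[0, T] by rewrite in_itv/= a0 (le_trans ac cT).
  have cT' : c \in `[0, T] by rewrite in_itv/= (le_trans a0 ac) cT.
  have := ipR_subr pL (fL c cT') (fL a aT).
  by rewrite ![ipR nn psi _]ipRC.
apply: (weak_derivative_increment T0 (time_continuous_form fL tc pL) Gi) => // eta eta_test.
have [I [I1 I2]] := wd eta eta_test.
have p0 : vnorm psi + 1 != 0 by rewrite gt_eqF// ltr_wpDl ?vnorm_ge0.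
have ev := bochner_integral_form W12_dual_mem0 W12_dual_memZD
  (dual_norm_ge0 he Q_closable) (evaluation_linear psi) (evaluation_le Vpsi).
have [i1 e1] := ev _ _ _ I1; have [i2 e2] := ev _ _ _ I2.
have := ae_RintegralZ (vnorm psi + 1) mD i1; rewrite e1 -e2.
rewrite -(ae_RintegralZ (vnorm psi + 1) mD i2) => E.
transitivity (\int[leb]_(t in `]0, T[) ((vnorm psi + 1) *
    evaluation psi (derive1 eta t *: @pivot R H nu e Qh (f t)))).
  apply: eq_Rintegral => t _.
  by rewrite /evaluation mulrA divff// mul1r.
rewrite E; apply: ae_Rintegral_eq => //.
refine (ae_leb2 gE Vf _) => t h1 h2 tT.
rewrite /evaluation mulrA divff// mul1r.
rewrite -[(- (eta t *: g t)) psi]/(- (eta t * g t psi)).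
by rewrite (h1 tT psi Vpsi) (rhsE (h2 tT) Vpsi).
Qed.

End right_hand_side.

End evolution.

Section strongly_measurable_combination.
Context {R : realType} (X : prespace R) (T : R).
Local Notation leb := (@lebesgue_measure R).
Local Notation V := (@ps_mem _ X).
Hypothesis V0 : V 0.
Hypothesis VZD : forall (a : R) x y, V x -> V y -> V (a *: x + y).
Variable q : X -> X -> R.
Hypothesis q_lin : forall (a : R) x y z, V x -> V y -> V z ->
  q (a *: x + y) z = a * q x z + q y z.
Hypothesis qC : forall x y, q x y = q y x.
Hypothesis q_ge0 : forall x, V x -> 0 <= q x x.
Hypothesis ps_normE : forall x, V x -> ps_norm x = (Num.sqrt (q x x))%:E.

Section sm_combination.
Variables (a : R) (s r : simple_map X).

Let set_ (i : 'I_(sm_size s + sm_size r)) : set R :=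
  match fintype.split i with inl j => sm_set j | inr j => sm_set j end.

Let val_ (i : 'I_(sm_size s + sm_size r)) : X :=
  match fintype.split i with inl j => a *: sm_val j | inr j => sm_val j end.

Let mset i : measurable (set_ i).
Proof. by rewrite /set_; case: (fintype.split _) => j; exact: sm_set_measurable. Qed.

Let vmem i : V (val_ i).
Proof.
rewrite /val_; case: (fintype.split _) => j; last exact: sm_val_mem.
by rewrite -[_ *: _]addr0; apply: VZD => //; exact: sm_val_mem.
Qed.

Definition sm_ZD : simple_map X := SimpleMap mset vmem.

Lemma sm_ZDE t : sm_eval sm_ZD t = a *: sm_eval s t + sm_eval r t.
Proof.
rewrite /sm_eval big_split_ord /=; congr (_ + _).
  rewrite scaler_sumr; apply: eq_bigr => i _.
  rewrite /set_ /val_ -[lshift _ i]/(unsplit (inl i)) unsplitK.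
  by rewrite !scalerA mulrC.
by apply: eq_bigr => i _; rewrite /set_ /val_ -[rshift _ i]/(unsplit (inr i)) unsplitK.
Qed.

End sm_combination.

Lemma strongly_measurableZD (a : R) (f g : R -> X) : strongly_measurable T f ->
  strongly_measurable T g -> strongly_measurable T (fun t => a *: f t + g t).
Proof.
move=> [s sP] [r rP]; exists (fun n => sm_ZD a (s n) (r n)).
refine (ae_leb2 sP rP _) => t hs hr tT; have [Vf fs] := hs tT; have [Vg gr] := hr tT.
split; first exact: VZD.
have Vs n := mem_B VZD Vf (sm_eval_mem V0 VZD (s n) t).
have Vr n := mem_B VZD Vg (sm_eval_mem V0 VZD (r n) t).
have {fs} fs := nx_sqr_cvg0 V0 VZD qC q_ge0 Vf (ps_norm_cvg0 V0 VZD ps_normE Vf fs).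
have {gr} gr := nx_sqr_cvg0 V0 VZD qC q_ge0 Vg (ps_norm_cvg0 V0 VZD ps_normE Vg gr).
have E n : a *: f t + g t - sm_eval (sm_ZD a (s n) (r n)) t =
    a *: (f t - sm_eval (s n) t) + (g t - sm_eval (r n) t).
  by rewrite sm_ZDE; exact: scale_add_sub.
have -> : (fun n => ps_norm (a *: f t + g t - sm_eval (sm_ZD a (s n) (r n)) t)) =
    fun n => (Num.sqrt (q (a *: (f t - sm_eval (s n) t) + (g t - sm_eval (r n) t))
      (a *: (f t - sm_eval (s n) t) + (g t - sm_eval (r n) t))))%:E.
  by apply/funext => n; rewrite E ps_normE//; exact: VZD.
apply/sqrt_cvg0; first by move=> n; apply: q_ge0; exact: VZD.
apply: cvg0_le (cvg0_ZD (2 * a ^+ 2) 2 fs gr) => n.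
by rewrite q_ge0/=; [exact: (q_le2 VZD q_lin qC q_ge0)|exact: VZD].
Qed.

End strongly_measurable_combination.

(** * The drift as a bounded form *)

Section drift_form.
Context {R : realType} {H : hilbertType R}.
Variables (nu : probability (borel H) R) (e : nat -> H).
Hypothesis he : is_orthonormal_basis e.
Variable Qh : {linear H -> H}.
Hypothesis Q_closable : sqrtQ_D_closable nu e Qh.
Local Notation nn := (nuc nu).
Local Notation X := (Hnu nu).
Local Notation V := (W12mem nu e Qh).
Local Notation QD := (sqrtQ_D nu e Qh).
Local Notation dq := (dq nu e Qh).
Local Notation vq := (vq nu e Qh).
Local Notation vnorm := (vnorm nu e Qh).
Local Notation LV := (@linear_form R (W12 nu e Qh)).

(** Used with the field [B u] in place of [u]. In the state equation the solution is the
    differentiated argument [f]; in the adjoint equation it is [psi]. *)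
Definition drift_form (u : H -> H) (f psi : H -> R) : R :=
  \int[nn]_x (ip (u x) (QD f x) * psi x).

Definition ae_bounded (u : H -> H) (C : R) :=
  borel_fun (X := X) u /\ {ae nn, forall x, `|u x| <= C}.

Lemma ae_drift_form (u v : H -> H) f psi : {ae nn, forall x, u x = v x} ->
  drift_form u f psi = drift_form v f psi.
Proof.
move=> uv; apply: ae_Rintegral_eq => //.
by apply: (ae_nu1 uv) => x -> _.
Qed.

Section bounded_drift.
Variables (u : H -> H) (C : R) (C0 : 0 <= C) (uC : ae_bounded u C).

Lemma drift_L2R f : V f -> L2R nn (fun x => ip (u x) (QD f x)) /\
  ipR nn (fun x => ip (u x) (QD f x)) (fun x => ip (u x) (QD f x)) <= C ^+ 2 * dq f f.
Proof.
move=> Vf; have [bu uae] := uC; have [bQ Qi] := QD_L2H he Vf.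
have mI : measurable_fun setT (fun x : X => ip (u x) (QD f x)) := borel_fun_ip2 he bu bQ.
have le : {ae nn, forall x, setT x ->
    ip (u x) (QD f x) ^+ 2 <= C ^+ 2 * `|QD f x| ^+ 2}.
  apply: (ae_nu1 uae) => x ux _; rewrite -real_normK ?num_real// -exprMn.
  rewrite lerXn2r ?nnegrE ?mulr_ge0//.
  apply: le_trans (ip_norm_le _ _) _; exact: ler_wpM2r.
have gi : nn.-integrable setT (EFin \o (fun x : X => C ^+ 2 * `|QD f x| ^+ 2)).
  exact: integrable_EFinZ.
have m2 : measurable_fun setT (fun x : X => ip (u x) (QD f x) ^+ 2) by exact: measurable_funX.
have i2 : nn.-integrable setT (EFin \o (fun x : X => ip (u x) (QD f x) ^+ 2)).
  apply/integrableP; split; first exact/measurable_EFinP.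
  have /integrableP[_] := gi; apply: le_lt_trans; apply: ge0_ae_integral_le => //.
  apply: (ae_nu1 le) => x h _ /=; rewrite lee_fin (ger0_norm (sqr_ge0 _)).
  by rewrite (ger0_norm (mulr_ge0 (sqr_ge0 _) (sqr_ge0 _))); exact: h.
split => //.
have -> : C ^+ 2 * dq f f = \int[nn]_x (C ^+ 2 * `|QD f x| ^+ 2).
  rewrite RintegralZl//; congr (_ * _); apply: eq_Rintegral => x _.
  by rewrite ip_sqr_norm.
by apply: ae_Rintegral_le => //; exact: integrable_ae_integrable.
Qed.

(** Keeps apart the gradient of [f] and the L^2 norm of [psi]. The energy estimate needs this: the
    gradient is absorbed by dissipation and the L^2 norm is left to Gronwall. *)
Lemma drift_form_lel f psi : V f -> L2R nn psi ->
  `|drift_form u f psi| <= C * Num.sqrt (dq f f) * Num.sqrt (ipR nn psi psi).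
Proof.
move=> Vf pL; have [dL dle] := drift_L2R Vf.
apply: norm_le_mul; rewrite ?mulr_ge0 ?sqrtr_ge0//.
rewrite exprMn !sqr_sqrtr ?ipR_ge0 ?dq_ge0//.
apply: le_trans (ipR_cauchy_schwarz dL pL) _.
by apply: ler_wpM2r => //; exact: ipR_ge0.
Qed.

Lemma drift_form_le f psi : V f -> V psi ->
  `|drift_form u f psi| <= C * vnorm f * vnorm psi.
Proof.
move=> Vf Vpsi; apply: le_trans (drift_form_lel Vf (W12mem_L2R he Vpsi)) _.
rewrite -!mulrA ler_wpM2l//; apply: ler_pM; rewrite ?sqrtr_ge0//; apply: ler_wsqrtr.
  by rewrite lerDr ipR_ge0.
by rewrite lerDl dq_ge0.
Qed.

Lemma drift_form_linl psi : L2R nn psi -> LV (drift_form u ^~ psi).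
Proof.
move=> pL a f g Vf Vg.
have [fL _] := drift_L2R Vf; have [gL _] := drift_L2R Vg.
rewrite /drift_form -(ipR_lin a fL gL pL); apply: ae_Rintegral_eq => //.
apply: (ae_nu1 (QD_ZD he Q_closable a Vf Vg)) => x E _.
rewrite -[sqrtQ_D nu e Qh (a *: f + g) x]/(sqrtQ_D nu e Qh (fun x => a * f x + g x) x) E.
by rewrite ipDr ipZr.
Qed.

Lemma drift_form_linr f : V f -> LV (drift_form u f).
Proof.
move=> Vf a g h Vg Vh; have [fL _] := drift_L2R Vf.
rewrite /drift_form.
have E k : \int[nn]_x (ip (u x) (QD f x) * k x) = ipR nn k (fun x => ip (u x) (QD f x)).
  by apply: eq_Rintegral => x _; rewrite mulrC.
by rewrite !E; exact: (ipR_lin a (W12mem_L2R he Vg) (W12mem_L2R he Vh) fL).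
Qed.

End bounded_drift.

Lemma drift_form_combination (a C D : R) (u v : H -> H) f psi : ae_bounded u C ->
  ae_bounded v D -> 0 <= C -> 0 <= D -> V f -> L2R nn psi ->
  drift_form (fun x => a *: u x + v x) f psi = a * drift_form u f psi + drift_form v f psi.
Proof.
move=> uC vD C0 D0 Vf pL; have [uL _] := drift_L2R C0 uC Vf; have [vL _] := drift_L2R D0 vD Vf.
rewrite /drift_form -(ipR_lin a uL vL pL); apply: eq_Rintegral => x _.
by rewrite ipDl ipZl.
Qed.

Lemma ae_bounded_Linfty (u : H -> H) : ps_mem (u : Lp_H nu +oo) ->
  exists2 C : R, 0 <= C & ae_bounded u C.
Proof.
move=> [[_ bu]]; rewrite /normH unlock /= nuc_setT lte01 => uy.
have h : {ae nn, forall x, (`|u x|%:E <= ess_sup nn (fun x => `|u x|%:E))%E}.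
  exact: ess_sup_ge.
have s0 : (0 <= ess_sup nn (fun x => `|u x|%:E))%E.
  apply: ess_sup_gee; first by rewrite nuc_setT lte01.
  by apply: ae_nuT => x; rewrite lee_fin.
have E : (fun x : X => `| `|u x|%:E |%E) = fun x => `|u x|%:E.
  by apply/funext => x /=; rewrite normr_id.
rewrite [abse \o _]E in uy.
exists (fine (ess_sup nn (fun x => `|u x|%:E))); first exact: fine_ge0.
split => //; apply: (ae_nu1 h) => x; rewrite -lee_fin fineK//.
by rewrite ge0_fin_numE.
Qed.

Lemma admissible_Linfty (rho : R) (u : H -> H) : admissible nu rho u -> ps_mem (u : Lp_H nu +oo).
Proof.
move=> [mu_ urho]; split => //; rewrite /= /normH unlock /= nuc_setT lte01.
apply: (@le_lt_trans _ _ rho%:E); last exact: ltry.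
by apply/ess_supP; apply: ae_nuT => x /=; rewrite normr_id lee_fin.
Qed.

End drift_form.

(** * First-order perturbation of the state equation *)

Section first_order_condition.
Context {R : realType} {H : hilbertType R}.
Variables (nu : probability (borel H) R) (e : nat -> H).
Hypothesis he : is_orthonormal_basis e.
Variable Qh : {linear H -> H}.
Hypothesis Q_closable : sqrtQ_D_closable nu e Qh.
Local Notation nn := (nuc nu).
Local Notation X := (Hnu nu).
Local Notation V := (W12mem nu e Qh).
Local Notation dq := (dq nu e Qh).
Local Notation vq := (vq nu e Qh).
Local Notation vnorm := (vnorm nu e Qh).
Local Notation leb := (@lebesgue_measure R).
Local Notation W := (W12 nu e Qh).
Local Notation LV := (@linear_form R W).
Local Notation dr := (drift_form nu e Qh).
Local Notation bounded := (ae_bounded nu).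
Local Notation HR := (H -> R^o).

Definition state_form (u : H -> H) (f psi : H -> R) : R := - (2^-1 * dq f psi) + dr u f psi.

(** The sign of the gradient form is reversed because time runs backward, and the arguments of the
    drift are exchanged because [G_op] differentiates its test function. *)
Definition adjoint_form (u : H -> H) (f psi : H -> R) : R := 2^-1 * dq f psi - dr u psi f.

Section forms.
Variables (u : H -> H) (C : R) (C0 : 0 <= C) (uC : bounded u C).

Let dqr (h : HR) : V h -> LV (dq h).
Proof. by move=> Vh a f g Vf Vg; exact: (dq_linr he Q_closable a Vf Vg Vh). Qed.

Let dql (h : HR) : V h -> LV (dq ^~ h).
Proof. by move=> Vh a f g Vf Vg; exact: (dq_lin he Q_closable a Vf Vg Vh). Qed.

Lemma state_form_linl z : V z -> LV (state_form u ^~ z).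
Proof.
move=> Vz a x y Vx Vy; rewrite /state_form (dql Vz a Vx Vy).
rewrite (drift_form_linl he Q_closable C0 uC (W12mem_L2R he Vz) a Vx Vy).
by move: (dq _ _) (dq _ _) (dr _ _ _) (dr _ _ _) => p1 p2 p3 p4; ring.
Qed.

Lemma state_form_linr z : V z -> LV (state_form u z).
Proof.
move=> Vz a x y Vx Vy; rewrite /state_form (dqr Vz a Vx Vy).
rewrite (drift_form_linr he C0 uC Vz a Vx Vy).
by move: (dq _ _) (dq _ _) (dr _ _ _) (dr _ _ _) => p1 p2 p3 p4; ring.
Qed.

Lemma adjoint_form_linl z : V z -> LV (adjoint_form u ^~ z).
Proof.
move=> Vz a x y Vx Vy; rewrite /adjoint_form (dql Vz a Vx Vy).
rewrite (drift_form_linr he C0 uC Vz a Vx Vy).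
by move: (dq _ _) (dq _ _) (dr _ _ _) (dr _ _ _) => p1 p2 p3 p4; ring.
Qed.

Lemma adjoint_form_linr z : V z -> LV (adjoint_form u z).
Proof.
move=> Vz a x y Vx Vy; rewrite /adjoint_form (dqr Vz a Vx Vy).
rewrite (drift_form_linl he Q_closable C0 uC (W12mem_L2R he Vz) a Vx Vy).
by move: (dq _ _) (dq _ _) (dr _ _ _) (dr _ _ _) => p1 p2 p3 p4; ring.
Qed.

Lemma half_add_le (a b m n : R) : `|a| <= m * n -> `|b| <= C * m * n -> 0 <= m -> 0 <= n ->
  `|2^-1 * a| + `|b| <= (C + 1) * m * n.
Proof.
move=> h1 h2 m0 n0; rewrite normrM ger0_norm ?invr_ge0//.
have mn := mulr_ge0 m0 n0; have := normr_ge0 a.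
by move: (`|a|) (`|b|) h1 h2 => A B h1 h2 A0; nra.
Qed.

Lemma state_form_le x y : V x -> V y -> `|state_form u x y| <= (C + 1) * vnorm x * vnorm y.
Proof.
move=> Vx Vy; apply: le_trans (ler_normD _ _) _; rewrite normrN.
exact: (half_add_le (dq_le he Vx Vy) (drift_form_le he C0 uC Vx Vy) (vnorm_ge0 _ _ _ _)
  (vnorm_ge0 _ _ _ _)).
Qed.

Lemma adjoint_form_le x y : V x -> V y -> `|adjoint_form u x y| <= (C + 1) * vnorm x * vnorm y.
Proof.
move=> Vx Vy; apply: le_trans (ler_normB _ _) _.
apply: (half_add_le (dq_le he Vx Vy)); rewrite ?vnorm_ge0//.
rewrite -mulrA [vnorm x * _]mulrC mulrA.
exact: (drift_form_le he C0 uC Vy Vx).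
Qed.

End forms.

Lemma L2R_lin (a : R) (x y : HR) : L2R nn x -> L2R nn y -> L2R nn (a *: x + y).
Proof. exact: L2R_ZD. Qed.

Lemma ipR_linear (a : R) (x y z : HR) : L2R nn x -> L2R nn y -> L2R nn z ->
  ipR nn (a *: x + y) z = a * ipR nn x z + ipR nn y z.
Proof. exact: ipR_lin. Qed.

Lemma ipR_form_ge0 (x : HR) : L2R nn x -> 0 <= ipR nn x x.
Proof. by move=> _; exact: ipR_ge0. Qed.

Lemma V_subset : (V : set HR) `<=` L2R nn.
Proof. by move=> x; exact: W12mem_L2R. Qed.

Lemma V_lin (a : R) (x y : HR) : V x -> V y -> V (a *: x + y).
Proof. exact: (W12mem_ZD he a). Qed.

Lemma vnorm_triangle (x y : HR) : V x -> V y -> vnorm (x + y) <= vnorm x + vnorm y.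
Proof. exact: (vnormD he Q_closable). Qed.

Lemma vnorm_scale (a : R) (x : HR) : V x -> vnorm (a *: x) = `|a| * vnorm x.
Proof. exact: (vnormZ he Q_closable a). Qed.

Lemma vnorm_nonneg (x : HR) : V x -> 0 <= vnorm x.
Proof. by move=> _; exact: vnorm_ge0. Qed.

Local Notation evolves_ := (@evolves R HR (L2R nn) V (ipR nn) vnorm).

Lemma evolves_combination T (a : R) (f1 f2 : R -> HR) G1 G2 :
  evolves_ T f1 G1 -> evolves_ T f2 G2 ->
  evolves_ T (fun t => a *: f1 t + f2 t) (fun t x => a * G1 t x + G2 t x).
Proof.
exact: (evolvesZD L2R_lin ipR_linear (ipRC nn) ipR_form_ge0 V_subset V_lin
  vnorm_triangle vnorm_scale vnorm_nonneg).
Qed.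

Lemma evolves_energy T (T0 : 0 < T) (f : R -> HR) G : evolves_ T f G ->
  ae_measurable leb `]0, T[ (fun t => G t (f t)) -> forall t, 0 <= t -> t <= T ->
  ipR nn (f t) (f t) - ipR nn (f 0) (f 0) = 2 * \int[leb]_(r in `]0, t[) G r (f r).
Proof.
move=> ev mG t t0 tT.
exact: (energy_identity T0 L2R_lin ipR_linear (ipRC nn) ipR_form_ge0 V_lin
  vnorm_triangle vnorm_scale vnorm_nonneg ev mG).
Qed.

Lemma evolves_duality T (T0 : 0 < T) (f1 f2 : R -> HR) G1 G2 :
  evolves_ T f1 G1 -> evolves_ T f2 G2 ->
  ae_measurable leb `]0, T[ (fun t => G1 t (f1 t)) ->
  ae_measurable leb `]0, T[ (fun t => G2 t (f2 t)) ->
  ae_measurable leb `]0, T[ (fun t => G1 t (f2 t)) ->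
  ae_measurable leb `]0, T[ (fun t => G2 t (f1 t)) ->
  ipR nn (f1 T) (f2 T) - ipR nn (f1 0) (f2 0) =
  \int[leb]_(r in `]0, T[) (G1 r (f2 r) + G2 r (f1 r)).
Proof.
exact: (duality_identity T0 L2R_lin ipR_linear (ipRC nn) ipR_form_ge0 V_subset V_lin
  vnorm_triangle vnorm_scale vnorm_nonneg).
Qed.

Lemma W12_combination_measurable T (a : R) (f g : R -> W) : strongly_measurable T f ->
  strongly_measurable T g -> strongly_measurable T (fun t => a *: f t + g t).
Proof.
exact: (strongly_measurableZD (W12_mem0 nu he Qh) (@W12_memZD _ _ nu e he Qh)
  (W12_lin he Q_closable) (@vqC _ _ nu e Qh) (@W12_form_ge0 _ _ nu e Qh)
  (@W12_normE _ _ nu e he Qh)).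
Qed.

Lemma W12_form_measurable T (b : W -> W -> R) C (f g : R -> W) :
  (forall z, V z -> LV (b ^~ z)) -> (forall z, V z -> LV (b z)) ->
  (forall x y, V x -> V y -> `|b x y| <= C * vnorm x * vnorm y) ->
  strongly_measurable T f -> strongly_measurable T g ->
  ae_measurable leb `]0, T[ (fun t => b (f t) (g t)).
Proof.
exact: (form_ae_measurable (W12_mem0 nu he Qh) (@W12_memZD _ _ nu e he Qh)
  (@W12_normE _ _ nu e he Qh)).
Qed.

Lemma strongly_measurable_mem T (f : R -> W) : strongly_measurable T f ->
  {ae leb, forall t, t \in `]0, T[ -> V (f t)}.
Proof. by move=> [s sP]; refine (ae_leb1 sP _) => t h /h[]. Qed.

Lemma vq_integrable T (f : R -> W) : bochner_L2 T f ->
  ae_integrable leb `]0, T[ (fun t => vq (f t) (f t)).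
Proof.
exact: (bochner_L2_integrable (W12_mem0 nu he Qh) (@W12_memZD _ _ nu e he Qh)
  (W12_lin he Q_closable) (@vqC _ _ nu e Qh) (@W12_form_ge0 _ _ nu e Qh)
  (@W12_normE _ _ nu e he Qh)).
Qed.

End first_order_condition.

Lemma energy_arith {R : realType} (y D KY P Q k Y : R) : 0 <= y -> y + 4^-1 * D <= KY + k ->
  KY <= P -> Y <= Q -> Y + D <= Q + 4 * (P + k).
Proof. by move=> y0 E h YQ; lra. Qed.

Lemma mul_le_sqr {R : realType} (a b : R) : a * b <= a ^+ 2 + b ^+ 2.
Proof. by have := sqr_ge0 (a - b); have := sqr_ge0 a; have := sqr_ge0 b; nra. Qed.

Lemma mul_le_weighted_sqr {R : realType} (a b l : R) : 0 < l ->
  a * b <= l^-1 * a ^+ 2 + l * b ^+ 2.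
Proof.
move=> l0; rewrite -subr_ge0.
have -> : l^-1 * a ^+ 2 + l * b ^+ 2 - a * b =
    l^-1 * ((a - 2^-1 * (l * b)) ^+ 2 + 3 * 4^-1 * (l * b) ^+ 2) by field; rewrite gt_eqF.
apply: mulr_ge0; first by rewrite invr_ge0 ltW.
by apply: addr_ge0; [exact: sqr_ge0|apply: mulr_ge0; [rewrite divr_ge0|exact: sqr_ge0]].
Qed.

Lemma lower_bound_arith {R : realType} (l C x y w p M : R) : 0 < l -> 0 <= C -> 0 <= x ->
  x - y <= C * (l^-1 * w + l * p) -> w <= M * l ^+ 2 -> - (C * (M + p) * l) <= y.
Proof.
move=> l0 C0 x0 h wM.
have h2 : l^-1 * w <= l * M.
  by rewrite ler_pdivrMl// mulrA -expr2 mulrC.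
have : C * (l^-1 * w + l * p) <= C * (l * M + l * p) by rewrite ler_wpM2l// lerD2r.
have -> : C * (l * M + l * p) = C * (M + p) * l by ring.
by move: (C * _ * l) (C * _) h => q r h qr; lra.
Qed.

(** [s] and [m] are the gradient norm and the L^2 norm of the difference, [s0] is the gradient norm
    of the reference state. The terms [a] and [b] give at most [4 * (C * s * m)], absorbed by
    [4^-1 * s ^+ 2 + 16 * C ^+ 2 * m ^+ 2]; the term [c] gives the source of order [l ^+ 2] and one
    more [m ^+ 2]. *)
Lemma energy_estimate {R : realType} (C l s m s0 a b c : R) : 0 <= l <= 1 ->
  `|a| <= C * s * m -> `|b| <= C * s * m -> `|c| <= C * s0 * m ->
  2 * (- (2^-1 * s ^+ 2) + a + l * (b + c)) <=
  - (4^-1 * s ^+ 2) + (16 * C ^+ 2 + 1) * m ^+ 2 + l ^+ 2 * C ^+ 2 * s0 ^+ 2.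
Proof.
move=> /andP[l0 l1] ha hb hc.
have ha' := le_trans (ler_norm _) ha.
have hb' : l * b <= C * s * m.
  apply: le_trans hb; apply: le_trans (ler_norm _) _; rewrite normrM ger0_norm//.
  by rewrite ler_piMl.
have hc' : l * c <= l * (C * s0 * m) by rewrite ler_wpM2l// (le_trans (ler_norm _) hc).
have q1 := sqr_ge0 (2^-1 * s - 4 * (C * m)).
have q2 := sqr_ge0 (l * C * s0 - m).
have q3 := sqr_ge0 s.
have e1 : (2^-1 * s - 4 * (C * m)) ^+ 2 = 4^-1 * s ^+ 2 - 4 * (C * s * m) + 16 * C ^+ 2 * m ^+ 2.
  by field.
have e2 : (l * C * s0 - m) ^+ 2 = l ^+ 2 * C ^+ 2 * s0 ^+ 2 - 2 * (l * (C * s0 * m)) + m ^+ 2.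
  by ring.
have e3 : (16 * C ^+ 2 + 1) * m ^+ 2 = 16 * C ^+ 2 * m ^+ 2 + m ^+ 2 by ring.
rewrite (mulrDr l b c) e3; rewrite e1 in q1; rewrite e2 in q2.
move: (l * b) (l * c) (C * s * m) (l * (C * s0 * m)) (16 * C ^+ 2 * m ^+ 2)
  (l ^+ 2 * C ^+ 2 * s0 ^+ 2) (m ^+ 2) (s ^+ 2) ha' hb' hc' q1 q2 q3.
by move=> B D P Q E F M S; lra.
Qed.

Section perturbation.
Context {R : realType} {H : hilbertType R}.
Variables (nu : probability (borel H) R) (e : nat -> H).
Hypothesis he : is_orthonormal_basis e.
Variable Qh : {linear H -> H}.
Hypothesis Q_closable : sqrtQ_D_closable nu e Qh.
Local Notation nn := (nuc nu).
Local Notation X := (Hnu nu).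
Local Notation V := (W12mem nu e Qh).
Local Notation dq := (dq nu e Qh).
Local Notation vq := (vq nu e Qh).
Local Notation vnorm := (vnorm nu e Qh).
Local Notation leb := (@lebesgue_measure R).
Local Notation W := (W12 nu e Qh).
Local Notation LV := (@linear_form R W).
Local Notation dr := (drift_form nu e Qh).
Local Notation bounded := (ae_bounded nu).
Local Notation HR := (H -> R^o).
Local Notation evolves_ := (@evolves R HR (L2R nn) V (ipR nn) vnorm).
Local Notation state := (state_form nu e Qh).
Local Notation adjoint := (adjoint_form nu e Qh).
(** [be] stands for [B us], [ga] for [B (u - us)], [ul] for the field of the perturbed control, [f0]
    and [f1] for the states at the reference and perturbed controls, and [w] for their
    difference. *)
Variables (T : R) (T0 : 0 < T) (be ga : H -> H) (C : R).
Hypotheses (C0 : 0 <= C) (beC : bounded be C) (gaC : bounded ga C).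
Variables (l : R) (l0 : 0 <= l) (l1 : l <= 1).
Let ul x := l *: ga x + be x.
Variables f0 f1 : R -> W.
Hypotheses (f0_L2 : bochner_L2 T f0) (f1_L2 : bochner_L2 T f1).
Hypothesis f0_ev : evolves_ T f0 (fun t y => state be (f0 t) y).
Hypothesis f1_ev : evolves_ T f1 (fun t y => state ul (f1 t) y).
Hypothesis init : {ae nn, forall x, f0 0 x = f1 0 x}.
Let w t : W := -1 *: f0 t + f1 t.
Let Gw t (y : H -> R) : R := -1 * state be (f0 t) y + state ul (f1 t) y.
Let mD : measurable (`]0, T[%classic : set (measurableTypeR R)).
Proof. exact: measurable_itv. Qed.

Let ulC : bounded ul (2 * C).
Proof.
have [bbe aebe] := beC; have [bga aega] := gaC; split; first exact: (borel_funZD he).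
apply: (ae_nu2 aebe aega) => x h1 h2; apply: le_trans (ler_normD _ _) _.
rewrite normrZ (ger0_norm l0).
have := normr_ge0 (ga x); move: (`|ga x|) (`|be x|) h1 h2 => a b h1 h2 a0.
by have := ler_wpM2r a0 l1; rewrite mul1r; lra.
Qed.

Let C20 : 0 <= 2 * C. Proof. by rewrite mulr_ge0. Qed.

Let fm0 : strongly_measurable T f0. Proof. by have [] := f0_L2. Qed.
Let fm1 : strongly_measurable T f1. Proof. by have [] := f1_L2. Qed.
Let wm : strongly_measurable T w.
Proof. exact: (W12_combination_measurable he Q_closable (-1) fm0 fm1). Qed.

Let w_ev : evolves_ T w Gw.
Proof. exact: (evolves_combination he Q_closable (-1) f0_ev f1_ev). Qed.

Let Vf0 := strongly_measurable_mem fm0.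
Let Vf1 := strongly_measurable_mem fm1.

Let w_mem t : V (f0 t) -> V (f1 t) -> V (w t).
Proof. exact: (V_lin he). Qed.

(* [Gw] is kept as the combination of the two right-hand sides, since the rewriting of
   difference_source only holds at the almost all times where both states are in V. *)
Let Gw_form (y : R -> W) : strongly_measurable T y ->
  ae_measurable leb `]0, T[ (fun t => Gw t (y t)).
Proof.
move=> ym; rewrite /Gw; apply: ae_measurableD.
  apply: ae_measurableM; first by apply: measurable_ae_measurable; exact: measurable_cst.
  apply: (W12_form_measurable he (C := C + 1)) => //.
  - exact: (state_form_linl he Q_closable C0 beC).
  - exact: (state_form_linr he Q_closable C0 beC).
  - exact: (state_form_le he C0 beC).
apply: (W12_form_measurable he (C := 2 * C + 1)) => //.
- exact: (state_form_linl he Q_closable C20 ulC).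
- exact: (state_form_linr he Q_closable C20 ulC).
- exact: (state_form_le he C20 ulC).
Qed.

(** The source carries the perturbed state [f1], so the formula is exact: no term of second order in
    [l] is left over. *)
Lemma difference_source t y : V (f0 t) -> V (f1 t) -> V y ->
  Gw t y = - (2^-1 * dq (w t) y) + dr be (w t) y + l * dr ga (f1 t) y.
Proof.
move=> V0t V1t Vy; rewrite /Gw /state_form /w.
rewrite (drift_form_combination he l gaC beC C0 C0 V1t (W12mem_L2R he Vy)).
rewrite (dq_lin he Q_closable (-1) V0t V1t Vy).
rewrite (drift_form_linl he Q_closable C0 beC (W12mem_L2R he Vy) (-1) V0t V1t).
by move: (dq _ _) (dq _ _) (dr _ _ _) (dr _ _ _) (dr _ _ _) => p1 p2 p3 p4 p5; ring.
Qed.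

(** Splits [f1] into [w] and [f0] in the source, so that the constants of the energy estimate
    involve only the reference state and stay independent of [l]. *)
Let w_linl y : V y -> forall t, V (f0 t) -> V (f1 t) ->
  dr ga (f1 t) y = dr ga (w t) y + dr ga (f0 t) y.
Proof.
move=> Vy t V0t V1t.
rewrite (drift_form_linl he Q_closable C0 gaC (W12mem_L2R he Vy) (-1) V0t V1t).
by rewrite mulN1r addrAC addNr add0r.
Qed.

Let K := 16 * C ^+ 2 + 1.

Let K0 : 0 <= K.
Proof. by rewrite addr_ge0// mulr_ge0// sqr_ge0. Qed.

Let w0 : ipR nn (w 0) (w 0) = 0.
Proof.
rewrite -[RHS](_ : \int[nn]_x 0 = 0); last by rewrite /Rintegral integral0.
apply: ae_Rintegral_eq => //; apply: (ae_nu1 init) => x E _.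
by rewrite -[w 0 x]/(-1 * f0 0 x + f1 0 x) E mulN1r addNr mulr0.
Qed.

Let dqi (f : R -> W) : bochner_L2 T f -> strongly_measurable T f ->
  ae_integrable leb `]0, T[ (fun t => dq (f t) (f t)).
Proof.
move=> f2 fm.
apply: (ae_integrable_le (mu := leb) (g := fun t => vq (f t) (f t))) => //.
- apply: (W12_form_measurable he (C := 1)) => //.
  + by move=> z Vz a x y Vx Vy; exact: (dq_lin he Q_closable).
  + by move=> z Vz a x y Vx Vy; exact: (dq_linr he Q_closable).
  + by move=> x y Vx Vy; rewrite mul1r; exact: (dq_le he Vx Vy).
- exact: (vq_integrable he Q_closable).
- by apply: ae_lebT => t _; rewrite ger0_norm ?dq_ge0// lerDr ipR_ge0.
Qed.

Let wvq : ae_integrable leb `]0, T[ (fun t => vq (w t) (w t)).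
Proof.
apply: (ae_integrable_le (mu := leb)
  (g := fun t => 2 * vq (f0 t) (f0 t) + 2 * vq (f1 t) (f1 t))) => //.
- apply: (W12_form_measurable he (C := 1)) => //.
  + by move=> z Vz a x y Vx Vy; exact: (vq_lin he Q_closable).
  + move=> z Vz a x y Vx Vy; rewrite (vqC _ _ _ z) (vq_lin he Q_closable a Vx Vy Vz).
    by rewrite (vqC _ _ _ x) (vqC _ _ _ y).
  + by move=> x y Vx Vy; rewrite mul1r; exact: (vq_cauchy_schwarz he Q_closable Vx Vy).
- by apply: ae_integrableD => //; apply: ae_integrableZ => //; exact: (vq_integrable he Q_closable).
- refine (ae_leb2 Vf0 Vf1 _) => t h0 h1 tT; rewrite ger0_norm ?vq_ge0//.
  have := q_le2 (@W12_memZD _ _ nu e he Qh) (W12_lin he Q_closable) (@vqC _ _ nu e Qh)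
    (@W12_form_ge0 _ _ nu e Qh) (-1) (h0 tT) (h1 tT).
  by rewrite sqrrN expr1n mulr1.
Qed.

Let A := \int[leb]_(t in `]0, T[) dq (f0 t) (f0 t).

Let ipR_measurable (f g : R -> W) : strongly_measurable T f -> strongly_measurable T g ->
  ae_measurable leb `]0, T[ (fun t => ipR nn (f t) (g t)).
Proof.
apply: (W12_form_measurable he (b := ipR nn) (C := 1)).
- by move=> z Vz a x y Vx Vy; exact: (ipR_lin a (W12mem_L2R he Vx) (W12mem_L2R he Vy) (W12mem_L2R he Vz)).
- move=> z Vz a x y Vx Vy; rewrite (ipRC nn z) (ipRC nn z x) (ipRC nn z y).
  exact: (ipR_lin a (W12mem_L2R he Vx) (W12mem_L2R he Vy) (W12mem_L2R he Vz)).
- move=> x y Vx Vy; rewrite mul1r; apply: le_trans (ipR_le_vnorm he (W12mem_L2R he Vx) Vy) _.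
  by rewrite ler_wpM2r ?vnorm_ge0//; apply: ler_wsqrtr; rewrite lerDl dq_ge0.
Qed.

Let wi : ae_integrable leb `]0, T[ (fun t => ipR nn (w t) (w t)).
Proof.
apply: (ae_integrable_le (mu := leb) (g := fun t => vq (w t) (w t))) => //.
- exact: (ipR_measurable wm wm).
- by apply: ae_lebT => t _; rewrite ger0_norm ?ipR_ge0// lerDl dq_ge0.
Qed.

Let wdq : ae_integrable leb `]0, T[ (fun t => dq (w t) (w t)).
Proof.
have := ae_integrableB mD wvq wi; apply: ae_integrable_eq.
apply: ae_lebT => t _.
by rewrite -[vq (w t) (w t)]/(ipR nn (w t) (w t) + dq (w t) (w t)) addrC addKr.
Qed.

Lemma difference_energy t : 0 <= t -> t <= T ->
  ipR nn (w t) (w t) + 4^-1 * \int[leb]_(r in `]0, t[) dq (w r) (w r) <=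
  K * primitive (fun r => ipR nn (w r) (w r)) t + l ^+ 2 * C ^+ 2 * A.
Proof.
move=> t0 tT; have mG := Gw_form wm.
have := evolves_energy he Q_closable T0 w_ev mG t0 tT; rewrite w0 subr0 => ->.
have mt : measurable (`]0, t[%classic : set (measurableTypeR R)) by exact: measurable_itv.
have sub (f : R -> R) : ae_integrable leb `]0, T[ f -> ae_integrable leb `]0, t[ f.
  exact: ae_integrable_itvS.
have i1 := sub _ (evolves_diag_integrable w_ev mG).
have i2 := ae_integrableZ (mu := leb) 4^-1 mt (sub _ wdq).
have i3 := ae_integrableZ (mu := leb) K mt (sub _ wi).
have i4 := ae_integrableZ (mu := leb) (l ^+ 2 * C ^+ 2) mt (sub _ (dqi f0_L2 fm0)).
have i5 := ae_integrableB mt (ae_integrableD mt i3 i4) i2.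
have Vw : {ae leb, forall r, r \in `]0, t[ -> V (f0 r) /\ V (f1 r)}.
  have sT : {subset `]0, t[ <= `]0, T[}.
    by move=> r; rewrite !in_itv/= => /andP[-> /lt_le_trans]; apply.
  by refine (ae_leb2 Vf0 Vf1 _) => r h0 h1 rt; split; [apply: h0|apply: h1]; exact: sT.
have le : \int[leb]_(r in `]0, t[) (2 * Gw r (w r)) <= \int[leb]_(r in `]0, t[)
    (K * ipR nn (w r) (w r) + l ^+ 2 * C ^+ 2 * dq (f0 r) (f0 r) - 4^-1 * dq (w r) (w r)).
  apply: ae_Rintegral_le => //; first exact: ae_integrableZ.
  refine (ae_leb1 Vw _) => r h rt; have [V0r V1r] := h rt.
  have Vwr := w_mem V0r V1r.
  rewrite (difference_source V0r V1r Vwr) (w_linl Vwr V0r V1r).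
  have n1 := drift_form_lel he C0 beC Vwr (W12mem_L2R he Vwr).
  have n2 := drift_form_lel he C0 gaC Vwr (W12mem_L2R he Vwr).
  have n3 := drift_form_lel he C0 gaC V0r (W12mem_L2R he Vwr).
  have l01 : 0 <= l <= 1 by rewrite l0.
  have := energy_estimate l01 n1 n2 n3.
  rewrite (sqr_sqrtr (dq_ge0 nu e Qh (w r))) (sqr_sqrtr (ipR_ge0 nn (w r))).
  rewrite (sqr_sqrtr (dq_ge0 nu e Qh (f0 r))) -/K => h'; apply: le_trans h' _.
  by rewrite -addrA addrC.
rewrite -(ae_RintegralZ 2 mt i1) -lerBrDr; apply: le_trans le _.
rewrite (ae_RintegralB mt (ae_integrableD mt i3 i4) i2) (ae_RintegralD mt i3 i4).
rewrite (ae_RintegralZ _ mt (sub _ wi)) (ae_RintegralZ _ mt (sub _ wdq)).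
rewrite (ae_RintegralZ _ mt (sub _ (dqi f0_L2 fm0))) lerD2r lerD2l.
apply: ler_wpM2l; first by rewrite mulr_ge0 ?sqr_ge0.
rewrite /A (ae_Rintegral_itvD t0 tT (dqi f0_L2 fm0)).
by rewrite lerDl; apply: ae_Rintegral_ge0 => //; apply: ae_lebT => r _; exact: dq_ge0.
Qed.

Let Kg := K * T * expR (K * T) + 1.

Let A0 : 0 <= A.
Proof. by apply: ae_Rintegral_ge0 => //; apply: ae_lebT => r _; exact: dq_ge0. Qed.

(** Gronwall bounds the L^2 norm of [w] by a multiple of [k], which is of order [l ^+ 2]. Inserted
    into the energy inequality at time [T], this also bounds the gradient part, with a factor 4 from
    the coefficient [4^-1]. *)
Lemma difference_bound :
  \int[leb]_(t in `]0, T[) vq (w t) (w t) <=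
  (T * Kg + 4 * (K * (T * Kg) + 1)) * (C ^+ 2 * A) * l ^+ 2.
Proof.
set k := l ^+ 2 * C ^+ 2 * A.
have k0 : 0 <= k by rewrite /k !mulr_ge0// sqr_ge0.
have [wL wc _ _ _] := w_ev.
have cy := energy_continuous (@L2R_lin _ _ nu) (@ipR_linear _ _ nu) (ipRC nn)
  (@ipR_form_ge0 _ _ nu) wL wc.
have ws t : 0 <= t -> t <= T -> 0 <= \int[leb]_(r in `]0, t[) dq (w r) (w r).
  by move=> t0 tT; apply: ae_Rintegral_ge0 => //; apply: ae_lebT => r _; exact: dq_ge0.
have yle t : 0 <= t -> t <= T -> ipR nn (w t) (w t) <= Kg * k.
  move=> t0 tT; refine (gronwall T0 K0 cy _ k0 t0 tT) => r r0 rT.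
  have h1 := difference_energy r0 rT; have h2 := ws r r0 rT.
  apply: le_trans h1; rewrite lerDl; apply: mulr_ge0; last exact: h2.
  by rewrite invr_ge0.
have Yle : \int[leb]_(t in `]0, T[) ipR nn (w t) (w t) <= T * Kg * k.
  apply: (@le_trans _ _ (\int[leb]_(t in `]0, T[) (Kg * k))).
    apply: ae_Rintegral_le => //; first exact: (ae_integrable_cst _ mD (lebesgue_itvoo_lty 0 T)).
    by apply: ae_lebT => t; rewrite /= in_itv/= => /andP[t0 tT]; apply: yle; exact: ltW.
  rewrite Rintegral_cst// fine_lebesgue_itvoo ?(ltW T0)// subr0.
  by rewrite -[T * Kg * k]mulrA [T * _]mulrC.
have := difference_energy (ltW T0) (lexx T); rewrite -/k /primitive => E.
have -> : \int[leb]_(t in `]0, T[) vq (w t) (w t) =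
    \int[leb]_(t in `]0, T[) ipR nn (w t) (w t) + \int[leb]_(t in `]0, T[) dq (w t) (w t).
  by rewrite -(ae_RintegralD mD wi wdq).
have y0 := ipR_ge0 nn (w T).
have h := ler_wpM2l K0 Yle.
have -> : (T * Kg + 4 * (K * (T * Kg) + 1)) * (C ^+ 2 * A) * l ^+ 2 =
    T * Kg * k + 4 * (K * (T * Kg * k) + k) by rewrite /k; ring.
apply: (energy_arith y0 E h Yle).
Qed.

Variable p : R -> W.
Hypothesis p_L2 : bochner_L2 T p.
Hypothesis p_ev : evolves_ T p (fun t y => adjoint be (p t) y + - ipR nn (fun=> 1) y).
Hypothesis pT : {ae nn, forall x, p T x = 0}.

Let pm : strongly_measurable T p. Proof. by have [] := p_L2. Qed.
Let Vp := strongly_measurable_mem pm.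

Let Gp_form (y : R -> W) : strongly_measurable T y ->
  ae_measurable leb `]0, T[ (fun t => adjoint be (p t) (y t) + - ipR nn (fun=> 1) (y t)).
Proof.
move=> ym; apply: ae_measurableD.
  apply: (W12_form_measurable he (C := C + 1)) => //.
  - exact: (adjoint_form_linl he Q_closable C0 beC).
  - exact: (adjoint_form_linr he Q_closable C0 beC).
  - exact: (adjoint_form_le he C0 beC).
have V1 : V (fun=> 1) by apply: (W12mem_FCb nu he Qh); exact: FCb_cst.
apply: (ae_measurable_eq (mu := leb) (f := fun t => -1 * ipR nn (fun=> 1) (y t))).
  by apply: ae_lebT => t _; rewrite mulN1r.
apply: ae_measurableM; first by apply: measurable_ae_measurable; exact: measurable_cst.
exact: (ipR_measurable (cst_strongly_measurable he Q_closable T V1) ym).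
Qed.

Let dr_integrable (f : R -> W) : bochner_L2 T f -> strongly_measurable T f ->
  ae_integrable leb `]0, T[ (fun t => dr ga (f t) (p t)).
Proof.
move=> f2 fm; apply: (ae_integrable_le (mu := leb)
  (g := fun t => C * (vq (f t) (f t) + vq (p t) (p t)))) => //.
- apply: (W12_form_measurable he (C := C)) => //.
  + by move=> z Vz; exact: (drift_form_linl he Q_closable C0 gaC (W12mem_L2R he Vz)).
  + by move=> z Vz; exact: (drift_form_linr he C0 gaC Vz).
  + by move=> x y Vx Vy; exact: (drift_form_le he C0 gaC Vx Vy).
- exact: (ae_integrableZ (mu := leb) C mD (ae_integrableD mD
    (vq_integrable he Q_closable f2) (vq_integrable he Q_closable p_L2))).
- refine (ae_leb2 (strongly_measurable_mem fm) Vp _) => t h1 h2 tT.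
  apply: le_trans (drift_form_le he C0 gaC (h1 tT) (h2 tT)) _.
  rewrite -mulrA; apply: ler_wpM2l => //.
  by rewrite -(vnorm_sqr nu e Qh (f t)) -(vnorm_sqr nu e Qh (p t)); exact: mul_le_sqr.
Qed.

(** The boundary terms vanish because the initial data agree and [p] vanishes at [T]. The gradient
    forms and the drift along [be] cancel between the two equations, so that only the source and the
    pairing with 1 remain. *)
Lemma difference_duality :
  \int[leb]_(t in `]0, T[) ipR nn (fun=> 1) (w t) =
  l * \int[leb]_(t in `]0, T[) dr ga (f1 t) (p t).
Proof.
have E := evolves_duality he Q_closable T0 w_ev p_ev (Gw_form wm) (Gp_form pm)
  (Gw_form pm) (Gp_form wm).
have z1 : ipR nn (w T) (p T) = 0.
  rewrite -[RHS](_ : \int[nn]_x 0 = 0); last by rewrite /Rintegral integral0.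
  by apply: ae_Rintegral_eq => //; apply: (ae_nu1 pT) => x -> _; rewrite mulr0.
have z2 : ipR nn (w 0) (p 0) = 0.
  rewrite -[RHS](_ : \int[nn]_x 0 = 0); last by rewrite /Rintegral integral0.
  apply: ae_Rintegral_eq => //; apply: (ae_nu1 init) => x Ex _.
  by rewrite -[w 0 x]/(-1 * f0 0 x + f1 0 x) Ex mulN1r addNr mul0r.
have i1 := ae_integrableZ (mu := leb) l mD (dr_integrable f1_L2 fm1).
move: E; rewrite z1 z2 subrr => E.
have V1 : V (fun=> 1) by apply: (W12mem_FCb nu he Qh); exact: FCb_cst.
have i2 : ae_integrable leb `]0, T[ (fun t => ipR nn (fun=> 1) (w t)).
  apply: (ae_integrable_le (mu := leb) (g := fun t => vq (fun=> 1) (fun=> 1) + vq (w t) (w t))).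
  - exact: mD.
  - exact: (ipR_measurable (cst_strongly_measurable he Q_closable T V1) wm).
  - exact: (ae_integrableD mD (ae_integrable_cst _ mD (lebesgue_itvoo_lty 0 T)) wvq).
  - refine (ae_leb2 Vf0 Vf1 _) => t h0 h1 tT; have Vwt := w_mem (h0 tT) (h1 tT).
    apply: le_trans (ipR_le_vnorm he (W12mem_L2R he V1) Vwt) _.
    apply: (@le_trans _ _ (vnorm (fun=> 1) * vnorm (w t))).
      by rewrite ler_wpM2r ?vnorm_ge0//; apply: ler_wsqrtr; rewrite lerDl dq_ge0.
    by rewrite -(vnorm_sqr nu e Qh (fun=> 1)) -(vnorm_sqr nu e Qh (w t)); exact: mul_le_sqr.
have : \int[leb]_(t in `]0, T[) (l * dr ga (f1 t) (p t) - ipR nn (fun=> 1) (w t)) = 0.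
  rewrite [RHS]E; apply: (ae_Rintegral_eq mD).
  refine (ae_leb3 Vf0 Vf1 Vp _) => t h0 h1 h2 tT.
  have V0t := h0 tT; have V1t := h1 tT; have Vpt := h2 tT.
  rewrite (difference_source V0t V1t Vpt) /adjoint_form (dqC _ _ _ (p t)).
  by move: (dq _ _) (dr be _ _) (dr ga _ _) (ipR _ _ _) => a b c d; ring.
rewrite (ae_RintegralB mD i1 i2) (ae_RintegralZ _ mD (dr_integrable f1_L2 fm1)).
by move/eqP; rewrite subr_eq0 => /eqP ->.
Qed.

(** By duality the pairing with [f1] is nonnegative. Exchanging [f1] for [f0] costs a product of the
    norms of [w] and [p]. Young's inequality with weight [l] is balanced here: the squared norm of
    [w] is of order [l ^+ 2], so both of its terms are of order [l]. *)
Lemma first_order_lower_bound : 0 < l ->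
  0 <= \int[leb]_(t in `]0, T[) ipR nn (fun=> 1) (w t) ->
  - (C * ((T * Kg + 4 * (K * (T * Kg) + 1)) * (C ^+ 2 * A) +
      \int[leb]_(t in `]0, T[) vq (p t) (p t)) * l) <=
  \int[leb]_(t in `]0, T[) dr ga (f0 t) (p t).
Proof.
move=> lpos D; have := eq_ind _ (fun z => 0 <= z) D _ difference_duality.
rewrite (pmulr_rge0 _ lpos) => D1.
have pvq := vq_integrable he Q_closable p_L2.
have iw : ae_integrable leb `]0, T[ (fun t => dr ga (f1 t) (p t) - dr ga (f0 t) (p t)).
  exact: (ae_integrableB mD (dr_integrable f1_L2 fm1) (dr_integrable f0_L2 fm0)).
have ib := ae_integrableZ (mu := leb) C mD (ae_integrableD mD
  (ae_integrableZ (mu := leb) l^-1 mD wvq) (ae_integrableZ (mu := leb) l mD pvq)).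
have : \int[leb]_(t in `]0, T[) (dr ga (f1 t) (p t) - dr ga (f0 t) (p t)) <=
    \int[leb]_(t in `]0, T[) (C * (l^-1 * vq (w t) (w t) + l * vq (p t) (p t))).
  apply: ae_Rintegral_le => //.
  refine (ae_leb3 Vf0 Vf1 Vp _) => t h0 h1 h2 tT.
  have V0t := h0 tT; have V1t := h1 tT; have Vpt := h2 tT.
  rewrite (w_linl Vpt V0t V1t) addrK; apply: le_trans (ler_norm _) _.
  apply: le_trans (drift_form_le he C0 gaC (w_mem V0t V1t) Vpt) _.
  rewrite -mulrA; apply: ler_wpM2l => //.
  rewrite -(vnorm_sqr nu e Qh (w t)) -(vnorm_sqr nu e Qh (p t)).
  exact: (mul_le_weighted_sqr _ _ lpos).
rewrite (ae_RintegralB mD (dr_integrable f1_L2 fm1) (dr_integrable f0_L2 fm0)).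
rewrite (ae_RintegralZ C mD (ae_integrableD mD
  (ae_integrableZ (mu := leb) l^-1 mD wvq) (ae_integrableZ (mu := leb) l mD pvq))).
rewrite (ae_RintegralD mD (ae_integrableZ (mu := leb) l^-1 mD wvq)
  (ae_integrableZ (mu := leb) l mD pvq)).
rewrite (ae_RintegralZ _ mD wvq) (ae_RintegralZ _ mD pvq) => D2.
exact: (lower_bound_arith lpos C0 D1 D2 difference_bound).
Qed.

End perturbation.

(** * The Bochner integral of a product in L^1 *)

Section L1_space.
Context {R : realType} {H : hilbertType R}.
Variables (nu : probability (borel H) R) (e : nat -> H).
Hypothesis he : is_orthonormal_basis e.
Local Notation nn := (nuc nu).
Local Notation X := (Hnu nu).
Local Notation leb := (@lebesgue_measure R).
Local Notation Y := (Lp_H nu 1%:E).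

Definition n1 (u : H -> H) : R := \int[nn]_x `|u x|.

Lemma L1H_norm (u : H -> H) : L1H nn u -> ps_norm (u : Y) = (n1 u)%:E.
Proof.
move=> [bu ui]; rewrite /= /normH Lnorm1 /n1 /Rintegral fineK.
  by apply: eq_integral => x _ /=; rewrite normr_id.
exact: (integrable_fin_num measurableT ui).
Qed.

Lemma L1H_mem (u : H -> H) : ps_mem (u : Y) <-> L1H nn u.
Proof.
split=> [[[_ bu] uy]|uL]; last first.
  split; first by split => //; have [] := uL.
  by rewrite -[normH _ _ _]/(ps_norm (u : Y)) (L1H_norm uL) ltry.
split => //; apply/integrableP; split.
  by apply/measurable_EFinP; exact: borel_fun_norm.
apply: le_lt_trans uy; rewrite /normH Lnorm1.
by apply: ge0_integral_le.
Qed.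

Lemma L1_mem0 : @ps_mem R Y 0.
Proof.
apply/L1H_mem; have [b0 _] := L2H_cst0 (mu := nn) he (nuc_lty nu); split => //.
have -> : EFin \o (fun x : X => `|(0 : H -> H) x|) = EFin \o (fun=> 0 : R).
  by apply/funext => x /=; rewrite normr0.
exact: (integrable_EFin_cst (nuc_lty nu)).
Qed.

Lemma L1_memZD (a : R) (u v : Y) : ps_mem u -> ps_mem v -> ps_mem (a *: u + v).
Proof. by move=> /L1H_mem uL /L1H_mem vL; apply/L1H_mem; exact: (L1H_ZD he). Qed.

Lemma L1_norm_ge0 (u : Y) : (0 <= ps_norm u)%E.
Proof. exact: Lnorm_ge0. Qed.

Lemma n1_triangle u v : L1H nn u -> L1H nn v -> n1 (fun x => u x + v x) <= n1 u + n1 v.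
Proof.
move=> uL vL; have [_ ui] := uL; have [_ vi] := vL.
have [_ si] := L1H_ZD he 1 uL vL.
have E : (fun x => 1 *: u x + v x) = (fun x => u x + v x).
  by apply/funext => x; rewrite scale1r.
rewrite /n1 -(RintegralD measurableT ui vi); apply: le_Rintegral => //.
- by have := si; under eq_fun do rewrite scale1r.
- exact: (integrable_EFinD ui vi).
- by move=> x _; exact: ler_normD.
Qed.

Section pairing.
Variables (b : H -> H) (C : R) (C0 : 0 <= C) (bC : ae_bounded nu b C).

Lemma pairing_integrable u : L1H nn u ->
  nn.-integrable setT (EFin \o (fun x : X => ip (b x) (u x))) /\
  `|\int[nn]_x ip (b x) (u x)| <= C * n1 u.
Proof.
move=> [bu ui]; have [bb bae] := bC.
have m : measurable_fun setT (fun x : X => ip (b x) (u x)) := borel_fun_ip2 he bb bu.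
have gi : nn.-integrable setT (EFin \o (fun x : X => C * `|u x|)) by exact: integrable_EFinZ.
have le : {ae nn, forall x, setT x -> `|ip (b x) (u x)| <= C * `|u x|}.
  apply: (ae_nu1 bae) => x bx _; apply: le_trans (ip_norm_le _ _) _.
  exact: ler_wpM2r.
have i : nn.-integrable setT (EFin \o (fun x : X => ip (b x) (u x))).
  apply/integrableP; split; first exact/measurable_EFinP.
  have /integrableP[_] := gi; apply: le_lt_trans; apply: ge0_ae_integral_le => //.
  by apply: (ae_nu1 le) => x h _ /=; rewrite lee_fin (le_trans (h I))// ler_norm.
split => //; rewrite /n1 -(RintegralZl C measurableT ui).
exact: (ae_Rintegral_norm_le (mu := nn) (D := setT) measurableT (integrable_ae_integrable i)
  (integrable_ae_integrable gi) le).
Qed.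

Lemma pairing_linear : @linear_form R Y (fun u => \int[nn]_x ip (b x) (u x)).
Proof.
move=> a u v /L1H_mem uL /L1H_mem vL.
have [iu _] := pairing_integrable uL; have [iv _] := pairing_integrable vL.
rewrite -(RintegralZl a measurableT iu) -(RintegralD measurableT (integrable_EFinZ a iu) iv).
apply: eq_Rintegral => x _.
by rewrite -[(a *: u + v) x]/(a *: u x + v x) ipDr ipZr.
Qed.

Lemma bochner_integral_pairing T (f : R -> Y) I : is_bochner_integral T f I ->
  \int[leb]_(t in `]0, T[) \int[nn]_x ip (b x) ((f t : H -> H) x) =
  \int[nn]_x ip (b x) ((I : H -> H) x).
Proof.
move=> fI; have mD : measurable (`]0, T[%classic : set (measurableTypeR R)).
  exact: measurable_itv.
have p0 : 0 < C + 1 by rewrite ltr_wpDl.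
pose L (u : Y) : R := (C + 1)^-1 * \int[nn]_x ip (b x) (u x).
have Llin : @linear_form R Y L.
  by move=> a u v uL vL; rewrite /L (pairing_linear a uL vL); ring.
have Lle (u : Y) : ps_mem u -> (`|L u|%:E <= ps_norm u)%E.
  move=> /L1H_mem uL; rewrite (L1H_norm uL) lee_fin /L normrM gtr0_norm ?invr_gt0//.
  rewrite ler_pdivrMl//; have [_ h] := pairing_integrable uL; apply: le_trans h _.
  by rewrite mulrDl mul1r lerDl; apply: Rintegral_ge0 => x _.
have [i E] := bochner_integral_form L1_mem0 L1_memZD L1_norm_ge0 Llin Lle fI.
have U u : \int[nn]_x ip (b x) (u x) = (C + 1) * L u.
  by rewrite /L mulrA divff ?gt_eqF// mul1r.
rewrite U -E -(ae_RintegralZ (C + 1) mD i).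
by apply: eq_Rintegral => t _; exact: U.
Qed.

End pairing.

(** Writes the L^1 norm as a pairing with a bounded field, so that bounds on scalar time integrals
    become bounds on the norm of a vector-valued integral. *)
Lemma unit_direction u : L1H nn u -> ae_bounded nu (fun x => `|u x|^-1 *: u x) 1 /\
  \int[nn]_x ip (`|u x|^-1 *: u x) (u x) = n1 u.
Proof.
move=> [bu ui]; split; last first.
  apply: eq_Rintegral => x _; rewrite ipZl ip_sqr_norm.
  have [->|nz] := eqVneq `|u x| 0; first by rewrite expr0n mulr0.
  by rewrite expr2 mulrA mulVf// mul1r.
split.
  apply: (borel_fun_scale he _ bu).
  have -> : (fun x : X => `|u x|^-1) = (fun r => r `^ (-1)) \o (fun x : X => `|u x|).
    by apply/funext => x /=; rewrite powR_inv1.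
  by apply: measurableT_comp; [exact: measurable_powR|exact: (borel_fun_norm bu)].
apply: ae_nuT => x; rewrite normrZ normfV normr_id.
have [->|nz] := eqVneq `|u x| 0; first by rewrite mulr0.
by rewrite mulVf.
Qed.

End L1_space.

Lemma beta_arith {R : realType} (d D E F P f p : R) : 0 < d -> 0 <= D -> 0 <= E ->
  f ^+ 2 = F -> p ^+ 2 = P ->
  p * Num.sqrt D + Num.sqrt E * f + Num.sqrt E * Num.sqrt D <=
  d * (F + P) + ((d^-1 + 1) * D + (d^-1 + 1) * E).
Proof.
move=> d0 D0 E0 <- <-.
have := mul_le_weighted_sqr (Num.sqrt D) p d0.
have := mul_le_weighted_sqr (Num.sqrt E) f d0.
have := mul_le_sqr (Num.sqrt E) (Num.sqrt D).
rewrite !sqr_sqrtr// [p * _]mulrC !mulrDl !mulrDr !mul1r.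
move: (Num.sqrt E * Num.sqrt D) (Num.sqrt E * f) (Num.sqrt D * p) (d^-1 * D) (d^-1 * E)
  (d * f ^+ 2) (d * p ^+ 2) => x1 x2 x3 x4 x5 x6 x7; lra.
Qed.

Lemma triangle_arith {R : realType} (a b c x y : R) : `|c - a| <= x -> `|c - b| <= y ->
  a - b <= x + y.
Proof. by rewrite !ler_norml => /andP[h1 h2] /andP[h3 h4]; lra. Qed.

(** * Bochner integrability of the product of a solution and a gradient *)

Section bochner_product.
Context {R : realType} {H : hilbertType R}.
Variables (nu : probability (borel H) R) (e : nat -> H).
Hypothesis he : is_orthonormal_basis e.
Variable Qh : {linear H -> H}.
Hypothesis Q_closable : sqrtQ_D_closable nu e Qh.
Local Notation nn := (nuc nu).
Local Notation X := (Hnu nu).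
Local Notation V := (W12mem nu e Qh).
Local Notation QD := (sqrtQ_D nu e Qh).
Local Notation vq := (vq nu e Qh).
Local Notation vnorm := (vnorm nu e Qh).
Local Notation leb := (@lebesgue_measure R).
Local Notation W := (W12 nu e Qh).
Local Notation Y := (Lp_H nu 1%:E).

Lemma product_L1H (g h : H -> R) : V g -> V h -> L1H nn (fun x => g x *: QD h x) /\
  n1 nu (fun x => g x *: QD h x) <= vnorm g * vnorm h.
Proof.
move=> Vg Vh; have gL := W12mem_L2R he Vg; have hL := L2H_norm (QD_L2H he Vh).
have [mg _] := gL; have [bh _] := QD_L2H he Vh.
have ag : L2R nn (fun x => `|g x|).
  have [_ gi] := gL; split; first exact: measurableT_comp.
  by have -> : (fun x : X => `|g x| ^+ 2) = (fun x => g x ^+ 2)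
    by apply/funext => x; rewrite real_normK ?num_real.
have E : (fun x : X => `|g x *: QD h x|) = fun x => `|g x| * `|QD h x|.
  by apply/funext => x; rewrite normrZ.
split.
  split; first exact: (borel_fun_scale he mg bh).
  by rewrite E; exact: (L2R_mul ag hL).
rewrite /n1 E; apply: le_trans (ler_norm _) _.
apply: norm_le_mul (vnorm_ge0 _ _ _ g) (vnorm_ge0 _ _ _ h) _.
rewrite (vnorm_sqr nu e Qh g) (vnorm_sqr nu e Qh h).
apply: le_trans (ipR_cauchy_schwarz ag hL) _.
rewrite -ipH_normE.
have -> : ipR nn (fun x => `|g x|) (fun x => `|g x|) = ipR nn g g.
  by apply: eq_Rintegral => x _; rewrite -!expr2 real_normK ?num_real.
apply: ler_pM (ipR_ge0 nn g) (ipH_ge0 nn (QD h)) _ _.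
  by rewrite lerDl dq_ge0.
by rewrite lerDr ipR_ge0.
Qed.

Lemma ae_n1 (u v : H -> H) : {ae nn, forall x, u x = v x} -> n1 nu u = n1 nu v.
Proof. by move=> uv; apply: ae_Rintegral_eq => //; apply: (ae_nu1 uv) => x -> _. Qed.

(** Every term on the right contains a difference, and its other factor is [P], [F] or again a
    difference: norms of the approximants [Q] and [S] never enter. *)
Lemma product_identity (M : lmodType R) (F S : M) (P Q : R) : P *: F - Q *: S =
  P *: (- S + F) + (P - Q) *: F - (P - Q) *: (- S + F).
Proof.
rewrite (scalerBl P Q (- S + F)) opprB [_ + (P - Q) *: F]addrC -addrA [_ + (_ - _)]addrC subrK.
by rewrite scalerBl scalerDr scalerN [- _ + Q *: F]addrC addrA subrK.
Qed.

Lemma product_dist (p f r s : W) : V p -> V f -> V r -> V s ->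
  n1 nu (fun x => p x *: QD f x - r x *: QD s x) <=
  vnorm p * vnorm (f - s) + vnorm (p - r) * vnorm f + vnorm (p - r) * vnorm (f - s).
Proof.
move=> Vp Vf Vr Vs.
have Vfs : V (f - s) := mem_B (@W12_memZD _ _ nu e he Qh) Vf Vs.
have Vpr : V (p - r) := mem_B (@W12_memZD _ _ nu e he Qh) Vp Vr.
have [L1 le1] := product_L1H Vp Vfs.
have [L2 le2] := product_L1H Vpr Vf.
have [L3 le3] := product_L1H Vpr Vfs.
have L12 := L1H_ZD he 1 L1 L2.
have L3' := L1H_ZD he (-2) L3 L3.
have E2 : (fun x => 1 *: (p x *: QD (f - s) x) + (p - r) x *: QD f x) =
    (fun x => p x *: QD (f - s) x + (p - r) x *: QD f x).
  by apply/funext => x; rewrite scale1r.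
have E3 : (fun x => -2 *: ((p - r) x *: QD (f - s) x) + (p - r) x *: QD (f - s) x) =
    (fun x => - ((p - r) x *: QD (f - s) x)).
  apply/funext => x; rewrite -[X in _ + X]scale1r -scalerDl.
  by rewrite (_ : -2 + 1 = -1 :> R) ?scaleN1r//; ring.
have n3 : n1 nu (fun x => - ((p - r) x *: QD (f - s) x)) = n1 nu (fun x => (p - r) x *: QD (f - s) x).
  by apply: eq_Rintegral => x _; rewrite normrN.
rewrite E2 in L12; rewrite E3 in L3'.
have key : {ae nn, forall x, p x *: QD f x - r x *: QD s x =
    (p x *: QD (f - s) x + (p - r) x *: QD f x) + - ((p - r) x *: QD (f - s) x)}.
  have := QD_ZD he Q_closable (-1) Vs Vf.
  have -> : (fun x => -1 * s x + f x) = f - s.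
    by apply/funext => x; rewrite mulN1r addrC.
  move=> h; apply: (ae_nu1 h) => x ->.
  rewrite -[(p - r) x]/(p x - r x) scaleN1r.
  move: (QD f x) (QD s x) (p x) (r x) => F S P Q.
  exact: product_identity.
rewrite (ae_n1 key).
apply: le_trans (n1_triangle he L12 L3') _; rewrite n3.
exact: (lerD (le_trans (n1_triangle he L1 L2) (lerD le1 le2)) le3).
Qed.

Section sm_product.
Variables s r : simple_map W.

(** The product is constant on intersections of one cell of each map; pairs of indices are
    enumerated because [simple_map] wants an ordinal. *)
Let pair (k : 'I_#|{: 'I_(sm_size s) * 'I_(sm_size r)}|) := enum_val k.
Let set_ k : set R := sm_set (pair k).1 `&` sm_set (pair k).2.
Let val_ k : Y := fun x => (sm_val (pair k).2 : H -> R) x *: QD (sm_val (pair k).1) x.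
Let mset k : measurable (set_ k).
Proof. by apply: measurableI; exact: sm_set_measurable. Qed.
Let vmem k : ps_mem (val_ k).
Proof.
by apply/L1H_mem; have [] := product_L1H (sm_val_mem (pair k).2) (sm_val_mem (pair k).1).
Qed.

Definition sm_product : simple_map Y := SimpleMap mset vmem.

Lemma QD_sum n (a : 'I_n -> R) (v : 'I_n -> W) : (forall i, V (v i)) ->
  {ae nn, forall x, QD (\sum_(i < n) a i *: v i) x = \sum_(i < n) a i *: QD (v i) x}.
Proof.
elim: n a v => [|n IH] a v Vv.
  have h := QD_ZD he Q_closable (-1) (W12mem0 nu he Qh) (W12mem0 nu he Qh).
  have -> : \sum_(i < 0) a i *: v i = (fun x => -1 * 0 + 0) :> W.
    by rewrite big_ord0; apply/funext => x; rewrite mulr0 addr0.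
  by apply: (ae_nu1 h) => x ->; rewrite big_ord0 scaleN1r addNr.
have Vs : V (\sum_(i < n) a (lift ord0 i) *: v (lift ord0 i)).
  exact: (mem_sum (W12_mem0 nu he Qh) (@W12_memZD _ _ nu e he Qh) _ (fun i => Vv _)).
have h := QD_ZD he Q_closable (a ord0) (Vv ord0) Vs.
apply: (ae_nu2 h (IH (fun i => a (lift ord0 i)) (fun i => v (lift ord0 i)) (fun i => Vv _))).
move=> x E1 E2; rewrite big_ord_recl [RHS]big_ord_recl -E2; exact: E1.
Qed.

Lemma sum_apply n (a : 'I_n -> R) (v : 'I_n -> W) x :
  (\sum_(i < n) a i *: v i : H -> R) x = \sum_(i < n) a i * (v i : H -> R) x.
Proof.
elim: n a v => [|n IH] a v; first by rewrite !big_ord0.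
rewrite big_ord_recl [RHS]big_ord_recl.
by rewrite -(IH (fun i => a (lift ord0 i)) (fun i => v (lift ord0 i))); exact: erefl.
Qed.

Lemma sum_applyY n (a : 'I_n -> R) (v : 'I_n -> Y) x :
  (\sum_(i < n) a i *: v i : H -> H) x = \sum_(i < n) a i *: (v i : H -> H) x.
Proof.
elim: n a v => [|n IH] a v; first by rewrite !big_ord0.
rewrite big_ord_recl [RHS]big_ord_recl.
by rewrite -(IH (fun i => a (lift ord0 i)) (fun i => v (lift ord0 i))); exact: erefl.
Qed.

(** Only almost everywhere in space, because [sqrtQ_D] commutes with finite sums only up to a null
    set. *)
Lemma sm_productE t : {ae nn, forall x, (sm_eval sm_product t : H -> H) x =
  (sm_eval r t : H -> R) x *: QD (sm_eval s t) x}.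
Proof.
apply: (ae_nu1 (QD_sum (fun i => \1_(sm_set i) t : R) (@sm_val_mem _ W s))) => x E.
rewrite -[QD (sm_eval s t) x]/(QD (\sum_(i < sm_size s) (\1_(sm_set i) t : R) *: sm_val i) x) E.
have -> : (sm_eval sm_product t : H -> H) x =
    \sum_(k < #|{: 'I_(sm_size s) * 'I_(sm_size r)}|) (\1_(set_ k) t : R) *: (val_ k : H -> H) x.
  exact: sum_applyY.
have -> : (sm_eval r t : H -> R) x =
    \sum_(j < sm_size r) (\1_(sm_set j) t : R) * (sm_val j : H -> R) x.
  exact: sum_apply.
rewrite /set_ /val_ /pair.
rewrite -(big_enum_val (A := {: 'I_(sm_size s) * 'I_(sm_size r)})
  (fun ij => (\1_(sm_set ij.1 `&` sm_set ij.2) t : R) *: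
    ((sm_val ij.2 : H -> R) x *: QD (sm_val ij.1) x))) /=.
have -> : \sum_(ij in {: 'I_(sm_size s) * 'I_(sm_size r)})
      (\1_(sm_set ij.1 `&` sm_set ij.2) t : R) *: ((sm_val ij.2 : H -> R) x *: QD (sm_val ij.1) x) =
    \sum_(i < sm_size s) \sum_(j < sm_size r) (\1_(@sm_set _ W s i `&` @sm_set _ W r j) t : R) *:
      ((@sm_val _ W r j : H -> R) x *: QD (@sm_val _ W s i) x).
  by rewrite pair_bigA; apply: eq_big => [ij|[i j] _].
rewrite exchange_big /=.
rewrite scaler_suml; apply: eq_bigr => j _; rewrite scaler_sumr; apply: eq_bigr => i _.
by rewrite indicI /= !scalerA; congr (_ *: _); ring.
Qed.

End sm_product.

(** Products of simple approximants of the two factors approximate the product in L^1. Along a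
    subsequence with summable errors their integrals [U n] are Cauchy at a geometric rate, and
    [L1H_complete] provides the integral as their limit. *)
Lemma bochner_product_exists T (f p : R -> W) : bochner_L2 T f -> bochner_L2 T p ->
  exists I : Y, is_bochner_integral T ((fun t x => (p t : H -> R) x *: QD (f t) x) : R -> Y) I.
Proof.
move=> f2 p2.
have mD : measurable (`]0, T[%classic : set (measurableTypeR R)) by exact: measurable_itv.
have simple := bochner_L2_simple (W12_mem0 nu he Qh) (@W12_memZD _ _ nu e he Qh)
  (W12_lin he Q_closable) (@vqC _ _ nu e Qh) (@W12_form_ge0 _ _ nu e Qh)
  (@W12_normE _ _ nu e he Qh).
have [s [sP [si s0]]] := simple _ _ f2; have [r [rP [ri r0]]] := simple _ _ p2.
have fi := vq_integrable he Q_closable f2; have pi_ := vq_integrable he Q_closable p2.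
pose Phi t : Y := fun x => (p t : H -> R) x *: QD (f t) x.
pose Pn n t : Y := sm_eval (sm_product (s n) (r n)) t.
pose D n t := vq (f t - sm_eval (s n) t) (f t - sm_eval (s n) t).
pose E n t := vq (p t - sm_eval (r n) t) (p t - sm_eval (r n) t).
pose beta n t := vnorm (p t) * Num.sqrt (D n t) + Num.sqrt (E n t) * vnorm (f t) +
  Num.sqrt (E n t) * Num.sqrt (D n t).
have dist n : {ae leb, forall t, t \in `]0, T[ -> L1H nn (Phi t) /\
    n1 nu (fun x => (Phi t : H -> H) x - (Pn n t : H -> H) x) <= beta n t}.
  refine (ae_leb2 sP rP _) => t h1 h2 tT; have [Vf _] := h1 tT; have [Vp _] := h2 tT.
  split; first by have [] := product_L1H Vp Vf.
  have Vs := sm_eval_mem (W12_mem0 nu he Qh) (@W12_memZD _ _ nu e he Qh) (s n) t.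
  have Vr := sm_eval_mem (W12_mem0 nu he Qh) (@W12_memZD _ _ nu e he Qh) (r n) t.
  apply: le_trans (product_dist Vp Vf Vr Vs).
  rewrite le_eqVlt; apply/orP; left; apply/eqP; apply: ae_n1.
  by apply: (ae_nu1 (sm_productE (s n) (r n) t)) => x E'; congr (_ - _); exact: E'.
have beta0 : {ae leb, forall t, t \in `]0, T[ -> beta n t @[n --> \oo] --> 0}.
  refine (ae_leb2 sP rP _) => t h1 h2 tT; have [_ d0] := h1 tT; have [_ e0] := h2 tT.
  have sq (a : nat -> R) : a n @[n --> \oo] --> 0 -> Num.sqrt (a n) @[n --> \oo] --> 0.
    move=> h; rewrite -[X in _ --> X]sqrtr0.
    by apply: (@cvg_comp _ _ _ a (@Num.sqrt R) _ _ _ h); exact: sqrt_continuous.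
  have d1 := sq _ d0; have e1 := sq _ e0.
  rewrite -[X in _ --> X](_ : vnorm (p t) * 0 + 0 * vnorm (f t) + 0 * 0 = 0);
    last by rewrite !mulr0 mul0r !addr0.
  apply: cvgD; first apply: cvgD.
  - by apply: cvgM; [exact: cvg_cst|exact: d1].
  - by apply: cvgM; [exact: e1|exact: cvg_cst].
  - by apply: cvgM; [exact: e1|exact: d1].
pose M := \int[leb]_(t in `]0, T[) (vq (f t) (f t) + vq (p t) (p t)).
have Mi := ae_integrableD mD fi pi_.
have M0 : 0 <= M.
  by apply: ae_Rintegral_ge0 => //; apply: ae_lebT => t _; rewrite addr_ge0 ?vq_ge0.
(* [b] is an integrable majorant of the error with a prescribed integral; [n <= m] sends the
   selected indices to infinity, so that pointwise convergence survives along them. *)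
have pick n : exists m (b : R -> R), [/\ (n <= m)%N, ae_integrable leb `]0, T[ b,
    \int[leb]_(t in `]0, T[) b t <= 4^-1 * 2^-1 ^+ n & forall t, beta m t <= b t].
  pose eps : R := 4^-1 * 2^-1 ^+ n.
  have eps0 : 0 < eps by rewrite mulr_gt0 ?exprn_gt0 ?invr_gt0.
  (* The weight in Young's inequality: the norms of [f] and [p] use up half of [eps], and [m] is
     then taken large enough, depending on [delta], for the errors [D] and [E] to use at most the
     other half. *)
  pose delta := eps / (2 * (M + 1)).
  have M1 : 0 < M + 1 by rewrite ltr_wpDl.
  have delta0 : 0 < delta by rewrite divr_gt0 ?mulr_gt0.
  have h := cvg0_ZD (delta^-1 + 1) (delta^-1 + 1) s0 r0.
  have e2 : 0 < eps / 2 by rewrite divr_gt0.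
  have /cvgrPdist_le/(_ _ e2)[N _ NP] := h.
  pose m := maxn n N.
  have i1 := ae_integrableZ (mu := leb) delta mD Mi.
  have i2 := ae_integrableZ (mu := leb) (delta^-1 + 1) mD (si m).
  have i3 := ae_integrableZ (mu := leb) (delta^-1 + 1) mD (ri m).
  exists m, (fun t => delta * (vq (f t) (f t) + vq (p t) (p t)) +
    ((delta^-1 + 1) * D m t + (delta^-1 + 1) * E m t)); split.
  - exact: leq_maxl.
  - exact: (ae_integrableD mD i1 (ae_integrableD mD i2 i3)).
  - rewrite (ae_RintegralD mD i1 (ae_integrableD mD i2 i3)) (ae_RintegralD mD i2 i3).
    rewrite (ae_RintegralZ _ mD Mi) (ae_RintegralZ _ mD (si m)) (ae_RintegralZ _ mD (ri m)).
    have := NP m (leq_maxr n N); rewrite sub0r normrN => /(le_trans (ler_norm _)) h1.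
    have h2 : delta * M <= eps / 2.
      rewrite /delta -mulrA ler_pM2l// ler_pdivrMl ?mulr_gt0//.
      by rewrite mulrAC mulfV// mul1r lerDl.
    by rewrite [leRHS](splitr eps); exact: lerD.
  - move=> t; rewrite /beta.
    have D0 : 0 <= D m t by exact: vq_ge0.
    have E0 : 0 <= E m t by exact: vq_ge0.
    exact: (beta_arith delta0 D0 E0 (vnorm_sqr nu e Qh (f t)) (vnorm_sqr nu e Qh (p t))).
have [k kP] := choice pick; have [B BP] := choice kP.
pose s' n := sm_product (s (k n)) (r (k n)).
have B_le n : {ae leb, forall t, t \in `]0, T[ -> L1H nn (Phi t) /\
    n1 nu (fun x => (Phi t : H -> H) x - (sm_eval (s' n) t : H -> H) x) <= B n t}.
  refine (ae_leb1 (dist (k n)) _) => t h tT; have [L le] := h tT; split => //.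
  by have [_ _ _ leB] := BP n; exact: le_trans le (leB t).
have eL n t : L1H nn (sm_eval (s' n) t : H -> H).
  by apply/L1H_mem; exact: (sm_eval_mem (L1_mem0 nu he) (@L1_memZD _ _ nu e he)).
have dL n t : L1H nn (Phi t) -> L1H nn (fun x => (Phi t : H -> H) x - (sm_eval (s' n) t : H -> H) x).
  move=> PL; apply/L1H_mem.
  by apply: (mem_B (@L1_memZD _ _ nu e he)); apply/L1H_mem; [exact: PL|exact: eL].
pose U n : H -> H := sm_integral T (s' n).
have UL n : L1H nn (U n).
  by apply/L1H_mem; exact: (sm_integral_mem T (L1_mem0 nu he) (@L1_memZD _ _ nu e he)).
(* The factor [4^-1] lets the errors at [n] and [n.+1] add up to at most the rate required by
   [L1H_complete]. *)
have half (n : nat) : 4^-1 * 2^-1 ^+ n.+1 + 4^-1 * 2^-1 ^+ n <= 2^-1 ^+ n :> R.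
  have : (0 : R) <= 2^-1 ^+ n by rewrite exprn_ge0 ?invr_ge0.
  by rewrite exprS; move: (2^-1 ^+ n) => z z0; lra.
(* The L^1 norm of a difference of Bochner sums is its pairing with its own unit
   direction, and pairings commute with the integral over ]0, T[. *)
have Ule n : \int[nn]_x `|U n.+1 x - U n x| <= 2^-1 ^+ n.
  have dU : L1H nn (fun x => U n.+1 x - U n x).
    apply/L1H_mem; apply: (mem_B (@L1_memZD _ _ nu e he) (x := U n.+1 : Y) (y := U n : Y));
    apply/L1H_mem; exact: UL.
  have [bb be] := unit_direction he dU.
  set b := fun x => _ in bb be.
  rewrite -/(n1 nu (fun x => U n.+1 x - U n x)) -be.
  have lin := pairing_linear he bb.
  pose L (u : Y) := \int[nn]_x ip (b x) ((u : H -> H) x).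
  have LB (u v : Y) : ps_mem u -> ps_mem v -> L (u - v) = L u - L v.
    by move=> uL vL; exact: (linear_formB (l := L) lin uL vL).
  have LU : \int[nn]_x ip (b x) (U n.+1 x - U n x) = L (U n.+1) - L (U n).
    by apply: LB; apply/L1H_mem; exact: UL.
  have sint i : ae_integrable leb `]0, T[ (fun t => L (sm_eval (s' i) t)) /\
      \int[leb]_(t in `]0, T[) L (sm_eval (s' i) t) = L (U i).
    by have [_ ? ?] := sm_eval_integral T (L1_mem0 nu he) (@L1_memZD _ _ nu e he) (s' i) lin.
  have [i1 e1] := sint n.+1; have [i2 e2] := sint n.
  have [_ Bi1 Bl1 _] := BP n.+1; have [_ Bi2 Bl2 _] := BP n.
  rewrite LU -e1 -e2 -(ae_RintegralB mD i1 i2).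
  apply: le_trans (half n); apply: le_trans (lerD Bl1 Bl2).
  rewrite -(ae_RintegralD mD Bi1 Bi2).
  apply: (ae_Rintegral_le mD (ae_integrableB mD i1 i2) (ae_integrableD mD Bi1 Bi2)).
  refine (ae_leb2 (B_le n.+1) (B_le n) _) => t h1 h2 tT.
  have [PL le1] := h1 tT; have [_ le2] := h2 tT.
  have Lle (u : H -> H) : L1H nn u -> `|L u| <= n1 nu u.
    by move=> uL; have [_] := pairing_integrable he bb uL; rewrite mul1r.
  have m1 := (L1H_mem nu _).2 (eL n.+1 t); have m2 := (L1H_mem nu _).2 (eL n t).
  have mP := (L1H_mem nu _).2 PL.
  have := Lle _ (dL n.+1 t PL); have := Lle _ (dL n t PL).
  rewrite -[L (fun x => _ x - (sm_eval (s' n) t : H -> H) x)]/(L (Phi t - sm_eval (s' n) t)).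
  rewrite -[L (fun x => _ x - (sm_eval (s' n.+1) t : H -> H) x)]/(L (Phi t - sm_eval (s' n.+1) t)).
  rewrite (LB _ _ mP m1) (LB _ _ mP m2) => q2 q1.
  exact: (triangle_arith (le_trans q1 le1) (le_trans q2 le2)).
have [I IL Ic] := L1H_complete he UL Ule.
have kinf : k n @[n --> \oo] --> \oo.
  apply/cvgnyPge => A; exists A => // n /= An.
  by have [kn _ _ _] := BP n; exact: leq_trans An kn.
have inv0 : (4^-1 * 2^-1 ^+ n : R) @[n --> \oo] --> 0.
  rewrite -[X in _ --> X](mulr0 4^-1); apply: cvgM; first exact: cvg_cst.
  by apply: cvg_expr; rewrite ger0_norm ?invr_ge0// invf_lt1// ltr1n.
have nE n t : L1H nn (Phi t) -> ps_norm (Phi t - sm_eval (s' n) t : Y) =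
    (n1 nu (fun x => (Phi t : H -> H) x - (sm_eval (s' n) t : H -> H) x))%:E.
  by move=> PL; exact: (L1H_norm (dL n t PL)).
have PL : {ae leb, forall t, t \in `]0, T[ -> L1H nn (Phi t)}.
  by refine (ae_leb1 (B_le 0%N) _) => t h tT; have [] := h tT.
exists I; split.
- exact/L1H_mem.
- exists s'; have dist' : {ae leb, forall t, forall n, t \in `]0, T[ ->
      n1 nu (fun x => (Phi t : H -> H) x - (sm_eval (s' n) t : H -> H) x) <= beta (k n) t}.
    by apply: ae_foralln => n; refine (ae_leb1 (dist (k n)) _) => t h tT; have [] := h tT.
  refine (ae_leb3 dist' beta0 PL _) => t h1 h2 h3 tT; split; first exact/L1H_mem/h3.
  have -> : (fun n => ps_norm (Phi t - sm_eval (s' n) t : Y)) = fun n =>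
      (n1 nu (fun x => (Phi t : H -> H) x - (sm_eval (s' n) t : H -> H) x))%:E.
    by apply/funext => n; exact: (nE n t (h3 tT)).
  apply/fine_cvgP; split; first exact: nearW.
  apply: (@squeeze_cvgr _ _ _ _ (cst 0) (fun n => beta (k n) t)).
  + apply: nearW => n /=; rewrite h1// andbT.
    by apply: Rintegral_ge0 => x _.
  + exact: cvg_cst.
  + exact: (@cvg_comp _ _ _ k (fun m => beta m t) _ _ _ kinf (h2 tT)).
- exists s'; split; last first.
    have -> : (fun n => ps_norm (sm_integral T (s' n) - I : Y)) =
        fun n => (\int[nn]_x `|U n x - I x|)%:E.
      apply/funext => n; apply: (@L1H_norm _ _ nu (fun x => U n x - I x)).
      apply/L1H_mem; apply: (mem_B (@L1_memZD _ _ nu e he) (x := U n : Y) (y := I : Y));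
      exact/L1H_mem.
    by apply/fine_cvgP; split; [exact: nearW|exact: Ic].
  apply: (squeeze_cvge (f := cst 0%E) (h := fun n => (4^-1 * 2^-1 ^+ n)%:E)).
  + apply: nearW => n; apply/andP; split.
      by apply: integral_ge0 => t _; exact: L1_norm_ge0.
    have [_ Bi Bl _] := BP n.
    apply: (@le_trans _ _ (\int[leb]_(t in `]0%R, T[) (B n t)%:E)%E); last first.
      by rewrite (ae_integrable_EFin mD Bi) lee_fin.
    (* [B n] is nonnegative only almost everywhere, whereas the comparison of integrals below asks
       for it at every time. *)
    have -> : (\int[leb]_(t in `]0%R, T[) (B n t)%:E =
        \int[leb]_(t in `]0%R, T[) (`|B n t|)%:E)%E.
      apply: (ae_integral_eq mD); refine (ae_leb1 (B_le n) _) => t h tT.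
      have [_ le] := h tT; rewrite ger0_norm//; apply: le_trans le.
      by apply: Rintegral_ge0 => x _.
    apply: (ge0_ae_integral_le mD).
    * by move=> t _; exact: L1_norm_ge0.
    * by move=> t _; rewrite lee_fin.
    * refine (ae_leb1 (B_le n) _) => t h tT; have [PLt le] := h tT.
      by apply: (@le_trans _ _ (B n t)%:E); [rewrite (nE n t PLt) lee_fin|rewrite lee_fin ler_norm].
  + exact: cvg_cst.
  + by apply/fine_cvgP; split; [exact: nearW|exact: inv0].
Qed.

End bochner_product.

Section solutions.
Context {R : realType} {H : hilbertType R}.
Variables (nu : probability (borel H) R) (e : nat -> H).
Hypothesis he : is_orthonormal_basis e.
Variables (Q Qh : {linear H -> H}) (q : nat -> R) (DAt : set H) (At F : H -> H).
Hypotheses (hQ : bounded_sa_positive Q) (hQh : is_sqrt_op Q Qh).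
Hypothesis hQe : forall i, Q (e i) = q i *: e i.
Hypotheses (At_lin : linear_on DAt At) (eDAt : forall i, DAt (e i)).
Variable DF : set H.
Hypotheses (F_meas : nu_measurable nu DF F) (DF_full : nuc nu DF = 1%E).
Hypothesis F_moment : (\int[nuc nu]_x (`|F x| ^+ 2 + `|x| ^+ 2)%:E < +oo)%E.
Hypothesis N0_invariant : forall phi, FCb e 2 phi ->
  (\int[nuc nu]_x (N0 e Q At F phi x)%:E = 0)%E.
Hypothesis N2_symmetric : forall f g,
  N2_adjoint_graph nu e Q At F f g <-> N2_graph nu e Q At F f g.
Hypothesis Q_closable : sqrtQ_D_closable nu e Qh.
Variables (T : R) (T0 : 0 < T) (B : (H -> H) -> (H -> H)).
Local Notation nn := (nuc nu).
Local Notation V := (W12mem nu e Qh).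
Local Notation vnorm := (vnorm nu e Qh).
Local Notation leb := (@lebesgue_measure R).
Local Notation evolves_ := (@evolves R (H -> R^o) (L2R nn) V (ipR nn) vnorm).

Let N2E := @N2_extE _ _ nu e he Qh Q_closable Q q DAt At F hQ hQh hQe At_lin eDAt DF
  F_meas DF_full F_moment N0_invariant N2_symmetric.

Lemma forward_evolves (u : H -> H) (C : R) (g : H -> R) (f : R -> H -> R) : 0 <= C ->
  ae_bounded nu (B u) C -> forward_solution nu e Q Qh At F B T u g f ->
  evolves_ T f (fun t y => state_form nu e Qh (B u) (f t) y).
Proof.
move=> C0 uC [fv _].
have -> : (fun t y => state_form nu e Qh (B u) (f t) y) =
    fun t y => state_form nu e Qh (B u) (f t) y + (fun=> 0) y.
  by apply/funext => t; apply/funext => y; rewrite addr0.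
have C1 : 0 <= C + 1 by rewrite addr_ge0.
refine (evolution_evolves he Q_closable T0 C1 _ (state_form_linl he Q_closable C0 uC)
  (state_form_linr he Q_closable C0 uC) (state_form_le he C0 uC) _ _ fv).
- by move=> x y Vx Vy; rewrite addr0 /state_form -(N2E Vx Vy).
- by move=> a x y _ _; rewrite mulr0 addr0.
- by move=> y _; rewrite normr0 mulr_ge0// vnorm_ge0.
Qed.

Lemma backward_evolves (u : H -> H) (C : R) (p : R -> H -> R) : 0 <= C ->
  ae_bounded nu (B u) C -> backward_solution nu e Q Qh At F B T u p ->
  evolves_ T p (fun t y => adjoint_form nu e Qh (B u) (p t) y + - ipR nn (fun=> 1) y).
Proof.
move=> C0 uC [pv _]; set c := Num.sqrt (ipR nn (fun=> 1) (fun=> 1)).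
have c0 : 0 <= c by exact: sqrtr_ge0.
(* The L^2 norm [c] of 1 accounts for the constant source of the backward equation. *)
have C1 : 0 <= C + 1 + c by rewrite !addr_ge0.
have L1 := L2R_cst (nuc_lty nu) (1 : R).
refine (evolution_evolves he Q_closable T0 C1 _ (adjoint_form_linl he Q_closable C0 uC)
  (adjoint_form_linr he Q_closable C0 uC) _ _ _ pv).
- move=> x y Vx Vy; rewrite /adjoint_form.
  rewrite -[2^-1 * _]opprK -(N2E Vx Vy); exact: erefl.
- move=> x y Vx Vy; apply: le_trans (adjoint_form_le he C0 uC Vx Vy) _.
  by rewrite -!mulrA ler_wpM2r ?lerDl// mulr_ge0// vnorm_ge0.
- move=> a x y Vx Vy; rewrite !(ipRC nn (fun=> 1)).
  rewrite (ipR_lin a (W12mem_L2R he Vx) (W12mem_L2R he Vy) L1).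
  by move: (ipR _ _ _) (ipR _ _ _) => r s; ring.
- move=> y Vy; rewrite normrN; apply: le_trans (ipR_le_vnorm he L1 Vy) _.
  by rewrite ler_wpM2r ?vnorm_ge0// lerDr addr_ge0.
Qed.

End solutions.

Section cost.
Context {R : realType} {H : hilbertType R}.
Variables (nu : probability (borel H) R) (T : R).
Local Notation nn := (nuc nu).
Local Notation leb := (@lebesgue_measure R).

Lemma cost_difference (f0 f1 : R -> H -> R) :
  continuous_into (X := Lp_real nu 2%:E) T f0 -> continuous_into (X := Lp_real nu 2%:E) T f1 ->
  \int[leb]_(t in `]0, T[) ipR nn (fun=> 1) (fun x => -1 * f0 t x + f1 t x) =
  cost nu T f1 - cost nu T f0.
Proof.
move=> c0 c1; have L1 := L2R_cst (nuc_lty nu) (1 : R).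
have mD : measurable (`]0, T[%classic : set (measurableTypeR R)) by exact: measurable_itv.
have key (f : R -> H -> R) : continuous_into (X := Lp_real nu 2%:E) T f ->
    ae_integrable leb `]0, T[ (fun t => ipR nn (f t) (fun=> 1)) /\
    cost nu T f = \int[leb]_(t in `]0, T[) ipR nn (f t) (fun=> 1).
  move=> cf; have [fL tc] := continuous_into_time_continuous cf.
  have cc := time_continuous_form fL tc L1.
  split; first exact: (continuous_ae_integrable cc).
  have ci : leb.-integrable `[0, T] (EFin \o (fun t => ipR nn (f t) (fun=> 1))).
    by apply: continuous_compact_integrable; [exact: segment_compact|exact: cc].
  have -> : cost nu T f = \int[leb]_(t in `[0, T]) ipR nn (f t) (fun=> 1).
    apply: eq_Rintegral => t _; apply: eq_Rintegral => x _; exact: esym (mulr1 _).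
  rewrite -Rintegral_itv_obnd_cbnd; last first.
    by apply: integrableS ci => //; apply: subset_itv; rewrite bnd_simp.
  rewrite -Rintegral_itv_bndo_bndc//.
  by apply: integrableS ci => //; apply: subset_itv; rewrite bnd_simp.
have [i0 ->] := key _ c0; have [i1 ->] := key _ c1.
rewrite -(ae_RintegralB mD i1 i0); apply: (ae_Rintegral_eq mD); apply: ae_lebT => t tT.
have tT' : t \in `[0, T].
  by move: tT; rewrite /= !in_itv/= => /andP[/ltW -> /ltW ->].
have [fL0 _] := continuous_into_time_continuous c0.
have [fL1 _] := continuous_into_time_continuous c1.
rewrite (ipRC nn (fun=> 1)) (ipR_lin (-1) (fL0 t tT') (fL1 t tT') L1).
by rewrite mulN1r addrC.
Qed.

End cost.

Lemma ae_bounded_le {R : realType} {H : hilbertType R} (nu : probability (borel H) R)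
  (u : H -> H) (C D : R) : C <= D -> ae_bounded nu u C -> ae_bounded nu u D.
Proof.
by move=> CD [bu uC]; split => //; apply: (ae_nu1 uC) => x ux; exact: le_trans ux CD.
Qed.

Lemma ge0_of_linear_lower_bound {R : realType} (J M : R) :
  (forall l, 0 < l -> l <= 1 -> - (M * l) <= J) -> 0 <= J.
Proof.
move=> h; apply/ler_addgt0Pr => eps eps0.
(* [M] may have either sign or vanish, hence the denominator. *)
pose l := Num.min 1 (eps / (`|M| + 1)).
have M1 : 0 < `|M| + 1 by rewrite ltr_wpDl.
have l0 : 0 < l by rewrite lt_min ltr01 divr_gt0.
have l1 : l <= 1 by rewrite ge_min lexx.
have le2 : l * (`|M| + 1) <= eps by rewrite -ler_pdivlMr// ge_min lexx orbT.
have := h l l0 l1; have := ler_wpM2r (ltW l0) (ler_norm M).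
by move: le2; rewrite mulrDr mulr1 [l * _]mulrC; move: (`|M| * l) (M * l) => x y; lra.
Qed.

Theorem theorem2p8 (R : realType) (H : hilbertType R)
  (nu : probability (borel H) R) (T rho : R) (T_gt0 : 0 < T) (rho_gt0 : 0 < rho)
  (e : nat -> H) (he : is_orthonormal_basis e)
  (Q Qh : {linear H -> H}) (hQ : bounded_sa_positive Q) (hQh : is_sqrt_op Q Qh)
  (q : nat -> R) (hQe : forall i, Q (e i) = q i *: e i)
  (q_ge0 : forall i, 0 <= q i) (q_gt0 : \forall i \near \oo, 0 < q i)
  (DAt : set H) (At : H -> H) (At_lin : linear_on DAt At)
  (At_sa : self_adjoint_on DAt At) (At_diss : m_dissipative_on DAt At)
  (eDAt : forall i, DAt (e i))
  (DF : set H) (F : H -> H)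
  (B : (H -> H) -> (H -> H)) (hB : bounded_linear_Linfty nu B)
  (F_meas : nu_measurable nu DF F) (DF_full : nuc nu DF = 1%E)
  (F_moment : (\int[nuc nu]_x (`|F x| ^+ 2 + `|x| ^+ 2)%:E < +oo)%E)
  (N0_invariant : forall phi, FCb e 2 phi ->
     (\int[nuc nu]_x (N0 e Q At F phi x)%:E = 0)%E)
  (N0_range_dense : forall f : Lp_real nu 2%:E, ps_mem f ->
     forall eps : R, 0 < eps -> exists2 phi, FCb e 2 phi &
       (ps_norm ((phi \- N0 e Q At F phi : Lp_real nu 2%:E) - f) < eps%:E)%E)
  (N2_symmetric : forall f g,
     N2_adjoint_graph nu e Q At F f g <-> N2_graph nu e Q At F f g)
  (Q_closable : sqrtQ_D_closable nu e Qh)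
  (compactness :
     (forall (u_ : nat -> H -> H) (u : H -> H),
        (forall n, admissible nu rho (u_ n)) -> admissible nu rho u ->
        weak_star_cvg nu u_ u ->
        normH nu 2%:E (fun x => Qh (B (u_ n) x) - Qh (B u x)) @[n --> \oo]
          --> 0%E) \/
     W12_compact_embedding nu e Qh)
  (g : H -> R) (hg : ps_mem (g : Lp_real nu 2%:E))
  (phi : (H -> H) -> R -> H -> R)
  (hphi : forall u, admissible nu rho u ->
     forward_solution nu e Q Qh At F B T u g (phi u))
  (us : H -> H) (hus : admissible nu rho us)
  (us_min : forall u, admissible nu rho u ->
     cost nu T (phi us) <= cost nu T (phi u))
  (ps : R -> H -> R) (hps : backward_solution nu e Q Qh At F B T us ps) :
  exists2 I : Lp_H nu 1%:E,
    is_bochner_integral T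
      ((fun t x => ps t x *: sqrtQ_D nu e Qh (phi us t) x) : R -> Lp_H nu 1%:E) I &
    forall u, admissible nu rho u ->
      0 <= \int[nuc nu]_x ip (B (fun y => u y - us y) x) ((I : H -> H) x).

Proof.
have [B_Linfty _ B_lin _] := hB.
have bound u : admissible nu rho u -> exists2 C : R, 0 <= C & ae_bounded nu (B u) C.
  by move=> uad; exact: ae_bounded_Linfty (B_Linfty _ (admissible_Linfty uad)).
have fw u C uad C0 uC := @forward_evolves _ _ nu e he Q Qh q DAt At F hQ hQh hQe At_lin eDAt
  DF F_meas DF_full F_moment N0_invariant N2_symmetric Q_closable T T_gt0 B u C g (phi u)
  C0 uC (hphi u uad).
have [[_ phis_L2 _] phis_g] := hphi us hus.
have [[_ ps_L2 _] psT] := hps.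
have [J hJ] := bochner_product_exists he Q_closable phis_L2 ps_L2.
exists J => // u uad.
have [mu_ urho] := uad; have [ms srho] := hus.
have [_ bu] := mu_; have [_ bs] := ms.
(* The difference need not be bounded by [rho]; being bounded by [rho + rho] it is still in L^oo,
   where [B] is linear and bounded. *)
pose d x := u x - us x.
have dad : admissible nu (rho + rho) d.
  split; last by move=> x; apply: le_trans (ler_normB _ _) _; exact: lerD.
  split; first exact: measurableT.
  have := borel_funZD he (-1) bs bu.
  by have -> : (fun x => -1 *: us x + u x) = d by apply/funext => x; rewrite scaleN1r addrC.
have dLi := admissible_Linfty dad.
have [Cg Cg0 gaC'] := ae_bounded_Linfty (B_Linfty _ dLi).
have [Cs Cs0 beC'] := bound us hus.
pose C := Cs + Cg.
have C0 : 0 <= C by rewrite addr_ge0.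
have beC : ae_bounded nu (B us) C by apply: ae_bounded_le beC'; rewrite lerDl.
have gaC : ae_bounded nu (B d) C by apply: ae_bounded_le gaC'; rewrite lerDr.
rewrite -(bochner_integral_pairing he C0 gaC hJ).
have -> : \int[@lebesgue_measure R]_(t in `]0, T[) \int[nuc nu]_x
      ip (B d x) (ps t x *: sqrtQ_D nu e Qh (phi us t) x) =
    \int[@lebesgue_measure R]_(t in `]0, T[) drift_form nu e Qh (B d) (phi us t) (ps t).
  by apply: eq_Rintegral => t _; apply: eq_Rintegral => x _; rewrite ipZr mulrC.
have p_ev := backward_evolves he hQ hQh hQe At_lin eDAt F_meas DF_full F_moment N0_invariant
  N2_symmetric Q_closable T_gt0 C0 beC hps.
have pT0 : {ae nuc nu, forall x, ps T x = 0}.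
  by apply: (ae_nu1 psT) => x /(_ I).
(* From here on [l] is fixed, and a lower bound linear in [l] with a constant independent of [l] is
   sought. *)
refine (ge0_of_linear_lower_bound (fun l l0 l1 => _)).
pose ul x := l *: d x + us x.
have ulad : admissible nu rho ul.
  split; first by split; [exact: measurableT|exact: (borel_funZD he l (proj2 (proj1 dad)) bs)].
  move=> x; have -> : ul x = l *: u x + (1 - l) *: us x.
    by rewrite /ul /d scalerBr scalerBl scale1r addrAC addrA.
  apply: le_trans (ler_normD _ _) _; rewrite !normrZ (ger0_norm (ltW l0)).
  rewrite ger0_norm ?subr_ge0//.
  have h1 := ler_wpM2l (ltW l0) (urho x).
  have h2 : (1 - l) * `|us x| <= (1 - l) * rho by rewrite ler_wpM2l// subr_ge0.
  by apply: le_trans (lerD h1 h2) _; rewrite mulrBl mul1r addrC subrK.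
(* [B] is linear only up to null sets, so the equation of the perturbed state is rewritten through
   [ae_drift_form], which does not see them. *)
have BulE : {ae nuc nu, forall x, B ul x = l *: B d x + B us x}.
  by apply: (ae_nu1 (B_lin l d us dLi (admissible_Linfty hus))) => x /(_ I).
have [[cl phil_L2 _] phil_g] := hphi ul ulad.
have [[cs _ _] _] := hphi us hus.
have f0_ev := fw us C hus C0 beC.
have [Cl Cl0 ulC] := bound ul ulad.
have f1_ev : @evolves R (H -> R^o) (L2R (nuc nu)) (W12mem nu e Qh) (ipR (nuc nu))
    (vnorm nu e Qh) T (phi ul)
    (fun t y => state_form nu e Qh (fun x => l *: B d x + B us x) (phi ul t) y).
  have -> : (fun t y => state_form nu e Qh (fun x => l *: B d x + B us x) (phi ul t) y) =
      (fun t y => state_form nu e Qh (B ul) (phi ul t) y).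
    apply/funext => t; apply/funext => y; rewrite /state_form.
    by rewrite (ae_drift_form e Qh _ _ BulE).
  exact: (fw ul Cl ulad Cl0 ulC).
have init : {ae nuc nu, forall x, phi us 0 x = phi ul 0 x}.
  by apply: (ae_nu2 phis_g phil_g) => x /(_ I) -> /(_ I) ->.
apply: (first_order_lower_bound he Q_closable T_gt0 C0 beC gaC (ltW l0) l1 phis_L2 phil_L2
  f0_ev f1_ev init ps_L2 p_ev pT0 l0).
(* Minimality enters here: the time integral of the mean of the difference is a difference of
   costs. *)
have := cost_difference cs cl; have := us_min ul ulad; rewrite -subr_ge0 => h E.
exact: (eq_ind_r (fun z => 0 <= z) h E).
Qed.
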